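(* Assume $4d\Lambda\le1$ and Hypothesis (H) below. Then there exist positive constants $\alpha,\gamma$, with $\alpha\le1$, depending only on $d,\Lambda/\lambda$, and a constant $C$ such that for all $x\in\mathbf{Z}^d$, $t\in\mathbf{Z}$, $t\ge0$, $$|G_{\mathbf{a}}(x,t)-G^{\rm lattice}_{\mathbf{a}_{\rm hom}}(x,t)|\le\frac{C}{[\Lambda t+1]^{(d+\alpha)/2}}\exp\Big[-\gamma\min\Big\{|x|,\frac{|x|^2}{\Lambda t+1}\Big\}\Big],$$ $$|\nabla G_{\mathbf{a}}(x,t)-\nabla G^{\rm lattice}_{\mathbf{a}_{\rm hom}}(x,t)|\le\frac{C}{[\Lambda t+1]^{(d+1+\alpha)/2}}\exp\Big[-\gamma\min\Big\{|x|,\frac{|x|^2}{\Lambda t+1}\Big\}\Big].$$ Moreover, if $0<\delta\le1$, there exist $\alpha,\gamma>0$ depending only on $d,\Lambda/\lambda,\delta$, with $\alpha<\delta$, and a constant $C_\delta$ such that $$\big|[\nabla G_{\mathbf{a}}(x',t)-\nabla G^{\rm lattice}_{\mathbf{a}_{\rm hom}}(x',t)]-[\nabla G_{\mathbf{a}}(x,t)-\nabla G^{\rm lattice}_{\mathbf{a}_{\rm hom}}(x,t)]\big|\le|x'-x|^{1-\delta}\frac{C_\delta}{[\Lambda t+1]^{(d+2-\delta+\alpha)/2}}\exp\Big[-\gamma\min\Big\{|x|,\frac{|x|^2}{\Lambda t+1}\Big\}\Big]$$ for all $x',x\in\mathbf{Z}^d$ with $1/2\le(|x'|+1)/(|x|+1)\le2$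 and $t\in\mathbf{Z}_{\ge0}$. Hypothesis (H): for every $k\ge1$, with $p_2=\dots=p_k=1$ and $S_{\xi,\eta}=T_{\xi,\eta}$ or $S_{\xi,\eta}=T^*_{\xi,\eta}$, there exist $p_0(\Lambda/\lambda)>1$ depending only on $d,\Lambda/\lambda$ and a constant $C(k)$ such that $$\Big\|\sum_{(x_1,t_1),\dots,(x_k,t_k)\in\mathbf{Z}^{d+1}}\Big\{\prod_{j=1}^kg_j(x_j,t_j)\tau_{x_j,-t_j}\Pi\mathbf{b}(\cdot)[I-\Pi S_{\xi,\eta}\mathbf{b}(\cdot)]^{-1}\Big\}v\Big\|\le C(k)\prod_{j=1}^k\|g_j\|_{p_j}|v|$$ for all $g_j\in L^{p_j}(\mathbf{Z}^{d+1},\mathbf{C}^d\otimes\mathbf{C}^d)$, $v\in\mathbf{C}^d$, whenever $1\le p_1\le p_0(\Lambda/\lambda)$ and $\xi\in\mathbf{C}^d$, $\eta\in\mathbf{C}$ satisfy $0<\Re\eta<\Lambda$, $|\Im\xi|\le C_1\sqrt{\Re\eta/\Lambda}$, with $C_1$ depending only on $d,\Lambda/\lambda$.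
   Context: $(\Omega,\mathcal{F},P)$: probability space, expectation $\langle\cdot\rangle$, commuting measure-preserving translations $\tau_{x,0}$ ($x\in\mathbf{Z}^d$), $\tau_{0,t}$ ($t\in\mathbf{Z}$), $\tau_{x,t}=\tau_{x,0}\tau_{0,t}$, acting on functions by $(\tau_{x,t}\psi)(\omega)=\psi(\tau_{x,t}\omega)$. $\mathbf{a}:\Omega\to\{$symmetric $d\times d$ matrices$\}$ measurable, $\lambda I_d\le\mathbf{a}\le\Lambda I_d$, $\mathbf{a}=\Lambda[I_d-\mathbf{b}]$. $\mathcal{H}(\Omega)$: $\mathbf{C}^d$-valued functions with $\|\psi\|^2=\langle|\psi|^2\rangle$; $\Pi$ the projection onto mean-zero functions. $\nabla_i\phi(x)=\phi(x+\mathbf{e}_i)-\phi(x)$, $\nabla_i^*\phi(x)=\phi(x-\mathbf{e}_i)-\phi(x)$. $G_\Lambda$ solves $G_\Lambda(x,t+1)-G_\Lambda(x,t)+\Lambda\nabla^*\nabla G_\Lambda(x,t)=0$, $G_\Lambda(x,0)=\delta(x)$. $T_{\xi,\eta}g(\omega)=\Lambda\sum_{t\ge0}e^{-\eta(t+1)}\sum_{x}\{\nabla\nabla^*G_\Lambda(x,t)\}^*e^{-ix\cdot\xi}g(\tau_{x,-t-1}\omega)$ (the series converges for the complex $\xi$ in the stated range), $T^*_{\xi,\eta}$ its adjoint. In (H) the product is an ordered composition of operators on $\mathcal{H}(\Omega)$ applied to the constant function $v$, $g_j(x,t)$ and $\mathbf{b}$ acting by matrix multiplication. $\|g\|_p^p=\sup_{|v|=1}\sum_{(x,t)}|g(x,t)v|^p$.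 For $\xi\in\mathbf{R}^d$: $\partial_{j,\xi}\psi(\omega)=e^{-i\mathbf{e}_j\cdot\xi}\psi(\tau_{\mathbf{e}_j,0}\omega)-\psi(\omega)$, $\partial^*_{j,\xi}\psi(\omega)=e^{i\mathbf{e}_j\cdot\xi}\psi(\tau_{-\mathbf{e}_j,0}\omega)-\psi(\omega)$; $\Phi(\xi,\eta,\cdot)$ the $L^2$ row-vector solution of $e^\eta\Phi(\xi,\eta,\tau_{0,1}\omega)-\Phi(\xi,\eta,\omega)+\Pi\partial^*_\xi\mathbf{a}\partial_\xi\Phi=-\Pi\partial^*_\xi\mathbf{a}$; $q(\xi,\eta)=\langle\mathbf{a}\rangle+\langle\mathbf{a}\partial_\xi\Phi\rangle$; $\mathbf{a}_{\rm hom}=q(0,0)=\lim_{(\xi,\eta)\to(0,0)}q(\xi,\eta)$ (the limit exists under the hypotheses). $G_{\mathbf{a}}(x,t)=\langle u(x,t,\cdot)\rangle$ where $u$ solves $u(x,t+1,\omega)-u(x,t,\omega)=-\nabla^*\mathbf{a}(\tau_{x,t}\omega)\nabla u(x,t,\omega)$, $u(x,0,\omega)=\delta(x)$. $G^{\rm lattice}_{\mathbf{a}_{\rm hom}}(x,t)$ is the solution of $w(x,t+1)-w(x,t)=-\nabla^*\mathbf{a}_{\rm hom}\nabla w(x,t)$, $x\in\mathbf{Z}^d$, $t\in\mathbf{Z}_{\ge0}$, with $w(x,0)=\delta(x)$. $\nabla$ acts in $x$. *)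

(* Defs.v *)
From HB Require Import structures.
From mathcomp Require Import all_boot all_order all_algebra.
From mathcomp Require Import all_classical all_reals all_analysis.
From mathcomp Require Import complex.
From Stdlib Require Import ClassicalEpsilon.
Set Implicit Arguments. Unset Strict Implicit. Unset Printing Implicit Defensive.
Import Order.TTheory GRing.Theory Num.Theory.
Local Open Scope classical_set_scope.
Local Open Scope ring_scope.

Section Cplx.
Variable R : realType.
Local Notation C := (complex R).
Definition cRe (z : C) : R := complex.Re z.
Definition cIm (z : C) : R := complex.Im z.
Definition cmod (z : C) : R := Num.sqrt (cRe z ^+ 2 + cIm z ^+ 2).
Definition cR (r : R) : C := Complex r 0.
Definition cconj (z : C) : C := Complex (cRe z) (- cIm z).
Definition cexp (z : C) : C :=
  Complex (expR (cRe z) * cos (cIm z)) (expR (cRe z) * sin (cIm z)).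
Definition mnorm m n (M : 'M[C]_(m, n)) : R :=
  Num.sqrt (\sum_i \sum_j cmod (M i j) ^+ 2).
End Cplx.

Notation Zd d := 'rV[int]_d.

Definition evec d (i : 'I_d) : Zd d := delta_mx 0 i.

Definition znorm (R : realType) d (x : Zd d) : R :=
  Num.sqrt (\sum_i ((x ord0 i)%:~R : R) ^+ 2).

(* Solution w of  w(x,t+1)-w(x,t) = - nabla^* M nabla w(x,t),  w(x,0)=delta(x),
   where (nabla_i f)(x) = f(x+e_i)-f(x), (nabla_i^* F)(x) = F(x-e_i)-F(x),
   and M(y,t) is a (possibly space-time dependent) d x d coefficient matrix. *)
Fixpoint heat (V : comPzRingType) d (M : Zd d -> nat -> 'M[V]_d) (t : nat)
  : Zd d -> V :=
  match t with
  | 0 => fun x => if x == 0 then 1 else 0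
  | t'.+1 =>
      let u := heat M t' in
      let flux := fun (y : Zd d) (i : 'I_d) =>
                    \sum_j M y t' i j * (u (y + evec j) - u y) in
      fun x => u x - \sum_i (flux (x - evec i) i - flux x i)
  end.

Definition dgrad (W : zmodType) d (f : Zd d -> W) (x : Zd d)
  : 'cV[W]_d := \col_i (f (x + evec i) - f x).

Definition boxpt d N (k : {ffun 'I_d -> 'I_(2 * N + 1)}) : Zd d :=
  \row_i ((nat_of_ord (k i))%:Z - N%:Z).

Definition zdot (R : realType) d (x : Zd d) (xi : 'rV[complex R]_d) : complex R :=
  \sum_i (x ord0 i)%:~R * xi ord0 i.

Definition pt d := (Zd d * int)%type.

Fixpoint tuples d (ss : seq (seq (pt d))) : seq (seq (pt d)) :=
  match ss with
  | [::] => [:: [::]]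
  | s :: ss' => [seq z :: zs | z <- s, zs <- tuples ss']
  end.

Section Env.
Context (R : realType) (dsp : measure_display) (Om : measurableType dsp)
        (P : probability Om R) (d : nat)
        (tau : Zd d -> int -> Om -> Om) (A : Om -> 'M[R]_d).
Local Notation C := (complex R).

Definition Env (lam Lam : R) : Prop :=
  0 < lam /\ lam <= Lam /\
      (forall w, tau 0 0 w = w) /\
      (forall x y s t w, tau (x + y) (s + t) w = tau x s (tau y t w)) /\
      (forall x s, measurable_fun setT (tau x s) /\
         forall B, measurable B -> P (tau x s @^-1` B) = P B) /\
      (forall i j, measurable_fun setT (fun w => A w i j)) /\
      (forall w, (A w)^T = A w /\
         forall v : 'rV[R]_d,
           lam * (v *m v^T) ord0 ord0 <= (v *m A w *m v^T) ord0 ord0 /\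
           (v *m A w *m v^T) ord0 ord0 <= Lam * (v *m v^T) ord0 ord0).

Definition Ga (t : nat) (x : Zd d) : R :=
  Rintegral P setT (fun w => heat (fun y s => A (tau y s%:Z w)) t x).

Definition cexpect (f : Om -> C) : C :=
  Complex (Rintegral P setT (fun w => cRe (f w)))
          (Rintegral P setT (fun w => cIm (f w))).
Definition meanM m n (psi : Om -> 'M[C]_(m, n)) : 'M[C]_(m, n) :=
  \matrix_(i, j) cexpect (fun w => psi w i j).
Definition PiM m n (psi : Om -> 'M[C]_(m, n)) : Om -> 'M[C]_(m, n) :=
  fun w => psi w - meanM psi.

Definition L2 m n (psi : Om -> 'M[C]_(m, n)) : Prop :=
  (forall i j, measurable_fun setT (fun w => cRe (psi w i j)) /\
               measurable_fun setT (fun w => cIm (psi w i j))) /\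
  (\int[P]_w ((mnorm (psi w)) ^+ 2)%:E < +oo)%E.
Definition hnorm m n (psi : Om -> 'M[C]_(m, n)) : R :=
  Num.sqrt (fine (\int[P]_w ((mnorm (psi w)) ^+ 2)%:E)).
Definition inner (f g : Om -> 'cV[C]_d) : C :=
  cexpect (fun w => \sum_i f w i ord0 * cconj (g w i ord0)).

Local Notation H := (Om -> 'cV[C]_d).
Definition zeroH : H := fun _ => 0.

(* G_Lambda and {nabla nabla^* G_Lambda(x,t)}^* (real, so ^* = transpose) *)
Definition GLam (Lam : R) (t : nat) (x : Zd d) : R :=
  heat (fun _ _ => Lam%:M) t x.
Definition NNstar (Lam : R) (x : Zd d) (t : nat) : 'M[R]_d :=
  \matrix_(i, j)
    (let G := GLam Lam t in
     (* entry (i,j) of the transpose = entry (j,i) of nabla nabla^* G *)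
     (G (x + evec j - evec i) - G (x + evec j)) - (G (x - evec i) - G x)).

Definition Tpart (Lam : R) (xi : 'rV[C]_d) (eta : C) (N : nat) (g : H) : H :=
  fun w => \sum_(t < N) \sum_(k : {ffun 'I_d -> 'I_(2 * N + 1)})
    (cR Lam * cexp (- eta * (t.+1)%:R) * cexp (- 'i%C * zdot (boxpt k) xi))
      *: (map_mx (@cR R) (NNstar Lam (boxpt k) t)
          *m g (tau (boxpt k) (- (t.+1)%:Z) w)).

Definition Top (Lam : R) (xi : 'rV[C]_d) (eta : C) (g : H) : H :=
  epsilon (inhabits zeroH) (fun psi => L2 psi /\
    (fun N : nat => hnorm (fun w => Tpart Lam xi eta N g w - psi w)) @ \oo --> 0).

Definition Tadj (Lam : R) (xi : 'rV[C]_d) (eta : C) (g : H) : H :=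
  epsilon (inhabits zeroH) (fun psi => L2 psi /\
    forall f, L2 f -> inner (Top Lam xi eta f) g = inner f psi).

Definition bmul (Lam : R) (psi : H) : H :=
  fun w => map_mx (@cR R) (1%:M - Lam^-1 *: A w) *m psi w.

Definition Inv (Lam : R) (S : H -> H) (phi : H) : H :=
  epsilon (inhabits zeroH) (fun psi => L2 psi /\
    {ae P, forall w, psi w - PiM (S (bmul Lam psi)) w = phi w}).

Definition factor (Lam : R) (S : H -> H) (g : pt d -> 'M[C]_d) (z : pt d)
  (psi : H) : H :=
  fun w => g z *m PiM (bmul Lam (Inv Lam S psi)) (tau z.1 (- z.2) w).

Definition chain (Lam : R) (S : H -> H) (gs : seq (pt d -> 'M[C]_d))
  (zs : seq (pt d)) (v : 'cV[C]_d) : H :=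
  foldr (fun gz acc => factor Lam S gz.1 gz.2 acc) (fun _ => v) (zip gs zs).

(* the multiple sum over (x_1,t_1),...,(x_k,t_k); g_j supported in s_j *)
Definition msum (Lam : R) (S : H -> H) (gs : seq ((pt d -> 'M[C]_d) * seq (pt d)))
  (v : 'cV[C]_d) : H :=
  fun w => \sum_(zs <- tuples [seq gsj.2 | gsj <- gs])
             chain Lam S [seq gsj.1 | gsj <- gs] zs v w.

(* ||g||_p for g supported in the finite duplicate-free list s *)
Definition gnorm (p : R) (g : pt d -> 'M[C]_d) (s : seq (pt d)) : R :=
  (sup [set \sum_(z <- s) (mnorm (g z *m v)) `^ p
        | v in [set v : 'cV[C]_d | mnorm v = 1]]) `^ p^-1.

Definition HypH (Lam p0 C1 : R) : Prop :=
  forall k : nat, (0 < k)%N ->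
  exists Ck : R,
  forall (xi : 'rV[C]_d) (eta : C),
    0 < cRe eta < Lam ->
    Num.sqrt (\sum_i cIm (xi ord0 i) ^+ 2) <= C1 * Num.sqrt (cRe eta / Lam) ->
  forall (adj : bool),
  let S := if adj then Tadj Lam xi eta else Top Lam xi eta in
  forall p1 : R, 1 <= p1 <= p0 ->
  forall gs : seq ((pt d -> 'M[C]_d) * seq (pt d)),
    size gs = k ->
    (forall gsj, gsj \in gs -> uniq gsj.2 /\
        forall z, gsj.1 z != 0 -> z \in gsj.2) ->
  forall v : 'cV[C]_d,
    hnorm (msum Lam S gs v) <=
      Ck * (\prod_(j < size gs)
              gnorm (if j == 0%N :> nat then p1 else 1)
                    (nth (fun _ => 0, [::]) gs j).1
                    (nth (fun _ => 0, [::]) gs j).2)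
         * mnorm v.

Definition Ac (w : Om) : 'M[C]_d := map_mx (@cR R) (A w).
Definition dxi (xi : 'rV[R]_d) (j : 'I_d) (f : Om -> C) : Om -> C :=
  fun w => cexp (- 'i%C * cR (xi ord0 j)) * f (tau (evec j) 0 w) - f w.
Definition dxistar (xi : 'rV[R]_d) (j : 'I_d) (f : Om -> C) : Om -> C :=
  fun w => cexp ('i%C * cR (xi ord0 j)) * f (tau (- evec j) 0 w) - f w.
Definition dPhi (xi : 'rV[R]_d) (Phi : Om -> 'rV[C]_d) : Om -> 'M[C]_d :=
  fun w => \matrix_(j, k) dxi xi j (fun w' => Phi w' ord0 k) w.
Definition divstar (xi : 'rV[R]_d) (M : Om -> 'M[C]_d) : Om -> 'rV[C]_d :=
  fun w => \row_k \sum_j dxistar xi j (fun w' => M w' j k) w.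

(* Phi(xi,eta,.) : the L^2 solution of the corrector equation *)
Definition Phi (xi : 'rV[R]_d) (eta : R) : Om -> 'rV[C]_d :=
  epsilon (inhabits (fun _ => 0)) (fun Ph => L2 Ph /\
    {ae P, forall w,
       cexp (cR eta) *: Ph (tau 0 1 w) - Ph w
       + PiM (divstar xi (fun w' => Ac w' *m dPhi xi Ph w')) w
       = - PiM (divstar xi Ac) w}).

Definition qhom (xi : 'rV[R]_d) (eta : R) : 'M[C]_d :=
  meanM Ac + meanM (fun w => Ac w *m dPhi xi (Phi xi eta) w).

Definition ahom : 'M[C]_d :=
  epsilon (inhabits 0) (fun M => forall e : R, 0 < e -> exists2 r : R, 0 < r &
    forall (xi : 'rV[R]_d) (eta : R),
      Num.sqrt (\sum_i xi ord0 i ^+ 2) < r -> 0 < eta < r ->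
      mnorm (qhom xi eta - M) < e).

Definition Glat (t : nat) (x : Zd d) : C := heat (fun _ _ => ahom) t x.

Definition Gdiff (t : nat) (x : Zd d) : C := cR (Ga t x) - Glat t x.
Definition gradGdiff (t : nat) (x : Zd d) : 'cV[C]_d :=
  @dgrad _ d (Gdiff t) x.

End Env.

(* Main.v *)
(* Only real frequencies are needed. Both kernels are averaged Green functions of equations
   whose coefficients belong to one class of matrices that is stable under transposition, so
   an energy, duality and Poincare argument with exponential weights bounds them and their
   second differences by Gaussians. For k = 1 and g the gradient of G_Lambda, hypothesis (H)
   bounds the corrector by eta^(-1/(2 p0)), which gains a power sigma = 1/2 - 1/(2 p0) over
   the energy bound eta^(-1/2). Hence q(xi, eta) tends to a_hom at a rate, a_hom belongs to
   the same class, and comparing the Fourier transform of u with its two-scale expansion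
   h_t (1 + Phi e) at eta ~ 1/t shows that the transform of the difference of the kernels is
   at most C t^(-sigma/2) (1 + sqrt t |xi|). Averaging over boxes slightly smaller than
   sqrt t turns this into a uniform bound that beats t^(-d/2) by a power. The geometric mean
   with the Gaussian bound restores the Gaussian factor, and discrete Landau-type
   interpolation with the second differences transfers the gain to the gradients and to
   their Hoelder differences. *)
Require Import Defs.
From HB Require Import structures.
From mathcomp Require Import all_boot all_order all_algebra.
From mathcomp Require Import all_classical all_reals all_analysis.
From mathcomp Require Import measurable_realfun complex ring lra zify.
From Stdlib Require Import ClassicalEpsilon.
Set Implicit Arguments. Unset Strict Implicit. Unset Printing Implicit Defensive.
Import Order.TTheory GRing.Theory Num.Theory.
Local Open Scope ring_scope.

(** * Finite sums over the lattice and the discrete parabolic equation *)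

(** Three obstacles shape the proof. First, [Top], [Inv], [Phi] and [ahom] are choice operators
    applied to predicates, so nothing is known about them until an object satisfying the predicate
    has been built; hence the explicit L2 completeness, the contraction argument for the resolvent
    equation and the separate uniqueness proofs. Second, the scheme is explicit in time, so its
    quadratic term must be absorbed in every energy estimate. This is the role of 4 d Lam <= 1, and
    it dictates the class [cls]: its first inequality is a norm bound for 1 - 4 d a in disguise,
    which survives transposition and homogenization without any claim of symmetry. Third, the
    Fourier bound carries no decay in xi and cannot be inverted directly; a box side t^((1 - eps)/2)
    with eps = sigma/(d + 2) equalizes the transform term and the error of replacing a function by
    its averages. The exponents may use only d, kappa and p0, while Lam itself may enter
    multiplicative constants; hence the a priori bounds quantify gamma before Lam and before the
    environment. *)

Section ZSum.
Context (T : choiceType) (V : zmodType).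
Implicit Types f g : T -> V.
(** A sum over all of [T] without a chosen range makes translations and reflections mere
    reindexings. By convention it is 0 when the support is infinite, hence the [fs] hypotheses
    everywhere. *)
Definition zsum f : V := \sum_(x \in [set: T]) f x.
Definition fs f := exists s : seq T, forall x, x \notin s -> f x = 0.
Lemma zsumE f (s : seq T) : uniq s -> (forall x, x \notin s -> f x = 0) ->
  zsum f = \sum_(x <- s) f x.
Proof.
move=> us sf; rewrite /zsum (fsbigE s) //; last by move=> x _ xs; apply: sf.
by apply: eq_bigl => x; rewrite in_setT.
Qed.

Lemma fs2 f g : fs f -> fs g -> exists s : seq T, [/\ uniq s,
  (forall x, x \notin s -> f x = 0) & (forall x, x \notin s -> g x = 0)].
Proof.
move=> [s hs] [s' hs']; exists (undup (s ++ s')); split; first exact: undup_uniq.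
  by move=> x; rewrite mem_undup mem_cat negb_or => /andP[/hs].
by move=> x; rewrite mem_undup mem_cat negb_or => /andP[_ /hs'].
Qed.

Lemma fs_uniq f : fs f -> exists s : seq T, uniq s /\ forall x, x \notin s -> f x = 0.
Proof. by move=> h; have [s [us hs _]] := fs2 h h; exists s. Qed.
Lemma eq_zsum f g : f =1 g -> zsum f = zsum g.
Proof. by move=> /funext ->. Qed.
Lemma fs0 : fs (fun=> 0).
Proof. by exists [::]. Qed.
Lemma fsD f g : fs f -> fs g -> fs (fun x => f x + g x).
Proof.
move=> hf hg; have [s [_ hs hs']] := fs2 hf hg; exists s => x xs.
by rewrite hs ?hs' ?addr0.
Qed.

Lemma fsN f : fs f -> fs (fun x => - f x).
Proof. by move=> [s hs]; exists s => x /hs ->; rewrite oppr0. Qed.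
Lemma fsB f g : fs f -> fs g -> fs (fun x => f x - g x).
Proof. by move=> hf hg; apply: fsD => //; apply: fsN. Qed.
Lemma fs_sum (I : Type) (r : seq I) (P : pred I) (F : I -> T -> V) :
  (forall i, fs (F i)) -> fs (fun x => \sum_(i <- r | P i) F i x).
Proof.
move=> h; elim: r => [|i r IH].
  by have -> : (fun x => \sum_(i <- [::] | P i) F i x) = fun=> 0;
     [apply/funext => x; rewrite big_nil | exact: fs0].
have -> : (fun x => \sum_(j <- i :: r | P j) F j x) =
  fun x => (if P i then F i x else 0) + \sum_(j <- r | P j) F j x.
  by apply/funext => x; rewrite big_cons; case: (P i); rewrite ?add0r.
by apply: fsD => //; case: (P i) => //; exact: fs0.
Qed.

Lemma fs_sub f g : fs f -> (forall x, f x = 0 -> g x = 0) -> fs g.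
Proof. by move=> [s hs] h; exists s => x /hs /h. Qed.
Lemma zsumD f g : fs f -> fs g -> zsum (fun x => f x + g x) = zsum f + zsum g.
Proof.
move=> hf hg; have [s [us hs hs']] := fs2 hf hg.
rewrite !(zsumE us) ?big_split //.
by move=> x xs; rewrite hs ?hs' ?addr0.
Qed.

Lemma zsumN f : fs f -> zsum (fun x => - f x) = - zsum f.
Proof.
move=> /fs_uniq[s [us hs]]; rewrite !(zsumE us) ?sumrN //.
by move=> x xs; rewrite hs ?oppr0.
Qed.

Lemma zsumB f g : fs f -> fs g -> zsum (fun x => f x - g x) = zsum f - zsum g.
Proof. by move=> hf hg; rewrite zsumD ?zsumN //; apply: fsN. Qed.
Lemma zsum0 : zsum (fun=> 0) = 0.
Proof. by rewrite (@zsumE _ [::]) ?big_nil. Qed.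
Lemma zsum_sum (I : Type) (r : seq I) (P : pred I) (F : I -> T -> V) :
  (forall i, fs (F i)) ->
  zsum (fun x => \sum_(i <- r | P i) F i x) = \sum_(i <- r | P i) zsum (F i).
Proof.
move=> h; elim: r => [|i r IH].
  by rewrite big_nil -[RHS]zsum0; apply: eq_zsum => x; rewrite big_nil.
rewrite big_cons -IH; case: ifP => Pi; last first.
  by apply: eq_zsum => x; rewrite big_cons Pi.
rewrite -zsumD //; last exact: fs_sum.
by apply: eq_zsum => x; rewrite big_cons Pi.
Qed.

Lemma fs_bij f (h h' : T -> T) : cancel h h' -> fs f -> fs (fun x => f (h x)).
Proof.
move=> hh [s hs]; exists [seq h' x | x <- s] => x xs; apply: hs.
by apply: contra xs => hx; apply/mapP; exists (h x); rewrite ?hh.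
Qed.

Lemma zsum_bij f (h h' : T -> T) : cancel h h' -> cancel h' h ->
  zsum (fun x => f (h x)) = zsum f.
Proof. by move=> a b; rewrite /zsum [RHS](@reindex_fsbigT _ _ _ _ _ h) //; exists h'. Qed.
Lemma zsum1 f a : (forall x, x != a -> f x = 0) -> zsum f = f a.
Proof.
move=> h; rewrite (@zsumE _ [:: a]) ?big_seq1 // => x.
by rewrite inE; apply: h.
Qed.
End ZSum.

Section ZSumRing.
Context (T : choiceType) (V : pzRingType).
Implicit Types f g : T -> V.
Lemma fsMl f g : fs f -> fs (fun x => f x * g x).
Proof. by move=> h; apply: fs_sub h _ => x ->; rewrite mul0r. Qed.
Lemma fsMr f g : fs g -> fs (fun x => f x * g x).
Proof. by move=> h; apply: fs_sub h _ => x ->; rewrite mulr0. Qed.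
Lemma fsX f n : (0 < n)%N -> fs f -> fs (fun x => f x ^+ n).
Proof. by move=> n0 h; apply: fs_sub h _ => x ->; rewrite expr0n -[n]prednK. Qed.
Lemma zsumZ a f : fs f -> zsum (fun x => a * f x) = a * zsum f.
Proof.
move=> /fs_uniq[s [us hs]]; rewrite !(zsumE us) ?mulr_sumr //.
by move=> x xs; rewrite hs ?mulr0.
Qed.
End ZSumRing.

Section ZSumNum.
Context (T : choiceType) (R : numDomainType).
Implicit Types f g : T -> R.
Lemma ler_zsum f g : fs f -> fs g -> (forall x, f x <= g x) -> zsum f <= zsum g.
Proof.
move=> hf hg fg; have [s [us hs hs']] := fs2 hf hg.
by rewrite !(zsumE us) //; apply: ler_sum.
Qed.

Lemma zsum_ge0 f : (forall x, 0 <= f x) -> 0 <= zsum f.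
Proof. by move=> h; apply: fsumr_ge0. Qed.
End ZSumNum.

Lemma ler_norm_zsum (T : choiceType) (R : numDomainType) (f : T -> R) :
  fs f -> `|zsum f| <= zsum (fun x => `|f x|).
Proof.
move=> /fs_uniq[s [us hs]]; rewrite !(zsumE us) ?ler_norm_sum // => x /hs ->.
by rewrite normr0.
Qed.

Ltac fstac := repeat first
  [ assumption | apply: fs0 | apply: fsD | apply: fsN | apply: fsB
  | apply: fs_sum => ? | apply: fsX => // | apply: fsMl; solve [fstac] | apply: fsMr; solve [fstac] ].
Section Shift.
Context (d : nat) (V : zmodType).
Implicit Types f : Zd d -> V.
Lemma fs_shift f a : fs f -> fs (fun x => f (x + a)).
Proof. by apply: (@fs_bij _ _ _ _ (fun x => x - a)) => x; rewrite addrK. Qed.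
Lemma fs_shiftl f a : fs f -> fs (fun x => f (a + x)).
Proof. by apply: (@fs_bij _ _ _ _ (fun x => x - a)) => x; rewrite addrC addKr. Qed.
Lemma zsum_shift f a : zsum (fun x => f (x + a)) = zsum f.
Proof. by apply: (@zsum_bij _ _ _ _ (fun x => x - a)) => x; rewrite ?addrK ?subrK. Qed.
Lemma zsum_shiftl f a : zsum (fun x => f (a + x)) = zsum f.
Proof. by rewrite -(zsum_shift _ a); apply: eq_zsum => x; rewrite addrC. Qed.
Lemma zsum_refl f a : zsum (fun x => f (a - x)) = zsum f.
Proof. by apply: (@zsum_bij _ _ _ _ (fun x => a - x)) => x; rewrite subKr. Qed.
End Shift.

Section Evo.
Context (d : nat) (V : comPzRingType).
Implicit Types (f g : Zd d -> V) (M : Zd d -> nat -> 'M[V]_d).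
Definition flux (a : Zd d -> 'M[V]_d) f (y : Zd d) (i : 'I_d) : V :=
  \sum_j a y i j * (f (y + evec j) - f y).
Definition step (a : Zd d -> 'M[V]_d) f : Zd d -> V :=
  fun x => f x - \sum_i (flux a f (x - evec i) i - flux a f x i).
(** Arbitrary initial data are needed for duality and superposition; [heat] is the case of a point
    mass at 0. *)
Fixpoint evo M t f : Zd d -> V :=
  if t is t'.+1 then step (M^~ t') (evo M t' f) else f.
Definition delta (z : Zd d) : Zd d -> V := fun x => if x == z then 1 else 0.
Lemma heatE M t : heat M t = evo M t (delta 0).
Proof. by elim: t => //= t ->. Qed.
Lemma fs_delta z : fs (delta z).
Proof. by exists [:: z] => x; rewrite inE /delta => /negbTE ->. Qed.
Lemma fs_flux a f i : fs f -> fs (fun x => flux a f x i).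
Proof. by move=> hf; apply: fs_sum => j; apply: fsMr; apply: fsB => //; apply: fs_shift. Qed.
Lemma fs_step a f : fs f -> fs (step a f).
Proof.
move=> hf; apply: fsB => //; apply: fs_sum => i; apply: fsB; last exact: fs_flux.
by apply: (@fs_shift _ _ (fun x => flux a f x i)); apply: fs_flux.
Qed.

Lemma fs_evo M t f : fs f -> fs (evo M t f).
Proof. by move=> hf; elim: t => //= t; apply: fs_step. Qed.
Lemma zsum_div f (F : 'I_d -> Zd d -> V) : fs f -> (forall i, fs (F i)) ->
  zsum (fun x => f x * \sum_i (F i (x - evec i) - F i x)) =
  \sum_i zsum (fun x => (f (x + evec i) - f x) * F i x).
Proof.
move=> hf hF.
have hFs i : fs (fun x => F i (x - evec i)) by apply: fs_shift.
under eq_zsum do rewrite mulr_sumr.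
rewrite zsum_sum => [|i]; last by apply: fsMl.
apply: eq_bigr => i _.
transitivity (zsum (fun x => f x * F i (x - evec i)) - zsum (fun x => f x * F i x)).
  by rewrite -zsumB; [apply: eq_zsum => x; rewrite mulrBr | exact: fsMl | exact: fsMl].
rewrite -(zsum_shift (fun x => f x * F i (x - evec i)) (evec i)) -zsumB.
- by apply: eq_zsum => x; rewrite addrK mulrBl.
- by apply: fsMr; under eq_fun do rewrite addrK.
- exact: fsMl.
Qed.

(** Summation by parts moves one difference onto [g] and the same is done on the right-hand side;
    exchanging the two indices of the coefficient then produces its transpose. *)
Lemma step_adj a f g : fs f -> fs g ->
  zsum (fun x => g x * step a f x) =
  zsum (fun x => step (fun y => (a y)^T) g x * f x).
Proof.
move=> hf hg; rewrite /step.
have hF b h : fs h -> fs (fun x => \sum_i (flux b h (x - evec i) i - flux b h x i)).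
  move=> hh; apply: fs_sum => i; apply: fsB; last exact: fs_flux.
  by apply: (@fs_shift _ _ (fun x => flux b h x i)); apply: fs_flux.
under eq_zsum do rewrite mulrBr.
under [in RHS]eq_zsum do rewrite mulrBl [X in _ - X]mulrC.
rewrite !zsumB; [|exact: fsMl| |exact: fsMl|]; [|by apply: fsMl|by apply: fsMl].
congr (_ - _).
rewrite (zsum_div (F := fun i x => flux a f x i)) //; last by move=> i; exact: fs_flux.
rewrite (zsum_div (F := fun i x => flux (fun y => (a y)^T) g x i)) //; last by move=> i; exact: fs_flux.
have hd h i : fs h -> fs (fun x => h (x + evec i) - h x :> V).
  by move=> hh; apply: fsB => //; apply: fs_shift.
rewrite -!zsum_sum => [|i|i]; [|by apply: fsMl; exact: hd..].
apply: eq_zsum => x; rewrite /flux.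
under eq_bigr do rewrite mulr_sumr.
rewrite exchange_big; apply: eq_bigr => i _ /=; rewrite mulr_sumr.
by apply: eq_bigr => j _; rewrite mxE mulrCA [RHS]mulrCA [X in _ * X]mulrC.
Qed.

Lemma stepD a f g : step a (fun x => f x + g x) = fun x => step a f x + step a g x.
Proof.
apply/funext => x; rewrite /step.
have e y i : flux a (fun x => f x + g x) y i = flux a f y i + flux a g y i.
  by rewrite /flux -big_split; apply: eq_bigr => j _; rewrite /= -mulrDr opprD addrACA.
rewrite addrACA -opprD -big_split; congr (_ - _); apply: eq_bigr => i _.
by rewrite !e /= opprD addrACA.
Qed.

Lemma stepZ a c f : step a (fun x => c * f x) = fun x => c * step a f x.
Proof.
apply/funext => x; rewrite /step.
have e y i : flux a (fun x => c * f x) y i = c * flux a f y i.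
  by rewrite /flux mulr_sumr; apply: eq_bigr => j _; rewrite -mulrBr mulrCA.
rewrite mulrBr mulr_sumr; congr (_ - _); apply: eq_bigr => i _.
by rewrite !e mulrBr.
Qed.

Lemma evoD M t f g : evo M t (fun x => f x + g x) = fun x => evo M t f x + evo M t g x.
Proof. by elim: t => //= t ->; rewrite stepD. Qed.
Lemma evoZ M t c f : evo M t (fun x => c * f x) = fun x => c * evo M t f x.
Proof. by elim: t => //= t ->; rewrite stepZ. Qed.
Lemma evo0 M t : evo M t (fun=> 0) = fun=> 0.
Proof.
have := evoZ M t 0 (fun=> 0).
by under eq_fun do rewrite mul0r; move=> ->; apply/funext => x; rewrite mul0r.
Qed.

Lemma evo_sum M t (I : Type) (r : seq I) (F : I -> Zd d -> V) :
  evo M t (fun x => \sum_(i <- r) F i x) = fun x => \sum_(i <- r) evo M t (F i) x.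
Proof.
elim: r => [|i r IH].
  under eq_fun do rewrite big_nil.
  by rewrite evo0; apply/funext => x; rewrite big_nil.
under eq_fun do rewrite big_cons.
by rewrite evoD IH; apply/funext => x; rewrite big_cons.
Qed.

Lemma evo_add M s t f : evo M (s + t) f = evo (fun y r => M y (r + t)%N) s (evo M t f).
Proof. by elim: s => //= s ->. Qed.
Lemma evoSr M t f : evo M t.+1 f = evo (fun y r => M y r.+1) t (step (M^~ 0) f).
Proof. by rewrite -[t.+1]addn1 evo_add; congr evo; apply/funext => y; apply/funext => r; rewrite addn1. Qed.
Lemma evo_eqM M M' t f : (forall y s, (s < t)%N -> M y s = M' y s) -> evo M t f = evo M' t f.
Proof.
elim: t => //= t IH h; rewrite IH; last by move=> y s st; apply: h; apply: ltnW.
by congr step; apply/funext => y; apply: h.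
Qed.

(** The last step of the evolution is moved onto [g] first, so it becomes the first step of the dual
    evolution: the transposed coefficients are met in reversed time order, which explains the index
    [t - r.+1]. *)
Lemma evo_adj M t f g : fs f -> fs g ->
  zsum (fun x => g x * evo M t f x) =
  zsum (fun x => evo (fun y r => (M y (t - r.+1)%N)^T) t g x * f x).
Proof.
elim: t M f g => [|t IH] M f g hf hg //=.
rewrite step_adj //; last exact: fs_evo.
under eq_zsum do rewrite mulrC.
under eq_zsum do rewrite mulrC.
rewrite IH //; last exact: fs_step.
apply: eq_zsum => x.
rewrite -[RHS]/(evo (fun y r => (M y (t.+1 - r.+1)%N)^T) t.+1 g x * f x).
rewrite evoSr; congr (_ * _).
have -> : (fun y => (M y (t.+1 - 1)%N)^T) = (fun y => (M y t)^T).
  by apply/funext => y; rewrite subn1.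
by [].
Qed.

Lemma step_shift a f c : step (fun y => a (y + c)) (fun y => f (y + c)) = fun x => step a f (x + c).
Proof.
apply/funext => x; rewrite /step; congr (_ - _); apply: eq_bigr => i _.
by rewrite /flux; congr (_ - _); apply: eq_bigr => j _; rewrite ![_ + c + _]addrAC // [_ - _ + c]addrAC.
Qed.

Lemma evo_shift M t f c :
  evo (fun y => M (y + c)) t (fun y => f (y + c)) = fun x => evo M t f (x + c).
Proof. by elim: t => //= t ->; rewrite (step_shift (M^~ t)). Qed.
(** Moving the point mass to 0 moves the coefficient field instead; this is how shifted environments
    enter. *)
Lemma evo_delta M t z x : evo M t (delta z) x = heat (fun y => M (y + z)) t (x - z).
Proof.
rewrite heatE.
have -> : delta 0 = fun y => delta z (y + z).
  by apply/funext => y; rewrite /delta -[y + z == z]subr_eq0 addrK.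
by rewrite evo_shift subrK.
Qed.

Lemma evo_superp M t f x : fs f -> evo M t f x = zsum (fun z => f z * evo M t (delta z) x).
Proof.
move=> /fs_uniq[s [us hs]].
rewrite (zsumE us); last by move=> z /hs ->; rewrite mul0r.
have {1}-> : f = fun x => \sum_(z <- s) f z * delta z x.
  apply/funext => y; case: (boolP (y \in s)) => ys.
    rewrite (bigD1_seq y) //= /delta eqxx mulr1 big1 ?addr0 // => z.
    by rewrite eq_sym => /negbTE ->; rewrite mulr0.
  rewrite hs // big_seq big1 // => z zs.
  by rewrite /delta; case: eqP => [e|_]; rewrite ?mulr0 //; rewrite e zs in ys.
by rewrite evo_sum; apply: eq_bigr => z _; rewrite evoZ.
Qed.
End Evo.

Lemma expn2_sumT (R : realFieldType) (I : finType) (y : I -> R) :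
  (\sum_i y i) ^+ 2 <= #|I|%:R * \sum_i y i ^+ 2.
Proof.
have h : 0 <= \sum_i \sum_j (y i - y j) ^+ 2.
  by apply: sumr_ge0 => i _; apply: sumr_ge0 => j _; apply: sqr_ge0.
have e : \sum_i \sum_j (y i - y j) ^+ 2 =
    2 * (#|I|%:R * \sum_i y i ^+ 2) - 2 * (\sum_i y i) ^+ 2.
  under eq_bigr => i _ do under eq_bigr => j _ do rewrite sqrrB.
  under eq_bigr => i _ do rewrite !big_split /= sumr_const sumrN.
  rewrite !big_split /= sumr_const sumrN.
  have -> : \sum_i \sum_j y i * y j *+ 2 = 2 * (\sum_i y i) ^+ 2.
    rewrite expr2 mulr_suml mulr_sumr; apply: eq_bigr => i _.
    by rewrite !mulr_sumr; apply: eq_bigr => j _; rewrite mulr_natl.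
  by rewrite sumrMnl -mulr_natl; ring.
by move: h; rewrite e; lra.
Qed.

Lemma expn2_sum (R : realFieldType) d (y : 'I_d -> R) :
  (\sum_i y i) ^+ 2 <= d%:R * \sum_i y i ^+ 2.
Proof. by have := expn2_sumT y; rewrite card_ord. Qed.
Section Energy.
Context (R : realFieldType) (d : nat).
Implicit Types (f g : Zd d -> R).
Definition mulv (a : 'M[R]_d) (v : 'I_d -> R) (i : 'I_d) : R := \sum_j a i j * v j.
Definition sqn (v : 'I_d -> R) : R := \sum_i v i ^+ 2.
Definition dotv (v w : 'I_d -> R) : R := \sum_i v i * w i.
(* This class of (not necessarily symmetric) matrices is stable under transposition
   and under homogenization, and makes [step a] a contraction of l^2. *)
Definition cls (l L : R) (a : 'M[R]_d) := forall v : 'I_d -> R,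
  2 * d%:R * sqn (mulv a v) + l * sqn v <= dotv v (mulv a v) /\
  sqn (mulv a v) <= L ^+ 2 * sqn v.
Lemma sqn_ge0 v : 0 <= sqn v.
Proof. by apply: sumr_ge0 => i _; apply: sqr_ge0. Qed.
Lemma fs_sqn (f : 'I_d -> Zd d -> R) : (forall i, fs (f i)) -> fs (fun x => sqn (fun i => f i x)).
Proof. by move=> h; apply: fs_sum => i; apply: fsX. Qed.
Definition dgr f (x : Zd d) (i : 'I_d) : R := f (x + evec i) - f x.
Lemma fs_dgr f i : fs f -> fs (fun x => dgr f x i).
Proof. by move=> hf; apply: fsB => //; apply: fs_shift. Qed.
Lemma energy_pointwise (F G e : 'I_d -> R) (dl : 'I_d -> R) (l L mu eps y : R) :
  0 < l -> 0 < L -> 4 * d%:R * mu * L ^+ 2 <= l ->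
  0 <= mu -> (forall i, dl i ^+ 2 <= eps ^+ 2) ->
  2 * d%:R * sqn F + l * sqn G <= dotv G F -> sqn F <= L ^+ 2 * sqn G ->
  (* y = (g x)^2 *)
  y - 2 * \sum_i (F i * (G i + dl i * e i)) + d%:R * (4 + 2 * mu) * sqn F <=
  y - l * sqn G + 2 * eps ^+ 2 * L ^+ 2 / l * sqn e.
Proof.
move=> l0 L0 hmu mu0 hdl hc hL.
(* This Young weight makes the cross term cost half of l |G|^2, and the 2 d mu |F|^2 from the
   weights costs the other half by the bound on mu. The remaining 4 d |F|^2 is exactly what twice
   the first inequality of [cls] provides, leaving l |G|^2 out of 2 l |G|^2. *)
set s := l / (2 * L ^+ 2).
have s0 : 0 < s by apply: divr_gt0 => //; rewrite mulr_gt0 // exprn_gt0.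
have L20 : 0 < L ^+ 2 by rewrite exprn_gt0.
have hcross : - (2 * \sum_i F i * (dl i * e i)) <= s * sqn F + eps ^+ 2 / s * sqn e.
  rewrite -mulrN -sumrN !mulr_sumr -big_split; apply: ler_sum => i _ /=.
  have h1 : - (2 * (F i * (dl i * e i))) <= s * F i ^+ 2 + dl i ^+ 2 / s * e i ^+ 2.
    have := sqr_ge0 (s * F i + dl i * e i).
    rewrite -(pmulr_lge0 _ (_ : 0 < s^-1)) ?invr_gt0 // => h.
    rewrite -subr_ge0; suff -> : s * F i ^+ 2 + dl i ^+ 2 / s * e i ^+ 2 - - (2 * (F i * (dl i * e i))) =
      (s * F i + dl i * e i) ^+ 2 * s^-1 by [].
    by field; rewrite gt_eqF.
  rewrite mulrN; apply: le_trans h1 _; rewrite lerD2l ler_wpM2r ?sqr_ge0 //.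
  by rewrite ler_wpM2r ?invr_ge0 ?(ltW s0).
have -> : \sum_i (F i * (G i + dl i * e i)) = dotv G F + \sum_i F i * (dl i * e i).
  by rewrite -big_split; apply: eq_bigr => i _; rewrite mulrDr [G i * _]mulrC.
have h2 : s * sqn F <= l / 2 * sqn G.
  apply: le_trans (ler_wpM2l (ltW s0) hL) _.
  by rewrite mulrA le_eqVlt /s; apply/orP; left; apply/eqP; field; rewrite gt_eqF.
have h3 : 2 * d%:R * mu * sqn F <= l / 2 * sqn G.
  have h30 : 2 * d%:R * mu * sqn F <= 2 * d%:R * mu * (L ^+ 2 * sqn G).
    by rewrite ler_wpM2l // !mulr_ge0.
  apply: le_trans h30 _; rewrite mulrA ler_wpM2r ?sqn_ge0 //; lra.
have -> : 2 * eps ^+ 2 * L ^+ 2 / l = eps ^+ 2 / s.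
  by rewrite /s; field; rewrite !gt_eqF.
move: hcross hc h2 h3.
set A := \sum_i _; set B := dotv _ _; set X := sqn F; set Y := sqn G; set Z := sqn e.
move=> h1 h2 h3 h4.
have -> : d%:R * (4 + 2 * mu) * X = 4 * d%:R * X + 2 * d%:R * mu * X by ring.
have -> : 2 * (B + A) = 2 * B + 2 * A by ring.
have -> : 4 * d%:R * X = 2 * (2 * d%:R * X) by ring.
move: h1 h2 h3 h4; set W := eps ^+ 2 / s * Z; set W2 := s * X; set W3 := 2 * d%:R * mu * X.
lra.
Qed.

(** The step is conjugated with the weight. For g = rho f, summation by parts produces m g(x + e) -
    g(x), which is the weighted gradient plus the defect (m - 1/m) g(x + e) of order eps; the
    divergence squared picks up m^2 <= 1 + mu, whence d (4 + 2 mu) |F|^2. *)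
Lemma energy (a : Zd d -> 'M[R]_d) f (rho : Zd d -> R) (m : 'I_d -> R) (l L mu eps : R) :
  fs f -> 0 < l -> 0 < L -> 0 <= mu -> 4 * d%:R * mu * L ^+ 2 <= l ->
  (forall i, 0 < m i) -> (forall i, m i ^+ 2 <= 1 + mu) ->
  (forall i, (m i - (m i)^-1) ^+ 2 <= eps ^+ 2) ->
  (forall x i, rho (x + evec i) = m i * rho x) ->
  (forall x, cls l L (a x)) ->
  zsum (fun x => (rho x * step a f x) ^+ 2) <=
  (1 + 2 * d%:R * eps ^+ 2 * L ^+ 2 / l) * zsum (fun x => (rho x * f x) ^+ 2)
  - l * zsum (fun x => sqn (fun i => rho x * dgr f x i)).
Proof.
move=> hf l0 L0 mu0 hmu m0 hm hdl hrho hcls.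
set g := fun x => rho x * f x.
have hg : fs g by apply: fsMr.
pose G x i := rho x * dgr f x i.
pose F x i := rho x * flux a f x i.
have hF i : fs (F^~ i) by apply: fsMr; exact: fs_flux.
have hG i : fs (G^~ i) by apply: fsMr; exact: fs_dgr.
have hFG x i : F x i = mulv (a x) (G x) i.
  by rewrite /F /flux mulr_sumr; apply: eq_bigr => j _; rewrite mulrCA.
have hrho' x i : rho x = m i * rho (x - evec i) by rewrite -hrho subrK.
pose y i x := m i * F (x - evec i) i - F x i.
have hFs i : fs (fun x => F (x - evec i) i) by apply: (fs_shift (f := F^~ i)).
have hy i : fs (y i) by apply: fsB => //; apply: fsMr.
have hst x : rho x * step a f x = g x - \sum_i y i x.
  rewrite /step mulrBr mulr_sumr; congr (_ - _); apply: eq_bigr => i _.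
  by rewrite /y /F mulrA -hrho' mulrBr.
have hgs i : fs (fun x => g (x + evec i)) by apply: fs_shift.
have e1 : zsum (fun x => (rho x * step a f x) ^+ 2) =
    zsum (fun x => g x ^+ 2) - 2 * zsum (fun x => g x * \sum_i y i x)
    + zsum (fun x => (\sum_i y i x) ^+ 2).
  have hY : fs (fun x => \sum_i y i x) by apply: fs_sum.
  rewrite -zsumZ; last by apply: fsMl.
  rewrite -zsumB; [|exact: fsX|by apply: fsMr; apply: fsMl].
  rewrite -zsumD; [|by apply: fsB; [exact: fsX|apply: fsMr; apply: fsMl]|exact: fsX].
  by apply: eq_zsum => x; rewrite hst; ring.
have e2 : zsum (fun x => g x * \sum_i y i x) =
    zsum (fun x => \sum_i F x i * (G x i + (m i - (m i)^-1) * g (x + evec i))).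
  rewrite zsum_sum => [|i]; last by apply: fsMl.
  under eq_zsum do rewrite mulr_sumr.
  rewrite zsum_sum => [|i]; last by apply: fsMl.
  apply: eq_bigr => i _.
  transitivity (zsum (fun x => m i * g (x + evec i) * F x i - g x * F x i)).
    rewrite [RHS]zsumB; [|exact: fsMr|exact: fsMr].
    rewrite -(zsum_shift (fun x => _ * F x i) (- evec i)) -zsumB.
    - by apply: eq_zsum => x; rewrite subrK /y; ring.
    - by apply: fsMr.
    - exact: fsMr.
  apply: eq_zsum => x; rewrite -mulrBl mulrC; congr (_ * _).
  rewrite /G /g /dgr hrho; have := m0 i; move: (m i) => c c0.
  by field; rewrite gt_eqF.
have e3 : zsum (fun x => (\sum_i y i x) ^+ 2) <=
    d%:R * (4 + 2 * mu) * zsum (fun x => sqn (F x)).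
  apply: (@le_trans _ _ (zsum (fun x => d%:R * \sum_i y i x ^+ 2))).
    apply: ler_zsum => [||x]; last exact: expn2_sum.
      by apply: fsX => //; apply: fs_sum.
    by apply: fsMr; apply: fs_sum => i; apply: fsX.
  rewrite zsumZ; last by apply: fs_sum => i; apply: fsX.
  rewrite -mulrA ler_wpM2l ?ler0n //.
  rewrite !zsum_sum => [|i|i]; try exact: fsX.
  rewrite mulr_sumr; apply: ler_sum => i _.
  apply: (@le_trans _ _ (zsum (fun x => 2 * (1 + mu) * F (x - evec i) i ^+ 2 + 2 * F x i ^+ 2))).
    apply: ler_zsum => [||x].
    - exact: fsX.
    - by apply: fsD; apply: fsMr; apply: fsX.
    rewrite /y; set u := F _ i; set v := F x i.
    have h1 : m i ^+ 2 * u ^+ 2 <= (1 + mu) * u ^+ 2 by rewrite ler_wpM2r ?sqr_ge0.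
    have := sqr_ge0 (m i * u + v); move: h1; rewrite !expr2; nra.
  rewrite zsumD ?zsumZ; try (by apply: fsX); try (by apply: fsMr; apply: fsX).
  rewrite (zsum_shift (fun x => F x i ^+ 2)); lra.
have hs1 : fs (fun x => g x ^+ 2) by apply: fsX.
have hsF : fs (fun x => sqn (F x)) by apply: (fs_sqn (f := fun i x => F x i)).
have hsG : fs (fun x => sqn (G x)) by apply: (fs_sqn (f := fun i x => G x i)).
have hse : fs (fun x => sqn (fun i => g (x + evec i))) by apply: (fs_sqn (f := fun i x => g (x + evec i))).
have hcr : fs (fun x => \sum_i F x i * (G x i + (m i - (m i)^-1) * g (x + evec i))).
  by apply: fs_sum => i; apply: fsMl.
apply: (@le_trans _ _ (zsum (fun x => g x ^+ 2 - 2 * (\sum_i F x i * (G x i + (m i - (m i)^-1) * g (x + evec i)))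
   + d%:R * (4 + 2 * mu) * sqn (F x)))).
  rewrite e1 e2 zsumD ?zsumB ?zsumZ //; try (by apply: fsMr); last by apply: fsB => //; apply: fsMr.
  by rewrite lerD2l.
apply: (@le_trans _ _ (zsum (fun x => g x ^+ 2 - l * sqn (G x) +
   2 * eps ^+ 2 * L ^+ 2 / l * sqn (fun i => g (x + evec i))))).
  apply: ler_zsum => [||x].
  - by apply: fsD; [apply: fsB => //|]; apply: fsMr.
  - by apply: fsD; [apply: fsB => //|]; apply: fsMr.
  have [hc1 hc2] := hcls x (G x).
  have eF : F x = mulv (a x) (G x) by apply/funext => i; rewrite hFG.
  by apply: energy_pointwise => //; rewrite eF.
rewrite zsumD ?zsumB ?zsumZ //; try (by apply: fsMr); last by apply: fsB => //; apply: fsMr.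
have -> : zsum (fun x => sqn (fun i => g (x + evec i))) = d%:R * zsum (fun x => g x ^+ 2).
  rewrite zsum_sum => [|i]; last exact: fsX.
  under eq_bigr => i _ do rewrite (zsum_shift (fun x => g x ^+ 2)).
  by rewrite sumr_const card_ord mulr_natl.
rewrite le_eqVlt; apply/orP; left; apply/eqP; rewrite /g /G; ring.
Qed.
End Energy.

(** * Annealed Green functions *)

Section ClsTr.
Context (R : realFieldType) (d : nat).
Implicit Types (a b : 'M[R]_d) (v w : 'I_d -> R).
Lemma dotvC v w : dotv v w = dotv w v.
Proof. by apply: eq_bigr => i _; rewrite mulrC. Qed.
Lemma dotv_sqn v : dotv v v = sqn v.
Proof. by []. Qed.
Lemma dotv_CS v w : dotv v w ^+ 2 <= sqn v * sqn w.
Proof.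
have h : 0 <= \sum_i \sum_j (v i * w j - v j * w i) ^+ 2.
  by apply: sumr_ge0 => i _; apply: sumr_ge0 => j _; apply: sqr_ge0.
have e : \sum_i \sum_j (v i * w j - v j * w i) ^+ 2 =
    2 * (sqn v * sqn w) - 2 * dotv v w ^+ 2.
  have -> : 2 * (sqn v * sqn w) = sqn v * sqn w + sqn w * sqn v by ring.
  rewrite expr2 /sqn /dotv !mulr_suml mulr_sumr -big_split -sumrB; apply: eq_bigr => i _ /=.
  rewrite !mulr_sumr -big_split -sumrB; apply: eq_bigr => j _ /=; ring.
by move: h; rewrite e; lra.
Qed.

Lemma mulvT a v w : dotv (mulv a^T v) w = dotv v (mulv a w).
Proof.
rewrite /dotv /mulv; under eq_bigr do rewrite mulr_suml.
rewrite exchange_big; apply: eq_bigr => i _ /=; rewrite mulr_sumr.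
by apply: eq_bigr => j _; rewrite mxE mulrCA mulrA.
Qed.

Lemma sqn_mulvT a c : (forall v, sqn (mulv a v) <= c * sqn v) ->
  forall v, sqn (mulv a^T v) <= c * sqn v.
Proof.
move=> h v; set X := sqn _.
have X0 : 0 <= X by apply: sqn_ge0.
have h1 : X ^+ 2 <= sqn v * (c * X).
  rewrite {1}/X -dotv_sqn mulvT; apply: le_trans (dotv_CS _ _) _.
  by rewrite ler_wpM2l ?sqn_ge0.
have [X1|] := ltrP 0 X.
  by rewrite -(ler_pM2r X1) -expr2; apply: le_trans h1 _; rewrite mulrCA mulrA.
move=> X1; apply: le_trans X1 _; apply: le_trans (h v); exact: sqn_ge0.
Qed.

(** The first inequality of [cls] is equivalent to |v - 4 d a v|^2 <= (1 - 8 d l) |v|^2, because the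
    left side expands to |v|^2 - 8 d (v.av - 2 d |av|^2). So both conditions are operator norm
    bounds, and a matrix and its transpose have the same norm. *)
Lemma cls_tr l L a : cls l L a -> cls l L a^T.
Proof.
move=> h; have [d0|dpos] := posnP d.
  by move: a h; rewrite d0 => a h v; rewrite /dotv /sqn !big_ord0 !mulr0 addr0; split.
have d1 : 0 < d%:R :> R by rewrite ltr0n.
have h2 : forall v, sqn (mulv a^T v) <= L ^+ 2 * sqn v.
  by apply: sqn_mulvT => v; have [] := h v.
pose b : 'M[R]_d := 1%:M - (4 * d%:R) *: a.
have bE (a' : 'M[R]_d) v : mulv (1%:M - (4 * d%:R) *: a') v = fun i => v i - 4 * d%:R * mulv a' v i.
  apply/funext => i; rewrite /mulv mulr_sumr.
  under eq_bigr do rewrite !mxE mulrBl.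
  rewrite big_split sumrN /= (bigD1 i) //= eqxx mul1r big1 ?addr0; last first.
    by move=> j /negbTE; rewrite eq_sym => ->; rewrite mul0r.
  by congr (_ - _); apply: eq_bigr => j _; rewrite mulrA.
have sb (a' : 'M[R]_d) v : sqn (mulv (1%:M - (4 * d%:R) *: a') v) =
    sqn v - 8 * d%:R * (dotv v (mulv a' v) - 2 * d%:R * sqn (mulv a' v)).
  rewrite bE /sqn /dotv mulr_sumr -sumrB mulr_sumr -sumrB; apply: eq_bigr => i _; ring.
have hb : forall v, sqn (mulv b v) <= (1 - 8 * d%:R * l) * sqn v.
  move=> v; rewrite sb; have [h1 _] := h v.
  have -> : (1 - 8 * d%:R * l) * sqn v = sqn v - 8 * d%:R * (l * sqn v) by ring.
  by rewrite lerD2l lerN2 ler_wpM2l ?mulr_ge0 ?ler0n // lerBrDl.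
have := sqn_mulvT hb => hbt v; split => //.
have bT : b^T = 1%:M - (4 * d%:R) *: a^T by rewrite /b linearB /= trmx1 linearZ.
have := hbt v; rewrite bT sb.
have -> : (1 - 8 * d%:R * l) * sqn v = sqn v - 8 * d%:R * (l * sqn v) by ring.
by rewrite lerD2l lerN2 ler_pM2l ?mulr_gt0 // lerBrDl.
Qed.
End ClsTr.

Section Boxes.
Context (d : nat).
(** The cube is listed through [boxpt], the enumeration used by the partial sums in [Tpart]. *)
Definition boxs N : seq (Zd d) := [seq boxpt k | k : {ffun 'I_d -> 'I_(2 * N + 1)}].
Lemma boxpt_inj N : injective (@boxpt d N).
Proof.
move=> k k' /rowP h; apply/ffunP => i; apply: val_inj => /=.
by have := h i; rewrite !mxE; move: (nat_of_ord (k i)) (nat_of_ord (k' i)) => n n'; lia.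
Qed.

Lemma boxs_uniq N : uniq (boxs N).
Proof. by rewrite map_inj_uniq ?enum_uniq //; exact: boxpt_inj. Qed.
Lemma mem_boxs N (x : Zd d) : (x \in boxs N) = [forall i, (`|x ord0 i| <= N)%N].
Proof.
apply/idP/forallP => [/mapP[k _ ->] i|h].
  by rewrite mxE; have := ltn_ord (k i); move: (nat_of_ord (k i)) => n; lia.
have hlt i : (absz (x ord0 i + N%:Z)%R < 2 * N + 1)%N.
  by have := h i; move: (x ord0 i) => z; lia.
apply/mapP; exists [ffun i => Ordinal (hlt i)]; first by rewrite mem_enum.
by apply/rowP => i; rewrite !mxE ffunE /=; have := h i; move: (x ord0 i) => z; lia.
Qed.

Lemma notin_boxs N (x : Zd d) : x \notin boxs N -> exists i, (N < `|x ord0 i|)%N.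
Proof. by rewrite mem_boxs => /forallPn /= [i hi]; exists i; rewrite ltnNge. Qed.
Lemma evecE (i j : 'I_d) : evec i ord0 j = (i == j)%:R.
Proof. by rewrite mxE eqxx eq_sym. Qed.
(** Finite propagation speed: one step reads the points x - e_i + e_j, x + e_j, x - e_i and x, which
    change no coordinate by more than 1. *)
Lemma heat_supp (V : comPzRingType) (M : Zd d -> nat -> 'M[V]_d) t x :
  x \notin boxs t -> heat M t x = 0.
Proof.
move=> /notin_boxs[k hk]; elim: t x hk => [|t IH] x hk /=.
  by case: eqP => // e; move: hk; rewrite e mxE.
have h0 (z : Zd d) : (t < `|z ord0 k|)%N -> heat M t z = 0 by apply: IH.
rewrite h0 ?sub0r; last by apply: ltn_trans hk.
rewrite big1 ?oppr0 // => i _; rewrite -sumrB big1 // => j _.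
have ek b : (evec b ord0 k == 0) || (evec b ord0 k == 1).
  by rewrite evecE; case: (b == k).
have xe b : (x + evec b) ord0 k = x ord0 k + evec b ord0 k by rewrite mxE.
have xm b : (x - evec b) ord0 k = x ord0 k - evec b ord0 k by rewrite !mxE.
have xem b c : (x - evec b + evec c) ord0 k = x ord0 k - evec b ord0 k + evec c ord0 k.
  by rewrite !mxE.
rewrite !h0 ?oppr0 ?addr0 ?mulr0 ?oppr0 ?addr0 //.
all: rewrite ?xem ?xe ?xm; move: (ek i) (ek j) hk; move: (evec i ord0 k) (evec j ord0 k) (x ord0 k) => a b z.
all: by move=> /orP[] /eqP ha /orP[] /eqP hb; lia.
Qed.

Lemma fs_heat (V : comPzRingType) (M : Zd d -> nat -> 'M[V]_d) t : fs (heat M t).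
Proof. by exists (boxs t) => x; apply: heat_supp. Qed.
End Boxes.

(* An abstract expectation over a stationary environment. The random environment, its
   time reversal, and constant coefficients (over [unit]) are all instances. *)
Record annealed (R : realType) (d : nat) (Om : Type) (adm : (Om -> R) -> Prop)
    (Ex : (Om -> R) -> R) (tau : Zd d -> int -> Om -> Om) (A : Om -> 'M[R]_d)
    (l L : R) : Prop := Annealed {
  adm_cst : forall c, adm (fun=> c);
  admD : forall f g, adm f -> adm g -> adm (fun w => f w + g w);
  admM : forall f g, adm f -> adm g -> adm (fun w => f w * g w);
  adm_tau : forall f x s, adm f -> adm (fun w => f (tau x s w));
  ExD : forall f g, adm f -> adm g -> Ex (fun w => f w + g w) = Ex f + Ex g;
  ExZ : forall c f, adm f -> Ex (fun w => c * f w) = c * Ex f;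
  Ex_le : forall f g, adm f -> adm g -> (forall w, f w <= g w) -> Ex f <= Ex g;
  Ex1 : Ex (fun=> 1) = 1;
  Ex_tau : forall f x s, adm f -> Ex (fun w => f (tau x s w)) = Ex f;
  tau00 : forall w, tau 0 0 w = w;
  tauDD : forall x y s t w, tau (x + y) (s + t) w = tau x s (tau y t w);
  adm_A : forall i j, adm (fun w => A w i j);
  cls_A : forall w, cls l L (A w) }.
Section Annealed.
Context (R : realType) (d : nat) (Om : Type) (adm : (Om -> R) -> Prop)
    (Ex : (Om -> R) -> R) (tau : Zd d -> int -> Om -> Om) (A : Om -> 'M[R]_d)
    (l L : R).
Hypothesis an : annealed adm Ex tau A l L.
Definition fieldA (w : Om) (y : Zd d) (s : nat) : 'M[R]_d := A (tau y s%:Z w).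
Definition K (t : nat) (x : Zd d) (w : Om) : R := heat (fieldA w) t x.
Lemma adm_sum (I : Type) (r : seq I) (P : pred I) (F : I -> Om -> R) :
  (forall i, adm (F i)) -> adm (fun w => \sum_(i <- r | P i) F i w).
Proof.
move=> h; elim: r => [|i r IH].
  by under eq_fun do rewrite big_nil; exact: (adm_cst an).
under eq_fun do rewrite big_cons.
by case: (P i) => //; apply: (admD an).
Qed.

Lemma admZ c f : adm f -> adm (fun w => c * f w).
Proof. by apply: (admM an); exact: (adm_cst an). Qed.
Lemma admN f : adm f -> adm (fun w => - f w).
Proof. by move=> /(admZ (-1)); under eq_fun do rewrite mulN1r. Qed.
Lemma admB f g : adm f -> adm g -> adm (fun w => f w - g w).
Proof. by move=> hf hg; apply: (admD an) => //; apply: admN. Qed.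
Lemma ExN f : adm f -> Ex (fun w => - f w) = - Ex f.
Proof. by move=> /(ExZ an (-1)); under eq_fun do rewrite mulN1r; rewrite mulN1r. Qed.
Lemma ExB f g : adm f -> adm g -> Ex (fun w => f w - g w) = Ex f - Ex g.
Proof. by move=> hf hg; rewrite (ExD an) ?ExN //; apply: admN. Qed.
Lemma Ex_cst c : Ex (fun=> c) = c.
Proof.
by have := ExZ an c (adm_cst an 1); rewrite (Ex1 an) mulr1.
Qed.

Lemma Ex_sum (I : Type) (r : seq I) (F : I -> Om -> R) :
  (forall i, adm (F i)) -> Ex (fun w => \sum_(i <- r) F i w) = \sum_(i <- r) Ex (F i).
Proof.
move=> h; elim: r => [|i r IH].
  by under eq_fun do rewrite big_nil; rewrite Ex_cst big_nil.
under eq_fun do rewrite big_cons.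
by rewrite (ExD an) ?IH ?big_cons //; apply: adm_sum.
Qed.

Lemma Ex_ge0 f : adm f -> (forall w, 0 <= f w) -> 0 <= Ex f.
Proof. by move=> hf h; rewrite -(Ex_cst 0); apply: (Ex_le an) => //; exact: (adm_cst an). Qed.
(** The support is asked to be finite uniformly in the environment, so that the spatial sum is one
    fixed finite sum and commutes with the expectation. *)
Definition afs (f : Zd d -> Om -> R) :=
  (forall x, adm (f x)) /\ exists s : seq (Zd d), forall x w, x \notin s -> f x w = 0.
Lemma afs_fs f w : afs f -> fs (f^~ w).
Proof. by move=> [_ [s hs]]; exists s => x; apply: hs. Qed.
Lemma zsum_afsE f : afs f -> exists s : seq (Zd d), [/\ uniq s,
   forall x w, x \notin s -> f x w = 0 &
   (fun w => zsum (f^~ w)) = fun w => \sum_(x <- s) f x w].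
Proof.
move=> [_ [s hs]]; exists (undup s); split; first exact: undup_uniq.
  by move=> x w; rewrite mem_undup; apply: hs.
apply/funext => w; apply: zsumE; first exact: undup_uniq.
by move=> x; rewrite mem_undup; apply: hs.
Qed.

Lemma adm_zsum f : afs f -> adm (fun w => zsum (f^~ w)).
Proof. by move=> hf; have [s [_ _ ->]] := zsum_afsE hf; apply: adm_sum; case: hf. Qed.
Lemma Ex_zsum f : afs f -> Ex (fun w => zsum (f^~ w)) = zsum (fun x => Ex (f x)).
Proof.
move=> hf; have [s [us hs ->]] := zsum_afsE hf.
rewrite Ex_sum; last by case: hf.
rewrite (zsumE us) // => x xs; rewrite -[RHS]Ex_cst; congr Ex.
by apply/funext => w; apply: hs.
Qed.

Lemma afsD f g : afs f -> afs g -> afs (fun x w => f x w + g x w).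
Proof.
move=> [af [s hs]] [ag [s' hs']]; split; first by move=> x; apply: (admD an).
exists (s ++ s') => x w; rewrite mem_cat negb_or => /andP[xs xs'].
by rewrite hs // hs' // addr0.
Qed.

Lemma afsMc f (h : Zd d -> R) : afs f -> afs (fun x w => h x * f x w).
Proof.
move=> [af [s hs]]; split; first by move=> x; apply: admZ.
by exists s => x w /hs ->; rewrite mulr0.
Qed.

Lemma afsB f g : afs f -> afs g -> afs (fun x w => f x w - g x w).
Proof.
move=> hf hg; have -> : (fun x w => f x w - g x w) = fun x w => f x w + -1 * g x w.
  by apply/funext => x; apply/funext => w; rewrite mulN1r.
by apply: afsD => //; apply: (afsMc (fun=> -1)).
Qed.

Lemma afsM f g : afs f -> (forall x, adm (g x)) -> afs (fun x w => f x w * g x w).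
Proof.
move=> [af [s hs]] ag; split; first by move=> x; apply: (admM an).
by exists s => x w /hs ->; rewrite mul0r.
Qed.

Lemma afsX f : afs f -> afs (fun x w => f x w ^+ 2).
Proof. by move=> hf; apply: (afsM hf); case: hf. Qed.
Lemma afs_bij f (h h' : Zd d -> Zd d) : cancel h h' -> afs f -> afs (fun x => f (h x)).
Proof.
move=> hh [af [s hs]]; split => // ; exists [seq h' x | x <- s] => x w xs; apply: hs.
by apply: contra xs => hx; apply/mapP; exists (h x); rewrite ?hh.
Qed.

Lemma afs_shift f a : afs f -> afs (fun x => f (x + a)).
Proof. by apply: (@afs_bij _ _ (fun x => x - a)) => x; rewrite addrK. Qed.
Lemma afs_sum (I : Type) (r : seq I) (F : I -> Zd d -> Om -> R) :
  (forall i, afs (F i)) -> afs (fun x w => \sum_(i <- r) F i x w).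
Proof.
move=> h; elim: r => [|i r IH].
  split=> [x|]; first by under eq_fun do rewrite big_nil; exact: (adm_cst an).
  by exists [::] => x w _; rewrite big_nil.
have -> : (fun x w => \sum_(j <- i :: r) F j x w) = fun x w => F i x w + \sum_(j <- r) F j x w.
  by apply/funext => x; apply/funext => w; rewrite big_cons.
exact: afsD.
Qed.

Lemma afs_K t : afs (K t).
Proof.
split; last by exists (boxs d t) => x w; apply: heat_supp.
elim: t => [|t IH] x; first exact: (adm_cst an).
have hst u : (forall x, adm (u x)) -> adm (fun w => step (fun y => fieldA w y t) (u^~ w) x).
  move=> hu; apply: admB => //; apply: adm_sum => i.
  have hA y j : adm (fun w => fieldA w y t i j).
    by have := adm_tau an y t%:Z (adm_A an i j).
  by apply: admB; apply: adm_sum => j; apply: (admM an) => //; apply: admB.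
by have := hst _ IH.
Qed.

Lemma fieldA_shift w y z (r t : nat) :
  fieldA w (y + z) (r + t) = fieldA (tau z t%:Z w) y r.
Proof. by rewrite /fieldA PoszD (tauDD an). Qed.
(** After time t the evolution restarts from the point masses at the sites z, and by the group law
    of [tau] the coefficients seen from (z, t) are those of the shifted environment. *)
Lemma K_semigroup s t x w :
  K (s + t) x w = zsum (fun z => K t z w * K s (x - z) (tau z t%:Z w)).
Proof.
rewrite /K !heatE evo_add evo_superp; last by apply: fs_evo; exact: fs_delta.
apply: eq_zsum => z; rewrite [evo _ s _ _]evo_delta; congr (_ * _).
congr (heat _ s _); apply/funext => y; apply/funext => r.
exact: fieldA_shift.
Qed.
End Annealed.

(** * Exponential weights and the Poincare inequality *)

Lemma expR_le1D2 (R : realType) (y : R) : `|y| <= 1 / 2 -> expR y <= 1 + 2 * `|y|.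
Proof.
move=> hy; have h := expR_ge1Dx (- y).
have hy2 : y <= `|y| by apply: ler_norm.
have h1 : 0 < 1 - `|y| by lra.
apply: (@le_trans _ _ (1 - `|y|)^-1).
  rewrite -[expR y]invrK -expRN lef_pV2 ?posrE ?expR_gt0 //; lra.
have h2 := normr_ge0 y; rewrite -(ler_pM2r h1) mulVf ?gt_eqF //; nra.
Qed.

Section Weight.
Context (R : realType) (d : nat) (k : 'I_d).
Implicit Types (s : R) (x : Zd d).
(** A weight in one coordinate direction suffices: the largest coordinate of x is comparable to its
    norm up to a factor d, and the weight is multiplicative along the lattice. *)
Definition rho s x : R := expR (s * (x ord0 k)%:~R).
Definition rhom s (i : 'I_d) : R := expR (s * (i == k)%:R).
Lemma rho_gt0 s x : 0 < rho s x. Proof. exact: expR_gt0. Qed.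
Lemma rhom_gt0 s i : 0 < rhom s i. Proof. exact: expR_gt0. Qed.
Lemma rhoD s x y : rho s (x + y) = rho s x * rho s y.
Proof. by rewrite /rho mxE intrD mulrDr expRD. Qed.
Lemma rho0 s : rho s 0 = 1. Proof. by rewrite /rho mxE mulr0 expR0. Qed.
Lemma rhoN s x : rho s (- x) = rho (- s) x.
Proof. by rewrite /rho mxE mulrNz mulrN mulNr. Qed.
Lemma rhoNK s x : rho s x * rho (- s) x = 1.
Proof. by rewrite -rhoN -rhoD subrr rho0. Qed.
Lemma rho_evec s i : rho s (evec i) = rhom s i.
Proof. by rewrite /rho evecE /rhom; case: (i == k). Qed.
Lemma rhomNK s i : rhom s i * rhom (- s) i = 1.
Proof. by rewrite -!rho_evec rhoNK. Qed.
Lemma rhomV s i : (rhom s i)^-1 = rhom (- s) i.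
Proof. by rewrite /rhom mulNr expRN. Qed.
Lemma rho_step s x i : rho s (x + evec i) = rhom s i * rho s x.
Proof. by rewrite rhoD rho_evec mulrC. Qed.
Lemma rhom_le s i (a : R) : `|s| <= a -> a <= 1 / 2 -> rhom s i <= 1 + 2 * a.
Proof.
move=> h1 h2; have h : `|s * (i == k)%:R| <= `|s|.
  by rewrite normrM; case: (i == k); rewrite ?normr1 ?normr0 ?mulr1 ?mulr0.
apply: le_trans (expR_le1D2 _) _; lra.
Qed.

Lemma rhom_sqr_le s i (mu : R) : mu <= 1 -> `|s| <= mu / 4 -> rhom s i ^+ 2 <= 1 + mu.
Proof.
move=> mu1 h; have -> : rhom s i ^+ 2 = rhom (2 * s) i by rewrite /rhom -expRM_natl; congr expR; ring.
have h2 : `|2 * s| <= mu / 2 by rewrite normrM [`|2|]ger0_norm //; lra.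
apply: le_trans (rhom_le i h2 _) _; lra.
Qed.

Lemma rhom_sub1 s i : `|s| <= 1 / 4 -> (rhom s i - 1) ^+ 2 <= 4 * s ^+ 2.
Proof.
move=> h; have h2 : `|s| <= 1 / 2 by lra.
have h3 := rhom_le i (lexx `|s|) h2.
have h4 : - `|s| <= rhom s i - 1.
  rewrite lerBrDl; apply: le_trans (expR_ge1Dx _).
  rewrite lerD2l; have := lerNnormlW (lexx `|s|).
  by case: (i == k); rewrite ?mulr1 ?mulr0 ?oppr_le0.
have := normr_ge0 s => h0.
have -> : 4 * s ^+ 2 = (2 * `|s|) ^+ 2 by rewrite exprMn real_normK ?num_real //; ring.
rewrite -subr_ge0 subr_sqr mulr_ge0 //; lra.
Qed.

Lemma rhom_subV s i : `|s| <= 1 / 4 -> (rhom s i - (rhom s i)^-1) ^+ 2 <= (4 * s) ^+ 2.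
Proof.
move=> h; rewrite rhomV.
have h1 := rhom_sub1 i h.
have := @rhom_sub1 (- s) i; rewrite normrN sqrrN => /(_ h) h2.
have -> : rhom s i - rhom (- s) i = (rhom s i - 1) - (rhom (- s) i - 1) by ring.
move: h1 h2; set a := rhom s i - 1; set b := rhom (- s) i - 1 => h1 h2.
have := sqr_ge0 (a + b); rewrite exprMn !expr2 in h1 h2 *; nra.
Qed.
End Weight.

Section WEnergy.
Context (R : realType) (d : nat) (l L mu : R) (k : 'I_d).
Hypotheses (l0 : 0 < l) (L0 : 0 < L) (mu0 : 0 < mu) (mu1 : mu <= 1)
  (hmu : 4 * d%:R * mu * L ^+ 2 <= l).
Variable s : R.
Hypothesis hs : `|s| <= mu / 4.
Implicit Types (f : Zd d -> R) (a : Zd d -> 'M[R]_d).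
(** The first term is 2 d (4 s)^2 L^2 / l divided by s^2, from the defect m - 1/m; the second comes
    from trading the weighted gradient for the gradient of the weighted function. *)
Definition c0 : R := 32 * d%:R * L ^+ 2 / l + 2 * d%:R * l.
Local Notation rho := (rho k s).
Local Notation m := (rhom k s).
Lemma c0_ge0 : 0 <= c0.
Proof. by rewrite /c0 addr_ge0 // ?divr_ge0 ?mulr_ge0 ?sqr_ge0 // ltW. Qed.
Lemma hs4 : `|s| <= 1 / 4. Proof. by move: hs mu1; lra. Qed.
(** Two gradients compete. The energy inequality dissipates the weighted gradient, while the
    Poincare inequality needs the gradient of the weighted function. [gradw_le] is the converse
    comparison, needed when differences of the kernel are bounded at the end. *)
Lemma wgrad_le f x :
  sqn (dgr (fun y => rho y * f y) x) <=
  4 * sqn (fun i => rho x * dgr f x i) + 8 * d%:R * s ^+ 2 * (rho x * f x) ^+ 2.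
Proof.
have -> : 8 * d%:R * s ^+ 2 * (rho x * f x) ^+ 2 = \sum_(i < d) 8 * s ^+ 2 * (rho x * f x) ^+ 2.
  by rewrite sumr_const card_ord -[RHS]mulr_natl; ring.
rewrite mulr_sumr -big_split; apply: ler_sum => i _ /=.
have h1 := rhom_sub1 k i hs4.
have h2 : m i ^+ 2 <= 2 by apply: le_trans (rhom_sqr_le k i mu1 hs) _; move: mu1; lra.
rewrite /dgr rho_step.
have -> : m i * rho x * f (x + evec i) - rho x * f x =
  m i * (rho x * (f (x + evec i) - f x)) + (m i - 1) * (rho x * f x) by ring.
move: (rho x * (_ - _)) (rho x * f x) => u v.
have a1 : m i ^+ 2 * u ^+ 2 <= 2 * u ^+ 2 by rewrite ler_wpM2r ?sqr_ge0.
have a2 : (m i - 1) ^+ 2 * v ^+ 2 <= 4 * s ^+ 2 * v ^+ 2 by rewrite ler_wpM2r ?sqr_ge0.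
have a3 := sqr_ge0 (m i * u - (m i - 1) * v).
have -> : 8 * s ^+ 2 * v ^+ 2 = 2 * (4 * s ^+ 2 * v ^+ 2) by ring.
have -> : (m i * u + (m i - 1) * v) ^+ 2 = 2 * (m i ^+ 2 * u ^+ 2) + 2 * ((m i - 1) ^+ 2 * v ^+ 2)
  - (m i * u - (m i - 1) * v) ^+ 2 by ring.
lra.
Qed.

Lemma gradw_le f x :
  sqn (fun i => rho x * dgr f x i) <=
  4 * sqn (dgr (fun y => rho y * f y) x) + 16 * d%:R * s ^+ 2 * (rho x * f x) ^+ 2.
Proof.
have -> : 16 * d%:R * s ^+ 2 * (rho x * f x) ^+ 2 = \sum_(i < d) 16 * s ^+ 2 * (rho x * f x) ^+ 2.
  by rewrite sumr_const card_ord -[RHS]mulr_natl; ring.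
rewrite mulr_sumr -big_split; apply: ler_sum => i _ /=.
have h1 := rhom_sub1 k i hs4.
have hsN : `|- s| <= mu / 4 by rewrite normrN.
have h2 : (m i)^-1 ^+ 2 <= 2.
  by rewrite rhomV; apply: le_trans (rhom_sqr_le k i mu1 hsN) _; move: mu1; lra.
have m0 := rhom_gt0 k s i.
rewrite /dgr rho_step.
set u := m i * rho x * f (x + evec i) - rho x * f x; set v := rho x * f x.
have -> : rho x * (f (x + evec i) - f x) = (m i)^-1 * (u - (m i - 1) * v).
  by rewrite /u /v; field; rewrite gt_eqF.
rewrite exprMn.
have a0 : 0 <= (u - (m i - 1) * v) ^+ 2 by apply: sqr_ge0.
apply: le_trans (ler_wpM2r a0 h2) _.
have a2 : (m i - 1) ^+ 2 * v ^+ 2 <= 4 * s ^+ 2 * v ^+ 2 by rewrite ler_wpM2r ?sqr_ge0.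
have a3 := sqr_ge0 (u + (m i - 1) * v).
have -> : (u - (m i - 1) * v) ^+ 2 = 2 * u ^+ 2 + 2 * ((m i - 1) ^+ 2 * v ^+ 2) - (u + (m i - 1) * v) ^+ 2 by ring.
lra.
Qed.

Lemma wenergy a f : fs f -> (forall x, cls l L (a x)) ->
  zsum (fun x => (rho x * step a f x) ^+ 2) <=
  (1 + c0 * s ^+ 2) * zsum (fun x => (rho x * f x) ^+ 2)
  - l / 4 * zsum (fun x => sqn (dgr (fun y => rho y * f y) x)).
Proof.
move=> hf ha.
have := energy (rho := rho) hf l0 L0 (ltW mu0) hmu (rhom_gt0 k s)
  (fun i => rhom_sqr_le k i mu1 hs) (fun i => rhom_subV k i hs4) (rho_step k s) ha.
have hg : fs (fun x => rho x * f x) by apply: fsMr.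
have hD : fs (fun x => sqn (fun i => rho x * dgr f x i)).
  by apply: (fs_sqn (f := fun i x => rho x * dgr f x i)) => i; apply: fsMr; exact: fs_dgr.
have hDg : fs (fun x => sqn (dgr (fun y => rho y * f y) x)).
  by apply: (fs_sqn (f := fun i x => dgr (fun y => rho y * f y) x i)) => i; exact: fs_dgr.
have : zsum (fun x => sqn (dgr (fun y => rho y * f y) x)) <=
    4 * zsum (fun x => sqn (fun i => rho x * dgr f x i)) +
    8 * d%:R * s ^+ 2 * zsum (fun x => (rho x * f x) ^+ 2).
  rewrite -!zsumZ //; last exact: fsX.
  rewrite -zsumD; [|exact: fsMr|by apply: fsMr; apply: fsX].
  apply: ler_zsum => //; last by move=> x; exact: wgrad_le.
  by apply: fsD; apply: fsMr => //; apply: fsX.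
set D := zsum _; set G := zsum _; set E := zsum _; set S := zsum _ => h1 h2.
apply: le_trans h2 _.
have h3 : l / 4 * D <= l / 4 * (4 * G + 8 * d%:R * s ^+ 2 * E) by rewrite ler_wpM2l ?divr_ge0 // ltW.
have -> : (1 + c0 * s ^+ 2) * E = (1 + 2 * d%:R * (4 * s) ^+ 2 * L ^+ 2 / l) * E + 2 * d%:R * l * s ^+ 2 * E.
  by rewrite /c0; field; rewrite gt_eqF.
have e : l / 4 * (4 * G + 8 * d%:R * s ^+ 2 * E) = l * G + 2 * d%:R * l * s ^+ 2 * E by field.
rewrite e in h3; lra.
Qed.

Lemma evo_contr M t f : fs f -> (forall x r, cls l L (M x r)) ->
  zsum (fun x => (rho x * evo M t f x) ^+ 2) <=
  (1 + c0 * s ^+ 2) ^+ t * zsum (fun x => (rho x * f x) ^+ 2).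
Proof.
move=> hf hM; elim: t => [|t IH]; first by rewrite expr0 mul1r.
apply: le_trans (wenergy (fs_evo _ _ hf) (hM^~ t)) _.
rewrite [in leRHS]exprS -[in leRHS]mulrA.
have h : 0 <= 1 + c0 * s ^+ 2 by rewrite addr_ge0 // mulr_ge0 ?c0_ge0 ?sqr_ge0.
apply: le_trans (ler_wpM2l h IH).
rewrite gerDl oppr_le0 mulr_ge0 ?divr_ge0 ?(ltW l0) //.
by apply: zsum_ge0 => x; apply: sqn_ge0.
Qed.
End WEnergy.

Section Poincare.
Context (R : realType) (d : nat).
Implicit Types (f : Zd d -> R).
Definition psum (p : seq 'I_d) : Zd d := \sum_(i <- p) evec i.
Lemma path_diff f p : fs f ->
  zsum (fun x => (f (x + psum p) - f x) ^+ 2) <=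
  (size p)%:R ^+ 2 * zsum (fun x => sqn (dgr f x)).
Proof.
move=> hf; have hD : fs (fun x => sqn (dgr f x)).
  by apply: (fs_sqn (f := fun i x => dgr f x i)) => i; exact: fs_dgr.
set D := zsum (fun x => sqn _); have D0 : 0 <= D by apply: zsum_ge0 => x; apply: sqn_ge0.
elim: p => [|i p IH].
  rewrite /psum big_nil; under eq_zsum do rewrite addr0 subrr expr0n.
  by rewrite zsum0 /= expr0n mul0r.
have e x : f (x + psum (i :: p)) - f x = (f ((x + evec i) + psum p) - f (x + evec i)) + dgr f x i.
  by rewrite /psum big_cons addrA /dgr addrA subrK.
under eq_zsum do rewrite e.
have hi : zsum (fun x => dgr f x i ^+ 2) <= D.
  apply: ler_zsum => [|//|x]; first by apply: fsX => //; exact: fs_dgr.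
  by rewrite /sqn (bigD1 i) //= lerDl sumr_ge0 // => j _; apply: sqr_ge0.
case: p IH {e} => [|j p] IH.
  rewrite /psum big_nil /= expr1n mul1r; apply: le_trans hi.
  by under eq_zsum do rewrite addr0 subrr add0r.
set n := size (j :: p); have n0 : (0 < n%:R :> R) by rewrite ltr0n.
have hsh : fs (fun x => f (x + psum (j :: p)) - f x).
  by apply: fsB => //; apply: fs_shift.
have hsh2 : fs (fun x => f (x + evec i + psum (j :: p)) - f (x + evec i)).
  exact: (fs_shift (f := fun x => f (x + psum (j :: p)) - f x)).
(* With the Young parameter 1/n the induction closes exactly: (1 + 1/n) n^2 + (1 + n) = (n +
   1)^2. *)
apply: (@le_trans _ _ (zsum (fun x =>
   (1 + n%:R^-1) * (f (x + evec i + psum (j :: p)) - f (x + evec i)) ^+ 2 +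
   (1 + n%:R) * dgr f x i ^+ 2))).
  apply: ler_zsum => [||x].
  - by apply: fsX => //; apply: fsD => //; exact: fs_dgr.
  - by apply: fsD; apply: fsMr; apply: fsX => //; exact: fs_dgr.
  move: (f _ - f _) (dgr f x i) => u v.
  rewrite -subr_ge0.
  have -> : (1 + n%:R^-1) * u ^+ 2 + (1 + n%:R) * v ^+ 2 - (u + v) ^+ 2 =
     n%:R^-1 * (u - n%:R * v) ^+ 2 by field; rewrite gt_eqF.
  by rewrite mulr_ge0 ?sqr_ge0 // invr_ge0 ltW.
rewrite zsumD ?zsumZ; try (by apply: fsX => //; exact: fs_dgr);
  try (by apply: fsMr; apply: fsX => //; exact: fs_dgr).
rewrite (zsum_shift (fun x => (f (x + psum (j :: p)) - f x) ^+ 2)).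
have h1 : (1 + n%:R^-1) * zsum (fun x => (f (x + psum (j :: p)) - f x) ^+ 2) <= (1 + n%:R^-1) * (n%:R ^+ 2 * D).
  by rewrite ler_wpM2l // addr_ge0 // invr_ge0 ltW.
have h2 : (1 + n%:R) * zsum (fun x => dgr f x i ^+ 2) <= (1 + n%:R) * D.
  by rewrite ler_wpM2l // addr_ge0 // ltW.
have -> : (size [:: i, j & p])%:R = 1 + n%:R :> R by rewrite -natr1 addrC.
apply: le_trans (lerD h1 h2) _; rewrite le_eqVlt; apply/orP; left; apply/eqP.
by field; rewrite gt_eqF.
Qed.

Definition qpt N (q : {ffun 'I_d -> 'I_N}) : Zd d := \row_i (nat_of_ord (q i))%:Z.
Lemma qpt_inj N : injective (@qpt N).
Proof.
move=> q q' /rowP h; apply/ffunP => i; apply: val_inj => /=.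
by have := h i; rewrite !mxE => -[].
Qed.

Lemma psum_nseq n i : psum (nseq n i) = evec i *+ n.
Proof. by elim: n => [|n IH]; rewrite /psum /= ?big_nil // big_cons -/(psum _) IH mulrS. Qed.
Lemma qpt_path N (q : {ffun 'I_d -> 'I_N}) : exists2 p, qpt q = psum p & (size p <= d * N)%N.
Proof.
exists (flatten [seq nseq (q i) i | i <- enum 'I_d]).
  have -> : psum (flatten [seq nseq (q i) i | i <- enum 'I_d]) = \sum_i evec i *+ q i.
    rewrite /psum big_flatten big_map -[RHS]big_enum /=.
    by apply: eq_bigr => i _; rewrite -psum_nseq.
  apply/rowP => j; rewrite mxE summxE (bigD1 j) //= big1 ?addr0 => [|i ij].
    by rewrite mulmxnE evecE eqxx -[RHS]/((q j)%:R) natz.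
  by rewrite mulmxnE evecE (negbTE ij) mul0rn.
rewrite size_flatten /shape -map_comp sumnE big_map big_enum /=.
apply: leq_trans (_ : (\sum_(i < d) N <= _)%N); last by rewrite sum_nat_const card_ord.
by apply: leq_sum => i _; rewrite size_nseq ltnW.
Qed.

Lemma card_qpt N : #|{ffun 'I_d -> 'I_N}| = (N ^ d)%N.
Proof. by rewrite card_ffun !card_ord. Qed.
(* The box average [N^-d * sum_q f (x + q)] replaces the mean over a box in the usual
   Poincare inequality; being a convex combination of translations, it needs no geometry. *)
Lemma poincare f N : (0 < N)%N -> fs f ->
  zsum (fun x => f x ^+ 2) <=
  2 * (d * N)%:R ^+ 2 * zsum (fun x => sqn (dgr f x)) +
  2 * (N%:R ^+ d) ^- 2 * zsum (fun x => (\sum_(q : {ffun 'I_d -> 'I_N}) f (x + qpt q)) ^+ 2).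
Proof.
move=> N0 hf; set D := zsum (fun x => sqn _).
have D0 : 0 <= D by apply: zsum_ge0 => x; apply: sqn_ge0.
set n : R := N%:R ^+ d.
have n0 : 0 < n by rewrite exprn_gt0 // ltr0n.
have nE : n = #|{ffun 'I_d -> 'I_N}|%:R by rewrite card_qpt natrX.
have fsh y : fs (fun x => f (x + y)) by apply: fs_shift.
have fsq : fs (fun x => (\sum_(q : {ffun 'I_d -> 'I_N}) f (x + qpt q)) ^+ 2).
  by apply: fsX => //; apply: fs_sum.
have fsd (q : {ffun 'I_d -> 'I_N}) : fs (fun x => (f (x + qpt q) - f x) ^+ 2).
  by apply: fsX => //; apply: fsB.
apply: (@le_trans _ _ (zsum (fun x =>
  2 * n ^-1 * (\sum_(q : {ffun 'I_d -> 'I_N}) (f (x + qpt q) - f x) ^+ 2) +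
  2 * n ^- 2 * (\sum_(q : {ffun 'I_d -> 'I_N}) f (x + qpt q)) ^+ 2))).
  apply: ler_zsum => [||x].
  - exact: fsX.
  - by apply: fsD; apply: fsMr => //; apply: fs_sum.
  set S1 := \sum_q (_ - _) ^+ 2; set S2 := \sum_q _.
  have e1 : \sum_(q : {ffun 'I_d -> 'I_N}) (f (x + qpt q) - f x) = S2 - n * f x.
    by rewrite sumrB sumr_const nE mulr_natl.
  have h1 : (S2 - n * f x) ^+ 2 <= n * S1.
    by rewrite -e1 /S1 nE; exact: expn2_sumT.
  have h2 : 2 * n ^- 2 * (S2 - n * f x) ^+ 2 <= 2 * n^-1 * S1.
    have -> : 2 * n^-1 * S1 = 2 * n ^- 2 * (n * S1) by field; rewrite gt_eqF.
    by rewrite ler_wpM2l // mulr_ge0 // invr_ge0 sqr_ge0.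
  have -> : f x ^+ 2 = 2 * n ^- 2 * (S2 - n * f x) ^+ 2 + 2 * n ^- 2 * S2 ^+ 2
     - n ^- 2 * (2 * S2 - n * f x) ^+ 2 by field; rewrite gt_eqF.
  have h4 : 0 <= n ^- 2 * (2 * S2 - n * f x) ^+ 2 by rewrite mulr_ge0 ?sqr_ge0 ?invr_ge0 ?sqr_ge0.
  lra.
rewrite zsumD; try (by apply: fsMr => //; apply: fs_sum).
rewrite !zsumZ //; last exact: fs_sum.
rewrite lerD2r zsum_sum //.
have h (q : {ffun 'I_d -> 'I_N}) : zsum (fun x => (f (x + qpt q) - f x) ^+ 2) <= (d * N)%:R ^+ 2 * D.
  have [p -> hp] := qpt_path q.
  apply: le_trans (path_diff p hf) _; rewrite ler_wpM2r // ler_sqr ?nnegrE ?ler0n //.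
  by rewrite ler_nat.
apply: (@le_trans _ _ (2 * n^-1 * \sum_(q : {ffun 'I_d -> 'I_N}) (d * N)%:R ^+ 2 * D)).
  by rewrite ler_wpM2l ?mulr_ge0 ?invr_ge0 ?(ltW n0) //; apply: ler_sum.
have -> : \sum_(q : {ffun 'I_d -> 'I_N}) (d * N)%:R ^+ 2 * D = n * ((d * N)%:R ^+ 2 * D).
  by rewrite sumr_const nE mulr_natl.
rewrite le_eqVlt; apply/orP; left; apply/eqP.
by field; rewrite gt_eqF.
Qed.
End Poincare.

(** * Decay of the weighted energies *)

Section DecaySeq.
Context (R : realType).
Definition rt (t : nat) : R := Num.sqrt t.+1%:R.
Lemma rt_gt0 t : 0 < rt t. Proof. by rewrite sqrtr_gt0 ltr0n. Qed.
Lemma rt_ge0 t : 0 <= rt t. Proof. exact: sqrtr_ge0. Qed.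
Lemma rt_ge1 t : 1 <= rt t.
Proof. by rewrite -[leLHS]sqrtr1 ler_sqrt ?ler0n // ler1n. Qed.
Lemma rt_sqr t : rt t ^+ 2 = t.+1%:R. Proof. by rewrite sqr_sqrtr ?ler0n. Qed.
Lemma rt_le2 m n : (n.+1 <= 4 * m.+1)%N -> rt n <= 2 * rt m.
Proof.
move=> h; rewrite -ler_sqr ?nnegrE ?mulr_ge0 ?rt_ge0 // exprMn !rt_sqr.
by rewrite -natrX -natrM ler_nat.
Qed.

Lemma rtV_le (d m n : nat) : (n.+1 <= 4 * m.+1)%N ->
  (rt m ^+ d)^-1 <= 2 ^+ d / rt n ^+ d.
Proof.
move=> h; rewrite ler_pdivlMr ?exprn_gt0 ?rt_gt0 // mulrC ler_pdivrMr ?exprn_gt0 ?rt_gt0 //.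
by rewrite -exprMn lerXn2r ?nnegrE ?mulr_ge0 ?rt_ge0 // rt_le2.
Qed.

Lemma avg_exists (f : nat -> R) n (B : R) : (0 < n)%N -> \sum_(i < n) f i <= B ->
  exists2 i, (i < n)%N & f i * n%:R <= B.
Proof.
move=> n0 h; apply: contrapT => H.
have H2 (i : 'I_n) : B < f i * n%:R.
  by rewrite ltNge; apply/negP => hi; apply: H; exists (i : nat).
have n1 : 0 < n%:R :> R by rewrite ltr0n.
have : \sum_(i < n) (B / n%:R) < \sum_(i < n) f i.
  apply: ltr_sum; last by move=> i _; rewrite ltr_pdivrMr.
  by apply/hasP; exists (Ordinal n0) => //; rewrite mem_index_enum.
rewrite sumr_const card_ord -[_ *+ n]mulr_natr divfK ?gt_eqF // => h2.
by have := lt_le_trans h2 h; rewrite ltxx.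
Qed.

Section Seq.
Variables (d : nat) (c C : R) (F D : nat -> R).
Hypotheses (c_gt0 : 0 < c) (C_gt0 : 0 < C) (Fge0 : forall t, 0 <= F t) (Dge0 : forall t, 0 <= D t)
  (F0 : F 0%N <= 1) (FD : forall t, F t.+1 <= F t - c * D t)
  (FP : forall t N, (0 < N)%N -> F t <= C * N%:R ^+ 2 * D t + 2 / N%:R ^+ d).
Lemma decay_mono m n : (m <= n)%N -> F n <= F m.
Proof.
move=> /subnK <-; elim: (n - m)%N => // j IH; rewrite addSn.
apply: le_trans (FD _) _; apply: le_trans IH; rewrite gerDl oppr_le0 mulr_ge0 // ltW //.
Qed.

Lemma decay_sum m n : \sum_(i < n) c * D (m + i)%N <= F m.
Proof.
suff h : \sum_(i < n) c * D (m + i)%N <= F m - F (m + n)%N.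
  by apply: le_trans h _; rewrite gerDl oppr_le0.
elim: n => [|n IH]; first by rewrite big_ord0 addn0 subrr.
by rewrite big_ord_recr /= addnS; have := FD (m + n)%N; lra.
Qed.
End Seq.

(** A Nash-type argument without the Nash inequality. Since F decreases and its dissipation is
    summable, some time in [n, 2n) has small D; there the Poincare inequality at scale about sqrt n
    bounds F by a small multiple of F n plus n^(-d/2). Strong induction from N/2 to N concludes. The
    constant is independent of F and D, hence later of the weight. *)
Lemma decay (d : nat) (c C : R) : 0 < c -> 0 < C -> exists K : R, 0 < K /\
  forall F D : nat -> R, (forall t, 0 <= F t) -> (forall t, 0 <= D t) -> F 0%N <= 1 ->
  (forall t, F t.+1 <= F t - c * D t) ->
  (forall t N, (0 < N)%N -> F t <= C * N%:R ^+ 2 * D t + 2 / N%:R ^+ d) ->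
  forall t, F t <= K / rt t ^+ d.
Proof.
move=> cp Cp.
(* Going from N/2 to N loses a factor 2^d in the induction hypothesis; with this eta the induction
   term uses up only half of the allowed constant. [K1] serves the early times b n < 1, [K2] the box
   term. *)
pose eta : R := (2 * 2 ^+ d)^-1; have eta0 : 0 < eta by rewrite invr_gt0 mulr_gt0 ?exprn_gt0.
pose b : R := eta * c / C; have b0 : 0 < b by rewrite divr_gt0 ?mulr_gt0.
pose sb : R := Num.sqrt b; have sb0 : 0 < sb by rewrite sqrtr_gt0.
pose K1 : R := Num.sqrt (2 / b + 4) ^+ d.
pose K2 : R := 4 * 4 ^+ d / sb ^+ d.
have b2 : 0 < 2 / b + 4 by rewrite addr_gt0 // divr_gt0.
have K10 : 0 < K1 by rewrite exprn_gt0 // sqrtr_gt0.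
have K20 : 0 < K2 by rewrite divr_gt0 ?mulr_gt0 ?exprn_gt0.
exists (K1 + K2); split; first by rewrite addr_gt0.
move=> F D Fge0 Dge0 F0 FD FP.
have mono := decay_mono cp Dge0 FD.
have hsum := decay_sum Fge0 FD.
have rd t : 0 < rt t ^+ d by rewrite exprn_gt0 // rt_gt0.
move=> t; elim/ltn_ind: t => N IH.
set n := N./2.
have hN : (N <= (2 * n).+1)%N by rewrite /n; clear; lia.
have hN2 : (2 * n <= N)%N by rewrite /n; clear; lia.
have [hs|hs] := ltrP (b * n%:R) 1.
  apply: le_trans (_ : 1 <= _); first exact: le_trans (mono _ _ (leq0n N)) F0.
  rewrite ler_pdivlMr // mul1r; apply: le_trans (_ : K1 <= _); last by rewrite lerDl ltW.
  rewrite lerXn2r ?nnegrE ?sqrtr_ge0 ?rt_ge0 // ler_sqrt; last exact: ltW.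
  have : n%:R < b^-1 by rewrite -[ltRHS]mul1r ltr_pdivlMr // mulrC.
  have : N.+1%:R <= (2 * n + 2)%:R :> R by rewrite ler_nat; clear -hN; lia.
  rewrite natrD natrM; have : 0 < b^-1 by rewrite invr_gt0.
  lra.
have n0 : (0 < n)%N by rewrite lt0n; apply: contraTneq hs => ->; rewrite mulr0 -ltNge.
have n1 : 0 < n%:R :> R by rewrite ltr0n.
have nN : (n < N)%N by clear -n0 hN2; lia.
have [i hi hDi] := avg_exists (f := fun i => c * D (n + i)%N) n0 (hsum n n).
set s := (n + i)%N in hDi.
have h1 : F N <= F s by apply: mono; rewrite /s; clear -hi hN2; lia.
apply: le_trans h1 _.
(* The box side is the integer part of x. The value of b gives C r^2 D(s) <= eta (c n D(s)), and the
   choice of s bounds this by eta F(n). *)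
set x := Num.sqrt (b * n%:R).
have x1 : 1 <= x by rewrite /x -[leLHS]sqrtr1 ler_sqrt // ltW // mulr_gt0.
have x0 : 0 <= x by apply: sqrtr_ge0.
have /andP[t1 t2] := truncn_itv x0.
set r := Num.truncn x in t1 t2.
have r0 : (0 < r)%N by rewrite /r truncn_gt0.
have r1 : 1 <= r%:R :> R by rewrite ler1n.
apply: le_trans (FP s r r0) _.
have h2 : C * r%:R ^+ 2 * D s <= eta * F n.
  have hr2 : r%:R ^+ 2 <= b * n%:R.
    rewrite -[leRHS]sqr_sqrtr; last by rewrite mulr_ge0 // ltW.
    by rewrite ler_sqr ?nnegrE ?ler0n // sqrtr_ge0.
  apply: (@le_trans _ _ (C * (b * n%:R) * D s)).
    by rewrite ler_wpM2r // ler_wpM2l // ltW.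
  have -> : C * (b * n%:R) * D s = eta * (c * D s * n%:R).
    by rewrite /b; field; rewrite gt_eqF.
  by rewrite ler_wpM2l // ltW.
have h3 : 2 / r%:R ^+ d <= K2 / 2 / rt N ^+ d.
  have hx : x <= 2 * r%:R by rewrite -natr1 in t2; lra.
  have hxs : x = sb * Num.sqrt n%:R by rewrite /x sqrtrM // ltW.
  have hn : rt N <= 2 * Num.sqrt n%:R.
    rewrite -ler_sqr ?nnegrE ?mulr_ge0 ?sqrtr_ge0 ?rt_ge0 // exprMn rt_sqr sqr_sqrtr ?ler0n //.
    by rewrite -natrX -natrM ler_nat; clear -hN n0; lia.
  have hh : sb * rt N <= 4 * r%:R.
    have : sb * rt N <= sb * (2 * Num.sqrt n%:R) by rewrite ler_pM2l.
    rewrite hxs in hx; lra.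
  have -> : K2 / 2 / rt N ^+ d = 2 * (4 ^+ d / (sb * rt N) ^+ d).
    by rewrite /K2 exprMn invfM; field; rewrite !gt_eqF // exprn_gt0.
  have p1 : 0 < (sb * rt N) ^+ d by rewrite exprn_gt0 // mulr_gt0 ?rt_gt0.
  rewrite ler_pM2l // ler_pdivlMr // mulrC ler_pdivrMr ?exprn_gt0 ?ltr0n //.
  by rewrite -exprMn lerXn2r ?nnegrE ?mulr_ge0 ?ler0n ?rt_ge0 // ltW.
have h4 : F n <= (K1 + K2) * (2 ^+ d / rt N ^+ d).
  apply: le_trans (IH n nN) _; rewrite ler_wpM2l //; first by rewrite addr_ge0 // ltW.
  by apply: rtV_le; clear -hN; lia.
have h5 : eta * F n <= (K1 + K2) / 2 / rt N ^+ d.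
  have -> : (K1 + K2) / 2 / rt N ^+ d = eta * ((K1 + K2) * (2 ^+ d / rt N ^+ d)).
    by rewrite /eta; field; rewrite !gt_eqF // exprn_gt0.
  by rewrite ler_pM2l.
apply: le_trans (lerD (le_trans h2 h5) h3) _.
by rewrite -mulrDl ler_wpM2r ?invr_ge0 ?(ltW (rd _)) //; lra.
Qed.
End DecaySeq.

Section AnnealedEnergy.
Context (R : realType) (d : nat) (Om : Type) (adm : (Om -> R) -> Prop)
    (Ex : (Om -> R) -> R) (tau : Zd d -> int -> Om -> Om) (A : Om -> 'M[R]_d)
    (l L mu : R) (k : 'I_d).
Hypothesis an : annealed adm Ex tau A l L.
Hypotheses (l0 : 0 < l) (L0 : 0 < L) (mu0 : 0 < mu) (mu1 : mu <= 1)
  (hmu : 4 * d%:R * mu * L ^+ 2 <= l).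
Variable s : R.
Hypothesis hs : `|s| <= mu / 4.
Local Notation K := (K tau A).
Local Notation fieldA := (fieldA tau A).
Definition wK t x w : R := rho k s x * K t x w.
Definition EE t : R := Ex (fun w => zsum (fun x => wK t x w ^+ 2)).
Definition DD t : R := Ex (fun w => zsum (fun x => sqn (dgr (wK t ^~ w) x))).
Definition qq : R := 1 + c0 d l L * s ^+ 2.
Lemma c0_pos : 0 <= c0 d l L.
Proof. by rewrite /c0 addr_ge0 // ?divr_ge0 ?mulr_ge0 ?sqr_ge0 // ltW. Qed.
Lemma qq_ge1 : 1 <= qq.
Proof. by rewrite lerDl mulr_ge0 ?c0_pos ?sqr_ge0. Qed.
Lemma qq_gt0 : 0 < qq. Proof. exact: lt_le_trans qq_ge1. Qed.
Lemma afs_wK t : afs adm (wK t).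
Proof. by apply: (afsMc an); exact: (afs_K an). Qed.
Lemma afs_dgr (f : Zd d -> Om -> R) i : afs adm f -> afs adm (fun x w => dgr (f^~ w) x i).
Proof. by move=> hf; apply: (afsB an) => //; apply: afs_shift. Qed.
Lemma afs_sqdgr (f : Zd d -> Om -> R) : afs adm f -> afs adm (fun x w => sqn (dgr (f^~ w) x)).
Proof. by move=> hf; apply: (afs_sum an) => i; apply: (afsX an); apply: afs_dgr. Qed.
Lemma cls_field w x r : cls l L (fieldA w x r). Proof. exact: (cls_A an). Qed.
Lemma EE_ge0 t : 0 <= EE t.
Proof.
apply: (Ex_ge0 an); first by apply: (adm_zsum an); apply: (afsX an); exact: afs_wK.
by move=> w; apply: zsum_ge0 => x; apply: sqr_ge0.
Qed.

Lemma DD_ge0 t : 0 <= DD t.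
Proof.
apply: (Ex_ge0 an); first by apply: (adm_zsum an); apply: afs_sqdgr; exact: afs_wK.
by move=> w; apply: zsum_ge0 => x; apply: sqn_ge0.
Qed.

Lemma EE_step t : EE t.+1 <= qq * EE t - l / 4 * DD t.
Proof.
have a1 : adm (fun w => zsum (fun x => wK t x w ^+ 2)).
  by apply: (adm_zsum an); apply: (afsX an); exact: afs_wK.
have a2 : adm (fun w => zsum (fun x => sqn (dgr (wK t ^~ w) x))).
  by apply: (adm_zsum an); apply: afs_sqdgr; exact: afs_wK.
rewrite /EE -(ExZ an) // /DD -(ExZ an) // -(ExB an); try exact: (admZ an).
apply: (Ex_le an) => [||w].
- by apply: (adm_zsum an); apply: (afsX an); exact: afs_wK.
- by apply: (admB an); apply: (admZ an).
have h := wenergy k l0 L0 mu0 mu1 hmu hs (fs_heat (fieldA w) t) (a := (fieldA w)^~ t) (fun x => cls_field w x t).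
exact: h.
Qed.

Lemma EE_0 : EE 0%N = 1.
Proof.
rewrite /EE -[RHS](Ex_cst an); congr Ex; apply/funext => w.
rewrite (@zsum1 _ _ _ 0) => [|x x0]; rewrite /wK /K /heat.
  by rewrite eqxx rho0 mulr1 expr1n.
by rewrite (negbTE x0) mulr0 expr0n.
Qed.

(* Backward in time, [psi] is evolved by the transposed equation, again a contraction;
   this bounds the box sums of the fundamental solutions over all starting points [z]. *)
Lemma dual_contr t N w :
  zsum (fun z => (\sum_(q : {ffun 'I_d -> 'I_N}) wK t (qpt q - z) (tau z 0 w)) ^+ 2) <=
  qq ^+ t * N%:R ^+ d.
Proof.
pose Q : seq (Zd d) := [seq qpt q | q : {ffun 'I_d -> 'I_N}].
have uQ : uniq Q by rewrite map_inj_uniq ?enum_uniq //; exact: qpt_inj.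
pose psi x : R := if x \in Q then rho k s x else 0.
have fpsi : fs psi by exists Q => x; rewrite /psi => /negbTE ->.
pose M := fun y r => (fieldA w y (t - r.+1))^T.
have hM x r : cls l L (M x r) by apply: cls_tr; exact: cls_field.
have e z : \sum_(q : {ffun 'I_d -> 'I_N}) wK t (qpt q - z) (tau z 0 w) =
    rho k (- s) z * evo M t psi z.
  transitivity (rho k (- s) z * zsum (fun x => psi x * evo (fieldA w) t (delta R z) x)); last first.
    congr (_ * _); rewrite evo_adj //; last exact: fs_delta.
    rewrite (@zsum1 _ _ _ z) => [|x xz]; first by rewrite /delta eqxx mulr1.
    by rewrite /delta (negbTE xz) mulr0.
  rewrite (zsumE uQ); last by move=> x; rewrite /psi => /negbTE ->; rewrite mul0r.
  rewrite mulr_sumr big_map big_enum /=; apply: eq_bigr => q _.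
  rewrite /psi map_f ?mem_enum // evo_delta mulrA [X in X * _]mulrC -rhoN -rhoD.
  congr (_ * heat _ _ _); apply/funext => y; apply/funext => r.
  by rewrite /fieldA -(tauDD an) addr0.
under eq_zsum do rewrite e.
have hsN : `|- s| <= mu / 4 by rewrite normrN.
apply: le_trans (evo_contr k l0 L0 mu0 mu1 hmu hsN t fpsi hM) _.
rewrite sqrrN ler_wpM2l ?exprn_ge0 ?(ltW qq_gt0) //.
rewrite (zsumE uQ); last by move=> x; rewrite /psi => /negbTE ->; rewrite mulr0 expr0n.
rewrite big_map big_enum /= (eq_bigr (fun=> 1)) => [|q _].
  by rewrite sumr_const card_qpt natrX.
by rewrite /psi map_f ?mem_enum // mulrC rhoNK expr1n.
Qed.

(** The box sums run over endpoints of the kernel started at 0. Reflection and stationarity of the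
    expectation turn them into sums over starting points with endpoints in a fixed box, which
    [dual_contr] bounds in every environment. *)
Lemma EE_poincare t N : (0 < N)%N ->
  EE t <= 2 * (d * N)%:R ^+ 2 * DD t + 2 * qq ^+ t / N%:R ^+ d.
Proof.
move=> N0.
have n0 : 0 < N%:R ^+ d :> R by rewrite exprn_gt0 // ltr0n.
pose S (f : Zd d -> Om -> R) x w := (\sum_(q : {ffun 'I_d -> 'I_N}) f (x + qpt q) w) ^+ 2.
have aS : afs adm (S (wK t)).
  by apply: (afsX an); apply: (afs_sum an) => q; apply: afs_shift; exact: afs_wK.
have a1 : adm (fun w => zsum (fun x => sqn (dgr (wK t ^~ w) x))).
  by apply: (adm_zsum an); apply: afs_sqdgr; exact: afs_wK.
have a2 : adm (fun w => zsum (S (wK t) ^~ w)) by apply: (adm_zsum an).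
have hS : Ex (fun w => zsum (S (wK t) ^~ w)) <= qq ^+ t * N%:R ^+ d.
  rewrite (Ex_zsum an) // -(zsum_refl (fun x => Ex (S (wK t) x)) 0).
  have aSr : afs adm (fun z w => S (wK t) (0 - z) (tau z 0 w)).
    have [h1 [l1 h2]] := aS.
    split=> [z|]; first by apply: (adm_tau an).
    exists [seq 0 - x | x <- l1] => x w hx; apply: h2; apply: contra hx => hx.
    by apply/mapP; exists (0 - x) => //; rewrite subKr.
  have -> : (fun x => Ex (S (wK t) (0 - x))) = fun x => Ex (fun w => S (wK t) (0 - x) (tau x 0 w)).
    by apply/funext => x; rewrite (Ex_tau an _ 0 (f := S (wK t) (0 - x))) //; case: aS.
  rewrite -(Ex_zsum an aSr) -[leRHS](Ex_cst an).
  apply: (Ex_le an) => [||w]; [exact: (adm_zsum an)|exact: (adm_cst an)|].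
  apply: le_trans (dual_contr t N w); rewrite le_eqVlt; apply/orP; left; apply/eqP.
  apply: eq_zsum => z; rewrite /S; congr (_ ^+ 2); apply: eq_bigr => q _.
  by rewrite sub0r addrC.
apply: (@le_trans _ _ (2 * (d * N)%:R ^+ 2 * DD t + 2 * (N%:R ^+ d) ^- 2 *
   Ex (fun w => zsum (S (wK t) ^~ w)))).
  rewrite /DD -(ExZ an) // -(ExZ an) // -(ExD an); try exact: (admZ an).
  apply: (Ex_le an) => [||w].
  - by apply: (adm_zsum an); apply: (afsX an); exact: afs_wK.
  - by apply: (admD an); apply: (admZ an).
  by apply: poincare => //; apply: afs_fs; exact: afs_wK.
rewrite lerD2l.
have -> : 2 * qq ^+ t / N%:R ^+ d = 2 * (N%:R ^+ d) ^- 2 * (qq ^+ t * N%:R ^+ d).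
  by field; rewrite gt_eqF.
by rewrite ler_wpM2l // mulr_ge0 ?invr_ge0 ?sqr_ge0.
Qed.

(** Division by [qq ^+ t] removes the growth due to the weight: the normalized energies satisfy the
    hypotheses of [decay] with constants that do not depend on s. *)
Definition EF t := EE t / qq ^+ t.
Definition DF t := DD t / qq ^+ t.
Definition cstep : R := l / 4 / (1 + c0 d l L).
Lemma cstep_gt0 : 0 < cstep.
Proof. by rewrite /cstep !divr_gt0 // ltr_wpDr // c0_pos. Qed.
Lemma EF_step t : EF t.+1 <= EF t - cstep * DF t.
Proof.
rewrite /EF exprS ler_pdivrMr ?mulr_gt0 ?exprn_gt0 ?qq_gt0 //.
apply: le_trans (EE_step t) _.
(* Here |s| <= 1 is used, so that [qq] is at most 1 + c0; this is where [cstep] comes from. *)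
have h : cstep * qq <= l / 4.
  rewrite /cstep mulrAC ler_pdivrMr ?ler_wpM2l ?divr_ge0 ?(ltW l0) //; last first.
    by rewrite ltr_wpDr // c0_pos.
  rewrite lerD2l ler_piMr ?c0_pos //.
  have hs1 : `|s| <= 1 by apply: le_trans hs _; move: mu1; lra.
  by rewrite -real_normK ?num_real // expr_le1.
have -> : (EE t / qq ^+ t - cstep * DF t) * (qq * qq ^+ t) = qq * EE t - cstep * qq * DD t.
  by rewrite /DF; field; rewrite gt_eqF // exprn_gt0 // qq_gt0.
by rewrite lerD2l lerN2 ler_wpM2r // DD_ge0.
Qed.

Lemma EF_poincare t N : (0 < N)%N -> EF t <= 2 * d%:R ^+ 2 * N%:R ^+ 2 * DF t + 2 / N%:R ^+ d.
Proof.
move=> N0; rewrite /EF ler_pdivrMr ?exprn_gt0 ?qq_gt0 //.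
apply: le_trans (EE_poincare t N0) _; rewrite le_eqVlt; apply/orP; left; apply/eqP.
have n0 : 0 < N%:R :> R by rewrite ltr0n.
by rewrite /DF natrM; field; rewrite !gt_eqF ?exprn_gt0 ?qq_gt0.
Qed.

Lemma EF_ge0 t : 0 <= EF t.
Proof. by rewrite divr_ge0 ?EE_ge0 ?exprn_ge0 // ltW // qq_gt0. Qed.
Lemma DF_ge0 t : 0 <= DF t.
Proof. by rewrite divr_ge0 ?DD_ge0 ?exprn_ge0 // ltW // qq_gt0. Qed.
Definition WD t := Ex (fun w => zsum (fun x => sqn (fun i => rho k s x * dgr (K t ^~ w) x i))).
Lemma WD_le t : WD t <= (4 * DF t + 16 * d%:R * s ^+ 2 * EF t) * qq ^+ t.
Proof.
have -> : (4 * DF t + 16 * d%:R * s ^+ 2 * EF t) * qq ^+ t = 4 * DD t + 16 * d%:R * s ^+ 2 * EE t.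
  by rewrite /EF /DF; field; rewrite gt_eqF // exprn_gt0 // qq_gt0.
have a1 : adm (fun w => zsum (fun x => wK t x w ^+ 2)).
  by apply: (adm_zsum an); apply: (afsX an); exact: afs_wK.
have a2 : adm (fun w => zsum (fun x => sqn (dgr (wK t ^~ w) x))).
  by apply: (adm_zsum an); apply: afs_sqdgr; exact: afs_wK.
have a3 : afs adm (fun x w => sqn (fun i => rho k s x * dgr (K t ^~ w) x i)).
  by apply: (afs_sum an) => i; apply: (afsX an); apply: (afsMc an); apply: afs_dgr; exact: (afs_K an).
rewrite /WD /EE -(ExZ an) // /DD -(ExZ an) // -(ExD an); try exact: (admZ an).
apply: (Ex_le an) => [||w].
- exact: (adm_zsum an).
- by apply: (admD an); apply: (admZ an).
have f1 : fs (fun x => wK t x w ^+ 2) by apply: (@fsX _ _ (wK t ^~ w)) => //; apply: afs_fs; exact: afs_wK.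
have f2 : fs (fun x => sqn (dgr (wK t ^~ w) x)) by apply: (@afs_fs _ _ _ adm (fun x w => sqn (dgr (wK t ^~ w) x))); apply: afs_sqdgr; exact: afs_wK.
rewrite -!zsumZ // -zsumD; try exact: fsMr.
apply: ler_zsum => [||x].
- exact: (afs_fs w a3).
- by apply: fsD; apply: fsMr.
exact: (gradw_le k mu1 hs).
Qed.
End AnnealedEnergy.

(** * Time reversal and factorization of the averaged kernel *)

Section Reversed.
Context (R : realType) (d : nat) (Om : Type) (adm : (Om -> R) -> Prop)
    (Ex : (Om -> R) -> R) (tau : Zd d -> int -> Om -> Om) (A : Om -> 'M[R]_d)
    (l L : R).
Hypothesis an : annealed adm Ex tau A l L.
Definition rtau (x : Zd d) (t : int) : Om -> Om := tau x (- t).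
(** The reversed evolution starting at time t first meets the coefficients of time t - 1, hence the
    shift by -1; the transpose is the one of the adjoint step. *)
Definition rA (w : Om) : 'M[R]_d := (A (tau 0 (-1) w))^T.
Lemma an_rev : annealed adm Ex rtau rA l L.
Proof.
case: (an) => a1 a2 a3 a4 a5 a6 a7 a8 a9 a10 a11 a12 a13.
split => //; rewrite /rtau.
- by move=> f x s; apply: a4.
- by move=> f x s; apply: a9.
- by move=> x y s t w; rewrite opprD a11.
- move=> i j; rewrite /rA; under eq_fun do rewrite mxE.
  exact: (a4 (fun w => A w j i)).
- by move=> w; apply: cls_tr.
Qed.

(** Pairing the solution with a point mass at x and applying [evo_adj] leaves the dual evolution
    started at x and read at 0, which is the reversed kernel in the environment seen from (x, t). *)
Lemma K_dual t x w : K tau A t x w = K rtau rA t (- x) (tau x t%:Z w).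
Proof.
have -> : K tau A t x w = zsum (fun y => delta R x y * evo (fieldA tau A w) t (delta R 0) y).
  rewrite (@zsum1 _ _ _ x) => [|y yx]; first by rewrite /delta eqxx mul1r /K heatE.
  by rewrite /delta (negbTE yx) mul0r.
rewrite evo_adj; [|exact: fs_delta..].
rewrite (@zsum1 _ _ _ 0) => [|y yx]; last by rewrite /delta (negbTE yx) mulr0.
rewrite {2}/delta eqxx mulr1 evo_delta sub0r /K !heatE.
congr (_ _); apply: evo_eqM => y r rt.
rewrite /fieldA /rA /rtau -!(tauDD an) add0r; congr ((A (tau _ _ w))^T).
by clear -rt; lia.
Qed.

Definition GG t x : R := Ex (K tau A t x).
Lemma afs_prod (f g : Zd d -> Om -> R) x : afs adm f -> afs adm g ->
  afs adm (fun z w => f (x + z) w * g z w).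
Proof.
move=> hf hg; apply: (afsM an); last by case: hg.
by apply: (@afs_bij _ _ _ adm f _ (fun y => y - x)) => // y; rewrite addrC addKr.
Qed.

(** Cutting the time interval at b and recentring the environment at the intermediate point, which
    is allowed under the expectation, writes the averaged kernel as a correlation of a forward and a
    reversed kernel in the same environment. Pointwise bounds thus follow from two L2 bounds. *)
Lemma GG_prod a b x :
  GG (a + b) x = Ex (fun w => zsum (fun z => K tau A a (x + z) w * K rtau rA b z w)).
Proof.
have h1 : afs adm (fun z w => K tau A a (x + z) w * K rtau rA b z w).
  by apply: afs_prod; [exact: (afs_K an)|exact: (afs_K an_rev)].
pose h z w := K tau A a (x - z) w * K rtau rA b (- z) w.
have h2 : afs adm (fun z w => h z (tau z b%:Z w)).
  have [u1 [s u2]] := h1.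
  split=> [z|]; first by apply: (adm_tau an (f := h z)); exact: u1.
  exists [seq - y | y <- s] => y w hy; apply: u2; apply: contra hy => hy.
  by apply/mapP; exists (- y); rewrite ?opprK.
rewrite (Ex_zsum an h1) -(zsum_refl _ 0) /GG.
have -> : K tau A (a + b) x = fun w => zsum (fun z => h z (tau z b%:Z w)).
  by apply/funext => w; rewrite (K_semigroup an); apply: eq_zsum => z; rewrite mulrC /h -K_dual.
rewrite (Ex_zsum an h2); apply: eq_zsum => z; rewrite sub0r.
by rewrite (Ex_tau an z b (f := h z)) // /h; case: h1.
Qed.
End Reversed.

Section Pointwise.
Context (R : realType) (d : nat) (Om : Type) (adm : (Om -> R) -> Prop)
    (Ex : (Om -> R) -> R) (tau : Zd d -> int -> Om -> Om) (A : Om -> 'M[R]_d)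
    (l L mu : R).
Hypothesis an : annealed adm Ex tau A l L.
Hypotheses (l0 : 0 < l) (L0 : 0 < L) (mu0 : 0 < mu) (mu1 : mu <= 1)
  (hmu : 4 * d%:R * mu * L ^+ 2 <= l).
Local Notation G := (GG Ex tau A).
Local Notation tau' := (rtau tau).
Local Notation A' := (rA tau A).
Local Notation q s := (qq d l L s).
Lemma rho_split (k : 'I_d) (s : R) (x z : Zd d) : rho k s x = rho k s (x + z) * rho k (- s) z.
Proof. by rewrite rhoD -mulrA rhoNK mulr1. Qed.
(** The weight splits as rho(x) = rho(x + z) rho(-z), one factor for each kernel with opposite signs
    of s; then uv <= (u^2 + v^2)/2. *)
Lemma GG_weighted_le k s a b x : `|s| <= mu / 4 ->
  rho k s x * `|G (a + b) x| <= (EE Ex tau A k s a + EE Ex tau' A' k (- s) b) / 2.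
Proof.
move=> hs; have an' := an_rev an.
rewrite (GG_prod an).
have h1 := afs_wK k an s a; have h2 := afs_wK k an' (- s) b.
have h3 : afs adm (fun z w => wK tau A k s a (x + z) w * wK tau' A' k (- s) b z w) by apply: (afs_prod an).
have e w : rho k s x * zsum (fun z => K tau A a (x + z) w * K tau' A' b z w) =
   zsum (fun z => wK tau A k s a (x + z) w * wK tau' A' k (- s) b z w).
  rewrite -zsumZ; last by apply: (afs_fs w (f := fun z w => K tau A a (x + z) w * K tau' A' b z w) (adm := adm)); apply: (afs_prod an); [exact: (afs_K an)|exact: (afs_K an')].
  apply: eq_zsum => z; rewrite /wK (rho_split k s x z); ring.
rewrite -[rho k s x]gtr0_norm ?rho_gt0 // -normrM -(ExZ an); last first.
  by apply: (adm_zsum an); apply: (afs_prod an); [exact: (afs_K an)|exact: (afs_K an')].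
under eq_fun do rewrite e.
set F := fun w => zsum _.
have aF : adm F by apply: (adm_zsum an).
have b1 : adm (fun w => zsum (fun x => wK tau A k s a x w ^+ 2)) by apply: (adm_zsum an); apply: (afsX an).
have b2 : adm (fun w => zsum (fun x => wK tau' A' k (- s) b x w ^+ 2)) by apply: (adm_zsum an); apply: (afsX an').
have hF w : `|F w| <= 2^-1 * (zsum (fun x => wK tau A k s a x w ^+ 2) + zsum (fun x => wK tau' A' k (- s) b x w ^+ 2)).
  have f1 : fs (fun z => wK tau A k s a (x + z) w ^+ 2).
    by apply: (@fsX _ _ (fun z => wK tau A k s a (x + z) w)) => //; apply: (fs_shiftl (f := fun y => wK tau A k s a y w)); exact: (afs_fs w h1).
  have f2 : fs (fun z => wK tau' A' k (- s) b z w ^+ 2).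
    by apply: (@fsX _ _ (fun z => wK tau' A' k (- s) b z w)) => //; exact: (afs_fs w h2).
  have f3 : fs (fun z => wK tau A k s a (x + z) w * wK tau' A' k (- s) b z w) by exact: (afs_fs w h3).
  rewrite -(zsum_shiftl (fun x => wK tau A k s a x w ^+ 2) x) -zsumD // -zsumZ; last exact: fsD.
  apply: le_trans (ler_norm_zsum f3) _.
  apply: ler_zsum => [||z]; first by apply: fs_sub f3 _ => z ->; rewrite normr0.
    by apply: fsMr; apply: fsD.
  move: (wK _ _ _ _ _ _ _) (wK _ _ _ _ _ _ _) => u v.
  have := sqr_ge0 (u - v); have := sqr_ge0 (u + v); rewrite ler_norml => h4 h5.
  apply/andP; split; nra.
have -> : (EE Ex tau A k s a + EE Ex tau' A' k (- s) b) / 2 =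
  Ex (fun w => 2^-1 * (zsum (fun x => wK tau A k s a x w ^+ 2) + zsum (fun x => wK tau' A' k (- s) b x w ^+ 2))).
  by rewrite (ExZ an) ?(ExD an) //; [rewrite mulrC|exact: (admD an)].
have aR : adm (fun w => 2^-1 * (zsum (fun x => wK tau A k s a x w ^+ 2) + zsum (fun x => wK tau' A' k (- s) b x w ^+ 2))).
  by apply: (admZ an); apply: (admD an).
rewrite ler_norml; apply/andP; split.
  rewrite lerNl -(ExN an) //; apply: (Ex_le an) => //; first exact: (admN an).
  by move=> w; have := hF w; rewrite ler_norml lerNl => /andP[].
by apply: (Ex_le an) => // w; have := hF w; rewrite ler_norml => /andP[].
Qed.

(** In the correlation formula one difference falls on each kernel, so a second difference of the
    average costs only one gradient of each factor. This is why second differences are controlled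
    although the random solution has no such regularity. *)
Lemma GG_grad2_le k s a b x i j : `|s| <= mu / 4 ->
  rho k s x * `|(G (a + b) (x + evec i) - G (a + b) x) -
     (G (a + b) (x - evec j + evec i) - G (a + b) (x - evec j))| <=
   (WD Ex tau A k s a + WD Ex tau' A' k (- s) b) / 2.
Proof.
move=> hs; have an' := an_rev an.
pose f i x w := dgr (K tau A a ^~ w) x i; pose g j x w := dgr (K tau' A' b ^~ w) x j.
have af : afs adm (f i) by apply: (afs_dgr an); exact: (afs_K an).
have ag : afs adm (g j) by apply: (afs_dgr an'); exact: (afs_K an').
have afg := afs_prod an x af ag.
have aK := afs_K an a; have aK' := afs_K an' b.
have aP y := afs_prod an y aK aK'.
have e0 : (G (a + b) (x + evec i) - G (a + b) x) -
     (G (a + b) (x - evec j + evec i) - G (a + b) (x - evec j)) =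
     - Ex (fun w => zsum (fun z => f i (x + z) w * g j z w)).
  rewrite !(GG_prod an) -!(ExB an) ?(ExN an) -?(ExN an);
    try (by repeat apply: (admB an); apply: (adm_zsum an)); try (by apply: (adm_zsum an)).
  congr Ex; apply/funext => w.
  have fP y : fs (fun z => K tau A a (y + z) w * K tau' A' b z w) by exact: (afs_fs w (aP y)).
  have s1 y : zsum (fun z => K tau A a (y - evec j + z) w * K tau' A' b z w) =
     zsum (fun z => K tau A a (y + z) w * K tau' A' b (z + evec j) w).
    rewrite -(zsum_shift (fun z => K tau A a (y - evec j + z) w * K tau' A' b z w) (evec j)).
    by apply: eq_zsum => z; congr (K _ _ _ _ _ * _); rewrite addrACA addNr addr0.
  have fP' y : fs (fun z => K tau A a (y + z) w * K tau' A' b (z + evec j) w).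
    apply: fsMr; apply: (fs_shift (f := fun z => K tau' A' b z w)); exact: (afs_fs w aK').
  rewrite [x - evec j + evec i]addrAC !s1 -[RHS]zsumN; last exact: (afs_fs w afg).
  rewrite -!zsumB; try (by first [exact: fP | exact: fP' | apply: fsB; first [exact: fP | exact: fP']]).
  apply: eq_zsum => z; rewrite /f /g /dgr [x + evec i + z]addrAC; ring.
rewrite e0 normrN -[rho k s x]gtr0_norm ?rho_gt0 // -normrM -(ExZ an); last exact: (adm_zsum an).
pose rf x w := rho k s x * f i x w; pose rg z w := rho k (- s) z * g j z w.
have arf : afs adm rf by apply: (afsMc an).
have arg : afs adm rg by apply: (afsMc an').
have h3 := afs_prod an x arf arg.
have e w : rho k s x * zsum (fun z => f i (x + z) w * g j z w) = zsum (fun z => rf (x + z) w * rg z w).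
  rewrite -zsumZ; last exact: (afs_fs w afg).
  apply: eq_zsum => z; rewrite /rf /rg (rho_split k s x z); ring.
under eq_fun do rewrite e.
set F := fun w => zsum _.
have aF : adm F by apply: (adm_zsum an).
pose X w := zsum (fun x => sqn (fun i => rho k s x * f i x w)).
pose Y w := zsum (fun x => sqn (fun j => rho k (- s) x * g j x w)).
have aX : afs adm (fun x w => sqn (fun i => rho k s x * f i x w)).
  by apply: (afs_sum an) => i'; apply: (afsX an); apply: (afsMc an); apply: (afs_dgr an).
have aY : afs adm (fun x w => sqn (fun j => rho k (- s) x * g j x w)).
  by apply: (afs_sum an') => i'; apply: (afsX an'); apply: (afsMc an'); apply: (afs_dgr an').
have bX : adm X by apply: (adm_zsum an).
have bY : adm Y by apply: (adm_zsum an').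
have hF w : `|F w| <= 2^-1 * (X w + Y w).
  have f1 : fs (fun z => sqn (fun i => rho k s (x + z) * f i (x + z) w)).
    exact: (fs_shiftl (f := fun z => sqn (fun i => rho k s z * f i z w)) x (afs_fs w aX)).
  have f2 := afs_fs w aY.
  have f3 := afs_fs w h3.
  rewrite /X -(zsum_shiftl (fun z => sqn (fun i => rho k s z * f i z w)) x) -zsumD // -zsumZ; last exact: fsD.
  apply: le_trans (ler_norm_zsum f3) _.
  apply: ler_zsum => [||z]; first by apply: fs_sub f3 _ => z ->; rewrite normr0.
    by apply: fsMr; apply: fsD.
  have h1 : rf (x + z) w ^+ 2 <= sqn (fun i => rho k s (x + z) * f i (x + z) w).
    by rewrite /sqn (bigD1 i) //= lerDl sumr_ge0 // => ? _; apply: sqr_ge0.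
  have h2 : rg z w ^+ 2 <= sqn (fun j => rho k (- s) z * g j z w).
    by rewrite /sqn (bigD1 j) //= lerDl sumr_ge0 // => ? _; apply: sqr_ge0.
  apply: (@le_trans _ _ (2^-1 * (rf (x + z) w ^+ 2 + rg z w ^+ 2))); last by rewrite ler_pM2l ?invr_gt0 // lerD.
  move: (rf _ _) (rg _ _) => u v.
  have := sqr_ge0 (u - v); have := sqr_ge0 (u + v); rewrite ler_norml => h4 h5.
  apply/andP; split; nra.
have -> : (WD Ex tau A k s a + WD Ex tau' A' k (- s) b) / 2 = Ex (fun w => 2^-1 * (X w + Y w)).
  by rewrite (ExZ an) ?(ExD an) //; [rewrite mulrC|exact: (admD an)].
have aR : adm (fun w => 2^-1 * (X w + Y w)).
  by apply: (admZ an); apply: (admD an).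
rewrite ler_norml; apply/andP; split.
  rewrite lerNl -(ExN an) //; apply: (Ex_le an) => //; first exact: (admN an).
  by move=> w; have := hF w; rewrite ler_norml lerNl => /andP[].
by apply: (Ex_le an) => // w; have := hF w; rewrite ler_norml => /andP[].
Qed.
End Pointwise.

(** * Gaussian bounds *)

Definition dgr2 (R : zmodType) d (f : Zd d -> R) (x : Zd d) (i j : 'I_d) : R :=
  (f (x + evec i) - f x) - (f (x - evec j + evec i) - f (x - evec j)).
(** For the kernel the time is cut in two halves. For second differences the cutting time is chosen
    in the middle third by averaging, so that the dissipations of the forward and of the reversed
    kernel are simultaneously of order 1/t. *)
Lemma apriori_weighted (R : realType) (d : nat) (l L mu : R) :
  0 < l -> 0 < L -> 0 < mu -> mu <= 1 -> 4 * d%:R * mu * L ^+ 2 <= l ->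
  exists C : R, 0 < C /\ forall (Om : Type) (adm : (Om -> R) -> Prop)
    (Ex : (Om -> R) -> R) (tau : Zd d -> int -> Om -> Om) (A : Om -> 'M[R]_d),
  annealed adm Ex tau A l L -> forall (k : 'I_d) (s : R), `|s| <= mu / 4 ->
  forall t x,
  rho k s x * `|GG Ex tau A t x| <= C * (qq d l L s ^+ t / rt R t ^+ d) /\
  forall i j, rho k s x * `|dgr2 (GG Ex tau A t) x i j| <=
    C * ((t.+1%:R^-1 + s ^+ 2) * qq d l L s ^+ t / rt R t ^+ d).
Proof.
move=> l0 L0 mu0 mu1 hmu.
have c_gt0 := cstep_gt0 d l0 L0.
have C2 : 0 < 2 * d%:R ^+ 2 + 1 :> R by rewrite ltr_wpDl // mulr_ge0 ?sqr_ge0.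
have [K [K0 hK]] := decay d c_gt0 C2.
set c := cstep d l L in c_gt0 hK.
pose C0 := K * 2 ^+ d.
have C00 : 0 < C0 by rewrite mulr_gt0 ?exprn_gt0.
pose C1 := 48 * C0.
pose C3 := (24 / c + 16 * d%:R) * C0.
have C10 : 0 <= C1 by rewrite mulr_ge0 // ltW.
have C30 : 0 <= C3.
  by rewrite mulr_ge0 ?(ltW C00) // addr_ge0 ?mulr_ge0 ?ler0n // invr_ge0 ltW.
exists (C0 + C1 + C3); split; first by rewrite ltr_wpDr // ltr_wpDr.
move=> Om adm Ex tau A an k s hs t x.
have an' := an_rev an.
have hs' : `|- s| <= mu / 4 by rewrite normrN.
set q := qq d l L s.
have q1 : 1 <= q by apply: qq_ge1.
have q0 : 0 < q by apply: qq_gt0.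
have qN : qq d l L (- s) = q by rewrite /q /qq sqrrN.
have rd m : 0 < rt R m ^+ d by rewrite exprn_gt0 // rt_gt0.
pose F := EF Ex tau A l L k s; pose F' := EF Ex (rtau tau) (rA tau A) l L k (- s).
pose D := DF Ex tau A l L k s; pose D' := DF Ex (rtau tau) (rA tau A) l L k (- s).
have F0 := EF_ge0 k an l0 L0 s : forall m, 0 <= F m.
have F0' := EF_ge0 k an' l0 L0 (- s) : forall m, 0 <= F' m.
have D0 := DF_ge0 k an l0 L0 s : forall m, 0 <= D m.
have D0' := DF_ge0 k an' l0 L0 (- s) : forall m, 0 <= D' m.
have S := EF_step k an l0 L0 mu0 mu1 hmu hs : forall m, F m.+1 <= F m - c * D m.
have S' := EF_step k an' l0 L0 mu0 mu1 hmu hs' : forall m, F' m.+1 <= F' m - c * D' m.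
have P m N : (0 < N)%N -> F m <= (2 * d%:R ^+ 2 + 1) * N%:R ^+ 2 * D m + 2 / N%:R ^+ d.
  move=> N0; apply: le_trans (EF_poincare k an l0 L0 mu0 mu1 hmu hs m N0) _.
  by rewrite lerD2r ler_wpM2r ?D0 // ler_wpM2r ?sqr_ge0 // lerDl.
have P' m N : (0 < N)%N -> F' m <= (2 * d%:R ^+ 2 + 1) * N%:R ^+ 2 * D' m + 2 / N%:R ^+ d.
  move=> N0; apply: le_trans (EF_poincare k an' l0 L0 mu0 mu1 hmu hs' m N0) _.
  by rewrite lerD2r ler_wpM2r ?D0' // ler_wpM2r ?sqr_ge0 // lerDl.
have I : F 0%N <= 1 by rewrite /F /EF (EE_0 k an) expr0 divr1.
have I' : F' 0%N <= 1 by rewrite /F' /EF (EE_0 k an') expr0 divr1.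
have H := hK F D F0 D0 I S P.
have H' := hK F' D' F0' D0' I' S' P'.
have HC m n : (n.+1 <= 4 * m.+1)%N -> F m <= C0 / rt R n ^+ d.
  move=> h; apply: le_trans (H m) _; rewrite /C0 -mulrA ler_pM2l //; exact: rtV_le.
have HC' m n : (n.+1 <= 4 * m.+1)%N -> F' m <= C0 / rt R n ^+ d.
  move=> h; apply: le_trans (H' m) _; rewrite /C0 -mulrA ler_pM2l //; exact: rtV_le.
have qt0 m : 0 < q ^+ m by rewrite exprn_gt0.
have qle a b : (a <= b)%N -> q ^+ a <= q ^+ b by move=> ab; rewrite ler_weXn2l.
have R1 y : rho k s y * `|GG Ex tau A t y| <= C0 * (q ^+ t / rt R t ^+ d).
  pose a := t./2; pose b := (t - a)%N.
  have tab : t = (a + b)%N by rewrite /b /a; clear; lia.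
  have := GG_weighted_le an k a b y hs; rewrite -tab => h; apply: le_trans h _.
  have e1 : EE Ex tau A k s a = F a * q ^+ a by rewrite /F /EF divfK // gt_eqF.
  have e2 : EE Ex (rtau tau) (rA tau A) k (- s) b = F' b * q ^+ b.
    by rewrite /F' /EF qN divfK // gt_eqF.
  have h1 : F a * q ^+ a <= C0 / rt R t ^+ d * q ^+ t.
    apply: ler_pM; rewrite ?F0 ?(ltW (qt0 _)) //; last by apply: qle; rewrite tab leq_addr.
    by apply: HC; rewrite /a; clear; lia.
  have h2 : F' b * q ^+ b <= C0 / rt R t ^+ d * q ^+ t.
    apply: ler_pM; rewrite ?F0' ?(ltW (qt0 _)) //; last by apply: qle; rewrite tab leq_addl.
    by apply: HC'; rewrite /b /a; clear; lia.
  rewrite e1 e2 [q ^+ t / _]mulrC mulrA; lra.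
split.
  apply: le_trans (R1 x) _; rewrite ler_wpM2r ?divr_ge0 ?(ltW (qt0 _)) ?(ltW (rd _)) //.
  by rewrite -addrA lerDl addr_ge0.
move=> i j.
have s2 : 0 <= s ^+ 2 by apply: sqr_ge0.
have Q0 : 0 <= q ^+ t / rt R t ^+ d by rewrite divr_ge0 ?(ltW (qt0 _)) ?(ltW (rd _)).
have tV : 0 < t.+1%:R^-1 :> R by rewrite invr_gt0 ltr0n.
(* There is no middle third for t < 3. The four values in the second difference are bounded
   separately, each with a weight ratio at most 4, and 1/(t + 1) >= 1/3 turns 16 into the constant
   48. *)
have [t3|t3] := ltnP t 3.
  have rm (i' : 'I_d) : rhom k s i' <= 2.
    apply: le_trans (rhom_le k i' hs _) _; move: mu1; lra.
  have rm' (i' : 'I_d) : rhom k (- s) i' <= 2.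
    apply: le_trans (rhom_le k i' hs' _) _; move: mu1; lra.
  have g0 := rhom_gt0 k s; have g0' := rhom_gt0 k (- s).
  have b1 y : 0 <= rho k s y * `|GG Ex tau A t y| by rewrite mulr_ge0 // ltW // rho_gt0.
  set B := C0 * (q ^+ t / rt R t ^+ d).
  have bb (a : R) y : 0 <= a -> a <= 4 -> rho k s x = a * rho k s y -> rho k s x * `|GG Ex tau A t y| <= 4 * B.
    move=> a0 a4 ->; rewrite -mulrA; apply: le_trans (ler_wpM2r (b1 y) a4) _.
    by rewrite ler_pM2l // R1.
  have e1 : rho k s x = 1 * rho k s x by rewrite mul1r.
  have e2 : rho k s x = rhom k (- s) i * rho k s (x + evec i).
    by rewrite rho_step mulrA [rhom k (- s) i * _]mulrC rhomNK mul1r.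
  have e3 : rho k s x = rhom k s j * rho k s (x - evec j) by rewrite -rho_step subrK.
  have e4 : rho k s x = (rhom k s j * rhom k (- s) i) * rho k s (x - evec j + evec i).
    by rewrite rho_step mulrA -[_ * _ * rhom k s i]mulrA [rhom k (- s) i * _]mulrC rhomNK mulr1 -rho_step subrK.
  have h24 : 2 <= 4 :> R by rewrite ler_nat.
  have h14 : 1 <= 4 :> R by rewrite ler1n.
  have E1 := bb 1 x ler01 h14 e1.
  have E2 := bb _ (x + evec i) (ltW (g0' _)) (le_trans (rm' i) h24) e2.
  have E3 := bb _ (x - evec j) (ltW (g0 _)) (le_trans (rm j) h24) e3.
  have E4 : rho k s x * `|GG Ex tau A t (x - evec j + evec i)| <= 4 * B.
    apply: bb e4; first by rewrite mulr_ge0 // ltW.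
    have -> : (4 : R) = 2 * 2 by rewrite -natrM.
    by apply: ler_pM => //; apply: ltW.
  have hD : `|dgr2 (GG Ex tau A t) x i j| <= `|GG Ex tau A t (x + evec i)| + `|GG Ex tau A t x| +
     (`|GG Ex tau A t (x - evec j + evec i)| + `|GG Ex tau A t (x - evec j)|).
    by apply: le_trans (ler_normB _ _) _; apply: lerD; exact: ler_normB.
  apply: le_trans (ler_wpM2l (ltW (rho_gt0 k s x)) hD) _.
  rewrite !mulrDr.
  apply: (@le_trans _ _ (16 * B)); first by move: E1 E2 E3 E4; clear; lra.
  rewrite /B -mulrA.
  have h13 : 1 <= 3 * (t.+1%:R^-1 + s ^+ 2).
    have : 3^-1 <= t.+1%:R^-1 :> R by rewrite lef_pV2 ?posrE ?ltr0n // ler_nat.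
    move: s2; move: (t.+1%:R^-1) (s ^+ 2) => u v; clear; lra.
  apply: (@le_trans _ _ (16 * (3 * (t.+1%:R^-1 + s ^+ 2)) * (C0 * (q ^+ t / rt R t ^+ d)))).
    by apply: ler_wpM2r; [rewrite mulr_ge0 // ltW | rewrite -[leLHS]mulr1 ler_pM2l].
  have -> : 16 * (3 * (t.+1%:R^-1 + s ^+ 2)) * (C0 * (q ^+ t / rt R t ^+ d)) =
     C1 * ((t.+1%:R^-1 + s ^+ 2) * (q ^+ t / rt R t ^+ d)) by rewrite /C1; ring.
  rewrite ler_wpM2r //; first by rewrite mulr_ge0 // addr_ge0 // ltW.
  by move: C00 C30; lra.
(* The cutting times n + i with i < n leave t - (n + i), which runs through the n integers starting
   from m = t - 2 n + 1; both dissipation sums are therefore telescoped from time n and from time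
   m. *)
pose n := (t %/ 3)%N.
have n0 : (0 < n)%N by rewrite divn_gt0.
have nt : (3 * n <= t)%N by rewrite /n mulnC leq_divM.
have nt2 : (t < 3 * n + 3)%N by rewrite /n; clear -t3; lia.
pose m := (t - 2 * n).+1.
have nm : (n <= m)%N by rewrite /m; clear -nt; lia.
have sum1 := decay_sum F0 S n n.
have sum2 := decay_sum F0' S' m n.
have sum3 : \sum_(i0 < n) (c * D (n + i0)%N + c * D' (t - (n + i0))%N) <= F n + F' m.
  rewrite big_split lerD //=.
  rewrite (reindex_inj rev_ord_inj) /=; apply: le_trans sum2.
  apply: ler_sum => i' _; congr (_ <= _): (lexx (c * D' (m + i')%N)).
  by congr (c * D' _); have := ltn_ord i'; rewrite /m; move: (nat_of_ord i') => r; clear -nt n0; lia.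
have [i' i'n hi'] := avg_exists (f := fun i0 => c * D (n + i0)%N + c * D' (t - (n + i0))%N) n0 sum3.
pose a := (n + i')%N; pose b := (t - a)%N.
have at_ : (a <= t)%N by rewrite /a; clear -nt i'n; lia.
have tab : t = (a + b)%N by rewrite /b subnKC.
have := GG_grad2_le an k a b x i j hs; rewrite -tab => h; apply: le_trans h _.
have W1 := WD_le k an l0 L0 mu1 hs a.
have W2 := WD_le k an' l0 L0 mu1 hs' b.
rewrite -/(F a) -/(D a) in W1; rewrite qN sqrrN -/(F' b) -/(D' b) in W2.
set X := C0 / rt R t ^+ d.
have X0 : 0 <= X by rewrite divr_ge0 ?(ltW C00) ?(ltW (rd _)).
have f1 : F n <= X by apply: HC; clear -nt2; lia.
have f2 : F' m <= X by apply: HC'; clear -nt2 nm; lia.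
have f3 : F a <= X by apply: HC; rewrite /a; clear -nt2; lia.
have f4 : F' b <= X by apply: HC'; rewrite /b /a; clear -nt nt2 i'n; lia.
have n6 : t.+1%:R <= 6 * n%:R :> R by rewrite -natrM ler_nat; clear -nt2 n0; lia.
have nR : 0 < n%:R :> R by rewrite ltr0n.
have hDD : D a + D' b <= 12 / c * t.+1%:R^-1 * X.
  have h1 : (c * D a + c * D' b) * n%:R <= 2 * X by apply: le_trans hi' _; move: f1 f2; clear; lra.
  have h2 : (D a + D' b) * t.+1%:R <= (D a + D' b) * (6 * n%:R) by rewrite ler_wpM2l // addr_ge0.
  have cT0 : 0 < c * t.+1%:R by apply: mulr_gt0 => //; rewrite ltr0n.
  rewrite -(ler_pM2r cT0).
  have -> : 12 / c * t.+1%:R^-1 * X * (c * t.+1%:R) = 12 * X.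
    by have /negbT := pnatr_eq0 R t.+1; move: (t.+1%:R) => T T0; field; rewrite T0 gt_eqF.
  have h3 : c * ((D a + D' b) * t.+1%:R) <= c * ((D a + D' b) * (6 * n%:R)) by rewrite ler_pM2l.
  have -> : (D a + D' b) * (c * t.+1%:R) = c * ((D a + D' b) * t.+1%:R) by ring.
  apply: le_trans h3 _.
  have -> : c * ((D a + D' b) * (6 * n%:R)) = 6 * ((c * D a + c * D' b) * n%:R) by ring.
  by move: h1; clear; lra.
have dd : 0 <= 16 * d%:R * s ^+ 2 by apply: mulr_ge0 => //; rewrite mulr_ge0.
have G1 : WD Ex tau A k s a <= (4 * D a + 16 * d%:R * s ^+ 2 * F a) * q ^+ t.
  by apply: le_trans W1 _; rewrite ler_wpM2l ?qle // addr_ge0 // mulr_ge0.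
have G2 : WD Ex (rtau tau) (rA tau A) k (- s) b <= (4 * D' b + 16 * d%:R * s ^+ 2 * F' b) * q ^+ t.
  have bt : (b <= t)%N by rewrite leq_subr.
  by apply: le_trans W2 _; rewrite ler_wpM2l ?qle // addr_ge0 // mulr_ge0.
apply: (@le_trans _ _ ((24 / c * t.+1%:R^-1 * X + 16 * d%:R * s ^+ 2 * X) * q ^+ t)).
  have h1 : 16 * d%:R * s ^+ 2 * F a <= 16 * d%:R * s ^+ 2 * X by rewrite ler_wpM2l.
  have h2 : 16 * d%:R * s ^+ 2 * F' b <= 16 * d%:R * s ^+ 2 * X by rewrite ler_wpM2l.
  set Y1 := 16 * _ * _ * F a in h1 G1; set Y2 := 16 * _ * _ * F' b in h2 G2; set Y := 16 * _ * _ * X in h1 h2 *.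
  have h3 : (4 * D a + Y1 + (4 * D' b + Y2)) / 2 <= 24 / c * t.+1%:R^-1 * X + Y.
    have -> : 24 / c * t.+1%:R^-1 * X = 2 * (12 / c * t.+1%:R^-1 * X) by ring.
    have hh (u u1 u2 v1 v2 z : R) : u1 <= u -> u2 <= u -> v1 + v2 <= z ->
      (4 * v1 + u1 + (4 * v2 + u2)) / 2 <= 2 * z + u by clear; move=> *; lra.
    exact: hh.
  apply: le_trans (ler_wpM2r (ltW (qt0 t)) h3).
  by rewrite mulrAC ler_pM2r ?invr_gt0 // mulrDl; apply: lerD.
have -> : (C0 + C1 + C3) * ((t.+1%:R^-1 + s ^+ 2) * q ^+ t / rt R t ^+ d) =
  (C0 + C1 + C3) * (t.+1%:R^-1 + s ^+ 2) / rt R t ^+ d * q ^+ t by ring.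
rewrite ler_pM2r //.
have -> : 24 / c * t.+1%:R^-1 * X + 16 * d%:R * s ^+ 2 * X =
  (24 / c * t.+1%:R^-1 + 16 * d%:R * s ^+ 2) * C0 / rt R t ^+ d by rewrite /X; ring.
rewrite ler_pM2r ?invr_gt0 //.
apply: (@le_trans _ _ (C3 * (t.+1%:R^-1 + s ^+ 2))).
  have -> : C3 * (t.+1%:R^-1 + s ^+ 2) = (24 / c * t.+1%:R^-1 + 16 * d%:R * s ^+ 2) * C0 +
    (16 * d%:R * t.+1%:R^-1 + 24 / c * s ^+ 2) * C0 by rewrite /C3; ring.
  have c24 : 0 <= 24 / c by rewrite divr_ge0 // ltW.
  rewrite lerDl mulr_ge0 ?(ltW C00) // addr_ge0 //; first by rewrite mulr_ge0 ?(ltW tV) // mulr_ge0.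
by rewrite ler_wpM2r ?addr_ge0 ?(ltW tV) // lerDr addr_ge0 // ltW.
Qed.

Section Gaussian.
Context (R : realType) (d : nat).
Definition dec (gamma Lam : R) (t : nat) (x : Zd d) : R :=
  expR (- gamma * Num.min (znorm R x) (znorm R x ^+ 2 / (Lam * t%:R + 1))).
Lemma dec_gt0 g Lam t x : 0 < dec g Lam t x. Proof. exact: expR_gt0. Qed.
Lemma znorm_ge0 (x : Zd d) : 0 <= znorm R x. Proof. exact: sqrtr_ge0. Qed.
Lemma znorm_sqr (x : Zd d) : znorm R x ^+ 2 = \sum_i ((x ord0 i)%:~R : R) ^+ 2.
Proof. by rewrite sqr_sqrtr // sumr_ge0 // => i _; apply: sqr_ge0. Qed.
Lemma znorm_max (x : Zd d) : (0 < d)%N -> exists k, znorm R x <= d%:R * `|(x ord0 k)%:~R|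
   /\ znorm R x ^+ 2 <= d%:R * `|(x ord0 k)%:~R| ^+ 2.
Proof.
move=> d0; pose f (k : 'I_d) := absz (x ord0 k).
case: (@arg_maxnP _ (Ordinal d0) xpredT f isT) => k _ hk; exists k.
have h i : ((x ord0 i)%:~R : R) ^+ 2 <= `|(x ord0 k)%:~R| ^+ 2.
  rewrite -[leLHS]real_normK ?num_real // ler_sqr ?nnegrE //.
  by rewrite -!intr_norm ler_int; have := hk i isT; rewrite /f; move: (x ord0 i) (x ord0 k) => u v; lia.
have h2 : znorm R x ^+ 2 <= d%:R * `|(x ord0 k)%:~R| ^+ 2.
  rewrite znorm_sqr; apply: le_trans (ler_sum _ (fun i _ => h i)) _.
  by rewrite sumr_const card_ord mulr_natl.
split=> //; rewrite -ler_sqr ?nnegrE ?znorm_ge0 ?mulr_ge0 //.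
apply: le_trans h2 _; rewrite exprMn ler_wpM2r ?sqr_ge0 //.
by rewrite -natrX ler_nat -[leqLHS]muln1 leq_mul2l d0 orbT.
Qed.

(** The parabola c2 w s^2 - s a is minimized under s <= mu/4. An interior minimizer s = a/(2 c2 w)
    gives the Gaussian branch a^2/w, the end point mu/4 the linear branch. *)
Lemma gauss_opt (c2 mu a w : R) : 0 < c2 -> 0 < mu -> 0 <= a -> 0 < w ->
  exists s, [/\ 0 <= s, s <= mu / 4 &
   c2 * w * s ^+ 2 - s * a <= - Num.min (1 / (4 * c2)) (mu / 8) * Num.min a (a ^+ 2 / w)].
Proof.
move=> c20 mu0 a0 w0.
set g := Num.min (1 / (4 * c2)) (mu / 8).
have g0 : 0 <= g by rewrite le_min !divr_ge0 // ltW // mulr_gt0.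
have g1 : g <= 1 / (4 * c2) by rewrite /g ge_min lexx.
have g2 : g <= mu / 8 by rewrite /g ge_min lexx orbT.
have cw : 0 < 2 * c2 * w by rewrite !mulr_gt0.
have a2w : 0 <= a ^+ 2 / w by rewrite divr_ge0 ?sqr_ge0 // ltW.
have m1 : Num.min a (a ^+ 2 / w) <= a by rewrite ge_min lexx.
have m2 : Num.min a (a ^+ 2 / w) <= a ^+ 2 / w by rewrite ge_min lexx orbT.
have m0 : 0 <= Num.min a (a ^+ 2 / w) by rewrite le_min a0.
move: (Num.min a _) m0 m1 m2 => M m0 m1 m2.
have [h|h] := lerP (a / (2 * c2 * w)) (mu / 4).
  exists (a / (2 * c2 * w)); split=> //; first by rewrite divr_ge0 // ltW.
  have -> : c2 * w * (a / (2 * c2 * w)) ^+ 2 - a / (2 * c2 * w) * a = - (1 / (4 * c2) * (a ^+ 2 / w)).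
    by field; rewrite !gt_eqF.
  rewrite mulNr lerN2; exact: ler_pM.
exists (mu / 4); split=> //; first by rewrite divr_ge0 // ltW.
have h' : mu / 4 * (2 * c2 * w) <= a by rewrite -ler_pdivlMr // ltW.
have h2 : g * M <= mu / 8 * a by apply: ler_pM.
have h3 : c2 * w * (mu / 4) ^+ 2 <= mu / 8 * a.
  have -> : c2 * w * (mu / 4) ^+ 2 = mu / 8 * (mu / 4 * (2 * c2 * w)) by field.
  by rewrite ler_pM2l // divr_gt0.
have -> : mu / 4 * a = mu / 8 * a + mu / 8 * a by field.
rewrite mulNr; lra.
Qed.

(** The order of the quantifiers is the content: gamma depends on d and on the ellipticity ratio
    only, whereas C may depend on Lam. One statement covers the random environment, its homogenized
    limit and the constant-coefficient kernel. *)
Lemma apriori (kap : R) : (0 < d)%N -> 1 <= kap -> exists2 gamma : R, 0 < gamma &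
  forall Lam l L : R, 0 < l -> l <= L -> L = 2 * Lam -> L <= 4 * kap * l -> 2 * d%:R * L <= 1 ->
  exists2 C : R, 0 < C &
  forall (Om : Type) (adm : (Om -> R) -> Prop)
    (Ex : (Om -> R) -> R) (tau : Zd d -> int -> Om -> Om) (A : Om -> 'M[R]_d),
  annealed adm Ex tau A l L -> forall t x,
  `|GG Ex tau A t x| <= C / rt R t ^+ d * dec gamma Lam t x /\
  forall i j, `|dgr2 (GG Ex tau A t) x i j| <= C / rt R t ^+ d.+2 * dec gamma Lam t x.
Proof.
move=> d0 kap1.
have dR : 0 < d%:R :> R by rewrite ltr0n.
(* Chosen so that 4 d mu L^2 = 2 d L (L / (4 kap)) <= L / (4 kap) <= l. *)
pose mu : R := 1 / (8 * kap).
have kap0 : 0 < kap by apply: lt_le_trans kap1.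
have mu0 : 0 < mu by rewrite divr_gt0 // mulr_gt0.
have mu1 : mu <= 1 by rewrite /mu ler_pdivrMr ?mulr_gt0 //; lra.
(* The bound [c0] <= (256 kap + 4) d Lam controls the growth [qq ^+ t]; the extra 1 pays for the
   factor s^2 in the second differences, absorbed by s'^2 w <= exp(s'^2 w). *)
pose c2 : R := (256 * kap + 4) * d%:R + 1.
have c20 : 0 < c2.
  by apply: addr_gt0 (mulr_gt0 _ dR) ltr01; have := kap0; lra.
pose g1 := Num.min (1 / (4 * c2)) (mu / 8).
have g10 : 0 < g1 by rewrite lt_min !divr_gt0 // mulr_gt0.
exists (g1 / d%:R); first by rewrite divr_gt0.
move=> Lam l L l0 lL LL Lk dL.
have L0 : 0 < L by apply: lt_le_trans lL.
have Lam0 : 0 < Lam by move: L0; rewrite LL; lra.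
have hmu : 4 * d%:R * mu * L ^+ 2 <= l.
  have -> : 4 * d%:R * mu * L ^+ 2 = 2 * d%:R * L * (L / (4 * kap)).
    by rewrite /mu; field; rewrite gt_eqF.
  apply: (@le_trans _ _ (1 * (L / (4 * kap)))).
    by rewrite ler_wpM2r // divr_ge0 // ltW // mulr_gt0.
  by rewrite mul1r ler_pdivrMr ?mulr_gt0 // mulrC.
have [C0 [C00 hC]] := apriori_weighted l0 L0 mu0 mu1 hmu.
pose C1 := 1 + (1 + Lam^-1).
have LamV : 0 < Lam^-1 by rewrite invr_gt0.
have C10 : 0 < C1 by rewrite !addr_gt0.
exists (C0 * C1); first by rewrite mulr_gt0.
move=> Om adm Ex tau A an t x.
pose w := Lam * t%:R + 1.
have w1 : 1 <= w by rewrite lerDr mulr_ge0 // ltW.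
have w0 : 0 < w by apply: lt_le_trans w1.
have [k [hk1 hk2]] := znorm_max x d0.
set a := `|(x ord0 k)%:~R| : R in hk1 hk2.
have a0 : 0 <= a by apply: normr_ge0.
have [s' [s0 smu hs]] := gauss_opt c20 mu0 a0 w0.
rewrite -/g1 in hs.
(* The sign makes the weight at x equal to exp(s' |x_k|), whatever the sign of the dominant
   coordinate. *)
pose s := s' * Num.sg ((x ord0 k)%:~R : R).
have hs4 : `|s| <= mu / 4.
  rewrite /s normrM ger0_norm // normr_sg; case: (_ != 0); rewrite ?mulr1 ?mulr0 //.
  by apply: le_trans smu.
have s2 : s ^+ 2 <= s' ^+ 2.
  rewrite /s exprMn sqr_sg; case: (_ != 0); rewrite ?mulr1 ?mulr0 ?sqr_ge0 //.
have rhoE : rho k s x = expR (s' * a) by rewrite /rho /s -mulrA -normrEsg.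
have [H1 H2] := hC Om adm Ex tau A an k s hs4 t x.
have decE : expR (c2 * w * s' ^+ 2 - s' * a) <= dec (g1 / d%:R) Lam t x.
  have hM : Num.min (znorm R x) (znorm R x ^+ 2 / w) <= d%:R * Num.min a (a ^+ 2 / w).
    rewrite minr_pMr ?(ltW dR) // le_min; apply/andP; split; first by rewrite ge_min hk1.
    by rewrite ge_min; apply/orP; right; rewrite mulrA ler_pM2r ?invr_gt0.
  rewrite /dec ler_expR; apply: le_trans hs _.
  by rewrite !mulNr lerN2 -mulrA ler_pM2l // ler_pdivrMl.
have qE : qq d l L s ^+ t <= expR (((256 * kap + 4) * d%:R) * w * s' ^+ 2).
  have h1 : qq d l L s <= expR (c0 d l L * s' ^+ 2).
    apply: le_trans (expR_ge1Dx _); rewrite lerD2l ler_wpM2l ?c0_pos //.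
  apply: (@le_trans _ _ (expR (c0 d l L * s' ^+ 2) ^+ t)).
    by rewrite lerXn2r ?nnegrE ?expR_ge0 // ltW // qq_gt0.
  rewrite -expRM_natl ler_expR mulrA ler_wpM2r ?sqr_ge0 //.
  have hc : c0 d l L <= (256 * kap + 4) * d%:R * Lam.
    have h2 : L ^+ 2 / l <= 4 * kap * L.
      have -> : 4 * kap * L = 4 * kap * l * L / l by field; rewrite gt_eqF.
      by rewrite ler_pM2r ?invr_gt0 // expr2 ler_pM2r.
    have -> : (256 * kap + 4) * d%:R * Lam = 32 * d%:R * (4 * kap * L) + 2 * d%:R * L by rewrite LL; ring.
    rewrite /c0 -mulrA lerD // ler_pM2l ?mulr_gt0 //.
  apply: (@le_trans _ _ (t%:R * ((256 * kap + 4) * d%:R * Lam))); first by rewrite ler_wpM2l.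
  have -> : t%:R * ((256 * kap + 4) * d%:R * Lam) = (256 * kap + 4) * d%:R * (Lam * t%:R) by ring.
  have k0 : 0 <= (256 * kap + 4) * d%:R.
    by apply: mulr_ge0 (ltW dR); have := kap0; lra.
  by apply: (ler_wpM2l k0); rewrite lerDl.
have rd : 0 < rt R t ^+ d by rewrite exprn_gt0 // rt_gt0.
have E1 : qq d l L s ^+ t <= expR (s' * a) * dec (g1 / d%:R) Lam t x.
  apply: le_trans qE _.
  apply: (@le_trans _ _ (expR (c2 * w * s' ^+ 2))).
    by rewrite ler_expR ler_wpM2r ?sqr_ge0 // ler_wpM2r ?(ltW w0) // lerDl.
  have -> : expR (c2 * w * s' ^+ 2) = expR (s' * a) * expR (c2 * w * s' ^+ 2 - s' * a).
    by rewrite -expRD addrC subrK.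
  by rewrite ler_pM2l ?expR_gt0.
rewrite rhoE in H1 H2.
have ea0 : 0 < expR (s' * a) by apply: expR_gt0.
split.
  rewrite -(ler_pM2l ea0); apply: le_trans H1 _.
  have -> : expR (s' * a) * (C0 * C1 / rt R t ^+ d * dec (g1 / d%:R) Lam t x) =
    C0 * (C1 * (expR (s' * a) * dec (g1 / d%:R) Lam t x) / rt R t ^+ d) by ring.
  rewrite ler_pM2l // ler_pM2r ?invr_gt0 //; apply: le_trans E1 _.
  by rewrite ler_peMl ?mulr_ge0 ?(ltW ea0) ?(ltW (dec_gt0 _ _ _ _)) // /C1 lerDl addr_ge0 // ltW.
move=> i j; rewrite -(ler_pM2l ea0); apply: le_trans (H2 i j) _.
have tR : 0 < t.+1%:R :> R by rewrite ltr0n.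
have -> : expR (s' * a) * (C0 * C1 / rt R t ^+ d.+2 * dec (g1 / d%:R) Lam t x) =
    C0 * (C1 / t.+1%:R * (expR (s' * a) * dec (g1 / d%:R) Lam t x) / rt R t ^+ d).
  rewrite -[d.+2]addn2 exprD rt_sqr; have : t.+1%:R != 0 :> R by rewrite gt_eqF.
  move: (t.+1%:R) => T T0; field; rewrite T0 gt_eqF //.
rewrite ler_pM2l // ler_pM2r ?invr_gt0 //.
have hw : t.+1%:R <= (1 + Lam^-1) * w.
  rewrite /w -natr1.
  have -> : (1 + Lam^-1) * (Lam * t%:R + 1) = t%:R + 1 + (Lam * t%:R + Lam^-1).
    by field; rewrite gt_eqF.
  by rewrite lerDl addr_ge0 ?mulr_ge0 // ltW.
have h5 : t.+1%:R^-1 + s ^+ 2 <= C1 / t.+1%:R * expR (w * s' ^+ 2).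
  have e1 : 1 + w * s' ^+ 2 <= expR (w * s' ^+ 2) by exact: expR_ge1Dx.
  have ws : 0 <= w * s' ^+ 2 by rewrite mulr_ge0 ?sqr_ge0 // ltW.
  have e2 : s ^+ 2 <= (1 + Lam^-1) / t.+1%:R * (w * s' ^+ 2).
    apply: le_trans s2 _; rewrite mulrA ler_peMl ?sqr_ge0 //.
    by rewrite mulrAC ler_pdivlMr // mul1r.
  have e3 : (1 + Lam^-1) / t.+1%:R * (w * s' ^+ 2) <= (1 + Lam^-1) / t.+1%:R * expR (w * s' ^+ 2).
    by rewrite ler_wpM2l ?divr_ge0 ?addr_ge0 ?(ltW LamV) // -[leLHS]add0r (le_trans _ e1) // lerD2r.
  have e4 : t.+1%:R^-1 <= t.+1%:R^-1 * expR (w * s' ^+ 2).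
    by rewrite ler_peMr ?invr_ge0 // (le_trans _ e1) // lerDl.
  have -> : C1 / t.+1%:R * expR (w * s' ^+ 2) = t.+1%:R^-1 * expR (w * s' ^+ 2) +
    (1 + Lam^-1) / t.+1%:R * expR (w * s' ^+ 2) by rewrite /C1; ring.
  by apply: lerD => //; apply: le_trans e3.
apply: (@le_trans _ _ (C1 / t.+1%:R * expR (w * s' ^+ 2) * expR (((256 * kap + 4) * d%:R) * w * s' ^+ 2))).
  apply: ler_pM => //; first by rewrite addr_ge0 ?sqr_ge0 // invr_ge0.
  by rewrite exprn_ge0 // ltW // qq_gt0.
rewrite -mulrA ler_wpM2l ?divr_ge0 ?(ltW C10) // -expRD.
have -> : w * s' ^+ 2 + (256 * kap + 4) * d%:R * w * s' ^+ 2 = s' * a + (c2 * w * s' ^+ 2 - s' * a).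
  by rewrite /c2; ring.
by rewrite expRD ler_pM2l.
Qed.
End Gaussian.

Import numFieldNormedType.Exports.
Local Open Scope classical_set_scope.
Local Open Scope ring_scope.
(** * Square integrable functions on the probability space *)

Section RealL2.
Context (R : realType) (dsp : measure_display) (Om : measurableType dsp)
        (P : probability Om R).
Implicit Types (u v : Om -> R).
(** Functions are not identified almost everywhere. Equality in L2 is expressed below by a
    difference of norm 0. *)
Definition rl2 u := measurable_fun setT u /\
  P.-integrable setT (EFin \o (fun w => u w ^+ 2)).
Definition rip u v : R := \int[P]_w (u w * v w).
Lemma rl2_meas u : rl2 u -> measurable_fun setT u. Proof. by case. Qed.
Lemma le_integrableR u v : measurable_fun setT u -> (forall w, `|u w| <= v w) ->
  P.-integrable setT (EFin \o v) -> P.-integrable setT (EFin \o u).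
Proof.
move=> mu h; apply: le_integrable => //; first exact/measurable_EFinP.
by move=> w _ /=; rewrite lee_fin; apply: le_trans (h w) _; exact: ler_norm.
Qed.

Lemma rl2_int u v : rl2 u -> rl2 v -> P.-integrable setT (EFin \o (fun w => u w * v w)).
Proof.
move=> [mu iu] [mv iv].
apply: (@le_integrableR _ (fun w => u w ^+ 2 + v w ^+ 2)).
- exact: measurable_funM.
- move=> w; rewrite ler_norml.
  by apply/andP; split; have := sqr_ge0 (u w + v w); have := sqr_ge0 (u w - v w); rewrite !expr2; nra.
- by have := integrableD measurableT iu iv.
Qed.

Lemma rl2D u v : rl2 u -> rl2 v -> rl2 (fun w => u w + v w).
Proof.
move=> hu hv; have [mu iu] := hu; have [mv iv] := hv; split; first exact: measurable_funD.
apply: (@le_integrableR _ (fun w => 2 * (u w ^+ 2 + v w ^+ 2))).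
- by apply: measurable_funX; exact: measurable_funD.
- by move=> w; rewrite ger0_norm ?sqr_ge0 //; have := sqr_ge0 (u w - v w); rewrite !expr2; nra.
- have h := integrableZl measurableT 2 (integrableD measurableT iu iv).
  exact: h.
Qed.

Lemma rl2_bdd u v (C : R) : measurable_fun setT u -> (forall w, `|u w| <= C) ->
  rl2 v -> rl2 (fun w => u w * v w).
Proof.
move=> mu hu [mv iv]; split; first exact: measurable_funM.
apply: (@le_integrableR _ (fun w => C ^+ 2 * v w ^+ 2)).
- by apply: measurable_funX; exact: measurable_funM.
- move=> w; rewrite ger0_norm ?sqr_ge0 // exprMn ler_wpM2r ?sqr_ge0 //.
  rewrite -real_normK ?num_real // ler_sqr ?nnegrE //; exact: le_trans (hu w).
- have h := integrableZl measurableT (C ^+ 2) iv; exact: h.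
Qed.

Lemma rl2_cst c : rl2 (fun=> c).
Proof.
split; first exact: measurable_cst.
exact: (finite_measure_integrable_cst P (c ^+ 2) measurableT).
Qed.

Lemma rl2Z c u : rl2 u -> rl2 (fun w => c * u w).
Proof. by apply: (@rl2_bdd _ _ `|c|). Qed.
Lemma rl2N u : rl2 u -> rl2 (fun w => - u w).
Proof. by move=> /(rl2Z (-1)); under eq_fun do rewrite mulN1r. Qed.
Lemma rl2B u v : rl2 u -> rl2 v -> rl2 (fun w => u w - v w).
Proof. by move=> hu hv; apply: rl2D => //; apply: rl2N. Qed.
Lemma rl2_integrable u : rl2 u -> P.-integrable setT (EFin \o u).
Proof.
move=> hu; have := rl2_int hu (rl2_cst 1).
by under eq_fun do rewrite mulr1.
Qed.

Lemma rl2_sum (I : Type) (r : seq I) (F : I -> Om -> R) : (forall i, rl2 (F i)) ->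
  rl2 (fun w => \sum_(i <- r) F i w).
Proof.
move=> h; elim: r => [|i r IH]; first by under eq_fun do rewrite big_nil; exact: rl2_cst.
by under eq_fun do rewrite big_cons; apply: rl2D.
Qed.

Lemma ripC u v : rip u v = rip v u.
Proof. by rewrite /rip; under eq_Rintegral do rewrite mulrC. Qed.
Lemma ripDl u v w : rl2 u -> rl2 v -> rl2 w ->
  rip (fun x => u x + v x) w = rip u w + rip v w.
Proof.
move=> hu hv hw; rewrite -RintegralD //; try exact: rl2_int.
by apply: eq_Rintegral => x _; rewrite mulrDl.
Qed.

Lemma ripZl c u v : rl2 u -> rl2 v -> rip (fun x => c * u x) v = c * rip u v.
Proof.
move=> hu hv; rewrite -RintegralZl //; last exact: rl2_int.
by apply: eq_Rintegral => x _; rewrite mulrA.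
Qed.

Lemma rip_ge0 u : 0 <= rip u u.
Proof. by apply: Rintegral_ge0 => w _; rewrite -expr2 sqr_ge0. Qed.
Lemma rip_eq0 u : rl2 u -> rip u u = 0 -> {ae P, forall w, u w = 0}.
Proof.
move=> hu h0; have [mu iu] := hu.
have mu2 : measurable_fun setT (fun w => (u w * u w)%:E).
  by apply/measurable_EFinP; exact: measurable_funM.
have h : (\int[P]_w `| (u w * u w)%:E | = 0)%E.
  under eq_integral => w _ do rewrite gee0_abs ?lee_fin -?expr2 ?sqr_ge0 // expr2.
  move: h0; rewrite /rip /Rintegral => h0.
  rewrite -[LHS]fineK ?h0 //.
  by apply: (integrable_fin_num measurableT); exact: rl2_int.
have := (ae_eq_integral_abs P measurableT mu2).1 h.
apply: filterS => w /= /(_ I) [] /eqP; rewrite mulf_eq0 orbb => /eqP //.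
Qed.

Lemma rip_ae0 u : (forall w, u w ^+ 2 >= 0) -> measurable_fun setT u ->
  {ae P, forall w, u w = 0} -> rip u u = 0.
Proof.
move=> _ mu h; rewrite /rip /Rintegral.
rewrite (_ : \int[P]_x _ = 0)%E //.
have mu2 : measurable_fun setT (fun w => (u w * u w)%:E).
  by apply/measurable_EFinP; exact: measurable_funM.
under eq_integral => w _ do rewrite -[(_)%:E]gee0_abs ?lee_fin -?expr2 ?sqr_ge0 // expr2.
apply/(ae_eq_integral_abs P measurableT mu2).
by apply: filterS h => w /= -> _; rewrite mulr0.
Qed.

Section Inv.
Variable T : Om -> Om.
Hypotheses (mT : measurable_fun setT T)
  (iT : forall B, measurable B -> P (T @^-1` B) = P B).
Lemma integrable_inv (f : Om -> \bar R) : measurable_fun setT f ->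
  P.-integrable setT f -> P.-integrable setT (f \o T).
Proof.
move=> mf /integrableP[_ fi]; apply/integrableP; split; first exact: measurableT_comp.
have mab : measurable_fun setT (fun w => `|f w|)%E by apply: measurableT_comp.
have h := @ge0_integral_pushforward _ _ _ _ R T mT P setT (fun w => `|f w|)%E measurableT mab.
rewrite preimage_setT in h.
have h2 : (\int[pushforward P T]_y `|f y| = \int[P]_y `|f y|)%E.
  by apply: eq_measure_integral => A mA _; rewrite /pushforward; exact: iT.
by rewrite (_ : (\int[P]_x `|(f \o T) x|)%E = \int[P]_y `|f y|)%E // -h2 h.
Qed.

Lemma Rintegral_inv u : P.-integrable setT (EFin \o u) ->
  \int[P]_w u (T w) = \int[P]_w u w.
Proof.
move=> iu; have mu : measurable_fun setT (EFin \o u) by case/integrableP: iu.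
rewrite /Rintegral; congr fine.
have := @integral_pushforward _ _ _ _ R T mT P setT (EFin \o u) mu.
rewrite preimage_setT => /(_ (integrable_inv mu iu) measurableT) <-.
by apply: eq_measure_integral => A mA _; rewrite /pushforward; exact: iT.
Qed.

Lemma rl2_inv u : rl2 u -> rl2 (fun w => u (T w)).
Proof.
move=> [mu iu]; split; first exact: measurableT_comp.
have := @integrable_inv (EFin \o (fun w => u w ^+ 2)); apply => //.
by case/integrableP: iu.
Qed.
End Inv.

End RealL2.
Lemma quad_disc (R : realFieldType) (A B C : R) : 0 <= A -> 0 <= B ->
  (forall t : R, 0 <= A + 2 * t * C + t ^+ 2 * B) -> C ^+ 2 <= A * B.
Proof.
move=> A0 B0 h; have [B1|B1] := ltrP 0 B.
  have := h (- C / B).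
  have -> : A + 2 * (- C / B) * C + (- C / B) ^+ 2 * B = (A * B - C ^+ 2) / B by field; rewrite gt_eqF.
  by rewrite pmulr_lge0 ?invr_gt0 // subr_ge0.
have B2 : B = 0 by apply/eqP; rewrite eq_le B1.
have [->|C0] := eqVneq C 0; first by rewrite expr0n mulr_ge0.
(* With B = 0 the quadratic is affine in t, and this t gives it the value -1. *)
have := h (- (A + 1) / (2 * C)).
have -> : A + 2 * (- (A + 1) / (2 * C)) * C + (- (A + 1) / (2 * C)) ^+ 2 * B = - 1.
  by rewrite B2; field; rewrite C0.
by rewrite oppr_ge0 ler10.
Qed.

Section Families.
Context (R : realType) (dsp : measure_display) (Om : measurableType dsp)
        (P : probability Om R) (I : finType).
Implicit Types (F G H : I -> Om -> R).
Definition rl2f F := forall i, rl2 P (F i).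
Definition fip F G : R := \sum_i rip P (F i) (G i).
Definition fn F : R := Num.sqrt (fip F F).
Lemma rl2fD F G : rl2f F -> rl2f G -> rl2f (fun i w => F i w + G i w).
Proof. by move=> hF hG i; apply: rl2D. Qed.
Lemma rl2fB F G : rl2f F -> rl2f G -> rl2f (fun i w => F i w - G i w).
Proof. by move=> hF hG i; apply: rl2B. Qed.
Lemma rl2fZ c F : rl2f F -> rl2f (fun i w => c * F i w).
Proof. by move=> hF i; apply: rl2Z. Qed.
Lemma fipC F G : fip F G = fip G F.
Proof. by apply: eq_bigr => i _; exact: ripC. Qed.
Lemma fipDl F G H : rl2f F -> rl2f G -> rl2f H ->
  fip (fun i w => F i w + G i w) H = fip F H + fip G H.
Proof. by move=> hF hG hH; rewrite -big_split; apply: eq_bigr => i _; exact: ripDl. Qed.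
Lemma fipZl c F G : rl2f F -> rl2f G -> fip (fun i w => c * F i w) G = c * fip F G.
Proof. by move=> hF hG; rewrite mulr_sumr; apply: eq_bigr => i _; exact: ripZl. Qed.
Lemma fipDr F G H : rl2f F -> rl2f G -> rl2f H ->
  fip H (fun i w => F i w + G i w) = fip H F + fip H G.
Proof. by move=> hF hG hH; rewrite fipC fipDl // !(fipC H). Qed.
Lemma fipZr c F G : rl2f F -> rl2f G -> fip F (fun i w => c * G i w) = c * fip F G.
Proof. by move=> hF hG; rewrite fipC fipZl // fipC. Qed.
Lemma fip_ge0 F : 0 <= fip F F.
Proof. by apply: sumr_ge0 => i _; exact: rip_ge0. Qed.
Lemma fn_ge0 F : 0 <= fn F. Proof. exact: sqrtr_ge0. Qed.
Lemma fn_sqr F : fn F ^+ 2 = fip F F. Proof. by rewrite sqr_sqrtr ?fip_ge0. Qed.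
Lemma fip_sqD F G : rl2f F -> rl2f G ->
  fip (fun i w => F i w + G i w) (fun i w => F i w + G i w) = fip F F + 2 * fip F G + fip G G.
Proof.
move=> hF hG; have hD := rl2fD hF hG.
by rewrite fipDl // !fipDr // (fipC G F); ring.
Qed.

Lemma fip_CS F G : rl2f F -> rl2f G -> `|fip F G| <= fn F * fn G.
Proof.
move=> hF hG; rewrite -ler_sqr ?nnegrE ?mulr_ge0 ?fn_ge0 //.
rewrite exprMn !fn_sqr real_normK ?num_real //.
apply: quad_disc; rewrite ?fip_ge0 // => t.
have := fip_ge0 (fun i w => F i w + t * G i w).
by rewrite fip_sqD ?fipZr ?fipZl //; try exact: rl2fZ; rewrite expr2 !mulrA.
Qed.

Lemma fnD F G : rl2f F -> rl2f G -> fn (fun i w => F i w + G i w) <= fn F + fn G.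
Proof.
move=> hF hG; rewrite -ler_sqr ?nnegrE ?addr_ge0 ?fn_ge0 //.
rewrite fn_sqr fip_sqD // -(fn_sqr F) -(fn_sqr G).
have := le_trans (ler_norm _) (fip_CS hF hG).
by move: (fip F G) (fn F) (fn G) => u a b; nra.
Qed.

Lemma fnZ c F : rl2f F -> fn (fun i w => c * F i w) = `|c| * fn F.
Proof.
move=> hF; rewrite /fn fipZl ?fipZr //; last exact: rl2fZ.
by rewrite mulrA -expr2 sqrtrM ?sqr_ge0 // sqrtr_sqr.
Qed.

Lemma fnBC F G : rl2f F -> rl2f G -> fn (fun i w => F i w - G i w) = fn (fun i w => G i w - F i w).
Proof.
move=> hF hG; have := fnZ (-1) (rl2fB hF hG); rewrite normrN1 mul1r => <-.
by congr fn; apply/funext => i; apply/funext => w; rewrite mulN1r opprB.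
Qed.

Lemma fn_triB G F H : rl2f F -> rl2f G -> rl2f H ->
  fn (fun i w => F i w - H i w) <= fn (fun i w => F i w - G i w) + fn (fun i w => G i w - H i w).
Proof.
move=> hF hG hH; apply: le_trans (fnD (rl2fB hF hG) (rl2fB hG hH)).
rewrite le_eqVlt; apply/orP; left; apply/eqP; congr fn.
by apply/funext => i; apply/funext => w; rewrite addrA subrK.
Qed.

Lemma fn_leB F G : rl2f F -> rl2f G -> fn F <= fn G + fn (fun i w => F i w - G i w).
Proof.
move=> hF hG; have := fnD hG (rl2fB hF hG).
by have -> : (fun i w => G i w + (F i w - G i w)) = F;
   [apply/funext => i; apply/funext => w; rewrite addrC subrK|].
Qed.

Lemma fn_eq0 F : rl2f F -> fn F = 0 -> {ae P, forall w, forall i, F i w = 0}.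
Proof.
move=> hF h; have h2 : fip F F = 0 by rewrite -fn_sqr h expr0n.
have h3 i : {ae P, forall w, F i w = 0}.
  apply: rip_eq0; first exact: hF.
  by apply: (psumr_eq0P (fun j _ => rip_ge0 P (F j)) h2).
have : \forall w \ae P, forall i, i \in enum I -> F i w = 0.
  elim: (enum I) => [|i s IH]; first by apply: nearW => w i; rewrite inE.
  by apply: filterS2 (h3 i) IH => w h4 h5 j; rewrite inE => /orP[/eqP ->|/h5].
by apply: filterS => w h4 i; apply: h4; rewrite mem_enum.
Qed.

Lemma fn_ae0 F : rl2f F -> {ae P, forall w, forall i, F i w = 0} -> fn F = 0.
Proof.
move=> hF h; rewrite /fn /fip big1 ?sqrtr0 // => i _.
apply: rip_ae0; [by move=> w; exact: sqr_ge0|by case: (hF i)|].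
by apply: filterS h => w; apply.
Qed.
End Families.

Section Complete.
Context (R : realType) (dsp : measure_display) (Om : measurableType dsp)
        (P : probability Om R).
Lemma geo_tail (B r : R) m n : 0 <= B -> 0 <= r -> r < 1 ->
  \sum_(k < n) B * r ^+ (m + k) <= B * r ^+ m / (1 - r).
Proof.
move=> B0 r0 r1; have r2 : 0 < 1 - r by rewrite subr_gt0.
have e : \sum_(k < n) B * r ^+ (m + k) = B * r ^+ m * (1 - r ^+ n) / (1 - r).
  elim: n => [|n IH]; first by rewrite big_ord0 expr0 subrr mulr0 mul0r.
  by rewrite big_ord_recr /= IH exprD exprS; field; rewrite gt_eqF.
rewrite e ler_pM2r ?invr_gt0 // ler_piMr ?mulr_ge0 ?exprn_ge0 //.
by rewrite gerBl exprn_ge0.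
Qed.

(** Riesz-Fischer for geometrically small increments. Monotone convergence makes the sum of the
    absolute increments finite almost everywhere, so the sequence converges there; Fatou transfers
    the geometric rate to the limit. *)
Lemma rl2_complete (u : nat -> Om -> R) (B r : R) : 0 <= B -> 0 <= r -> r < 1 ->
  (forall n, rl2 P (u n)) ->
  (forall n, fn P (fun (_ : 'I_1) w => u n.+1 w - u n w) <= B * r ^+ n) ->
  exists v, rl2 P v /\ forall n, rip P (fun w => u n w - v w) (fun w => u n w - v w) <= (B * r ^+ n / (1 - r)) ^+ 2.
Proof.
move=> B0 r0 r1 hu hd.
pose U n (_ : 'I_1) w := u n w.
have hU n : rl2f P (U n) by move=> i; exact: hu.
have r2 : 0 < 1 - r by rewrite subr_gt0.
have tri m k : fn P (fun i w => U (m + k)%N i w - U m i w) <= B * r ^+ m / (1 - r).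
  apply: le_trans (geo_tail m k B0 r0 r1).
  elim: k => [|k IH].
    rewrite addn0 big_ord0 (_ : (fun i w => _) = fun i w => 0 * U m i w) ?fnZ ?normr0 ?mul0r //.
    by apply/funext => i; apply/funext => w; rewrite subrr mul0r.
  rewrite big_ord_recr /= addnS.
  have h := fn_triB (hU (m + k).+1) (hU (m + k)%N) (hU m).
  apply: le_trans h _.
  by rewrite addrC; apply: lerD => //; exact: hd.
have triR m n : (m <= n)%N -> rip P (fun w => u n w - u m w) (fun w => u n w - u m w) <= (B * r ^+ m / (1 - r)) ^+ 2.
  move=> /subnKC <-; have := tri m (n - m)%N.
  rewrite -ler_sqr ?nnegrE ?fn_ge0 ?divr_ge0 ?mulr_ge0 ?exprn_ge0 ?(ltW r2) //.
  by rewrite fn_sqr /fip big_ord1.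
have mu n := rl2_meas (hu n).
pose g n w : \bar R := (\sum_(k < n) `|u k.+1 w - u k w|)%:E.
have mg n : measurable_fun setT (g n).
  apply/measurable_EFinP; apply: measurable_sum => k.
  by apply: measurableT_comp => //; exact: measurable_funB.
have g0 n w : setT w -> (0 <= g n w)%E by move=> _; rewrite lee_fin sumr_ge0.
have gnd w : setT w -> {homo g^~ w : n m / (n <= m)%N >-> (n <= m)%E}.
  move=> _ n m /subnKC <-; rewrite lee_fin; elim: (m - n)%N => [|k IH]; first by rewrite addn0.
  by apply: le_trans IH _; rewrite addnS big_ord_recr /= lerDl.
have id1 k : P.-integrable setT (EFin \o (fun w => u k.+1 w - u k w)).
  by apply: rl2_integrable; apply: rl2B.
have ig n : (\int[P]_w g n w <= (B / (1 - r))%:E)%E.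
  have e : (\int[P]_w g n w = \sum_(k < n) \int[P]_w `|(u k.+1 w - u k w)%:E|)%E.
    rewrite -ge0_integral_sum //.
    - by apply: eq_integral => w _; rewrite /g -sumEFin.
    - move=> k _; apply: measurableT_comp => //; apply/measurable_EFinP; exact: measurable_funB.
  rewrite e.
  have hk k : (\int[P]_w `|(u k.+1 w - u k w)%:E| <= (B * r ^+ (0 + k))%:E)%E.
    have hdk : rl2 P (fun w => u k.+1 w - u k w) by apply: rl2B.
    have habs : rl2 P (fun w => `|u k.+1 w - u k w|).
      have [m1 i1] := hdk; split; first by apply: measurableT_comp.
      apply: le_integrableR i1; last by move=> w; rewrite ger0_norm ?sqr_ge0 // real_normK ?num_real.
      by apply: measurable_funX; apply: measurableT_comp.
    have -> : (\int[P]_w `|(u k.+1 w - u k w)%:E| = (rip P (fun w => `|u k.+1 w - u k w|) (fun=> 1))%:E)%E.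
      rewrite /rip /Rintegral fineK; last by apply: integrable_fin_num => //; apply: rl2_int => //; exact: rl2_cst.
      by apply: eq_integral => w _; rewrite mulr1.
    rewrite lee_fin add0n; apply: le_trans (hd k).
    have h1 : rl2f P (fun (_ : 'I_1) w => `|u k.+1 w - u k w|) by move=> ?.
    have h2 : rl2f P (fun (_ : 'I_1) (_ : Om) => 1) by move=> ?; exact: rl2_cst.
    have := fip_CS h1 h2; rewrite /fip big_ord1 => /(le_trans (ler_norm _)) h3.
    apply: le_trans h3 _.
    have -> : fn P (fun (_ : 'I_1) (_ : Om) => 1) = 1.
      rewrite /fn /fip big_ord1 /rip mulr1 Rintegral_cst //= probability_setT /= mulr1 sqrtr1 //.
    rewrite mulr1 /fn /fip !big_ord1 /rip.
    by under eq_Rintegral do rewrite -normrM -expr2 ger0_norm ?sqr_ge0 // expr2.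
  apply: (@le_trans _ _ (\sum_(k < n) (B * r ^+ (0 + k))%:E)%E); first by apply: lee_sum.
  by rewrite sumEFin lee_fin; apply: le_trans (geo_tail 0 n B0 r0 r1) _; rewrite expr0 mulr1.
have cI : (\int[P]_w limn (g^~ w) <= (B / (1 - r))%:E)%E.
  rewrite (monotone_convergence _ _ mg) //.
  apply: lime_le; last by apply: nearW.
  apply: ereal_nondecreasing_is_cvgn => m n mn; apply: ge0_le_integral => //; first exact: g0.
  by move=> w _; exact: gnd.
have mlim : measurable_fun setT (fun w => limn (g^~ w)).
  apply: (emeasurable_fun_cvg g) => // w _; apply: ereal_nondecreasing_is_cvgn; exact: gnd.
have glim0 w : (0 <= limn (g^~ w))%E.
  apply: lime_ge; first by apply: ereal_nondecreasing_is_cvgn; exact: gnd.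
  by apply: nearW => n; exact: g0.
have iS : P.-integrable setT (fun w => limn (g^~ w)).
  apply/integrableP; split => //.
  under eq_integral => w _ do rewrite gee0_abs //.
  by apply: le_lt_trans cI _; rewrite ltry.
have aecvg : {ae P, forall w, cvgn (fun n => u n w)}.
  apply: filterS (integrable_ae measurableT iS) => w /(_ I) hw.
  have gle n : (g n w <= limn (g^~ w))%E.
    apply: lime_ge; first by apply: ereal_nondecreasing_is_cvgn; exact: gnd.
    by exists n => // m /= nm; exact: gnd.
  have hb n : \sum_(k < n) `|u k.+1 w - u k w| <= fine (limn (g^~ w)).
    by rewrite -lee_fin fineK //; exact: gle.
  have hc : cvgn [normed series (telescope (fun n => u n w))].
    have e n : [normed series (telescope (fun n => u n w))] n = \sum_(k < n) `|u k.+1 w - u k w|.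
      by rewrite /normed_series_of /series /= big_mkord.
    apply: nondecreasing_is_cvgn.
      by move=> n m nm; rewrite !e -lee_fin; exact: (gnd w I _ _ nm).
    by exists (fine (limn (g^~ w))) => _ [n _ <-]; rewrite e.
  have := normed_cvg hc; rewrite telescopeK => hc2.
  have -> : (fun n => u n w) = (fun n => [sequence u n w - u 0%N w]_n n + u 0%N w).
    by apply/funext => n /=; rewrite subrK.
  by apply: is_cvgD => //; exact: is_cvg_cst.
(* The upper limit is measurable without any convergence assumption and equals the limit wherever
   the latter exists. *)
pose v w := fine (limn_esup (fun n => (u n w)%:E)).
have vE w : cvgn (fun n => u n w) -> (fun n => u n w) @ \oo --> v w.
  move=> hc; have h1 : (fun n => (u n w)%:E) @ \oo --> (limn (fun n => u n w))%:E.
    by apply: cvg_EFin => //; apply: nearW.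
  by rewrite /v (cvg_limn_einf_sup h1).2.
have mv : measurable_fun setT v.
  have mue n : measurable_fun setT (fun w => (u n w)%:E) by exact/measurable_EFinP.
  have h := @measurable_fun_limn_esup _ Om R setT (fun n w => (u n w)%:E) mue.
  by apply: (measurableT_comp (@fine_measurable R setT measurableT) h).
have fat m : (\int[P]_w ((u m w - v w) ^+ 2)%:E <= ((B * r ^+ m / (1 - r)) ^+ 2)%:E)%E.
  pose f n w : \bar R := ((u n w - u m w) ^+ 2)%:E.
  have mf n : measurable_fun setT (f n).
    by apply/measurable_EFinP; apply: measurable_funX; exact: measurable_funB.
  have f0 n w : setT w -> (0 <= f n w)%E by move=> _; rewrite lee_fin sqr_ge0.
  have h1 : (\int[P]_w ((u m w - v w) ^+ 2)%:E = \int[P]_w limn_einf (f^~ w))%E.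
    apply: ge0_ae_eq_integral => //.
    - by apply/measurable_EFinP; apply: measurable_funX; exact: measurable_funB.
    - have -> : (fun w => limn_einf (f^~ w)) = (fun w => - limn_esup (fun n => - f n w))%E.
        apply/funext => w; rewrite -limn_einfN; congr limn_einf.
        by apply/funext => n; rewrite /comp oppeK.
      apply: measurableT_comp => //; apply: measurable_fun_limn_esup => n; exact: measurableT_comp.
    - by move=> w _; rewrite lee_fin sqr_ge0.
    - move=> w _; rewrite limn_einf_lim; apply: lime_ge; first exact: is_cvg_einfs.
      by apply: nearW => n; apply: le_ereal_inf_tmp => _ [k /= _ <-]; exact: f0.
    apply: filterS aecvg => w /vE hw _.
    have h2 : f^~ w @ \oo --> ((v w - u m w) ^+ 2)%:E.
      apply: cvg_EFin; first by apply: nearW.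
      rewrite /f /comp /= expr2; under eq_fun do rewrite expr2.
      by apply: cvgM; apply: cvgB => //; exact: cvg_cst.
    by rewrite (cvg_limn_einf_sup h2).1 -sqrrN opprB.
  rewrite h1; apply: le_trans (fatou P measurableT mf f0) _.
  rewrite limn_einf_lim; apply: lime_le; first exact: is_cvg_einfs.
  apply: nearW => n; apply: (@le_trans _ _ (\int[P]_w f (maxn n m) w)%E).
    by apply: ereal_inf_lbound; exists (maxn n m) => //=; rewrite leq_maxl.
  have := triR m (maxn n m) (leq_maxr n m); rewrite -lee_fin; apply: le_trans.
  rewrite /rip /Rintegral fineK; last by apply: integrable_fin_num => //; apply: rl2_int; apply: rl2B.
  by rewrite le_eqVlt; apply/orP; left; apply/eqP; apply: eq_integral => w _; rewrite /f expr2.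
have hv m : rl2 P (fun w => u m w - v w).
  split; first exact: measurable_funB.
  apply/integrableP; split; first by apply/measurable_EFinP; apply: measurable_funX; exact: measurable_funB.
  under eq_integral => w _ do rewrite /= ger0_norm ?sqr_ge0 //.
  by apply: le_lt_trans (fat m) _; rewrite ltry.
exists v; split.
  have := rl2B (hu 0%N) (hv 0%N).
  by have -> : (fun w => u 0%N w - (u 0%N w - v w)) = v; [apply/funext => w; rewrite subKr|].
move=> m; rewrite /rip /Rintegral -lee_fin fineK.
  by apply: le_trans (fat m); rewrite le_eqVlt; apply/orP; left; apply/eqP; apply: eq_integral => w _; rewrite expr2.
by apply: integrable_fin_num => //; apply: rl2_int.
Qed.
End Complete.

(** * Complex-valued square integrable functions as real pairs *)

Section CplxArith.
Context (R : realType).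
Local Notation C := (complex R).
Implicit Types (x y z : C) (r : R).
Lemma cReD x y : cRe (x + y) = cRe x + cRe y. Proof. by case: x y => [? ?] [? ?]. Qed.
Lemma cImD x y : cIm (x + y) = cIm x + cIm y. Proof. by case: x y => [? ?] [? ?]. Qed.
Lemma cReN x : cRe (- x) = - cRe x. Proof. by case: x. Qed.
Lemma cImN x : cIm (- x) = - cIm x. Proof. by case: x. Qed.
Lemma cReM x y : cRe (x * y) = cRe x * cRe y - cIm x * cIm y. Proof. by case: x y => [? ?] [? ?]. Qed.
Lemma cImM x y : cIm (x * y) = cRe x * cIm y + cIm x * cRe y. Proof. by case: x y => [? ?] [? ?]. Qed.
Lemma cRe0 : cRe (0 : C) = 0. Proof. by []. Qed.
Lemma cIm0 : cIm (0 : C) = 0. Proof. by []. Qed.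
Lemma cRe1 : cRe (1 : C) = 1. Proof. by []. Qed.
Lemma cIm1 : cIm (1 : C) = 0. Proof. by []. Qed.
Lemma cRe_cR r : cRe (cR r) = r. Proof. by []. Qed.
Lemma cIm_cR r : cIm (cR r) = 0. Proof. by []. Qed.
Lemma cRe_conj x : cRe (cconj x) = cRe x. Proof. by []. Qed.
Lemma cIm_conj x : cIm (cconj x) = - cIm x. Proof. by []. Qed.
Lemma cRe_sum (I : Type) (s : seq I) (P : pred I) (F : I -> C) :
  cRe (\sum_(i <- s | P i) F i) = \sum_(i <- s | P i) cRe (F i).
Proof. by apply: (big_morph _ cReD cRe0). Qed.
Lemma cIm_sum (I : Type) (s : seq I) (P : pred I) (F : I -> C) :
  cIm (\sum_(i <- s | P i) F i) = \sum_(i <- s | P i) cIm (F i).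
Proof. by apply: (big_morph _ cImD cIm0). Qed.
Lemma ceq x y : cRe x = cRe y -> cIm x = cIm y -> x = y.
Proof. by case: x y => [? ?] [? ?] /= -> ->. Qed.
Lemma cRD (a b : R) : cR (a + b) = cR a + cR b.
Proof. by apply: ceq; rewrite ?cReD ?cImD /= ?addr0. Qed.
Lemma cRM (a b : R) : cR (a * b) = cR a * cR b.
Proof. by apply: ceq; rewrite ?cReM ?cImM /= ?mulr0 ?mul0r ?subr0 ?addr0. Qed.
Lemma cRN (a : R) : cR (- a) = - cR a.
Proof. by apply: ceq; rewrite ?cReN ?cImN /= ?oppr0. Qed.
Lemma cR1 : cR (1 : R) = 1. Proof. by []. Qed.
Lemma cR0 : cR (0 : R) = 0. Proof. by []. Qed.
(** The real part of x times the conjugate of y. Treating the complex plane as a real one lets all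
    norm inequalities follow from the real theory, at the sole price of [cdot_conj] for complex
    factors. *)
Definition cdot x y : R := cRe x * cRe y + cIm x * cIm y.
Lemma cdotC x y : cdot x y = cdot y x. Proof. by rewrite /cdot mulrC [cIm x * _]mulrC. Qed.
Lemma cdotDl x y z : cdot (x + y) z = cdot x z + cdot y z.
Proof. by rewrite /cdot cReD cImD; ring. Qed.
Lemma cdot_ge0 x : 0 <= cdot x x.
Proof. by rewrite /cdot addr_ge0 // -expr2 sqr_ge0. Qed.
Lemma cdot_conj z x y : cdot (z * x) y = cdot x (cconj z * y).
Proof. by rewrite /cdot !cReM !cImM cRe_conj cIm_conj; ring. Qed.
Lemma cdot_unit z x y : cdot z z = 1 -> cdot (z * x) (z * y) = cdot x y.
Proof.
move=> h; have -> : cdot (z * x) (z * y) = cdot z z * cdot x y.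
  by rewrite /cdot !cReM !cImM; ring.
by rewrite h mul1r.
Qed.

Lemma conj_unit z : cdot z z = 1 -> cconj z * z = 1.
Proof.
by move=> h; apply: ceq; rewrite ?cReM ?cImM cRe_conj cIm_conj ?cRe1 ?cIm1 -?h /cdot; ring.
Qed.

Lemma cdot_sqrD_le x y : cdot (x + y) (x + y) <= 2 * cdot x x + 2 * cdot y y.
Proof.
rewrite /cdot cReD cImD; have := sqr_ge0 (cRe x - cRe y); have := sqr_ge0 (cIm x - cIm y).
rewrite !expr2; nra.
Qed.

Lemma cdotB_le x y : cdot (x - y) (x - y) <= 2 * cdot x x + 2 * cdot y y.
Proof.
by apply: le_trans (cdot_sqrD_le _ _) _; rewrite {2}/cdot cReN cImN !mulrNN.
Qed.

Lemma cmod_sqr x : cmod x ^+ 2 = cdot x x.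
Proof. by rewrite sqr_sqrtr ?addr_ge0 ?sqr_ge0 // !expr2. Qed.
Lemma cmod_ge0 x : 0 <= cmod x. Proof. exact: sqrtr_ge0. Qed.
Lemma cdot_sum_le (d : nat) (F : 'I_d -> C) :
  cdot (\sum_i F i) (\sum_i F i) <= d%:R * \sum_i cdot (F i) (F i).
Proof.
rewrite {1}/cdot !cRe_sum !cIm_sum big_split /= mulrDr lerD //.
  have := expn2_sum (fun i => cRe (F i)); rewrite -expr2.
  by move=> h; apply: le_trans h _; rewrite ler_wpM2l // ler_sum // => i _; rewrite expr2.
have := expn2_sum (fun i => cIm (F i)); rewrite -expr2.
by move=> h; apply: le_trans h _; rewrite ler_wpM2l // ler_sum // => i _; rewrite expr2.
Qed.
End CplxArith.

Section CplxL2.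
Context (R : realType) (dsp : measure_display) (Om : measurableType dsp)
        (P : probability Om R) (d : nat) (tau : Zd d -> int -> Om -> Om).
Local Notation C := (complex R).
Implicit Types (f g h : Om -> C) (F G H : 'I_d -> Om -> C).
Definition sl2 f := rl2 P (fun w => cRe (f w)) /\ rl2 P (fun w => cIm (f w)).
Definition sip f g : R := \int[P]_w cdot (f w) (g w).
Lemma sl2D f g : sl2 f -> sl2 g -> sl2 (fun w => f w + g w).
Proof.
move=> [a b] [a' b']; split; first by under eq_fun do rewrite cReD; exact: rl2D.
by under eq_fun do rewrite cImD; exact: rl2D.
Qed.

Lemma sl2N f : sl2 f -> sl2 (fun w => - f w).
Proof.
move=> [a b]; split; first by under eq_fun do rewrite cReN; exact: rl2N.
by under eq_fun do rewrite cImN; exact: rl2N.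
Qed.

Lemma sl2B f g : sl2 f -> sl2 g -> sl2 (fun w => f w - g w).
Proof. by move=> hf hg; apply: sl2D => //; exact: sl2N. Qed.
Lemma sl2Z c f : sl2 f -> sl2 (fun w => c * f w).
Proof.
move=> [a b]; split.
  by under eq_fun do rewrite cReM; apply: rl2B; exact: rl2Z.
by under eq_fun do rewrite cImM; apply: rl2D; exact: rl2Z.
Qed.

Lemma sl2_cst c : sl2 (fun=> c).
Proof. by split; exact: rl2_cst. Qed.
Lemma sl2_sum (I : Type) (r : seq I) (K : I -> Om -> C) : (forall i, sl2 (K i)) ->
  sl2 (fun w => \sum_(i <- r) K i w).
Proof.
move=> hK; split.
  by under eq_fun do rewrite cRe_sum; apply: rl2_sum => i; case: (hK i).
by under eq_fun do rewrite cIm_sum; apply: rl2_sum => i; case: (hK i).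
Qed.

Lemma sl2_bdd (u : Om -> R) (B : R) f : measurable_fun setT u -> (forall w, `|u w| <= B) ->
  sl2 f -> sl2 (fun w => cR (u w) * f w).
Proof.
move=> mu hu [a b]; split.
  have -> : (fun w => cRe (cR (u w) * f w)) = fun w => u w * cRe (f w).
    by apply/funext => w; rewrite cReM cRe_cR cIm_cR mul0r subr0.
  exact: rl2_bdd mu hu a.
have -> : (fun w => cIm (cR (u w) * f w)) = fun w => u w * cIm (f w).
  by apply/funext => w; rewrite cImM cRe_cR cIm_cR mul0r addr0.
exact: rl2_bdd mu hu b.
Qed.

Lemma sip_int f g : sl2 f -> sl2 g -> P.-integrable setT (EFin \o (fun w => cdot (f w) (g w))).
Proof.
move=> [a b] [a' b'].
exact: (integrableD measurableT (rl2_int a a') (rl2_int b b')).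
Qed.

Lemma sipE f g : sl2 f -> sl2 g ->
  sip f g = rip P (fun w => cRe (f w)) (fun w => cRe (g w)) + rip P (fun w => cIm (f w)) (fun w => cIm (g w)).
Proof. by move=> [a b] [a' b']; rewrite -RintegralD //; exact: rl2_int. Qed.
Lemma sipC f g : sip f g = sip g f.
Proof. by apply: eq_Rintegral => w _; rewrite cdotC. Qed.
Lemma sipDl f g h : sl2 f -> sl2 g -> sl2 h -> sip (fun w => f w + g w) h = sip f h + sip g h.
Proof.
move=> hf hg hh; rewrite -RintegralD //; try exact: sip_int.
by apply: eq_Rintegral => w _; rewrite cdotDl.
Qed.

Lemma sipDr f g h : sl2 f -> sl2 g -> sl2 h -> sip h (fun w => f w + g w) = sip h f + sip h g.
Proof. by move=> hf hg hh; rewrite sipC sipDl // !(sipC h). Qed.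
Lemma sip_conj z f g : sip (fun w => z * f w) g = sip f (fun w => cconj z * g w).
Proof. by apply: eq_Rintegral => w _; rewrite cdot_conj. Qed.
Lemma sipRl (r : R) f g : sl2 f -> sl2 g -> sip (fun w => cR r * f w) g = r * sip f g.
Proof.
move=> hf hg; rewrite -RintegralZl //; last exact: sip_int.
by apply: eq_Rintegral => w _; rewrite /cdot cReM cImM cRe_cR cIm_cR; ring.
Qed.

Lemma sipRr (r : R) f g : sl2 f -> sl2 g -> sip f (fun w => cR r * g w) = r * sip f g.
Proof. by move=> hf hg; rewrite sipC sipRl // sipC. Qed.
Lemma sip_ge0 f : 0 <= sip f f.
Proof. by apply: Rintegral_ge0 => w _; exact: cdot_ge0. Qed.
Lemma sipNl f g : sl2 f -> sl2 g -> sip (fun w => - f w) g = - sip f g.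
Proof.
move=> hf hg; have := sipRl (-1) hf hg; rewrite mulN1r => <-.
by apply: eq_Rintegral => w _; rewrite cRN cR1 mulN1r.
Qed.

Lemma sip_sqB f g : sl2 f -> sl2 g ->
  sip (fun w => f w - g w) (fun w => f w - g w) = sip f f - 2 * sip f g + sip g g.
Proof.
move=> hf hg; have hN := sl2N hg; have hB := sl2B hf hg.
rewrite sipDl // !sipDr // !sipNl // !(sipC _ (fun w => - g w)) !sipNl // (sipC g f); ring.
Qed.

(* Complex families as real ones: the index set is doubled. *)
Definition rc (J : finType) (K : J -> Om -> C) (p : J * bool) (w : Om) : R :=
  if p.2 then cRe (K p.1 w) else cIm (K p.1 w).
Lemma rc_l2 (J : finType) (K : J -> Om -> C) : (forall j, sl2 (K j)) -> rl2f P (rc K).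
Proof. by move=> h [j [|]]; case: (h j). Qed.
Lemma fip_rc (J : finType) (K K' : J -> Om -> C) : (forall j, sl2 (K j)) -> (forall j, sl2 (K' j)) ->
  fip P (rc K) (rc K') = \sum_j sip (K j) (K' j).
Proof.
move=> h h'; rewrite /fip.
rewrite -(pair_bigA _ (fun j b => rip P (rc K (j, b)) (rc K' (j, b)))) /=.
by apply: eq_bigr => j _; rewrite sipE // big_bool.
Qed.

Definition sn f : R := Num.sqrt (sip f f).
Definition vip F G : R := \sum_i sip (F i) (G i).
Definition vn F : R := Num.sqrt (vip F F).
Definition vl2 F := forall i, sl2 (F i).
Lemma sn_ge0 f : 0 <= sn f. Proof. exact: sqrtr_ge0. Qed.
Lemma vn_ge0 F : 0 <= vn F. Proof. exact: sqrtr_ge0. Qed.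
Lemma sn_sqr f : sn f ^+ 2 = sip f f. Proof. by rewrite sqr_sqrtr ?sip_ge0. Qed.
Lemma vip_ge0 F : 0 <= vip F F. Proof. by apply: sumr_ge0 => i _; exact: sip_ge0. Qed.
Lemma vn_sqr F : vn F ^+ 2 = vip F F. Proof. by rewrite sqr_sqrtr ?vip_ge0. Qed.
Lemma vn_fn F : vl2 F -> vn F = fn P (rc F).
Proof. by move=> h; rewrite /vn /fn fip_rc. Qed.
Lemma sn_fn f : sl2 f -> sn f = fn P (rc (fun _ : 'I_1 => f)).
Proof. by move=> h; rewrite /sn /fn fip_rc // big_ord1. Qed.
Lemma rcD (J : finType) (K K' : J -> Om -> C) :
  rc (fun j w => K j w + K' j w) = fun p w => rc K p w + rc K' p w.
Proof. by apply/funext => -[j [|]]; apply/funext => w; rewrite /rc /= ?cReD ?cImD. Qed.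
Lemma rcB (J : finType) (K K' : J -> Om -> C) :
  rc (fun j w => K j w - K' j w) = fun p w => rc K p w - rc K' p w.
Proof. by apply/funext => -[j [|]]; apply/funext => w; rewrite /rc /= ?cReD ?cImD ?cReN ?cImN. Qed.
Lemma snD f g : sl2 f -> sl2 g -> sn (fun w => f w + g w) <= sn f + sn g.
Proof.
move=> hf hg; rewrite !sn_fn //; last exact: sl2D.
by rewrite (rcD (fun _ : 'I_1 => f) (fun _ : 'I_1 => g)); apply: fnD; exact: rc_l2.
Qed.

Lemma vnD F G : vl2 F -> vl2 G -> vn (fun i w => F i w + G i w) <= vn F + vn G.
Proof.
move=> hF hG; rewrite !vn_fn //; last by move=> i; exact: sl2D.
by rewrite rcD; apply: fnD; exact: rc_l2.
Qed.

Lemma vn_leB F G : vl2 F -> vl2 G -> vn F <= vn G + vn (fun i w => F i w - G i w).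
Proof.
move=> hF hG; rewrite !vn_fn //; last by move=> i; exact: sl2B.
by rewrite rcB; apply: fn_leB; exact: rc_l2.
Qed.

Lemma vnBC F G : vl2 F -> vl2 G -> vn (fun i w => F i w - G i w) = vn (fun i w => G i w - F i w).
Proof.
move=> hF hG; rewrite !vn_fn; try by move=> i; exact: sl2B.
by rewrite !rcB; apply: fnBC; exact: rc_l2.
Qed.

Lemma snBC f g : sl2 f -> sl2 g -> sn (fun w => f w - g w) = sn (fun w => g w - f w).
Proof.
move=> hf hg; rewrite !sn_fn; try exact: sl2B.
by rewrite !(rcB (fun _ : 'I_1 => _) (fun _ : 'I_1 => _)); apply: fnBC; exact: rc_l2.
Qed.

Lemma sn_leB f g : sl2 f -> sl2 g -> sn f <= sn g + sn (fun w => f w - g w).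
Proof.
move=> hf hg; rewrite !sn_fn //; last exact: sl2B.
by rewrite (rcB (fun _ : 'I_1 => f) (fun _ : 'I_1 => g)); apply: fn_leB; exact: rc_l2.
Qed.

Lemma sip_CS f g : sl2 f -> sl2 g -> `|sip f g| <= sn f * sn g.
Proof.
move=> hf hg; rewrite !sn_fn //; apply: le_trans (fip_CS (rc_l2 _) (rc_l2 _)) => //.
by rewrite fip_rc // big_ord1.
Qed.

Lemma vip_CS F G : vl2 F -> vl2 G -> `|vip F G| <= vn F * vn G.
Proof. by move=> hF hG; rewrite !vn_fn // /vip -fip_rc //; apply: fip_CS; exact: rc_l2. Qed.
Lemma sn_eq0 f : sl2 f -> sn f = 0 -> {ae P, forall w, f w = 0}.
Proof.
move=> hf; rewrite sn_fn // => h; have := fn_eq0 (rc_l2 (fun _ => hf)) h.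
apply: filterS => w h2; apply: ceq; first exact: (h2 (ord0, true)).
exact: (h2 (ord0, false)).
Qed.

Lemma sn_ae0 f : sl2 f -> {ae P, forall w, f w = 0} -> sn f = 0.
Proof.
move=> hf h; rewrite sn_fn //; apply: fn_ae0; first exact: rc_l2.
by apply: filterS h => w h2 [j [|]]; rewrite /rc /= h2.
Qed.

Lemma vn_eq0 F : vl2 F -> vn F = 0 -> {ae P, forall w i, F i w = 0}.
Proof.
move=> hF; rewrite vn_fn // => h; have := fn_eq0 (rc_l2 hF) h.
apply: filterS => w h2 i; apply: ceq; first exact: (h2 (i, true)).
exact: (h2 (i, false)).
Qed.

Lemma vn_ae0 F : vl2 F -> {ae P, forall w i, F i w = 0} -> vn F = 0.
Proof.
move=> hF h; rewrite vn_fn //; apply: fn_ae0; first exact: rc_l2.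
by apply: filterS h => w h2 [j [|]]; rewrite /rc /= h2.
Qed.

Lemma snR (r : R) f : sl2 f -> sn (fun w => cR r * f w) = `|r| * sn f.
Proof.
move=> hf; rewrite /sn sipRl ?sipRr //; last exact: sl2Z.
by rewrite mulrA -expr2 sqrtrM ?sqr_ge0 // sqrtr_sqr.
Qed.

Definition pim f : Om -> C := fun w => f w - cexpect P f.
Lemma sl2_pim f : sl2 f -> sl2 (pim f).
Proof. by move=> hf; apply: sl2B => //; exact: sl2_cst. Qed.
Lemma cexpectD f g : sl2 f -> sl2 g -> cexpect P (fun w => f w + g w) = cexpect P f + cexpect P g.
Proof.
move=> [a b] [a' b']; apply: ceq; rewrite ?cReD ?cImD /cexpect /=.
  by rewrite -RintegralD //; try exact: rl2_integrable; apply: eq_Rintegral => w _; rewrite cReD.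
by rewrite -RintegralD //; try exact: rl2_integrable; apply: eq_Rintegral => w _; rewrite cImD.
Qed.

Lemma cexpect_cst c : cexpect P (fun=> c) = c.
Proof.
by apply: ceq; rewrite /cexpect /= Rintegral_cst //= probability_setT /= mulr1.
Qed.

Lemma cexpectZ c f : sl2 f -> cexpect P (fun w => c * f w) = c * cexpect P f.
Proof.
move=> [[a1 a2] [b1 b2]]; have a := rl2_integrable (conj a1 a2); have b := rl2_integrable (conj b1 b2).
apply: ceq; rewrite ?cReM ?cImM /cexpect /=.
  rewrite -!RintegralZl // -RintegralB //; try (by apply: rl2_integrable; apply: rl2Z).
  by apply: eq_Rintegral => w _; rewrite cReM.
rewrite -!RintegralZl // -RintegralD //; try (by apply: rl2_integrable; apply: rl2Z).
by apply: eq_Rintegral => w _; rewrite cImM.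
Qed.

Lemma cexpectN f : sl2 f -> cexpect P (fun w => - f w) = - cexpect P f.
Proof.
move=> hf; have := cexpectZ (-1) hf; rewrite mulN1r => <-.
by congr cexpect; apply/funext => w; rewrite mulN1r.
Qed.

Lemma cexpectB f g : sl2 f -> sl2 g -> cexpect P (fun w => f w - g w) = cexpect P f - cexpect P g.
Proof. by move=> hf hg; rewrite cexpectD ?cexpectN //; exact: sl2N. Qed.
Lemma cexpect_pim f : sl2 f -> cexpect P (pim f) = 0.
Proof. by move=> hf; rewrite cexpectB ?cexpect_cst ?subrr //; exact: sl2_cst. Qed.
Lemma sip_cstr f c : sl2 f -> sip f (fun=> c) = cdot (cexpect P f) c.
Proof.
move=> [[a1 a2] [b1 b2]]; have a := rl2_integrable (conj a1 a2); have b := rl2_integrable (conj b1 b2).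
rewrite /sip /cdot /cexpect /= -!RintegralZr // -RintegralD //.
  by have := rl2_integrable (rl2Z (cRe c) (conj a1 a2)); under eq_fun do rewrite mulrC.
by have := rl2_integrable (rl2Z (cIm c) (conj b1 b2)); under eq_fun do rewrite mulrC.
Qed.

Lemma sip_pim f : sl2 f -> sip f f = sip (pim f) (pim f) + cdot (cexpect P f) (cexpect P f).
Proof.
move=> hf; have hc := sl2_cst (cexpect P f).
rewrite /pim sip_sqB // !sip_cstr // cexpect_cst; ring.
Qed.

Lemma sn_pim f : sl2 f -> sn (pim f) <= sn f.
Proof. by move=> hf; rewrite ler_sqrt ?sip_ge0 // [leRHS]sip_pim // lerDl cdot_ge0. Qed.
Lemma cexpect_le f : sl2 f -> cmod (cexpect P f) <= sn f.
Proof.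
move=> hf; rewrite -ler_sqr ?nnegrE ?cmod_ge0 ?sn_ge0 // cmod_sqr sn_sqr sip_pim //.
by rewrite lerDr sip_ge0.
Qed.

Lemma pimB f g : sl2 f -> sl2 g -> pim (fun w => f w - g w) = fun w => pim f w - pim g w.
Proof.
move=> hf hg; apply/funext => w; rewrite /pim cexpectB //; ring.
Qed.
End CplxL2.
(** * Twisted derivatives and resolvents *)

Section Ops.
Context (R : realType) (dsp : measure_display) (Om : measurableType dsp)
        (P : probability Om R) (d : nat) (tau : Zd d -> int -> Om -> Om).
Local Notation C := (complex R).
Implicit Types (f g h phi : Om -> C) (F G H : 'I_d -> Om -> C) (z : 'I_d -> C) (a : Om -> 'M[R]_d).
Definition flow : Prop :=
  (forall w, tau 0 0 w = w) /\
  (forall x y s t w, tau (x + y) (s + t) w = tau x s (tau y t w)) /\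
  (forall x s, measurable_fun setT (tau x s) /\
     forall B, measurable B -> P (tau x s @^-1` B) = P B).
Hypothesis fl : flow.
Lemma tauNK x s w : tau (- x) (- s) (tau x s w) = w.
Proof. by case: fl => [h0 [hD _]]; rewrite -hD !addNr. Qed.
Lemma tau_add x y s t w : tau x s (tau y t w) = tau (x + y) (s + t) w.
Proof. by case: fl => [_ [-> _]]. Qed.
Lemma tau_meas x s : measurable_fun setT (tau x s).
Proof. by case: fl => [_ [_ h]]; case: (h x s). Qed.
Lemma tau_inv x s B : measurable B -> P (tau x s @^-1` B) = P B.
Proof. by case: fl => [_ [_ h]]; case: (h x s) => _; exact. Qed.
Lemma sl2_sh x s f : sl2 P f -> sl2 P (fun w => f (tau x s w)).
Proof.
move=> [a b]; split.
  exact: (rl2_inv (tau_meas x s) (@tau_inv x s) a).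
exact: (rl2_inv (tau_meas x s) (@tau_inv x s) b).
Qed.

Lemma sip_sh x s f g : sl2 P f -> sl2 P g ->
  sip P (fun w => f (tau x s w)) (fun w => g (tau x s w)) = sip P f g.
Proof.
move=> hf hg; exact: (Rintegral_inv (tau_meas x s) (@tau_inv x s) (sip_int hf hg)).
Qed.

Lemma sn_sh x s f : sl2 P f -> sn P (fun w => f (tau x s w)) = sn P f.
Proof. by move=> hf; rewrite /sn sip_sh. Qed.
Lemma cexpect_sh x s f : sl2 P f -> cexpect P (fun w => f (tau x s w)) = cexpect P f.
Proof.
move=> [a b]; apply: ceq.
  exact: (Rintegral_inv (tau_meas x s) (@tau_inv x s) (rl2_integrable a)).
exact: (Rintegral_inv (tau_meas x s) (@tau_inv x s) (rl2_integrable b)).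
Qed.

(* The twisted derivatives of the paper, with [z j] standing for exp(-i e_j.xi). *)
Definition dd z (j : 'I_d) f : Om -> C := fun w => z j * f (tau (evec j) 0 w) - f w.
Definition dds z (j : 'I_d) f : Om -> C := fun w => cconj (z j) * f (tau (- evec j) 0 w) - f w.
Definition dv z F : Om -> C := fun w => \sum_j dds z j (F j) w.
Definition am a F (i : 'I_d) : Om -> C := fun w => \sum_j cR (a w i j) * F j w.
Lemma sl2_dd z j f : sl2 P f -> sl2 P (dd z j f).
Proof. by move=> hf; apply: sl2B => //; apply: sl2Z; exact: sl2_sh. Qed.
Lemma sl2_dds z j f : sl2 P f -> sl2 P (dds z j f).
Proof. by move=> hf; apply: sl2B => //; apply: sl2Z; exact: sl2_sh. Qed.
Lemma sl2_dv z F : vl2 P F -> sl2 P (dv z F).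
Proof. by move=> hF; apply: (sl2_sum _ (K := fun j => dds z j (F j))) => i; apply: sl2_dds. Qed.
Lemma ddB z j f g : dd z j (fun w => f w - g w) = fun w => dd z j f w - dd z j g w.
Proof. by apply/funext => w; rewrite /dd; ring. Qed.
Lemma ddsB z j f g : dds z j (fun w => f w - g w) = fun w => dds z j f w - dds z j g w.
Proof. by apply/funext => w; rewrite /dds; ring. Qed.
Lemma dvB z F G : dv z (fun i w => F i w - G i w) = fun w => dv z F w - dv z G w.
Proof. by apply/funext => w; rewrite /dv -sumrB; apply: eq_bigr => i _; rewrite ddsB. Qed.
Lemma amB a F G : am a (fun i w => F i w - G i w) = fun i w => am a F i w - am a G i w.
Proof.
apply/funext => i; apply/funext => w; rewrite /am -sumrB; apply: eq_bigr => j _.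
by rewrite mulrBr.
Qed.

Lemma Rint_eq0 (u : Om -> R) : (forall w, u w = 0) -> \int[P]_w u w = 0.
Proof.
move=> h; rewrite (_ : u = fun=> 0); last by apply/funext.
by rewrite Rintegral_cst // mul0r.
Qed.

Lemma sip_dd z j f g : sl2 P f -> sl2 P g -> sip P (dd z j f) g = sip P f (dds z j g).
Proof.
move=> hf hg.
have hzf : sl2 P (fun w => z j * f (tau (evec j) 0 w)) by apply: sl2Z; exact: sl2_sh.
have hzg : sl2 P (fun w => cconj (z j) * g (tau (- evec j) 0 w)) by apply: sl2Z; exact: sl2_sh.
have hN k : sl2 P k -> sl2 P (fun w => - k w) by exact: sl2N.
rewrite /dd /dds sipDl //; last exact: hN.
rewrite sipDr //; last exact: hN.
rewrite sipNl // (sipC _ f (fun w => - g w)) sipNl // (sipC _ g f); congr (_ - _).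
rewrite sip_conj -(sip_sh (evec j) 0 hf hzg); apply: eq_Rintegral => w _.
by rewrite tau_add addNr add0r; case: fl => [-> _].
Qed.

Lemma vip_dd z f F : sl2 P f -> vl2 P F -> vip P (dd z ^~ f) F = sip P f (dv z F).
Proof.
move=> hf hF; rewrite /vip.
have -> : sip P f (dv z F) = \sum_j sip P f (dds z j (F j)).
  rewrite /dv; elim: (index_enum _) => [|j s IH].
    by rewrite big_nil; apply: Rint_eq0 => w; rewrite big_nil /cdot cRe0 cIm0 !mulr0 addr0.
  rewrite big_cons -IH -sipDr //.
  - by congr sip; apply/funext => w; rewrite big_cons.
  - exact: sl2_dds.
  - by apply: (sl2_sum _ (K := fun j => dds z j (F j))) => i; apply: sl2_dds.
by apply: eq_bigr => j _; exact: sip_dd.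
Qed.

Section Unit.
Context (z : 'I_d -> C) (hz : forall j, cdot (z j) (z j) = 1).
Let hzc j : cdot (cconj (z j)) (cconj (z j)) = 1.
Proof. by rewrite -(hz j) /cdot cRe_conj cIm_conj; ring. Qed.
Lemma sip_unit_le c x s f : cdot c c = 1 -> sl2 P f ->
  sip P (fun w => c * f (tau x s w) - f w) (fun w => c * f (tau x s w) - f w) <= 4 * sip P f f.
Proof.
move=> hc hf; have hs := sl2_sh x s hf; have hzs := sl2Z c hs.
have e : sip P (fun w => c * f (tau x s w)) (fun w => c * f (tau x s w)) = sip P f f.
  by rewrite -(sip_sh x s hf hf); apply: eq_Rintegral => w _; rewrite cdot_unit.
have := ler_norm (- sip P (fun w => c * f (tau x s w)) f); rewrite normrN => h1.
have := le_trans h1 (sip_CS hzs hf).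
rewrite sip_sqB // e /sn e -expr2 sqr_sqrtr ?sip_ge0 //; lra.
Qed.

Lemma dd_le j f : sl2 P f -> sip P (dd z j f) (dd z j f) <= 4 * sip P f f.
Proof. exact: sip_unit_le. Qed.
Lemma dds_le j f : sl2 P f -> sip P (dds z j f) (dds z j f) <= 4 * sip P f f.
Proof. exact: sip_unit_le. Qed.
Lemma sip_sum (F G : 'I_d -> Om -> C) : vl2 P F -> vl2 P G ->
  P.-integrable setT (EFin \o (fun w => \sum_i cdot (F i w) (G i w))) /\
  vip P F G = \int[P]_w (\sum_i cdot (F i w) (G i w)).
Proof.
move=> hF hG; rewrite /vip; elim: (index_enum _) => [|j s [IH1 IH2]].
  split.
    apply: (eq_integrable measurableT (EFin \o (fun=> 0))).
      by move=> w _; rewrite /= big_nil.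
    exact: finite_measure_integrable_cst.
  by rewrite big_nil; symmetry; apply: Rint_eq0 => w; rewrite big_nil.
have h1 := sip_int (hF j) (hG j).
split.
  apply: eq_integrable (integrableD measurableT h1 IH1) => // w _.
  by rewrite /= big_cons.
rewrite big_cons IH2 /sip -RintegralD //.
by apply: eq_Rintegral => w _; rewrite big_cons.
Qed.

(** Each twisted difference has norm at most 2 because its phase is unimodular, and the sum over d
    directions costs a factor d. The resulting 4 d is the one in 4 d Lam <= 1. *)
Lemma dv_le F : vl2 P F -> sip P (dv z F) (dv z F) <= 4 * d%:R * vip P F F.
Proof.
move=> hF; have hds : vl2 P (fun j => dds z j (F j)) by move=> j; exact: sl2_dds.
have [h1 h2] := sip_sum hds hds.
apply: (@le_trans _ _ (d%:R * vip P (fun j => dds z j (F j)) (fun j => dds z j (F j)))).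
  rewrite h2 -RintegralZl //; apply: le_Rintegral => //.
  - by apply: sip_int; exact: sl2_dv.
  - by apply: eq_integrable (integrableZl measurableT d%:R h1) => // w _.
  - by move=> w _; exact: cdot_sum_le.
rewrite -mulrA mulrCA ler_wpM2l ?ler0n // /vip mulr_sumr; apply: ler_sum => j _.
exact: dds_le.
Qed.
End Unit.

(** For symmetric nonnegative a, [coef_up] is the upper bound a <= Lam in the form a^2 <= Lam a,
    which controls the flux by the energy itself. *)
Record coef (lam Lam : R) a : Prop := Coef {
  coef_meas : forall i j, measurable_fun setT (fun w => a w i j);
  coef_bdd : exists B, forall w i j, `|a w i j| <= B;
  coef_sym : forall w, (a w)^T = a w;
  coef_lo : forall w v, lam * sqn v <= dotv v (mulv (a w) v);
  coef_up : forall w v, sqn (mulv (a w) v) <= Lam * dotv v (mulv (a w) v) }.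
Section Coefficients.
Context (lam Lam : R) (a : Om -> 'M[R]_d) (ha : coef lam Lam a).
Lemma vl2_am F : vl2 P F -> vl2 P (am a F).
Proof.
move=> hF i; apply: (sl2_sum _ (K := fun j w => cR (a w i j) * F j w)) => j.
have [B hB] := coef_bdd ha; apply: (sl2_bdd (coef_meas ha i j) (B := B)) => // w; exact: hB.
Qed.

Lemma dot_am F G w : \sum_i cdot (am a F i w) (G i w) =
  dotv (mulv (a w) (fun i => cRe (F i w))) (fun i => cRe (G i w)) +
  dotv (mulv (a w) (fun i => cIm (F i w))) (fun i => cIm (G i w)).
Proof.
rewrite /dotv -big_split; apply: eq_bigr => i _ /=; rewrite /cdot /am cRe_sum cIm_sum /mulv.
by congr (_ * _ + _ * _); apply: eq_bigr => j _; rewrite ?cReM ?cImM cRe_cR cIm_cR; ring.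
Qed.

Lemma vip_am_sym F G : vl2 P F -> vl2 P G -> vip P (am a F) G = vip P F (am a G).
Proof.
move=> hF hG; have hF' := vl2_am hF; have hG' := vl2_am hG.
rewrite (sip_sum hF' hG).2 (sip_sum hF hG').2; apply: eq_Rintegral => w _.
rewrite dot_am; under [RHS]eq_bigr do rewrite cdotC.
rewrite dot_am -{1 2}(coef_sym ha w) !mulvT.
by congr (_ + _); exact: dotvC.
Qed.

Lemma am_lo F : vl2 P F -> lam * vip P F F <= vip P F (am a F).
Proof.
move=> hF; have hF' := vl2_am hF.
rewrite (sip_sum hF hF').2 (sip_sum hF hF).2 -RintegralZl //; last exact: (sip_sum hF hF).1.
apply: le_Rintegral => //.
- apply: eq_integrable (integrableZl measurableT lam (sip_sum hF hF).1) => //.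
- exact: (sip_sum hF hF').1.
move=> w _; under [leRHS]eq_bigr do rewrite cdotC.
rewrite dot_am !(dotvC (mulv _ _)).
have := coef_lo ha w (fun i => cRe (F i w)); have := coef_lo ha w (fun i => cIm (F i w)).
rewrite /cdot big_split /= mulrDr => h1 h2; apply: lerD.
  by move: h2; congr (_ <= _); congr (_ * _); apply: eq_bigr => i _; rewrite expr2.
by move: h1; congr (_ <= _); congr (_ * _); apply: eq_bigr => i _; rewrite expr2.
Qed.

Lemma am_up F : vl2 P F -> vip P (am a F) (am a F) <= Lam * vip P F (am a F).
Proof.
move=> hF; have hF' := vl2_am hF.
rewrite (sip_sum hF hF').2 (sip_sum hF' hF').2 -RintegralZl //; last exact: (sip_sum hF hF').1.
apply: le_Rintegral => //.
- exact: (sip_sum hF' hF').1.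
- apply: eq_integrable (integrableZl measurableT Lam (sip_sum hF hF').1) => //.
move=> w _; under [in leRHS]eq_bigr do rewrite cdotC.
rewrite !dot_am !(dotvC (mulv _ _)).
have h1 := coef_up ha w (fun i => cRe (F i w)); have h2 := coef_up ha w (fun i => cIm (F i w)).
rewrite mulrDr; apply: lerD.
  apply: le_trans h1; rewrite le_eqVlt; apply/orP; left; apply/eqP.
  apply: eq_bigr => i _; rewrite expr2 /am cRe_sum; congr (_ * _).
  by apply: eq_bigr => j _; rewrite cReM cRe_cR cIm_cR mul0r subr0.
apply: le_trans h2; rewrite le_eqVlt; apply/orP; left; apply/eqP.
apply: eq_bigr => i _; rewrite expr2 /am cIm_sum; congr (_ * _).
by apply: eq_bigr => j _; rewrite cImM cRe_cR cIm_cR mul0r addr0.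
Qed.
End Coefficients.

End Ops.
Section Evolution.
Context (R : realType) (dsp : measure_display) (Om : measurableType dsp)
        (P : probability Om R) (d : nat) (tau : Zd d -> int -> Om -> Om).
Local Notation C := (complex R).
Hypothesis fl : flow P tau.
Context (z : 'I_d -> C) (hz : forall j, cdot (z j) (z j) = 1).
Context (lam Lam : R) (a : Om -> 'M[R]_d) (ha : coef lam Lam a).
Hypothesis Lam4 : 4 * d%:R * Lam <= 1.
Hypothesis Lam0 : 0 < Lam.
Implicit Types (f g h phi : Om -> C) (F G H : 'I_d -> Om -> C).
Local Notation grad f := (fun i => dd tau z i f).
(* With [G = e_k] and a projection this is the right-hand side of the corrector equation;
   with [a = Lam] and [G = -g] it is the one of the recursion that sums [T_{xi,eta} g]. *)
Definition yop G phi : Om -> C :=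
  fun w => phi w - dv tau z (am a (fun i w => dd tau z i phi w + G i w)) w.
Lemma vl2_grad phi : sl2 P phi -> vl2 P (grad phi).
Proof. by move=> h i; apply: sl2_dd. Qed.
Lemma vl2D F G : vl2 P F -> vl2 P G -> vl2 P (fun i w => F i w + G i w).
Proof. by move=> hF hG i; apply: sl2D. Qed.
Lemma vl2B F G : vl2 P F -> vl2 P G -> vl2 P (fun i w => F i w - G i w).
Proof. by move=> hF hG i; apply: sl2B. Qed.
Lemma sl2_yop G phi : vl2 P G -> sl2 P phi -> sl2 P (yop G phi).
Proof.
move=> hG hp; apply: sl2B => //; apply: sl2_dv => //; apply: (vl2_am ha).
by apply: vl2D => //; exact: vl2_grad.
Qed.

Lemma yopB G H phi psi w : yop G phi w - yop H psi w =
  yop (fun i w => G i w - H i w) (fun w => phi w - psi w) w.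
Proof.
rewrite /yop.
have -> : (fun i w => dd tau z i (fun w0 => phi w0 - psi w0) w + (G i w - H i w)) =
   (fun i w => (dd tau z i phi w + G i w) - (dd tau z i psi w + H i w)).
  by apply/funext => i; apply/funext => v; rewrite ddB; ring.
rewrite amB dvB; ring.
Qed.

Lemma vipDl F G H : vl2 P F -> vl2 P G -> vl2 P H ->
  vip P (fun i w => F i w + G i w) H = vip P F H + vip P G H.
Proof. by move=> hF hG hH; rewrite -big_split; apply: eq_bigr => i _; rewrite sipDl. Qed.
Lemma snN f : sl2 P f -> sn P (fun w => - f w) = sn P f.
Proof.
move=> hf; have hN := sl2N hf.
by rewrite /sn sipNl // (sipC P f) sipNl // opprK.
Qed.

Lemma snB f g : sl2 P f -> sl2 P g -> sn P (fun w => f w - g w) <= sn P f + sn P g.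
Proof. by move=> hf hg; rewrite -(snN hg); apply: snD => //; exact: sl2N. Qed.
Lemma vipC F G : vip P F G = vip P G F.
Proof. by apply: eq_bigr => i _; rewrite sipC. Qed.
Lemma amD F G : am a (fun i w => F i w + G i w) = fun i w => am a F i w + am a G i w.
Proof.
apply/funext => i; apply/funext => w; rewrite /am -big_split; apply: eq_bigr => j _ /=.
by rewrite mulrDr.
Qed.

(* The explicit scheme is dissipative because the quadratic term |div F|^2 is at most
   4d Lam <F, grad phi + g>, which is absorbed by half of the cross term. *)
Lemma yop_le G phi : vl2 P G -> sl2 P phi ->
  sip P (yop G phi) (yop G phi) <=
  sip P phi phi - vip P (grad phi) (am a (grad phi)) + vip P G (am a G).
Proof.
move=> hG hp; have hg := vl2_grad hp.
set V := fun i w => dd tau z i phi w + G i w; set F := am a V.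
have hV : vl2 P V by apply: vl2D.
have hF : vl2 P F := vl2_am ha hV.
have hdF : sl2 P (dv tau z F) by exact: sl2_dv.
rewrite /yop -/V -/F sip_sqB // -(vip_dd fl) //.
have h1 := dv_le fl hz hF.
have h2 := am_up ha hV; rewrite -/F in h2.
have e1 : vip P V F = vip P (grad phi) F + vip P G F by rewrite vipDl.
have ha1 := vl2_am ha hg; have ha2 := vl2_am ha hG.
have eF H : vl2 P H -> vip P H F = vip P H (am a (grad phi)) + vip P H (am a G).
  by move=> hH; rewrite vipC /F /V amD vipDl // !(vipC H).
have e2 : vip P (grad phi) (am a G) = vip P G (am a (grad phi)).
  by rewrite -(vip_am_sym ha) // vipC.
have h3 : 4 * d%:R * vip P F F <= vip P V F.
  have h4 : 4 * d%:R * vip P F F <= 4 * d%:R * (Lam * vip P V F).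
    by rewrite ler_wpM2l // mulr_ge0 // ler0n.
  apply: le_trans h4 _; rewrite mulrA ler_piMl //.
  by have := vip_ge0 P F; move=> h5; move: (le_trans h5 h2); rewrite pmulr_rge0.
move: h1 h3; rewrite e1 !eF // e2.
move: (4 * d%:R * _) (vip P (grad phi) (am a (grad phi))) (vip P G (am a (grad phi))) (vip P G (am a G))
  (sip P phi phi) (sip P _ _) => m x1 x2 x3 s1 s2; lra.
Qed.

(** A switch between the two equations to be solved: the corrector equation carries the projection
    on mean-zero functions, the resolvent equation behind T does not. *)
Definition cproj (b : bool) f := if b then pim P f else f.
Lemma sl2_proj b f : sl2 P f -> sl2 P (cproj b f).
Proof. by case: b => //= h; exact: sl2_pim. Qed.
Lemma sn_proj b f : sl2 P f -> sn P (cproj b f) <= sn P f.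
Proof. by case: b => //= h; exact: sn_pim. Qed.
Lemma projB b f g : sl2 P f -> sl2 P g -> cproj b (fun w => f w - g w) = fun w => cproj b f w - cproj b g w.
Proof. by case: b => //= hf hg; exact: pimB. Qed.
(** As [tau] preserves the measure, E phi(tau) has norm E |phi|. Comparing squares with [yop_le]
    yields gradient control together with the mass term E^2 - 1. The residual r is there for the
    comparison of two correctors. *)
Lemma energy_res b (E : R) G phi r : vl2 P G -> sl2 P phi -> sl2 P r -> 0 <= E ->
  sn P (fun w => cR E * phi (tau 0 1 w) - r w - cproj b (yop G phi) w) = 0 ->
  vip P (grad phi) (am a (grad phi)) + (E ^+ 2 - 1) * sip P phi phi
    <= vip P G (am a G) + 2 * E * sn P phi * sn P r.
Proof.
move=> hG hp hr E0 h.
have hy := sl2_yop hG hp; have hpy := sl2_proj b hy.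
have hs := sl2_sh fl 0 1 hp; have hu : sl2 P (fun w => cR E * phi (tau 0 1 w)) by exact: sl2Z.
have hur := sl2B hu hr.
have h1 : sn P (fun w => cR E * phi (tau 0 1 w) - r w) <= sn P (yop G phi).
  apply: le_trans (sn_leB hur hpy) _; rewrite h addr0; exact: sn_proj.
have h2 : sip P (fun w => cR E * phi (tau 0 1 w) - r w) (fun w => cR E * phi (tau 0 1 w) - r w)
   <= sip P (yop G phi) (yop G phi).
  by rewrite -!sn_sqr lerXn2r ?nnegrE ?sn_ge0.
have := le_trans h2 (yop_le hG hp).
have e1 : sn P (fun w => cR E * phi (tau 0 1 w)) = E * sn P phi.
  by rewrite (snR E hs) ger0_norm // (sn_sh fl 0 1 hp).
rewrite sip_sqB // -(sn_sqr P (fun w => cR E * phi (tau 0 1 w))) e1 exprMn sn_sqr.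
have h3 := le_trans (ler_norm _) (sip_CS hu hr); rewrite e1 in h3.
have := sip_ge0 P r; move: h3; lra.
Qed.

(** The equation E phi(tau_{0,1}) = y(phi) is solved for its left-hand side by shifting back in
    time, which makes it a fixed-point equation with contraction factor 1/E. *)
Definition stepf b (E : R) G phi : Om -> C :=
  fun w => cR E^-1 * cproj b (yop G phi) (tau 0 (-1) w).
Lemma sl2_stepf b E G phi : vl2 P G -> sl2 P phi -> sl2 P (stepf b E G phi).
Proof.
move=> hG hp; apply: sl2Z; apply: (sl2_sh fl 0 (-1)); apply: sl2_proj; exact: sl2_yop.
Qed.
Hypothesis lam0 : 0 <= lam.
Lemma sn_yop0 phi : sl2 P phi -> sn P (yop (fun _ _ => 0) phi) <= sn P phi.
Proof.
move=> hp; rewrite ler_sqrt ?sip_ge0 //.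
have hz0 : vl2 P (fun (_ : 'I_d) (_ : Om) => 0 : C) by move=> i; exact: sl2_cst.
apply: le_trans (yop_le hz0 hp) _.
have h1 := am_lo ha (vl2_grad hp).
have h2 : 0 <= lam * vip P (grad phi) (grad phi) by rewrite mulr_ge0 // vip_ge0.
have -> : vip P (fun=> (fun=> 0 : C)) (am a (fun=> (fun=> 0 : C))) = 0.
  rewrite /vip big1 // => i _; apply: Rint_eq0 => w.
  by rewrite /cdot cRe0 cIm0 !mul0r addr0.
lra.
Qed.

Lemma stepf_contr b E G phi psi : 0 < E -> vl2 P G -> sl2 P phi -> sl2 P psi ->
  sn P (fun w => stepf b E G phi w - stepf b E G psi w) <= E^-1 * sn P (fun w => phi w - psi w).
Proof.
move=> E0 hG hp hq.
have h1 := sl2_yop hG hp; have h2 := sl2_yop hG hq; have hB := sl2B hp hq.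
have h12 := sl2B h1 h2; have hP := sl2_proj b h12.
have -> : (fun w => stepf b E G phi w - stepf b E G psi w) =
  fun w => cR E^-1 * cproj b (fun w => yop G phi w - yop G psi w) (tau 0 (-1) w).
  by apply/funext => w; rewrite projB // /stepf mulrBr.
rewrite snR; last exact: (sl2_sh fl 0 (-1)).
have Ei : 0 <= E^-1 by rewrite invr_ge0 ltW.
rewrite ger0_norm // ler_wpM2l //.
rewrite (sn_sh fl 0 (-1)) //; apply: le_trans (sn_proj b h12) _.
have -> : (fun w => yop G phi w - yop G psi w) = yop (fun _ _ => 0) (fun w => phi w - psi w).
  apply/funext => w; rewrite yopB; congr (yop _ _ w).
  by apply/funext => i; apply/funext => v; rewrite subrr.
exact: sn_yop0.
Qed.

Definition soln b (E : R) G phi := sl2 P phi /\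
  sn P (fun w => cR E * phi (tau 0 1 w) - cproj b (yop G phi) w) = 0.
Lemma soln_stepf b (E : R) G phi : 0 < E -> vl2 P G -> sl2 P phi ->
  sn P (fun w => phi w - stepf b E G phi w) = 0 -> soln b E G phi.
Proof.
move=> E0 hG hp h; split=> //.
have hy := sl2_proj b (sl2_yop hG hp).
have hs := sl2_stepf b E hG hp; have hB := sl2B hp hs.
have -> : (fun w => cR E * phi (tau 0 1 w) - cproj b (yop G phi) w) =
   (fun w => cR E * (phi (tau 0 1 w) - stepf b E G phi (tau 0 1 w))).
  apply/funext => w; rewrite mulrBr /stepf mulrA -cRM mulfV ?gt_eqF // cR1 mul1r.
  have -> : tau 0 (-1) (tau 0 1 w) = w by have := tauNK fl 0 1 w; rewrite oppr0.
  by [].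
by rewrite (snR E (sl2_sh fl 0 1 hB)) (sn_sh fl 0 1 hB) h mulr0.
Qed.

(** Banach iteration from 0. The iterates and their rate are part of the conclusion because for
    constant coefficients the iterates are the partial sums of the series defining T. *)
Lemma soln_ex b (E : R) G : 1 < E -> vl2 P G ->
  exists phi, soln b E G phi /\
   exists B, forall n, sn P (fun w => iter n (stepf b E G) (fun=> 0) w - phi w) <= B * E^-1 ^+ n.
Proof.
move=> E1 hG; have E0 : 0 < E by apply: lt_trans E1.
have r0 : 0 <= E^-1 by rewrite invr_ge0 ltW.
have r1 : E^-1 < 1 by rewrite invf_lt1.
pose u n := iter n (stepf b E G) (fun=> 0).
have uE n : iter n (stepf b E G) (fun=> 0) = u n by [].
have uS n : u n.+1 = stepf b E G (u n) by [].
have hu n : sl2 P (u n).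
  elim: n => [|n IH]; first exact: sl2_cst.
  by rewrite uS; exact: sl2_stepf.
clearbody u.
pose B := sn P (fun w => u 1 w - u 0 w).
have B0 : 0 <= B by exact: sn_ge0.
have inc n : sn P (fun w => u n.+1 w - u n w) <= B * E^-1 ^+ n.
  elim: n => [|n IH]; first by rewrite expr0 mulr1.
  have := stepf_contr b E0 hG (hu n.+1) (hu n); rewrite -!uS => hh; apply: le_trans hh _.
  by rewrite exprS mulrCA ler_wpM2l.
have le1 n (v : C -> R) : v = @cRe R \/ v = @cIm R ->
   fn P (fun (_ : 'I_1) w => v (u n.+1 w) - v (u n w)) <= sn P (fun w => u n.+1 w - u n w).
  move=> hv; rewrite /fn /sn ler_sqrt ?sip_ge0 // /fip big_ord1.
  have hD := sl2B (hu n.+1) (hu n); rewrite sipE //.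
  move: (u n.+1) (u n) hv {hD} => x y hv.
  have e1 : (fun w => cRe (x w - y w)) = fun w => cRe (x w) - cRe (y w).
    by apply/funext => w; rewrite cReD cReN.
  have e2 : (fun w => cIm (x w - y w)) = fun w => cIm (x w) - cIm (y w).
    by apply/funext => w; rewrite cImD cImN.
  rewrite e1 e2; case: hv => ->; rewrite ?lerDl ?lerDr; exact: rip_ge0.
have [v1 [hv1 c1]] := rl2_complete B0 r0 r1 (fun n => (hu n).1) (fun n => le_trans (le1 n _ (or_introl erefl)) (inc n)).
have [v2 [hv2 c2]] := rl2_complete B0 r0 r1 (fun n => (hu n).2) (fun n => le_trans (le1 n _ (or_intror erefl)) (inc n)).
pose phi w : C := Complex (v1 w) (v2 w).
have hp : sl2 P phi by split.
pose B' := 2 * (B / (1 - E^-1)).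
have hB' : 0 <= B / (1 - E^-1) by rewrite divr_ge0 // subr_ge0 ltW.
have cv n : sn P (fun w => u n w - phi w) <= B' * E^-1 ^+ n.
  have p0 : 0 <= E^-1 ^+ n by rewrite exprn_ge0.
  have B'0 : 0 <= B' * E^-1 ^+ n by rewrite mulr_ge0 // mulr_ge0.
  rewrite -ler_sqr ?nnegrE ?sn_ge0 // sn_sqr sipE; last 2 first.
  - exact: sl2B.
  - exact: sl2B.
  have e1 : (fun w => cRe (u n w - phi w)) = fun w => cRe (u n w) - v1 w.
    by apply/funext => w; rewrite cReD cReN.
  have e2 : (fun w => cIm (u n w - phi w)) = fun w => cIm (u n w) - v2 w.
    by apply/funext => w; rewrite cImD cImN.
  rewrite e1 e2; have := lerD (c1 n) (c2 n).
  rewrite /B' mulrAC; move: (B / (1 - E^-1)) (E^-1 ^+ n) hB' p0 => x y x0 y0.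
  rewrite -(mulrA 2); have := mulr_ge0 x0 y0; move: (x * y) => s s0; rewrite exprMn !expr2; nra.
exists phi; split; last by exists B' => n; rewrite uE.
apply: soln_stepf => //.
have hS := sl2_stepf b E hG hp.
apply/eqP; rewrite eq_le sn_ge0 andbT; apply/ler_addgt0Pr => e e0; rewrite add0r.
have bd n : sn P (fun w => phi w - stepf b E G phi w) <= 2 * B' * E^-1 ^+ n.
  have hn1 := hu n.+1.
  apply: le_trans (_ : sn P (fun w => phi w - u n.+1 w) + sn P (fun w => u n.+1 w - stepf b E G phi w) <= _).
    apply: le_trans (snD (sl2B hp hn1) (sl2B hn1 hS)).
    rewrite le_eqVlt; apply/orP; left; apply/eqP; congr sn; apply/funext => w; ring.
  rewrite (snBC hp hn1); have h1 := cv n.+1; have h2 := stepf_contr b E0 hG (hu n) hp.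
  have h3 : E^-1 * sn P (fun w => u n w - phi w) <= sn P (fun w => u n w - phi w).
    by rewrite ler_piMl ?sn_ge0 // ltW.
  have h4 : B' * E^-1 ^+ n.+1 <= B' * E^-1 ^+ n.
    have B'00 : 0 <= B' by exact: mulr_ge0.
    apply: ler_wpM2l => //; rewrite exprS; apply: ler_piMl; [exact: exprn_ge0|exact: ltW].
  have h5 := cv n; rewrite -uS in h2; rewrite uS -?uS -mulrA; move: h1 h2 h3 h4 h5.
  by clear; move: (sn P _) (sn P _) (sn P _) (B' * _) (B' * _) => x y t p q; lra.
have : (fun n => 2 * B' * E^-1 ^+ n) @ \oo --> (2 * B' * 0 : R).
  by apply: cvgZr; apply: cvg_expr; rewrite ger0_norm.
rewrite mulr0 => /cvgrPdist_lt /(_ e e0) [N _ /(_ N (leqnn N))] /=.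
rewrite sub0r normrN => h; apply: le_trans (bd N) _; apply: le_trans (ler_norm _) _.
exact: ltW.
Qed.

(** The difference solves the equation with zero source, and the energy inequality then gives (E^2 -
    1) |phi - psi|^2 <= 0. *)
Lemma soln_uniq b (E : R) G phi psi : 1 < E -> vl2 P G -> soln b E G phi -> soln b E G psi ->
  sn P (fun w => phi w - psi w) = 0.
Proof.
move=> E1 hG [hp h] [hq h']; have E0 : 0 < E by apply: lt_trans E1.
have hB := sl2B hp hq; have hz0 : vl2 P (fun (_ : 'I_d) (_ : Om) => 0 : C) by move=> i; exact: sl2_cst.
have hy := sl2_yop hG hp; have hy' := sl2_yop hG hq.
have hPy := sl2_proj b hy; have hPy' := sl2_proj b hy'.
have hs := sl2Z (cR E) (sl2_sh fl 0 1 hp); have hs' := sl2Z (cR E) (sl2_sh fl 0 1 hq).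
have := @energy_res b E (fun _ _ => 0) (fun w => phi w - psi w) (fun=> 0) hz0 hB (sl2_cst _ _) (ltW E0).
have -> : (fun w => cR E * (phi (tau 0 1 w) - psi (tau 0 1 w)) - 0 - cproj b (yop (fun _ _ => 0) (fun w => phi w - psi w)) w)
  = fun w => (cR E * phi (tau 0 1 w) - cproj b (yop G phi) w) - (cR E * psi (tau 0 1 w) - cproj b (yop G psi) w).
  have -> : yop (fun _ _ => 0) (fun w => phi w - psi w) = fun w => yop G phi w - yop G psi w.
    apply/funext => w; rewrite yopB; congr (yop _ _ w).
    by apply/funext => i; apply/funext => v; rewrite subrr.
  by apply/funext => w; rewrite projB //; ring.
have -> : sn P (fun=> (0 : C)) = 0 by apply: sn_ae0; [exact: sl2_cst|exact: aeW].
have -> : vip P (fun=> (fun=> 0 : C)) (am a (fun=> (fun=> 0 : C))) = 0.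
  rewrite /vip big1 // => i _; apply: Rint_eq0 => w.
  by rewrite /cdot cRe0 cIm0 !mul0r addr0.
rewrite mulr0 addr0 => e.
have {}e : vip P (grad (fun w => phi w - psi w)) (am a (grad (fun w => phi w - psi w))) +
  (E ^+ 2 - 1) * sip P (fun w => phi w - psi w) (fun w => phi w - psi w) <= 0.
  apply: e; apply/eqP; rewrite eq_le sn_ge0 andbT.
  have hA := sl2B hs hPy; have hA' := sl2B hs' hPy'.
  by apply: le_trans (snB hA hA') _; rewrite h h' addr0.
have h1 := am_lo ha (vl2_grad hB).
have h2 : 0 <= lam * vip P (grad (fun w => phi w - psi w)) (grad (fun w => phi w - psi w)) by rewrite mulr_ge0 // vip_ge0.
have h3 := le_trans h2 h1.
have e2 : (E ^+ 2 - 1) * sip P (fun w => phi w - psi w) (fun w => phi w - psi w) <= 0.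
  by apply: le_trans e; rewrite lerDr.
have e3 : 0 < E ^+ 2 - 1 by rewrite subr_gt0 exprn_egt1 //.
move: e2; rewrite pmulr_rle0 // => e4.
by rewrite /sn; apply/eqP; rewrite sqrtr_eq0.
Qed.
End Evolution.

(** * Correctors *)

Section HilbertNorm.
Context (R : realType) (dsp : measure_display) (Om : measurableType dsp)
        (P : probability Om R).
Local Notation C := (complex R).
Lemma mnorm_sqr m n (M : 'M[C]_(m, n)) : mnorm M ^+ 2 = \sum_i \sum_j cdot (M i j) (M i j).
Proof.
rewrite sqr_sqrtr; last by apply: sumr_ge0 => i _; apply: sumr_ge0 => j _; exact: sqr_ge0.
by apply: eq_bigr => i _; apply: eq_bigr => j _; rewrite cmod_sqr.
Qed.

Lemma mnorm_ge0 m n (M : 'M[C]_(m, n)) : 0 <= mnorm M.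
Proof. exact: sqrtr_ge0. Qed.
Lemma int_sum (I : Type) (s : seq I) (F : I -> Om -> R) :
  (forall i, P.-integrable setT (EFin \o F i)) ->
  P.-integrable setT (EFin \o (fun w => \sum_(i <- s) F i w)).
Proof.
move=> h; elim: s => [|i s IH].
  apply: (eq_integrable measurableT (EFin \o (fun=> 0))).
    by move=> w _; rewrite /= big_nil.
  exact: finite_measure_integrable_cst.
apply: eq_integrable (integrableD measurableT (h i) IH) => // w _.
by rewrite /= big_cons.
Qed.

Lemma ae_forall (I : finType) (Q : I -> Om -> Prop) :
  (forall i, {ae P, forall w, Q i w}) -> {ae P, forall w, forall i, Q i w}.
Proof. by move=> h; apply: filter_forall. Qed.
Lemma L2E m n (psi : Om -> 'M[C]_(m, n)) :
  L2 P psi <-> forall i j, sl2 P (fun w => psi w i j).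
Proof.
have eM : (fun w => mnorm (psi w) ^+ 2) = fun w => \sum_i \sum_j cdot (psi w i j) (psi w i j).
  by apply/funext => w; rewrite mnorm_sqr.
split=> [[mp ip] i j|h].
  have iM : P.-integrable setT (EFin \o (fun w => mnorm (psi w) ^+ 2)).
    apply/integrableP; split.
      apply/measurable_EFinP; rewrite eM; apply: measurable_sum => k; apply: measurable_sum => l.
      have [h1 h2] := mp k l.
      by apply: measurable_funD; apply: measurable_funM.
    rewrite (eq_integral (fun w => (mnorm (psi w) ^+ 2)%:E)) // => w _ /=.
    by rewrite ger0_norm ?sqr_ge0.
  have bd w : cdot (psi w i j) (psi w i j) <= mnorm (psi w) ^+ 2.
    rewrite mnorm_sqr (bigD1 i) //= (bigD1 j) //= -addrA lerDl.
    rewrite addr_ge0 //; first by apply: sumr_ge0 => k _; exact: cdot_ge0.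
    by apply: sumr_ge0 => k _; apply: sumr_ge0 => l _; exact: cdot_ge0.
  have [h1 h2] := mp i j.
  split; (split; first by []); apply: le_integrableR iM; try exact: measurable_funX;
    move=> w; rewrite ger0_norm ?sqr_ge0 //; apply: le_trans (bd w);
    by rewrite /cdot -!expr2 ?lerDl ?lerDr sqr_ge0.
split=> [i j|].
  by have [[h1 _] [h2 _]] := h i j.
have iM : P.-integrable setT (EFin \o (fun w => mnorm (psi w) ^+ 2)).
  by rewrite eM; apply: int_sum => i; apply: int_sum => j; exact: sip_int.
move/integrableP: iM => [_]; congr (_ < _)%E; apply: eq_integral => w _ /=.
by rewrite ger0_norm ?sqr_ge0.
Qed.

Lemma hnormE d (psi : Om -> 'cV[C]_d) : L2 P psi -> hnorm P psi = vn P (fun i w => psi w i ord0).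
Proof.
move=> /L2E h; have hv : vl2 P (fun i w => psi w i ord0) by move=> i; exact: h.
rewrite /hnorm /vn (sip_sum hv hv).2; congr (Num.sqrt _).
rewrite -[LHS]/(\int[P]_w (mnorm (psi w) ^+ 2)).
by apply: eq_Rintegral => w _; rewrite mnorm_sqr; apply: eq_bigr => i _; rewrite big_ord1.
Qed.
End HilbertNorm.

Section Characters.
Context (R : realType) (d : nat).
Local Notation C := (complex R).
Definition zz (xi : 'rV[R]_d) (j : 'I_d) : C := cexp (- 'i%C * cR (xi ord0 j)).
Lemma cexpD (x y : C) : cexp (x + y) = cexp x * cexp y.
Proof.
by apply: ceq; rewrite ?cReM ?cImM /cexp /= cReD cImD expRD ?cosD ?sinD; ring.
Qed.

Lemma cexp0 : cexp (0 : C) = 1.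
Proof. by apply: ceq; rewrite /= expR0 ?cos0 ?sin0; ring. Qed.
Lemma cexp_conj (x : C) : cexp (cconj x) = cconj (cexp x).
Proof. by apply: ceq; rewrite /= ?cosN ?sinN ?mulrN. Qed.
Lemma cexp_unit (x : C) : cRe x = 0 -> cdot (cexp x) (cexp x) = 1.
Proof.
move=> h; rewrite /cdot /= h expR0 !mul1r -!expr2; exact: cos2Dsin2.
Qed.

Lemma cRe_iM (r : R) : cRe (- 'i%C * cR r) = 0.
Proof. by rewrite cReM /=; ring. Qed.
Lemma zz_unit xi j : cdot (zz xi j) (zz xi j) = 1.
Proof. by apply: cexp_unit; rewrite cRe_iM. Qed.
Lemma zz_conj (xi : 'rV[R]_d) j : cexp ('i%C * cR (xi ord0 j)) = cconj (zz xi j).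
Proof.
rewrite -cexp_conj; congr cexp.
by apply: ceq; rewrite ?cRe_conj ?cIm_conj ?cReM ?cImM /=; ring.
Qed.

Lemma cexp_cR (r : R) : cexp (cR r) = cR (expR r).
Proof. by apply: ceq; rewrite /= ?cos0 ?sin0; ring. Qed.
End Characters.

Section Environment.
Context (R : realType) (dsp : measure_display) (Om : measurableType dsp)
        (P : probability Om R) (d : nat) (tau : Zd d -> int -> Om -> Om)
        (A : Om -> 'M[R]_d) (lam Lam : R).
Local Notation C := (complex R).
Hypothesis hE : Env P tau A lam Lam.
Hypothesis Lam4 : 4 * d%:R * Lam <= 1.
Lemma env_flow : flow P tau.
Proof. by case: hE => [_ [_ [h1 [h2 [h3 _]]]]]. Qed.
Lemma env_lam0 : 0 < lam. Proof. by case: hE. Qed.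
Lemma env_lamLam : lam <= Lam. Proof. by case: hE => [_ []]. Qed.
Lemma env_Lam0 : 0 < Lam. Proof. by case: hE => [h1 [h2 _]]; apply: lt_le_trans h2. Qed.
Lemma quad_dotv (M : 'M[R]_d) (v : 'I_d -> R) :
  ((\row_i v i) *m M *m (\row_i v i)^T) ord0 ord0 = dotv v (mulv M v).
Proof.
rewrite -mulmxA !mxE; apply: eq_bigr => i _; rewrite !mxE; congr (_ * _).
by apply: eq_bigr => j _; rewrite !mxE.
Qed.

Lemma sqn_row (v : 'I_d -> R) : ((\row_i v i) *m (\row_i v i)^T) ord0 ord0 = sqn v.
Proof. by rewrite !mxE; apply: eq_bigr => i _; rewrite !mxE expr2. Qed.
Lemma dotv_mulv_sqrB (M : 'M[R]_d) (v w : 'I_d -> R) (s : R) : M^T = M ->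
  dotv (fun i => v i - s * w i) (mulv M (fun i => v i - s * w i)) =
  dotv v (mulv M v) - 2 * s * dotv w (mulv M v) + s ^+ 2 * dotv w (mulv M w).
Proof.
move=> hM.
have e : dotv v (mulv M w) = dotv w (mulv M v) by rewrite -mulvT hM dotvC.
have eM : mulv M (fun i => v i - s * w i) = fun i => mulv M v i - s * mulv M w i.
  apply/funext => i; rewrite /mulv mulr_sumr -sumrB; apply: eq_bigr => j _; ring.
have -> : dotv v (mulv M v) - 2 * s * dotv w (mulv M v) + s ^+ 2 * dotv w (mulv M w) =
  dotv v (mulv M v) - s * dotv w (mulv M v) - s * dotv v (mulv M w) + s ^+ 2 * dotv w (mulv M w).
  by rewrite e; ring.
rewrite eM /dotv !mulr_sumr -!sumrB -big_split; apply: eq_bigr => i _ /=; ring.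
Qed.

Lemma env_form w v : lam * sqn v <= dotv v (mulv (A w) v) <= Lam * sqn v.
Proof.
case: hE => [_ [_ [_ [_ [_ [_ h]]]]]]; have [_ /(_ (\row_i v i))] := h w.
by rewrite quad_dotv sqn_row => -[-> ->].
Qed.

Lemma env_sym w : (A w)^T = A w.
Proof. by case: hE => [_ [_ [_ [_ [_ [_ h]]]]]]; case: (h w). Qed.
Lemma env_meas i j : measurable_fun setT (fun w => A w i j).
Proof. by case: hE => [_ [_ [_ [_ [_ [h _]]]]]]; exact: h. Qed.
(** Test the nonnegativity of the form on v - Av/Lam and its upper bound on Av: 0 <= v.Av - 2
    |Av|^2/Lam + (Av.A(Av))/Lam^2 <= v.Av - |Av|^2/Lam. *)
Lemma env_up w v : sqn (mulv (A w) v) <= Lam * dotv v (mulv (A w) v).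
Proof.
have L0 := env_Lam0.
have /andP[h1 _] := env_form w (fun i => v i - Lam^-1 * mulv (A w) v i).
have /andP[_ h2] := env_form w (mulv (A w) v).
have h0 : 0 <= lam * sqn (fun i => v i - Lam^-1 * mulv (A w) v i).
  by rewrite mulr_ge0 ?sqn_ge0 // (ltW env_lam0).
have := le_trans h0 h1; rewrite dotv_mulv_sqrB ?env_sym // dotv_sqn.
move: h2; move: (dotv _ _) (dotv _ _) (sqn _) => x y s h2 h3.
have h4 : Lam^-1 ^+ 2 * y <= Lam^-1 * s.
  apply: le_trans (_ : Lam^-1 ^+ 2 * (Lam * s) <= _); first by rewrite ler_wpM2l // sqr_ge0.
  by rewrite expr2 -mulrA mulKf ?gt_eqF.
have h5 : Lam^-1 * s <= x by lra.
by move: h5; rewrite mulrC ler_pdivrMr // mulrC.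
Qed.

Lemma env_bdd w i j : `|A w i j| <= Lam.
Proof.
have L0 := env_Lam0; pose v (k : 'I_d) : R := (k == j)%:R.
have sv : sqn v = 1.
  rewrite /sqn (bigD1 j) //= big1 ?addr0 => [|k /negPf hk]; rewrite /v ?eqxx ?expr1n //.
  by rewrite hk expr0n.
have av k : mulv (A w) v k = A w k j.
  rewrite /mulv (bigD1 j) //= big1 ?addr0 => [|l /negPf hl]; rewrite /v ?eqxx ?mulr1 //.
  by rewrite hl mulr0.
have h1 : A w i j ^+ 2 <= sqn (mulv (A w) v).
  by rewrite /sqn (bigD1 i) //= av lerDl sumr_ge0 // => k _; exact: sqr_ge0.
have /andP[_] := env_form w v; rewrite sv mulr1 => h2.
rewrite -ler_sqr ?nnegrE ?(ltW L0) // real_normK ?num_real //.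
apply: le_trans h1 _; apply: le_trans (env_up w v) _.
by rewrite expr2 ler_wpM2l // ltW.
Qed.

Lemma env_coef : coef lam Lam A.
Proof.
split; [exact: env_meas|by exists Lam; exact: env_bdd|exact: env_sym| |exact: env_up].
by move=> w v; case/andP: (env_form w v).
Qed.

Lemma mulv_scalar (c : R) v : mulv (c%:M : 'M[R]_d) v = fun i => c * v i.
Proof.
apply/funext => i; rewrite /mulv (bigD1 i) //= big1 ?addr0 => [|j /negPf hj]; rewrite mxE ?eqxx //.
by rewrite eq_sym hj mul0r.
Qed.

Lemma cst_coef : coef Lam Lam (fun _ : Om => Lam%:M : 'M[R]_d).
Proof.
have L0 := env_Lam0; split=> [i j||w|w v|w v].
- exact: measurable_cst.
- by exists Lam => w i j; rewrite mxE; case: eqP => _; rewrite ?mulr0n ?normr0 ?(ltW L0) // ger0_norm // ltW.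
- by rewrite tr_scalar_mx.
- by rewrite mulv_scalar /sqn /dotv mulr_sumr ler_sum // => i _; rewrite expr2 mulrCA.
- rewrite mulv_scalar /sqn /dotv mulr_sumr ler_sum // => i _.
  by rewrite le_eqVlt; apply/orP; left; apply/eqP; ring.
Qed.

Definition ek (k i : 'I_d) (_ : Om) : C := (i == k)%:R.
Lemma vl2_ek k : vl2 P (ek k). Proof. by move=> i; exact: sl2_cst. Qed.
Lemma am_ek k : am A (ek k) = fun i w => cR (A w i k).
Proof.
apply/funext => i; apply/funext => w; rewrite /am (bigD1 k) //= big1 ?addr0 => [|j /negPf hj].
  by rewrite /ek eqxx mulr1.
by rewrite /ek hj mulr0.
Qed.

Lemma cexpect_eq0 f : sl2 P f -> sn P f = 0 -> cexpect P f = 0.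
Proof.
move=> hf h; have := cexpect_le hf; rewrite h => h1.
have h2 : cmod (cexpect P f) ^+ 2 = 0.
  by rewrite (_ : cmod _ = 0) ?expr0n //; apply/eqP; rewrite eq_le h1 cmod_ge0.
move: h2; rewrite cmod_sqr /cdot -!expr2 => /eqP.
rewrite paddr_eq0 ?sqr_ge0 // !sqrf_eq0 => /andP[/eqP a /eqP b].
by apply: ceq.
Qed.

Section Corrector.
Context (xi : 'rV[R]_d) (eta : R) (eta0 : 0 < eta).
Local Notation z := (zz xi).
Local Notation E := (expR eta).
Let E1 : 1 < E. Proof. by rewrite expR_gt1. Qed.
Let fl := env_flow.
Definition corr k (phi : Om -> C) :=
  soln P tau z A true E (ek k) phi /\ cexpect P phi = 0.
(** In [soln] with [true] the projection acts on phi too, whereas the corrector equation leaves phi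
    unprojected. The two forms differ exactly by the mean of phi, which is shown to vanish in either
    case. *)
Lemma corr_defect k phi : sl2 P phi ->
  (fun w => cR E * phi (tau 0 1 w) - cproj P true (yop tau z A (ek k) phi) w) =
  (fun w => (cR E * phi (tau 0 1 w) - phi w + pim P (dv tau z (am A (fun i => dd tau z i phi))) w
     + pim P (dv tau z (am A (ek k))) w) + cexpect P phi).
Proof.
move=> hp; have hg := vl2_grad fl z hp; have hk := vl2_ek k.
have h1 := sl2_dv fl z (vl2_am env_coef hg); have h2 := sl2_dv fl z (vl2_am env_coef hk).
have -> : yop tau z A (ek k) phi = fun w => (phi w - dv tau z (am A (fun i => dd tau z i phi)) w)
    - dv tau z (am A (ek k)) w.
  apply/funext => w; rewrite /yop amD.
  have e F G : dv tau z (fun i w => F i w + G i w) w = dv tau z F w + dv tau z G w.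
    by rewrite /dv -big_split; apply: eq_bigr => i _; rewrite /dds /=; ring.
  rewrite e; ring.
rewrite /cproj !pimB //; last exact: sl2B.
apply/funext => w; rewrite {1}/pim; ring.
Qed.

Lemma corr_mean k phi : soln P tau z A true E (ek k) phi -> cexpect P phi = 0.
Proof.
move=> [hp h]; have hy := sl2_yop fl z env_coef (vl2_ek k) hp.
have hs := sl2_sh fl 0 1 hp; have hu := sl2Z (cR E) hs.
have := cexpect_eq0 (sl2B hu (sl2_proj true hy)) h.
rewrite cexpectB //; last exact: (sl2_proj true).
rewrite cexpectZ // (cexpect_sh fl 0 1) // cexpect_pim // subr0 => /eqP.
rewrite mulf_eq0 => /orP[/eqP e|/eqP //].
by have := congr1 (@cRe R) e => /= /eqP; rewrite gt_eqF // expR_gt0.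
Qed.

Lemma corr_ex k : exists phi, corr k phi.
Proof.
have [phi [h _]] := soln_ex fl (zz_unit xi) env_coef Lam4 env_Lam0 (ltW env_lam0) true E1 (vl2_ek k).
by exists phi; split => //; exact: corr_mean h.
Qed.

Lemma div_entry (Ph : Om -> 'rV[C]_d) k :
  (fun w => divstar tau xi (fun w' => Ac A w' *m dPhi tau xi Ph w') w ord0 k) =
  dv tau z (am A (fun i => dd tau z i (fun w => Ph w ord0 k))).
Proof.
apply/funext => w; rewrite mxE; apply: eq_bigr => j _; rewrite /dxistar /dds zz_conj.
by congr (_ * _ - _); rewrite mxE; apply: eq_bigr => l _; rewrite !mxE.
Qed.

Lemma div_entry0 k :
  (fun w => divstar tau xi (Ac A) w ord0 k) = dv tau z (am A (ek k)).
Proof.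
apply/funext => w; rewrite mxE am_ek; apply: eq_bigr => j _; rewrite /dxistar /dds zz_conj.
by congr (_ * _ - _); rewrite mxE.
Qed.

Definition Phi_spec (Ph : Om -> 'rV[C]_d) := L2 P Ph /\ {ae P, forall w,
       cexp (cR eta) *: Ph (tau 0 1 w) - Ph w
       + PiM P (divstar tau xi (fun w' => Ac A w' *m dPhi tau xi Ph w')) w
       = - PiM P (divstar tau xi (Ac A)) w}.
Lemma Phi_entry (Ph : Om -> 'rV[C]_d) w k :
  (cexp (cR eta) *: Ph (tau 0 1 w) - Ph w
       + PiM P (divstar tau xi (fun w' => Ac A w' *m dPhi tau xi Ph w')) w
       + PiM P (divstar tau xi (Ac A)) w) ord0 k =
  let phi := fun w => Ph w ord0 k in
  cR E * phi (tau 0 1 w) - phi w + pim P (dv tau z (am A (fun i => dd tau z i phi))) w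
     + pim P (dv tau z (am A (ek k))) w.
Proof.
by rewrite /= 7!mxE cexp_cR /pim -div_entry -div_entry0 !mxE.
Qed.

(** The entrywise solutions of [corr_ex] show that the predicate behind [Phi] is inhabited, so the
    chosen [Phi] satisfies it. Its entries have mean zero because averaging the equation leaves (E -
    1) times the mean. *)
Lemma Phi_corr k : corr k (fun w => Phi P tau A xi eta w ord0 k).
Proof.
have hs : Phi_spec (Phi P tau A xi eta).
  apply: epsilon_spec.
  have [phi hphi] := boolp.choice corr_ex.
  exists (fun w => \row_k phi k w).
  have e k0 : (fun w => (\row_k phi k w) ord0 k0) = phi k0 by apply/funext => w; rewrite mxE.
  split; first by apply/L2E => i k0; rewrite (ord1 i) e; case: (hphi k0) => [[]].
  have h k0 : {ae P, forall w, (cexp (cR eta) *: (\row_k phi k (tau 0 1 w)) - (\row_k phi k w)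
       + PiM P (divstar tau xi (fun w' => Ac A w' *m dPhi tau xi (fun w => \row_k phi k w) w')) w
       + PiM P (divstar tau xi (Ac A)) w) ord0 k0 = 0}.
    have [[hp h1] h2] := hphi k0.
    have hy := sl2_yop fl z env_coef (vl2_ek k0) hp.
    have hu := sl2Z (cR E) (sl2_sh fl 0 1 hp).
    have hh := sl2B hu (sl2_proj true hy); rewrite corr_defect // h2 in h1 hh; have := sn_eq0 hh h1.
    by apply: filterS => w; rewrite addr0 (Phi_entry (fun w => \row_k phi k w)) /= e mxE [in X in _ -> X]mxE.
  have := ae_forall h; apply: filterS => w hw.
  apply/eqP; rewrite -subr_eq0 opprK; apply/eqP/matrixP => i j.
  by rewrite (ord1 i) hw mxE.
case: hs => hL hae; have hp : sl2 P (fun w => Phi P tau A xi eta w ord0 k) by move/L2E: hL; exact.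
set phi := fun w => _ in hp *.
have hg := vl2_grad fl z hp; have hk := vl2_ek k.
have hd1 := sl2_dv fl z (vl2_am env_coef hg); have hd2 := sl2_dv fl z (vl2_am env_coef hk).
have h1 := sl2_pim hd1; have h2 := sl2_pim hd2.
have hu := sl2Z (cR E) (sl2_sh fl 0 1 hp); have hup := sl2B hu hp.
have hf := sl2D (sl2D hup h1) h2.
have h0 : sn P (fun w => cR E * phi (tau 0 1 w) - phi w + pim P (dv tau z (am A (fun i => dd tau z i phi))) w
     + pim P (dv tau z (am A (ek k))) w) = 0.
  apply: sn_ae0 => //; apply: filterS hae => w hw.
  by apply: etrans (esym (Phi_entry (Phi P tau A xi eta) w k)) _; rewrite hw addNr mxE.
have m0 : cexpect P phi = 0.
  have := cexpect_eq0 hf h0; rewrite (cexpectD (sl2D hup h1) h2) (cexpectD hup h1) (cexpectB hu hp).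
  rewrite (cexpect_pim hd1) (cexpect_pim hd2) !addr0 (cexpectZ _ (sl2_sh fl 0 1 hp)) (cexpect_sh fl 0 1 hp).
  rewrite -{2}(mul1r (cexpect P phi)) -mulrBl => /eqP; rewrite mulf_eq0 => /orP[/eqP e|/eqP //].
  have : cRe (cR E - 1) = 0 by rewrite e.
  by rewrite cReD cReN cRe1 cRe_cR => /eqP; rewrite subr_eq0 gt_eqF.
split=> //; split=> //; rewrite corr_defect // m0.
by under eq_fun do rewrite addr0.
Qed.
End Corrector.

End Environment.
(** * The resolvent of the constant-coefficient equation *)

Section Kernel.
Context (R : realType) (dsp : measure_display) (Om : measurableType dsp)
        (P : probability Om R) (d : nat) (tau : Zd d -> int -> Om -> Om) (Lam : R)
        (xi : 'rV[R]_d).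
Local Notation C := (complex R).
Hypothesis fl : flow P tau.
Let tau0 : forall w, tau 0 0 w = w. Proof. by case: fl. Qed.
Let tauD : forall x y s t w, tau (x + y) (s + t) w = tau x s (tau y t w).
Proof. by case: fl => [_ []]. Qed.
Local Notation z := (zz xi).
Definition cxi : 'rV[C]_d := \row_i cR (xi ord0 i).
Definition chr (x : Zd d) : C := cexp (- 'i%C * zdot x cxi).
Lemma zdotD (x y : Zd d) : zdot (x + y) cxi = zdot x cxi + zdot y cxi.
Proof. by rewrite /zdot -big_split; apply: eq_bigr => i _; rewrite mxE rmorphD mulrDl. Qed.
Lemma chrD x y : chr (x + y) = chr x * chr y.
Proof. by rewrite /chr zdotD mulrDr cexpD. Qed.
Lemma zdot0 : zdot (0 : Zd d) cxi = 0.
Proof. by rewrite /zdot big1 // => i _; rewrite mxE mul0r. Qed.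
Lemma chr0 : chr 0 = 1.
Proof. by rewrite /chr zdot0 mulr0 cexp0. Qed.
Lemma chr_evec i : chr (evec i) = z i.
Proof.
rewrite /chr /zz; congr (cexp (_ * _)); rewrite /zdot (bigD1 i) //= evecE eqxx mulr1z mul1r mxE.
by rewrite big1 ?addr0 // => j /negPf hj; rewrite evecE eq_sym hj mulr0z mul0r.
Qed.

Lemma cR_int (n : int) : n%:~R = cR (n%:~R) :> C.
Proof. by rewrite -[RHS]/((n%:~R)%:C)%C rmorph_int. Qed.
Lemma cR_sum (I : Type) (s : seq I) (F : I -> R) : cR (\sum_(i <- s) F i) = \sum_(i <- s) cR (F i) :> C.
Proof. by apply: (big_morph _ (@cRD R)). Qed.
Lemma zdotE (x : Zd d) : zdot x cxi = cR (\sum_i (x ord0 i)%:~R * xi ord0 i).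
Proof. by rewrite cR_sum; apply: eq_bigr => i _; rewrite mxE cR_int cRM. Qed.
Lemma chr_unit x : cdot (chr x) (chr x) = 1.
Proof. by apply: cexp_unit; rewrite zdotE cRe_iM. Qed.
Lemma chrN x : chr (- x) = cconj (chr x).
Proof.
rewrite -[LHS]mul1r -(conj_unit (chr_unit x)) -mulrA -chrD subrr chr0 mulr1 //.
Qed.

Section Source.
Context (G : 'I_d -> Om -> C).
(** A twisted convolution of the source with the kernel k. Its point is that twisted derivatives in
    the environment become plain lattice differences of k, so the heat recursion of [GLam] can be
    read as a recursion for functions of the environment. *)
Definition ksum (k : 'I_d -> Zd d -> R) (w : Om) : C :=
  zsum (fun x => chr x * \sum_j cR (k j x) * G j (tau x 0 w)).
Definition fsk (k : 'I_d -> Zd d -> R) := forall j, fs (k j).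
Lemma fs_ksum k w : fsk k -> fs (fun x => chr x * \sum_j cR (k j x) * G j (tau x 0 w)).
Proof.
move=> hk; apply: fsMr; apply: fs_sum => j; apply: fsMl.
by have [s hs] := hk j; exists s => x /hs ->; rewrite cR0.
Qed.

Lemma eq_ksum k k' w : (forall j x, k j x = k' j x) -> ksum k w = ksum k' w.
Proof. by move=> h; apply: eq_zsum => x; congr (_ * _); apply: eq_bigr => j _; rewrite h. Qed.
Lemma ksumD k k' w : fsk k -> fsk k' -> ksum (fun j x => k j x + k' j x) w = ksum k w + ksum k' w.
Proof.
move=> h h'; rewrite /ksum -zsumD; try exact: fs_ksum.
apply: eq_zsum => x; rewrite -mulrDr -big_split; congr (_ * _); apply: eq_bigr => j _ /=.
by rewrite cRD mulrDl.
Qed.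

Lemma ksumZ (c : R) k w : fsk k -> ksum (fun j x => c * k j x) w = cR c * ksum k w.
Proof.
move=> h; rewrite /ksum -zsumZ; last exact: fs_ksum.
apply: eq_zsum => x; rewrite mulrCA; congr (_ * _); rewrite mulr_sumr; apply: eq_bigr => j _.
by rewrite cRM mulrA.
Qed.

Lemma ksumB k k' w : fsk k -> fsk k' -> ksum (fun j x => k j x - k' j x) w = ksum k w - ksum k' w.
Proof.
move=> h h'; rewrite -[- ksum k' w]mulN1r -cR1 -cRN -ksumZ // -ksumD //.
  by apply: eq_ksum => j x; rewrite mulN1r.
by move=> j; apply: fsMr.
Qed.

Lemma ksum_sum (I : Type) (s : seq I) (k : I -> 'I_d -> Zd d -> R) w : (forall i, fsk (k i)) ->
  ksum (fun j x => \sum_(i <- s) k i j x) w = \sum_(i <- s) ksum (k i) w.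
Proof.
move=> h; elim: s => [|i s IH].
  rewrite big_nil -[LHS]/(zsum _) -[RHS](zsum0 (Zd d)); apply: eq_zsum => x.
  by rewrite big1 ?mulr0 // => j _; rewrite big_nil cR0 mul0r.
rewrite big_cons -IH -ksumD //; last by move=> j; apply: fs_sum => i'; exact: h.
by apply: eq_ksum => j x; rewrite big_cons.
Qed.

Lemma ksum_shift k y w : fsk k ->
  chr y * ksum k (tau y 0 w) = ksum (fun j x => k j (x - y)) w.
Proof.
move=> hk; rewrite /ksum -zsumZ; last exact: fs_ksum.
rewrite -(zsum_shift (fun x => chr x * \sum_j cR (k j (x - y)) * G j (tau x 0 w)) y).
apply: eq_zsum => x; rewrite mulrA -chrD (addrC y) addrK; congr (_ * _).
by apply: eq_bigr => j _; rewrite -tauD addr0.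
Qed.

Lemma dd_ksum k i w : fsk k ->
  dd tau z i (ksum k) w = ksum (fun j x => k j (x - evec i) - k j x) w.
Proof.
move=> hk; rewrite /dd -chr_evec ksum_shift // ksumB // => j.
exact: (fs_shift (f := k j)).
Qed.

Lemma dds_ksum k i w : fsk k ->
  dds tau z i (ksum k) w = ksum (fun j x => k j (x + evec i) - k j x) w.
Proof.
move=> hk; rewrite /dds -chr_evec -chrN ksum_shift // -ksumB // => [|j].
  by apply: eq_ksum => j x; rewrite opprK.
by rewrite opprK; exact: (fs_shift (f := k j)).
Qed.

Definition DG (t : nat) (j : 'I_d) (x : Zd d) : R := GLam Lam t (x + evec j) - GLam Lam t x.
Definition Tk t := ksum (DG t).
Lemma fs_GLam t : fs (GLam Lam t : Zd d -> R).
Proof. exact: fs_heat. Qed.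
Lemma fsk_DG t : fsk (DG t).
Proof. by move=> j; apply: fsB; [exact: (fs_shift (f := GLam Lam t) _ (fs_GLam t))|exact: fs_GLam]. Qed.
Lemma Tk0 w : Tk 0 w = dv tau z G w.
Proof.
rewrite /Tk.
have -> : DG 0 = fun j x => delta R (- evec j) x - delta R 0 x.
  apply/funext => j; apply/funext => x; rewrite /DG /GLam /= /delta.
  by rewrite addr_eq0.
have hd j y : fs (delta R y : Zd d -> R) by exact: fs_delta.
have e y (j0 : 'I_d) : ksum (fun j x => if j == j0 then delta R (y j) x else 0) w = chr (y j0) * G j0 (tau (y j0) 0 w).
  rewrite /ksum (zsum1 (a := y j0)).
    rewrite (bigD1 j0) //= eqxx /delta eqxx cR1 mul1r big1 ?addr0 // => j /negPf ->.
    by rewrite cR0 mul0r.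
  move=> x /negPf hx; rewrite big1 ?mulr0 // => j _; case: eqP => [->|_]; rewrite ?cR0 ?mul0r //.
  by rewrite /delta hx cR0 mul0r.
have -> : (fun j x => delta R (- evec j) x - delta R 0 x) =
  fun j x => \sum_(j0 <- index_enum 'I_d) ((if j == j0 then delta R (- evec j) x else 0) - (if j == j0 then delta R 0 x else 0)).
  apply/funext => j; apply/funext => x; rewrite (bigD1 j) //= eqxx big1 ?addr0 // => i /negPf hi.
  by rewrite eq_sym hi subr0.
have hf y : fsk (fun j x => if j == y.1 then delta R (y.2 j) x else 0).
  by move=> j; case: eqP => // _; [exact: fs_delta|exact: fs0].
rewrite ksum_sum => [|j0 j]; last by case: eqP => _; [apply: fsB; exact: fs_delta|rewrite subr0; exact: fs0].
apply: eq_bigr => j _; rewrite ksumB; [|exact: (hf (j, fun j => - evec j))|exact: (hf (j, fun=> 0))].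
rewrite (e (fun j => - evec j)) (e (fun=> 0)) /dds chrN chr_evec chr0 mul1r tau0 //.
Qed.

Lemma GLamS t (x : Zd d) : GLam Lam t.+1 x = GLam Lam t x +
  Lam * \sum_i ((GLam Lam t (x + evec i) - GLam Lam t x) - (GLam Lam t x - GLam Lam t (x - evec i))).
Proof.
rewrite /GLam /=; congr (_ + _); rewrite mulr_sumr -sumrN; apply: eq_bigr => i _.
have e y : \sum_(j < d) (Lam%:M : 'M[R]_d) i j * (heat (fun _ _ => Lam%:M) t (y + evec j) - heat (fun _ _ => Lam%:M) t y)
   = Lam * (heat (fun _ _ => Lam%:M) t (y + evec i) - heat (fun _ _ => Lam%:M) t y).
  rewrite (bigD1 i) //= mxE eqxx big1 ?addr0 // => j /negPf hj.
  by rewrite mxE eq_sym hj mul0r.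
by rewrite !e subrK; ring.
Qed.

Lemma TkS t w : Tk t.+1 w = Tk t w - cR Lam * dv tau z (fun i => dd tau z i (Tk t)) w.
Proof.
have hD := fsk_DG t.
have hsh (k : 'I_d -> Zd d -> R) y : fsk k -> fsk (fun j x => k j (x + y)).
  by move=> hk j; exact: (fs_shift (f := k j)).
have hk i : fsk (fun j x => DG t j (x - evec i) - DG t j x).
  by move=> j; apply: fsB; [exact: (hsh _ _ hD)|exact: hD].
have hk2 i : fsk (fun j x => (DG t j (x + evec i - evec i) - DG t j (x + evec i)) - (DG t j (x - evec i) - DG t j x)).
  by move=> j; apply: fsB; [exact: (hsh _ _ (hk i))|exact: hk].
rewrite /dv; have -> : \sum_j dds tau z j (dd tau z j (Tk t)) w =
   \sum_i ksum (fun j x => (DG t j (x + evec i - evec i) - DG t j (x + evec i)) - (DG t j (x - evec i) - DG t j x)) w.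
  apply: eq_bigr => i _; rewrite -dds_ksum //; congr (dds _ _ _ _ w).
  by apply/funext => v; rewrite /Tk dd_ksum.
rewrite -ksum_sum // -ksumZ; last by move=> j; apply: fs_sum => i; exact: hk2.
rewrite -ksumB //; last by move=> j; apply: fsMr; apply: fs_sum => i; exact: hk2.
apply: eq_ksum => j x; rewrite /DG !GLamS.
rewrite opprD addrACA; congr (_ + _); rewrite -mulrBr -mulrN; congr (_ * _).
rewrite -sumrB -sumrN; apply: eq_bigr => i _; rewrite !addrK.
rewrite (addrAC x (evec j) (evec i)) (addrAC x (evec j) (- evec i)); ring.
Qed.
Variable E : R.
Hypothesis E0 : 0 < E.
Local Notation aL := (fun _ : Om => Lam%:M : 'M[R]_d).
(** Partial sums of a scalar potential; their twisted gradients are the partial sums of T applied to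
    the source. *)
Definition cht N (w : Om) : C := \sum_(t < N) cR (Lam * E^-1 ^+ t.+1) * Tk t (tau 0 (- (t.+1)%:Z) w).
Lemma am_cst F : am aL F = fun i w => cR Lam * F i w.
Proof.
apply/funext => i; apply/funext => w; rewrite /am (bigD1 i) //= mxE eqxx mulr1n.
by rewrite big1 ?addr0 // => j /negPf hj; rewrite mxE eq_sym hj mulr0n cR0 mul0r.
Qed.

Lemma yop_cst phi w : yop tau z aL (fun i w => - G i w) phi w =
   phi w - cR Lam * dv tau z (fun i => dd tau z i phi) w + cR Lam * dv tau z G w.
Proof.
rewrite /yop am_cst /dv !mulr_sumr -addrA; congr (_ + _); rewrite -sumrN -sumrN -big_split.
by apply: eq_bigr => i _; rewrite /dds /=; ring.
Qed.

Lemma dv_lin_sum (I : Type) (s : seq I) (c : I -> C) (f : I -> Om -> C) w :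
  dv tau z (fun i => dd tau z i (fun v => \sum_(k <- s) c k * f k v)) w =
  \sum_(k <- s) c k * dv tau z (fun i => dd tau z i (f k)) w.
Proof.
rewrite /dv; under [RHS]eq_bigr do rewrite mulr_sumr.
rewrite exchange_big; apply: eq_bigr => i _ /=; rewrite /dds /dd !mulr_sumr -!sumrB mulr_sumr -sumrB.
by apply: eq_bigr => k _; ring.
Qed.

Lemma dv_sh f s w : dv tau z (fun i => dd tau z i f) (tau 0 s w) =
  dv tau z (fun i => dd tau z i (fun v => f (tau 0 s v))) w.
Proof.
by rewrite /dv; apply: eq_bigr => i _; rewrite /dds /dd -!tauD !add0r !addr0.
Qed.

(** Splitting off the first term of the series exhibits one fixed-point step: the term t = 0 is the
    divergence of the source ([Tk0]), the others are a heat step of the preceding ones ([TkS]).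
    Convergence of the series is thus that of the iteration. *)
Lemma cht_iter N : cht N = iter N (stepf P tau z aL false E (fun i w => - G i w)) (fun=> 0).
Proof.
elim: N => [|N IH]; first by apply/funext => w; rewrite /cht big_ord0.
rewrite iterS -IH; apply/funext => w; rewrite /stepf /= yop_cst /cht big_ord_recl /= expr1.
have Ec : forall t, cR (Lam * E^-1 ^+ t.+2) = cR E^-1 * cR (Lam * E^-1 ^+ t.+1) :> C.
  by move=> t; rewrite -cRM (exprS _ t.+1) mulrCA.
rewrite (dv_lin_sum _ _ (fun (k : 'I_N) v => Tk k (tau 0 (- (k.+1)%:Z) v))) addrC mulrDr; congr (_ + _).
  rewrite mulr_sumr -sumrB mulr_sumr; apply: eq_bigr => t _.
  rewrite /bump /= add1n Ec -mulrA TkS; congr (_ * _).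
  rewrite dv_sh -tauD add0r mulrCA -mulrBr; congr (_ * (_ - _ * _)).
    by congr (Tk t (tau 0 _ w)); lia.
  rewrite (dv_sh (fun v => Tk t (tau 0 (- t.+1%:Z) v)) (-1) w).
  rewrite /dv; apply: eq_bigr => i _; rewrite /dds /dd -!tauD !add0r !addr0.
  by rewrite (_ : - t.+2%:Z = - 1 + - t.+1%:Z) ?(addrC (- 1) (- t.+1%:Z)) //; lia.
by rewrite Tk0 [in RHS]mulrA -cRM (mulrC E^-1).
Qed.
End Source.

End Kernel.
Section Limits.
Context (R : realType).
Lemma lim0_le (a : R) (u : nat -> R) : (forall n, a <= u n) -> u @ \oo --> (0 : R) -> a <= 0.
Proof.
move=> h /cvgrPdist_lt hu; apply/ler_addgt0Pr => e e0; rewrite add0r.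
have [N _ /(_ N (leqnn N))] := hu e e0; rewrite /= sub0r normrN => h2.
by apply: le_trans (h N) _; apply: le_trans (ler_norm _) _; exact: ltW.
Qed.

Lemma cvg0D (u v : nat -> R) : u @ \oo --> (0 : R) -> v @ \oo --> (0 : R) ->
  (fun n => u n + v n) @ \oo --> (0 : R).
Proof. by move=> hu hv; rewrite -[X in _ --> X]addr0; exact: cvgD. Qed.
Lemma le_contr0 (x y : R) : x <= (1 - y) * x -> y * x <= 0.
Proof. by move=> h; lra. Qed.
End Limits.

Section Resolvent.
Context (R : realType) (dsp : measure_display) (Om : measurableType dsp)
        (P : probability Om R) (d : nat) (tau : Zd d -> int -> Om -> Om)
        (A : Om -> 'M[R]_d) (lam Lam : R).
Local Notation C := (complex R).
Hypothesis hE : Env P tau A lam Lam.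
Hypothesis Lam4 : 4 * d%:R * Lam <= 1.
Context (xi : 'rV[R]_d) (eta : R) (eta0 : 0 < eta).
Local Notation z := (zz xi).
Local Notation E := (expR eta).
Local Notation H := (Om -> 'cV[C]_d).
Local Notation aL := (fun _ : Om => Lam%:M : 'M[R]_d).
Let E1 : 1 < E. Proof. by rewrite expR_gt1. Qed.
Let E0 : 0 < E. Proof. exact: expR_gt0. Qed.
Let fl := env_flow hE.
Let L0 := env_Lam0 hE.
Let cL := cst_coef hE.
Definition fam (g : H) (i : 'I_d) (w : Om) : C := g w i ord0.
Definition neg (G : 'I_d -> Om -> C) i w : C := - G i w.
Lemma L2_fam g : L2 P g <-> vl2 P (fam g).
Proof.
rewrite L2E; split=> [h i|h i j]; first exact: h.
by rewrite (ord1 j); exact: h.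
Qed.

Lemma vl2_neg G : vl2 P G -> vl2 P (neg G).
Proof. by move=> h i; apply: sl2N. Qed.
Lemma ksum_box G (k : 'I_d -> Zd d -> R) N w : (forall j x, x \notin boxs d N -> k j x = 0) ->
  ksum tau xi G k w = \sum_(b : {ffun 'I_d -> 'I_(2 * N + 1)})
    chr xi (boxpt b) * \sum_j cR (k j (boxpt b)) * G j (tau (boxpt b) 0 w).
Proof.
move=> hk; rewrite /ksum (zsumE (boxs_uniq d N)).
  by rewrite /boxs big_map big_enum.
by move=> x hx; rewrite big1 ?mulr0 // => j _; rewrite hk // cR0 mul0r.
Qed.

Lemma GLam_supp t (x : Zd d) (i : 'I_d) : (t < `|x ord0 i|)%N -> GLam Lam t x = 0.
Proof.
move=> h; apply: heat_supp; rewrite mem_boxs; apply/negP => /forallP /(_ i).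
by rewrite leqNgt h.
Qed.

Lemma DG_box t N j x : (t < N)%N -> x \notin boxs d N -> DG Lam t j x = 0.
Proof.
move=> tN /notin_boxs[i hi]; rewrite /DG.
rewrite (@GLam_supp t x i) ?(@GLam_supp t (x + evec j) i) ?subrr //; last by apply: leq_ltn_trans hi; exact: ltnW.
rewrite mxE evecE; move: hi tN; case: (_ == _); move: (x ord0 i) => n; clear; lia.
Qed.

Lemma NN_box t N i j x : (t < N)%N -> x \notin boxs d N -> NNstar Lam x t i j = 0.
Proof.
move=> tN /notin_boxs[k hk]; rewrite mxE.
have h (y : Zd d) : (`|x ord0 k| <= `|y ord0 k| + 1)%N -> GLam Lam t y = 0.
  by move=> h; apply: (@GLam_supp t y k); apply: leq_trans tN _; have := leq_trans hk h; rewrite addn1 ltnS.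
have h2 : (`|x ord0 k| <= `|(x + evec j - evec i)%R ord0 k| + 1)%N.
  by rewrite !mxE !eqxx /=; move: (x ord0 k) => n; clear; do ?case: (_ == _); lia.
have h3 : (`|x ord0 k| <= `|(x + evec j)%R ord0 k| + 1)%N.
  by rewrite !mxE !eqxx /=; move: (x ord0 k) => n; clear; do ?case: (_ == _); lia.
have h4 : (`|x ord0 k| <= `|(x - evec i)%R ord0 k| + 1)%N.
  by rewrite !mxE !eqxx /=; move: (x ord0 k) => n; clear; do ?case: (_ == _); lia.
by rewrite /= (h _ h2) (h _ h3) (h _ h4) (h x) ?subrr // leq_addr.
Qed.

Lemma NN_DG t i j (x : Zd d) : NNstar Lam x t i j = DG Lam t j (x - evec i) - DG Lam t j x.
Proof. by rewrite mxE /DG (addrAC x (evec j)); ring. Qed.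
Lemma cexp_eta (t : nat) : cexp (- cR eta * (t.+1)%:R) = cR (E^-1 ^+ t.+1) :> C.
Proof.
have -> : - cR eta * (t.+1)%:R = cR (- eta * (t.+1)%:R) :> C.
  by rewrite cRM cRN; congr (_ * _); exact: (cR_int R t.+1%:Z).
by rewrite cexp_cR mulNr expRN mulrC expRM_natl exprVn.
Qed.

(** [NNstar] is a backward difference of the forward gradient [DG] of [GLam]. Hence T factors
    through a scalar potential, and studying T reduces to a scalar resolvent equation. *)
Lemma Tpart_dd g N w i : Tpart tau Lam (cxi xi) (cR eta) N g w i ord0 =
  dd tau z i (cht tau Lam xi (fam g) E N) w.
Proof.
have e1 : dd tau z i (cht tau Lam xi (fam g) E N) w =
   \sum_(t < N) cR (Lam * E^-1 ^+ t.+1) * dd tau z i (Tk tau Lam xi (fam g) t) (tau 0 (- (t.+1)%:Z) w).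
  rewrite /dd /cht mulr_sumr -sumrB; apply: eq_bigr => t _.
  rewrite mulrBr mulrCA; congr (_ * (_ * Tk _ _ _ _ _ _) - _).
  by rewrite !(tau_add fl) !addr0 !add0r.
rewrite e1 /Tpart summxE; apply: eq_bigr => t _.
rewrite (dd_ksum _ fl) => [|j]; last exact: fsk_DG.
rewrite (@ksum_box _ _ N) => [|j x hx]; last first.
  by rewrite -NN_DG; exact: NN_box hx.
rewrite summxE mulr_sumr; apply: eq_bigr => b _; rewrite mxE cexp_eta -cRM -mulrA; congr (_ * _).
rewrite -/(chr xi (boxpt b)); congr (_ * _); rewrite mxE; apply: eq_bigr => j _.
by rewrite mxE NN_DG (tau_add fl) addr0 add0r.
Qed.

Lemma vn_grad f : sl2 P f -> vn P (fun i => dd tau z i f) <= Num.sqrt (4 * d%:R) * sn P f.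
Proof.
move=> hf; rewrite /sn -sqrtrM ?mulr_ge0 ?ler0n // ler_sqrt; last first.
  by rewrite mulr_ge0 ?sip_ge0 // mulr_ge0 // ler0n.
apply: le_trans (_ : \sum_(i < d) 4 * sip P f f <= _).
  by apply: ler_sum => i _; exact: (dd_le fl (zz_unit xi)).
by rewrite sumr_const card_ord -[leLHS]mulr_natr mulrAC.
Qed.

Definition Top_spec g (psi : H) := L2 P psi /\
  (fun N : nat => hnorm P (fun w => Tpart tau Lam (cxi xi) (cR eta) N g w - psi w)) @ \oo --> (0 : R).
Lemma soln_neg_ex G : vl2 P G -> exists chi, soln P tau z aL false E (neg G) chi /\
   exists B, forall n, sn P (fun w => cht tau Lam xi G E n w - chi w) <= B * E^-1 ^+ n.
Proof.
move=> hG; have [chi [h1 [B hB]]] := soln_ex fl (zz_unit xi) cL Lam4 L0 (ltW L0) false E1 (vl2_neg hG).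
by exists chi; split=> //; exists B => n; rewrite (cht_iter Lam xi fl) //; exact: hB.
Qed.

Lemma sl2_cht G n : vl2 P G -> sl2 P (cht tau Lam xi G E n).
Proof.
move=> hG; rewrite (cht_iter Lam xi fl) //; elim: n => [|n IH]; first exact: sl2_cst.
by rewrite iterS; apply: (sl2_stepf fl z cL) => //; exact: vl2_neg.
Qed.

Lemma geo_cvg0 (B : R) : (fun n => B * E^-1 ^+ n) @ \oo --> (0 : R).
Proof.
have : (fun n => B * E^-1 ^+ n) @ \oo --> (B * 0 : R).
  by apply: cvgZr; apply: cvg_expr; rewrite ger0_norm ?invr_ge0 ?(ltW E0) // invf_lt1.
by rewrite mulr0.
Qed.

Lemma Top_spec_grad g chi : L2 P g -> soln P tau z aL false E (neg (fam g)) chi ->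
  Top_spec g (fun w => \col_i dd tau z i chi w).
Proof.
move=> /L2_fam hg hs; have [chi' [hs' [B hB]]] := soln_neg_ex hg.
have hc := hs.1; have hc' := hs'.1; have hgr := vl2_grad fl z hc.
have e : fam (fun w => \col_i dd tau z i chi w) = fun i => dd tau z i chi.
  by apply/funext => i; apply/funext => w; rewrite /fam mxE.
split; first by apply/L2_fam; rewrite e.
have u0 := soln_uniq fl (zz_unit xi) cL Lam4 L0 (ltW L0) E1 (vl2_neg hg) hs' hs.
have bd N : hnorm P (fun w => Tpart tau Lam (cxi xi) (cR eta) N g w - \col_i dd tau z i chi w)
     <= Num.sqrt (4 * d%:R) * B * E^-1 ^+ N.
  have hN := sl2_cht N hg; have hD := sl2B hN hc.
  have eT : fam (fun w => Tpart tau Lam (cxi xi) (cR eta) N g w - \col_i dd tau z i chi w) =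
     fun i => dd tau z i (fun w => cht tau Lam xi (fam g) E N w - chi w).
    by apply/funext => i; apply/funext => w; rewrite /fam mxE Tpart_dd ddB !mxE.
  rewrite hnormE; last by apply/L2_fam; rewrite eT; exact: vl2_grad.
  rewrite -/(fam _) eT; apply: le_trans (vn_grad hD) _; rewrite -mulrA ler_wpM2l ?sqrtr_ge0 //.
  apply: le_trans (hB N).
  have -> : (fun w => cht tau Lam xi (fam g) E N w - chi w) =
     fun w => (cht tau Lam xi (fam g) E N w - chi' w) + (chi' w - chi w).
    by apply/funext => w; ring.
  by apply: le_trans (snD (sl2B hN hc') (sl2B hc' hc)) _; rewrite u0 addr0.
apply: (@squeeze_cvgr _ _ _ _ (fun=> 0) (fun N => Num.sqrt (4 * d%:R) * B * E^-1 ^+ N)).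
- by near=> N; rewrite sqrtr_ge0 bd.
- exact: cvg_cst.
- exact: geo_cvg0.
Unshelve. all: by end_near.
Qed.

(** [Top] is some L2 limit of the partial sums. The gradient of the potential is such a limit, and
    two limits of the same sequence are at distance 0. *)
Lemma Top_grad g chi : L2 P g -> soln P tau z aL false E (neg (fam g)) chi ->
  L2 P (Top P tau Lam (cxi xi) (cR eta) g) /\
  vn P (fun i w => fam (Top P tau Lam (cxi xi) (cR eta) g) i w - dd tau z i chi w) = 0.
Proof.
move=> hg hs; have h1 := Top_spec_grad hg hs.
have [h2 h3] : Top_spec g (Top P tau Lam (cxi xi) (cR eta) g).
  by apply: epsilon_spec; exists (fun w => \col_i dd tau z i chi w).
split=> //; have [h4 h5] := h1; move/L2_fam: (h2) => h2'.
have hgr := vl2_grad fl z hs.1.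
have e : fam (fun w => \col_i dd tau z i chi w) = fun i => dd tau z i chi.
  by apply/funext => i; apply/funext => w; rewrite /fam mxE.
apply/eqP; rewrite eq_le vn_ge0 andbT.
apply: (lim0_le _ (cvg0D h3 h5)) => N.
pose T := Tpart tau Lam (cxi xi) (cR eta) N g.
have hT : vl2 P (fam T).
  have -> : fam T = fun i => dd tau z i (cht tau Lam xi (fam g) E N).
    by apply/funext => i; apply/funext => w; rewrite /fam /T Tpart_dd.
  by apply: vl2_grad => //; apply: sl2_cht; apply/L2_fam.
have hn psi : L2 P psi -> hnorm P (fun w => T w - psi w) = vn P (fun i w => fam T i w - fam psi i w).
  move=> /L2_fam hp; have e2 : fam (fun w => T w - psi w) = fun i w => fam T i w - fam psi i w.
    by apply/funext => i; apply/funext => w; rewrite /fam !mxE.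
  rewrite hnormE; last by apply/L2_fam; rewrite e2; exact: vl2B.
  by rewrite -[LHS]/(vn P (fam (fun w => T w - psi w))) e2.
rewrite -/T !hn // e (vnBC hT h2').
have -> : (fun i w => fam (Top P tau Lam (cxi xi) (cR eta) g) i w - dd tau z i chi w) =
   fun i w => (fam (Top P tau Lam (cxi xi) (cR eta) g) i w - fam T i w) + (fam T i w - dd tau z i chi w).
  by apply/funext => i; apply/funext => w; ring.
by apply: vnD; apply: vl2B.
Qed.

Definition bB (w : Om) : 'M[R]_d := 1%:M - Lam^-1 *: A w.
Lemma fam_bmul psi : fam (bmul A Lam psi) = am bB (fam psi).
Proof.
by apply/funext => i; apply/funext => w; rewrite /fam /bmul mxE /am; apply: eq_bigr => j _; rewrite mxE.
Qed.

Lemma am_bB F : am bB F = fun i w => F i w - cR Lam^-1 * am A F i w.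
Proof.
apply/funext => i; apply/funext => w; rewrite /am mulr_sumr.
have -> : F i w = \sum_j (if j == i then F j w else 0).
  by rewrite (bigD1 i) //= eqxx big1 ?addr0 // => j /negPf ->.
rewrite -sumrB; apply: eq_bigr => j _; rewrite !mxE eq_sym.
case: eqP => _; rewrite ?mulr1n ?mulr0n cRD cRN cRM ?cR1 ?cR0; ring.
Qed.

Lemma vl2_bB F : vl2 P F -> vl2 P (am bB F).
Proof.
move=> hF; rewrite am_bB; apply: vl2B => // i; apply: sl2Z; exact: (vl2_am (env_coef hE) hF).
Qed.

(** Expanding |F - aF/Lam|^2 and using |aF|^2 <= Lam F.aF leaves |F|^2 - F.aF/Lam, and F.aF >= lam
    |F|^2. This strict contraction is what makes the inverse in (H) unique. *)
Lemma bB_contr F : vl2 P F -> vip P (am bB F) (am bB F) <= (1 - lam / Lam) * vip P F F.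
Proof.
move=> hF; have ha := vl2_am (env_coef hE) hF; rewrite am_bB.
have -> : vip P (fun i w => F i w - cR Lam^-1 * am A F i w) (fun i w => F i w - cR Lam^-1 * am A F i w)
  = vip P F F - 2 * Lam^-1 * vip P F (am A F) + Lam^-1 ^+ 2 * vip P (am A F) (am A F).
  rewrite /vip !mulr_sumr -sumrB -big_split; apply: eq_bigr => i _ /=.
  have hz := sl2Z (cR Lam^-1) (ha i).
  rewrite sip_sqB // sipRl // !sipRr //; ring.
have h1 := am_lo (env_coef hE) hF; have h2 := am_up (env_coef hE) hF.
have Li : 0 <= Lam^-1 by rewrite invr_ge0 ltW.
have h3 : Lam^-1 ^+ 2 * vip P (am A F) (am A F) <= Lam^-1 * vip P F (am A F).
  apply: le_trans (_ : Lam^-1 ^+ 2 * (Lam * vip P F (am A F)) <= _); first by rewrite ler_wpM2l // exprn_ge0.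
  by rewrite expr2 -mulrA mulKf ?gt_eqF.
have h4 : Lam^-1 * (lam * vip P F F) <= Lam^-1 * vip P F (am A F) by rewrite ler_wpM2l.
have -> : (1 - lam / Lam) * vip P F F = vip P F F - Lam^-1 * (lam * vip P F F) by ring.
move: (vip P F F) (vip P F (am A F)) (vip P (am A F) (am A F)) Lam^-1 h3 h4 => a b c l; lra.
Qed.

Lemma pimD f g : sl2 P f -> sl2 P g -> pim P (fun w => f w + g w) = fun w => pim P f w + pim P g w.
Proof. by move=> hf hg; apply/funext => w; rewrite /pim cexpectD //; ring. Qed.
Lemma pimZ c f : sl2 P f -> pim P (fun w => c * f w) = fun w => c * pim P f w.
Proof. by move=> hf; apply/funext => w; rewrite /pim cexpectZ //; ring. Qed.
Lemma pim_sh f x s w : sl2 P f -> pim P (fun w => f (tau x s w)) w = pim P f (tau x s w).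
Proof. by move=> hf; rewrite /pim (cexpect_sh fl). Qed.
Lemma pim_mean0 f : cexpect P f = 0 -> pim P f = f.
Proof. by move=> h; apply/funext => w; rewrite /pim h subr0. Qed.
Lemma pim_dd i f : sl2 P f -> pim P (dd tau z i f) = dd tau z i (pim P f).
Proof.
move=> hf; have hs := sl2_sh fl (evec i) 0 hf.
rewrite /dd pimB //; last exact: sl2Z.
by apply/funext => w; rewrite pimZ // pim_sh.
Qed.

Lemma pim_dds i f : sl2 P f -> pim P (dds tau z i f) = dds tau z i (pim P f).
Proof.
move=> hf; have hs := sl2_sh fl (- evec i) 0 hf.
rewrite /dds pimB //; last exact: sl2Z.
by apply/funext => w; rewrite pimZ // pim_sh.
Qed.

Lemma pim_dv F : vl2 P F -> pim P (dv tau z F) = dv tau z (fun i => pim P (F i)).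
Proof.
move=> hF; apply/funext => w; rewrite /dv.
elim: (index_enum _) => [|i s IH].
  rewrite big_nil /pim big_nil.
  rewrite (_ : (fun v => _) = fun=> (0 : C)) ?cexpect_cst ?subr0 //.
  by apply/funext => v; rewrite big_nil.
rewrite big_cons -IH -pim_dds //.
have hs : sl2 P (fun v => \sum_(j <- s) dds tau z j (F j) v).
  by apply: (sl2_sum _ (K := fun j => dds tau z j (F j))) => j; apply: sl2_dds.
transitivity (pim P (fun v => dds tau z i (F i) v + \sum_(j <- s) dds tau z j (F j) v) w).
  by congr (pim P _ w); apply/funext => v; rewrite big_cons.
by rewrite pimD //; exact: sl2_dds.
Qed.

Lemma solnB b a l L G1 G2 f g : coef l L a -> vl2 P G1 -> vl2 P G2 ->
  soln P tau z a b E G1 f -> soln P tau z a b E G2 g ->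
  soln P tau z a b E (fun i w => G1 i w - G2 i w) (fun w => f w - g w).
Proof.
move=> ha h1 h2 [hf e1] [hg e2]; split; first exact: sl2B.
have hy1 := sl2_yop fl z ha h1 hf; have hy2 := sl2_yop fl z ha h2 hg.
have hs1 := sl2Z (cR E) (sl2_sh fl 0 1 hf); have hs2 := sl2Z (cR E) (sl2_sh fl 0 1 hg).
have hA := sl2B hs1 (sl2_proj b hy1); have hB := sl2B hs2 (sl2_proj b hy2).
have -> : (fun w => cR E * (f (tau 0 1 w) - g (tau 0 1 w)) -
    cproj P b (yop tau z a (fun i w => G1 i w - G2 i w) (fun w => f w - g w)) w) =
   fun w => (cR E * f (tau 0 1 w) - cproj P b (yop tau z a G1 f) w) - (cR E * g (tau 0 1 w) - cproj P b (yop tau z a G2 g) w).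
  have -> : yop tau z a (fun i w => G1 i w - G2 i w) (fun w => f w - g w) = fun w => yop tau z a G1 f w - yop tau z a G2 g w.
    by apply/funext => w; rewrite yopB.
  by apply/funext => w; rewrite projB //; ring.
apply/eqP; rewrite eq_le sn_ge0 andbT; apply: le_trans (snB hA hB) _.
by rewrite e1 e2 addr0.
Qed.

Lemma soln_energy b a l L G f : coef l L a -> 4 * d%:R * L <= 1 -> 0 < L -> vl2 P G ->
  soln P tau z a b E G f ->
  vip P (fun i => dd tau z i f) (am a (fun i => dd tau z i f)) + (E ^+ 2 - 1) * sip P f f <= vip P G (am a G).
Proof.
move=> ha L4 L1 hG [hf e].
have := energy_res fl (zz_unit xi) ha L4 L1 (b := b) (E := E) hG hf (sl2_cst P 0) (ltW E0).
have -> : sn P (fun=> (0 : C)) = 0 by apply: sn_ae0; [exact: sl2_cst|exact: aeW].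
rewrite mulr0 addr0; apply; rewrite -[RHS]e; congr (sn P _); apply/funext => w; ring.
Qed.

Lemma vip_cst F G : vl2 P F -> vl2 P G -> vip P F (am aL G) = Lam * vip P F G.
Proof. by move=> hF hG; rewrite am_cst /vip mulr_sumr; apply: eq_bigr => i _; rewrite sipRr. Qed.
Lemma cst_soln_bound b G f : vl2 P G -> soln P tau z aL b E G f ->
  vip P (fun i => dd tau z i f) (fun i => dd tau z i f) <= vip P G G /\
  (E ^+ 2 - 1) * sip P f f <= Lam * vip P G G.
Proof.
move=> hG hs; have hg := vl2_grad fl z hs.1.
have := soln_energy cL Lam4 L0 hG hs; rewrite !vip_cst //.
have h1 : 0 <= (E ^+ 2 - 1) * sip P f f.
  by apply: mulr_ge0; rewrite ?sip_ge0 // subr_ge0 exprn_ege1 // ltW.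
have h2 : 0 <= Lam * vip P (fun i => dd tau z i f) (fun i => dd tau z i f).
  by apply: mulr_ge0; rewrite ?vip_ge0 // ltW.
by move=> h; split; [rewrite -(ler_pM2l L0)|]; apply: le_trans h; rewrite ?lerDl ?lerDr.
Qed.
Local Notation TOP := (Top P tau Lam (cxi xi) (cR eta)).
Definition Inv_spec (v psi : H) := L2 P psi /\
  {ae P, forall w, psi w - PiM P (TOP (bmul A Lam psi)) w = v w}.
(** With T b psi = grad chi and since the projection commutes with twisted derivatives, psi - Pi T b
    psi = v says that psi is the gradient of Pi chi plus v. *)
Lemma Inv_char v psi chi : L2 P v -> L2 P psi ->
  soln P tau z aL false E (neg (fam (bmul A Lam psi))) chi ->
  {ae P, forall w, psi w - PiM P (TOP (bmul A Lam psi)) w = v w} <->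
  vn P (fun i w => fam psi i w - (dd tau z i (pim P chi) w + fam v i w)) = 0.
Proof.
move=> /L2_fam hv /L2_fam hp hs; have hc := hs.1.
have hg : L2 P (bmul A Lam psi) by apply/L2_fam; rewrite fam_bmul; exact: vl2_bB.
have [/L2_fam hT h0] := Top_grad hg hs.
have hgr := vl2_grad fl z hc; have hpc := sl2_pim hc.
have hD := vl2B hT hgr; have h1 := vn_eq0 hD h0.
have em i : cexpect P (fam (TOP (bmul A Lam psi)) i) = cexpect P (dd tau z i chi).
  apply/eqP; rewrite -subr_eq0 -cexpectB //; apply/eqP; apply: cexpect_eq0; first exact: hD.
  by apply: sn_ae0; [exact: hD|apply: filterS h1 => w; exact].
have eP w i : fam (TOP (bmul A Lam psi)) i w - dd tau z i chi w = 0 ->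
   (psi w - PiM P (TOP (bmul A Lam psi)) w) i ord0 = fam psi i w - dd tau z i (pim P chi) w.
  move=> h; rewrite -pim_dd // /pim -em !mxE -/(fam psi i w); congr (_ - (_ - _)).
  by apply/eqP; rewrite -subr_eq0; apply/eqP.
have hE2 : vl2 P (fun i w => fam psi i w - (dd tau z i (pim P chi) w + fam v i w)).
  by apply: vl2B => //; apply: vl2D => //; exact: vl2_grad.
split=> [h|/(vn_eq0 hE2) h].
  apply: vn_ae0 => //; apply: filterS2 h h1 => w hw h2 i.
  by rewrite opprD addrA -eP // hw subrr.
apply: filterS2 h h1 => w hw h2; apply/matrixP => i j; rewrite (ord1 j) eP //.
by apply/eqP; rewrite -subr_eq0 -addrA -opprD; apply/eqP.
Qed.

Definition vk (k : 'I_d) : 'cV[C]_d := \col_i (i == k)%:R.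
Lemma fam_vk k : fam (fun=> vk k) = (@ek R dsp Om d k).
Proof. by apply/funext => i; apply/funext => w; rewrite /fam mxE. Qed.
Definition psik (k : 'I_d) (phi : Om -> C) (i : 'I_d) (w : Om) : C :=
  dd tau z i phi w + @ek R dsp Om d k i w.
Definition psiH k phi : H := fun w => \col_i psik k phi i w.
Lemma fam_psiH k phi : fam (psiH k phi) = psik k phi.
Proof. by apply/funext => i; apply/funext => w; rewrite /fam mxE. Qed.
Lemma vl2_psik k phi : sl2 P phi -> vl2 P (psik k phi).
Proof. by move=> hp; apply: vl2D; [exact: vl2_grad|exact: vl2_ek]. Qed.
(** Substituting A = Lam (1 - b) turns the corrector equation into the constant-coefficient one with
    source Pi b (grad phi + e_k). The projection leaves phi unchanged, by its zero mean, and kills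
    the constant e_k. *)
Lemma corr_soln k phi : corr P tau A xi eta k phi ->
  soln P tau z aL false E (neg (fun i => pim P (am bB (psik k phi) i))) phi.
Proof.
move=> [[hp e] m0]; split; first exact: hp.
rewrite -[RHS]e; congr (sn P _); apply/funext => w; congr (_ - _).
have hg := vl2_grad fl z hp; have hpsi := vl2_psik k hp.
have hF := vl2_bB hpsi; have hA := vl2_am (env_coef hE) hpsi.
rewrite /= {2}/yop -[fun i w => dd tau z i phi w + ek R k i w]/(psik k phi) pimB //; last exact: sl2_dv.
rewrite (pim_mean0 m0) pim_dv // /yop; congr (_ - dv tau z _ w); rewrite am_cst.
apply/funext => i; apply/funext => v.
have eA : am A (psik k phi) i = fun w => cR Lam * (psik k phi i w - am bB (psik k phi) i w).
  apply/funext => u; rewrite am_bB /=.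
  have -> : psik k phi i u - (psik k phi i u - cR Lam^-1 * am A (psik k phi) i u) = cR Lam^-1 * am A (psik k phi) i u by ring.
  by rewrite mulrA -cRM mulfV ?gt_eqF // cR1 mul1r.
rewrite eA pimZ; last exact: sl2B.
rewrite pimB // /neg; congr (_ * (_ - _)).
rewrite /psik pimD //; last exact: vl2_ek.
by rewrite pim_dd // (pim_mean0 m0) /pim /ek cexpect_cst subrr addr0.
Qed.

Lemma soln_pim G f : vl2 P G -> soln P tau z aL false E (neg G) f ->
  soln P tau z aL false E (neg (fun i => pim P (G i))) (pim P f).
Proof.
move=> hG [hf e]; have hpf := sl2_pim hf; split; first exact: hpf.
have hnG := vl2_neg hG; have hy := sl2_yop fl z cL hnG hf.
have hs := sl2_sh fl 0 1 hf; have hs1 := sl2Z (cR E) hs.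
have hgr := vl2_grad fl z hf.
have hdd := sl2_dv fl z hgr; have hdG := sl2_dv fl z hG.
apply/eqP; rewrite eq_le sn_ge0 andbT -[leRHS]e; apply: le_trans (sn_pim (sl2B hs1 hy)).
rewrite le_eqVlt; apply/orP; left; apply/eqP; congr (sn P _).
rewrite /= pimB // pimZ //; apply/funext => w; rewrite pim_sh //; congr (_ - _).
have -> : yop tau z aL (neg G) f = fun w => (f w - cR Lam * dv tau z (fun i => dd tau z i f) w) + cR Lam * dv tau z G w.
  by apply/funext => v; rewrite -yop_cst.
have hZ1 := sl2Z (cR Lam) hdd; have hZ2 := sl2Z (cR Lam) hdG.
rewrite pimD //; last exact: sl2B.
rewrite pimB // !pimZ // !pim_dv // yop_cst; congr (_ - _ * dv tau z _ w + _).
by apply/funext => i; rewrite pim_dd.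
Qed.

Lemma Inv_cand k phi : corr P tau A xi eta k phi ->
  Inv_spec (fun=> vk k) (psiH k phi).
Proof.
move=> hc; have hp := hc.1.1; have hgr := vl2_grad fl z hp.
have e := fam_psiH k phi; set psi := psiH k phi in e *.
have hpsi : L2 P psi by apply/L2_fam; rewrite e; exact: vl2_psik.
split=> //; have hF : vl2 P (fam (bmul A Lam psi)) by rewrite fam_bmul; apply: vl2_bB; apply/L2_fam.
have [chi [hs _]] := soln_neg_ex hF.
apply/(Inv_char _ hpsi hs); first by apply/L2_fam; rewrite fam_vk; exact: vl2_ek.
have h1 := soln_pim hF hs; have h2 := corr_soln hc; rewrite -e -fam_bmul in h2.
have hnF : vl2 P (neg (fun i => pim P (fam (bmul A Lam psi) i))) by apply: vl2_neg => i; exact: sl2_pim.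
have h3 := soln_uniq fl (zz_unit xi) cL Lam4 L0 (ltW L0) E1 hnF h2 h1.
have hpc := h1.1; apply/eqP; rewrite eq_le vn_ge0 andbT.
have := vn_grad (sl2B hp hpc); rewrite h3 mulr0; apply: le_trans.
rewrite le_eqVlt; apply/orP; left; apply/eqP; congr (vn P _).
by apply/funext => i; apply/funext => w; rewrite e fam_vk ddB /psik; ring.
Qed.

(** [Inv] is known only through its equation, so uniqueness identifies it with grad phi + e_k: the
    difference D of two solutions satisfies |D|^2 <= |bD|^2 <= (1 - lam/Lam) |D|^2, because neither
    T nor the projection increases norms. *)
Lemma Inv_eq k phi : corr P tau A xi eta k phi ->
  L2 P (Defs.Inv P A Lam TOP (fun=> vk k)) /\
  vn P (fun i w => fam (Defs.Inv P A Lam TOP (fun=> vk k)) i w - psik k phi i w) = 0.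
Proof.
move=> hc; have h1 := Inv_cand hc.
have [h2 h3] : Inv_spec (fun=> vk k) (Defs.Inv P A Lam TOP (fun=> vk k)).
  by apply: epsilon_spec; exists (psiH k phi).
split=> //; move: h1; set psi1 := psiH k phi; move=> [h4 h5].
set psi2 := Defs.Inv _ _ _ _ _ in h2 h3 *.
have hv : L2 P (fun=> vk k) by apply/L2_fam; rewrite fam_vk; exact: vl2_ek.
have hF psi : L2 P psi -> vl2 P (fam (bmul A Lam psi)) by move=> h; rewrite fam_bmul; apply: vl2_bB; apply/L2_fam.
have [chi1 [hs1 _]] := soln_neg_ex (hF _ h4).
have [chi2 [hs2 _]] := soln_neg_ex (hF _ h2).
have n1 := (Inv_char hv h4 hs1).1 h5; have n2 := (Inv_char hv h2 hs2).1 h3.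
have e : fam psi1 = psik k phi by exact: fam_psiH.
rewrite -e; have f1 := (L2_fam psi1).1 h4; have f2 := (L2_fam psi2).1 h2; have fv := (L2_fam _).1 hv.
have hD := vl2B f2 f1.
set D := fun i w => _ in hD *.
have hs := solnB cL (vl2_neg (hF _ h2)) (vl2_neg (hF _ h4)) hs2 hs1.
have hd := vl2B (vl2_neg (hF _ h2)) (vl2_neg (hF _ h4)).
have [b1 _] := cst_soln_bound hd hs.
have b2 : vip P D D <= (1 - lam / Lam) * vip P D D.
  apply: le_trans (bB_contr hD).
  have -> : vip P (am bB D) (am bB D) = vip P (fun i w => neg (fam (bmul A Lam psi2)) i w - neg (fam (bmul A Lam psi1)) i w)
     (fun i w => neg (fam (bmul A Lam psi2)) i w - neg (fam (bmul A Lam psi1)) i w).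
    rewrite !fam_bmul /D amB; apply: eq_bigr => i _; apply: eq_Rintegral => w _.
    by rewrite /neg /cdot !cReD !cImD !cReN !cImN; ring.
  apply: le_trans b1.
  have hch := sl2B hs2.1 hs1.1; have hgr := vl2_grad fl z hch; have hpc := vl2_grad fl z (sl2_pim hch).
  apply: le_trans (_ : vip P (fun i => dd tau z i (pim P (fun w => chi2 w - chi1 w))) (fun i => dd tau z i (pim P (fun w => chi2 w - chi1 w))) <= _).
    rewrite -!vn_sqr lerXn2r ?nnegrE ?vn_ge0 //; apply: le_trans (vn_leB hD hpc) _.
    rewrite gerDl.
    have g1 : vl2 P (fun i w => fam psi1 i w - (dd tau z i (pim P chi1) w + fam (fun=> vk k) i w)).
      exact: (vl2B f1 (vl2D (vl2_grad fl z (sl2_pim hs1.1)) fv)).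
    have g2 : vl2 P (fun i w => fam psi2 i w - (dd tau z i (pim P chi2) w + fam (fun=> vk k) i w)).
      exact: (vl2B f2 (vl2D (vl2_grad fl z (sl2_pim hs2.1)) fv)).
    have e0 := vn_ae0 (vl2B g2 g1); rewrite le_eqVlt; apply/orP; left; apply/eqP.
    rewrite -[RHS]e0.
      congr (vn P _); apply/funext => i; apply/funext => w.
      rewrite pimB ?ddB; [rewrite /D; ring|exact: hs2.1|exact: hs1.1].
    have := vn_eq0 g1 n1; apply: filterS2 (vn_eq0 g2 n2) => w q1 q2 i.
    by rewrite q1 q2 subrr.
  apply: ler_sum => i _; rewrite -pim_dd // -!sn_sqr lerXn2r ?nnegrE ?sn_ge0 //.
  by apply: sn_pim; exact: hgr.
have th : 0 < lam / Lam by rewrite divr_gt0 // (env_lam0 hE).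
have b3 : vip P D D = 0.
  apply/eqP; rewrite eq_le vip_ge0 andbT -(pmulr_rle0 _ th); move: b2.
  exact: le_contr0.
by rewrite /vn b3 sqrtr0.
Qed.
End Resolvent.

(** * The corrector bound from hypothesis (H) *)

Section CorrectorNorm.
Context (R : realType) (dsp : measure_display) (Om : measurableType dsp)
        (P : probability Om R) (d : nat) (tau : Zd d -> int -> Om -> Om)
        (A : Om -> 'M[R]_d) (lam Lam : R).
Local Notation C := (complex R).
Hypothesis hE : Env P tau A lam Lam.
Hypothesis Lam4 : 4 * d%:R * Lam <= 1.
Let fl := env_flow hE.
Let L0 := env_Lam0 hE.
Let cL := cst_coef hE.
Context (i0 : 'I_d).
Definition rown (t : nat) (x : Zd d) : R := Num.sqrt (\sum_j DG Lam t j x ^+ 2).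
Section Fixed.
Context (xi : 'rV[R]_d) (eta : R) (eta0 : 0 < eta).
Local Notation z := (zz xi).
Local Notation E := (expR eta).
Local Notation H := (Om -> 'cV[C]_d).
Local Notation TOP := (Top P tau Lam (cxi xi) (cR eta)).
Let E1 : 1 < E. Proof. by rewrite expR_gt1. Qed.
Let E0 : 0 < E. Proof. exact: expR_gt0. Qed.
Definition supp (N : nat) : seq (pt d) :=
  [seq (boxpt b, (nat_of_ord t).+1%:Z) | t <- enum 'I_N, b <- enum {ffun 'I_d -> 'I_(2 * N + 1)}].
(* The kernel to which (H) is applied: its row [i0] is
   Lam e^{-eta t} e^{-i x.xi} grad G_Lam(x, t-1), so that the sum in (H) is a partial sum
   of the series representing the corrector. *)
Definition gker (N : nat) (y : pt d) : 'M[C]_d :=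
  if y \in supp N then
    \matrix_(i, j) (if i == i0 then cR (Lam * E^-1 ^+ `|y.2|) * (chr xi y.1 * cR (DG Lam (`|y.2|).-1 j y.1)) else 0)
  else 0.
Lemma supp_uniq N : uniq (supp N).
Proof.
rewrite allpairs_uniq ?enum_uniq // => -[t b] [t' b'] _ _ /= [h1 h2].
by rewrite (boxpt_inj h1) (ord_inj h2).
Qed.

Lemma mem_supp N (t : 'I_N) (b : {ffun 'I_d -> 'I_(2 * N + 1)}) : (boxpt b, (nat_of_ord t).+1%:Z) \in supp N.
Proof. by apply/allpairsP; exists (t, b); rewrite !mem_enum. Qed.
Lemma big_supp (V : nmodType) N (F : pt d -> V) :
  \sum_(y <- supp N) F y = \sum_(t < N) \sum_(b : {ffun 'I_d -> 'I_(2 * N + 1)}) F (boxpt b, (nat_of_ord t).+1%:Z).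
Proof.
rewrite /supp big_allpairs_dep big_enum /=; apply: eq_bigr => t _.
by rewrite big_enum.
Qed.

Lemma gker_row N (t : 'I_N) (b : {ffun 'I_d -> 'I_(2 * N + 1)}) (v : 'cV[C]_d) i :
  (gker N (boxpt b, (nat_of_ord t).+1%:Z) *m v) i ord0 =
  if i == i0 then cR (Lam * E^-1 ^+ t.+1) * (chr xi (boxpt b) * \sum_j cR (DG Lam t j (boxpt b)) * v j ord0) else 0.
Proof.
rewrite /gker mem_supp mxE; case: eqP => [->|/eqP/negPf hi].
  rewrite !mulr_sumr; apply: eq_bigr => j _; rewrite mxE eqxx /=; ring.
by rewrite big1 // => j _; rewrite mxE hi mul0r.
Qed.

Lemma msum1 (S : H -> H) N k w :
  Defs.msum P tau A Lam S [:: (gker N, supp N)] (vk R k) w =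
  \sum_(y <- supp N) gker N y *m PiM P (bmul A Lam (Defs.Inv P A Lam S (fun=> vk R k))) (tau y.1 (- y.2) w).
Proof.
rewrite /Defs.msum /= (_ : [seq y :: zs | y <- supp N, zs <- [:: [::]]] = [seq [:: y] | y <- supp N]).
  by rewrite big_map.
by elim: (supp N) => //= y s ->.
Qed.

Lemma PiM_entry (psi : H) j w : PiM P psi w j ord0 = pim P (fam psi j) w.
Proof. by rewrite /PiM /pim !mxE. Qed.
(** For k = 1 the ordered product in (H) has a single factor. With [gker], whose times start at 1 to
    match the shift by t + 1, the sum has in row [i0] a partial sum of the potential with source Pi
    b applied to the inverse, and zeros in the other rows. *)
Lemma msum_cht (S : H -> H) N k w i :
  Defs.msum P tau A Lam S [:: (gker N, supp N)] (vk R k) w i ord0 =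
  if i == i0 then cht tau Lam xi (fun j => pim P (fam (bmul A Lam (Defs.Inv P A Lam S (fun=> vk R k))) j)) E N w else 0.
Proof.
rewrite msum1 summxE big_supp.
case: eqP => [->|/eqP/negPf hi]; last first.
  by rewrite big1 // => t _; rewrite big1 // => b _; rewrite gker_row hi.
rewrite /cht; apply: eq_bigr => t _.
rewrite /Tk (@ksum_box _ _ _ _ tau xi _ _ N) => [|j x hx]; last exact: (DG_box Lam j (ltn_ord t) hx).
rewrite mulr_sumr; apply: eq_bigr => b _; rewrite gker_row eqxx /=; congr (_ * (_ * _)).
by apply: eq_bigr => j _; rewrite (tau_add fl) addr0 add0r PiM_entry.
Qed.

Lemma mnorm_cV (v : 'cV[C]_d) : mnorm v ^+ 2 = \sum_i cdot (v i ord0) (v i ord0).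
Proof. by rewrite mnorm_sqr; apply: eq_bigr => i _; rewrite big_ord1. Qed.
Lemma mnorm_vk k : mnorm (vk R k : 'cV[C]_d) = 1.
Proof.
have h : mnorm (vk R k : 'cV[C]_d) ^+ 2 = 1.
  rewrite mnorm_cV (bigD1 k) //= big1 ?addr0 => [|i /negPf hi]; rewrite mxE.
    by rewrite eqxx /cdot /= !mulr1 mulr0 addr0.
  by rewrite hi /cdot /= !mulr0 addr0.
by move/eqP: h; rewrite sqrf_eq1 => /orP[/eqP //|/eqP h]; have := mnorm_ge0 (vk R k : 'cV[C]_d); rewrite h ler0N1.
Qed.

Lemma cdot_CS (c v : 'I_d -> C) :
  cdot (\sum_j c j * v j) (\sum_j c j * v j) <= (\sum_j cdot (c j) (c j)) * (\sum_j cdot (v j) (v j)).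
Proof.
set S := \sum_j c j * v j; pose w j := cconj (c j) * S.
have eS x : cdot S x = \sum_j cdot (c j * v j) x.
  by rewrite /S; apply: (big_morph (fun y => cdot y x)) => [y y'|]; rewrite ?cdotDl // /cdot cRe0 cIm0 !mul0r addr0.
have e1 : \sum_j cdot (v j) (w j) = cdot S S.
  by rewrite eS; apply: eq_bigr => j _; rewrite cdot_conj.
have e2 : \sum_j cdot (w j) (w j) = (\sum_j cdot (c j) (c j)) * cdot S S.
  rewrite mulr_suml; apply: eq_bigr => j _.
  by rewrite /w /cdot !cReM !cImM cRe_conj cIm_conj; ring.
have h : (cdot S S) ^+ 2 <= (\sum_j cdot (v j) (v j)) * \sum_j cdot (w j) (w j).
  rewrite -e1; apply: quad_disc => [||t]; try by apply: sumr_ge0 => j _; exact: cdot_ge0.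
  apply: le_trans (_ : \sum_j cdot (v j + cR t * w j) (v j + cR t * w j) <= _).
    by apply: sumr_ge0 => j _; exact: cdot_ge0.
  rewrite !mulr_sumr -!big_split le_eqVlt; apply/orP; left; apply/eqP; apply: eq_bigr => j _ /=.
  by rewrite /cdot !cReD !cImD !cReM !cImM cRe_cR cIm_cR; ring.
have := cdot_ge0 S; rewrite le_eqVlt => /orP[/eqP <-|h0].
  by apply: mulr_ge0; apply: sumr_ge0 => j _; exact: cdot_ge0.
by rewrite -(ler_pM2r h0) -expr2; apply: le_trans h _; rewrite e2 mulrCA mulrA.
Qed.

Lemma mnorm_gker N (t : 'I_N) (b : {ffun 'I_d -> 'I_(2 * N + 1)}) (v : 'cV[C]_d) : mnorm v = 1 ->
  mnorm (gker N (boxpt b, (nat_of_ord t).+1%:Z) *m v) <= Lam * E^-1 ^+ t.+1 * rown t (boxpt b).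
Proof.
move=> hv; have c0 : 0 <= Lam * E^-1 ^+ t.+1 by rewrite mulr_ge0 ?(ltW L0) // exprn_ge0 // invr_ge0 ltW.
have c1 : 0 <= Lam * E^-1 ^+ t.+1 * rown t (boxpt b) by apply: mulr_ge0 => //; exact: sqrtr_ge0.
rewrite -ler_sqr ?nnegrE ?mnorm_ge0 //.
rewrite mnorm_cV (bigD1 i0) //= big1 ?addr0 => [|i /negPf hi]; rewrite gker_row; last first.
  by rewrite hi /cdot /= !mulr0 addr0.
rewrite eqxx [leRHS]exprMn /rown sqr_sqrtr; last by apply: sumr_ge0 => j _; exact: sqr_ge0.
have e (r : R) (x : C) : cdot (cR r * x) (cR r * x) = r ^+ 2 * cdot x x.
  by rewrite /cdot !cReM !cImM cRe_cR cIm_cR; ring.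
rewrite e (cdot_unit _ _ (chr_unit xi _)) ler_wpM2l ?sqr_ge0 //.
apply: le_trans (cdot_CS _ _) _.
have -> : \sum_j cdot (v j ord0) (v j ord0) = 1.
  by rewrite -mnorm_cV hv expr1n.
by rewrite mulr1; apply: ler_sum => j _; rewrite /cdot cRe_cR cIm_cR mulr0 addr0 expr2.
Qed.

Lemma gnorm_le (p K : R) N : 1 <= p -> 0 <= K ->
  \sum_(t < N) \sum_(b : {ffun 'I_d -> 'I_(2 * N + 1)}) (Lam * E^-1 ^+ t.+1 * rown t (boxpt b)) `^ p <= K `^ p ->
  Defs.gnorm p (gker N) (supp N) <= K.
Proof.
move=> p1 K0 hK; have p0 : 0 < p by apply: lt_le_trans p1.
rewrite /Defs.gnorm; set S := [set _ | _ in _].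
have hub : ubound S (K `^ p).
  move=> _ [v /= hv <-]; apply: le_trans hK; rewrite big_supp; apply: ler_sum => t _; apply: ler_sum => b _.
  apply: ge0_ler_powR; rewrite ?nnegrE ?mnorm_ge0 ?(ltW p0) //; last exact: mnorm_gker.
  rewrite mulr_ge0 ?sqrtr_ge0 // mulr_ge0 ?(ltW L0) // exprn_ge0 // invr_ge0 ltW //.
have hne : S !=set0 by exists (\sum_(y <- supp N) (mnorm (gker N y *m vk R i0)) `^ p); exists (vk R i0) => //=; exact: mnorm_vk.
have hs := ge_sup hne hub.
have hs0 : 0 <= sup S.
  have [y hy] := hne; apply: le_trans (_ : y <= _); last by apply: ub_le_sup hy; exists (K `^ p).
  by case: hy => v _ <-; apply: sumr_ge0 => ? _; exact: powR_ge0.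
have {1}-> : K = (K `^ p) `^ p^-1 by rewrite -powRrM mulfV ?gt_eqF // powRr1.
by apply: ge0_ler_powR; rewrite ?nnegrE ?invr_ge0 ?(ltW p0) ?powR_ge0.
Qed.

(** (H) and [gnorm_le] bound all partial sums of the potential by |Ck| K. The corrector coincides
    with their L2 limit, so it inherits the bound. *)
Lemma corr_norm (Ck p K : R) k phi : 1 <= p -> 0 <= K ->
  (forall N, hnorm P (Defs.msum P tau A Lam TOP [:: (gker N, supp N)] (vk R k)) <= Ck * Defs.gnorm p (gker N) (supp N)) ->
  (forall N, \sum_(t < N) \sum_(b : {ffun 'I_d -> 'I_(2 * N + 1)}) (Lam * E^-1 ^+ t.+1 * rown t (boxpt b)) `^ p <= K `^ p) ->
  corr P tau A xi eta k phi -> sn P phi <= `|Ck| * K.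
Proof.
move=> p1 K0 hH hK hc; have [hI hI2] := Inv_eq hE Lam4 eta0 hc.
set F := fun j => pim P (fam (bmul A Lam (Defs.Inv P A Lam TOP (fun=> vk R k))) j).
have hb : vl2 P (fam (bmul A Lam (Defs.Inv P A Lam TOP (fun=> vk R k)))).
  by rewrite fam_bmul; apply: (vl2_bB hE); apply/L2_fam.
have hF : vl2 P F by move=> j; exact: sl2_pim.
have [chi [hs [B hB]]] := soln_neg_ex hE Lam4 xi eta0 hF.
have bd N : sn P (cht tau Lam xi F E N) <= `|Ck| * K.
  have hN := sl2_cht hE xi eta N hF.
  have hM : L2 P (Defs.msum P tau A Lam TOP [:: (gker N, supp N)] (vk R k)).
    apply/L2_fam => i; rewrite /fam; under eq_fun do rewrite msum_cht.
    by case: eqP => _ //; exact: sl2_cst.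
  have gn : 0 <= Defs.gnorm p (gker N) (supp N) by exact: powR_ge0.
  apply: le_trans (_ : hnorm P (Defs.msum P tau A Lam TOP [:: (gker N, supp N)] (vk R k)) <= _).
    rewrite hnormE // /vn /sn ler_sqrt; last by exact: vip_ge0.
    rewrite /vip (bigD1 i0) //=; under eq_fun do rewrite msum_cht eqxx.
    by rewrite lerDl; apply: sumr_ge0 => i _; exact: sip_ge0.
  apply: le_trans (hH N) _; apply: le_trans (_ : `|Ck| * Defs.gnorm p (gker N) (supp N) <= _).
    by rewrite ler_wpM2r // ler_norm.
  by rewrite ler_wpM2l // gnorm_le.
(* Both functions solve the constant-coefficient equation, with sources that agree up to norm 0 by
   [Inv_eq]; the energy bound for the difference then has right-hand side 0. *)
have h1 : sn P (fun w => phi w - chi w) = 0.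
  have hc2 := corr_soln hE hc; have hp := hc.1.1.
  have hps := vl2_psik hE xi k hp.
  have hG1 : vl2 P (fun i => pim P (am (bB A Lam) (psik tau xi k phi) i)) by move=> i; apply: sl2_pim; exact: (vl2_bB hE).
  have hs2 := solnB hE cL (vl2_neg hG1) (vl2_neg hF) hc2 hs.
  have hd := vl2B (vl2_neg hG1) (vl2_neg hF).
  have [_] := cst_soln_bound hE Lam4 eta0 hd hs2.
  set V := vip _ _ _; have -> : V = 0.
    apply/eqP; rewrite eq_le vip_ge0 andbT; move/L2_fam: (hI) => hI'.
    have hD := vl2B hI' hps; have hbD := vl2_bB hE hD.
    apply: le_trans (_ : vip P (am (bB A Lam) (fun i w => fam (Defs.Inv P A Lam TOP (fun=> vk R k)) i w - psik tau xi k phi i w))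
        (am (bB A Lam) (fun i w => fam (Defs.Inv P A Lam TOP (fun=> vk R k)) i w - psik tau xi k phi i w)) <= _).
      apply: ler_sum => i _; rewrite -!sn_sqr lerXn2r ?nnegrE ?sn_ge0 //.
      apply: le_trans (sn_pim (hbD i)); rewrite le_eqVlt; apply/orP; left; apply/eqP.
      rewrite amB pimB; [|exact: (vl2_bB hE hI')|exact: (vl2_bB hE hps)].
      by congr (sn P _); apply/funext => w; rewrite /neg /F fam_bmul; ring.
    by apply: le_trans (bB_contr hE hD) _; rewrite -vn_sqr hI2 expr0n mulr0.
  rewrite mulr0 pmulr_rle0 ?subr_gt0 ?exprn_egt1 // => h.
  by rewrite /sn; apply/eqP; rewrite sqrtr_eq0.
have hp := hc.1.1; have hch := hs.1.
apply: le_trans (sn_leB hp hch) _; rewrite h1 addr0 -subr_le0.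
apply: (lim0_le _ (geo_cvg0 eta0 B)) => N; rewrite lerBlDr.
have hN := sl2_cht hE xi eta N hF.
apply: le_trans (sn_leB hch hN) _; rewrite addrC (snBC hch hN) lerD //.
Qed.
End Fixed.

End CorrectorNorm.

(** * Discrete Landau interpolation and the p-norm of the gradient kernel *)

Section Landau.
Context (R : realType) (d : nat).
(** First-order Taylor expansion: after n steps the increment is n (g 1 - g 0) up to n^2 b. *)
Lemma landau1 (g : nat -> R) (b : R) n :
  (forall k, `|(g k.+2 - g k.+1) - (g k.+1 - g k)| <= b) ->
  n%:R * `|g 1%N - g 0%N| <= `|g n.+1 - g 1%N| + n%:R ^+ 2 * b.
Proof.
move=> h; have b0 : 0 <= b by apply: le_trans (h 0%N).
have h1 k : `|(g k.+1 - g k) - (g 1%N - g 0%N)| <= k%:R * b.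
  elim: k => [|k IH]; first by rewrite subrr normr0 mul0r.
  have -> : (g k.+2 - g k.+1) - (g 1%N - g 0%N) =
    ((g k.+2 - g k.+1) - (g k.+1 - g k)) + ((g k.+1 - g k) - (g 1%N - g 0%N)) by ring.
  apply: le_trans (ler_normD _ _) _; rewrite -natr1 mulrDl mul1r addrC; exact: lerD.
have h2 : `|(g n.+1 - g 1%N) - n%:R * (g 1%N - g 0%N)| <= n%:R ^+ 2 * b.
  elim: n => [|n IH]; first by rewrite subrr mul0r subrr normr0 expr0n mul0r.
  have -> : (g n.+2 - g 1%N) - n.+1%:R * (g 1%N - g 0%N) =
    ((g n.+1 - g 1%N) - n%:R * (g 1%N - g 0%N)) + ((g n.+2 - g n.+1) - (g 1%N - g 0%N)).
    by rewrite -natr1; ring.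
  apply: le_trans (ler_normD _ _) _; apply: le_trans (lerD IH (h1 n.+1)) _.
  rewrite -mulrDl ler_wpM2r // -natr1; have := ler0n R n; move: (n%:R : R) => m m0.
  rewrite !expr2; nra.
have -> : n%:R * `|g 1%N - g 0%N| = `|n%:R * (g 1%N - g 0%N)| by rewrite normrM normr_nat.
have -> : n%:R * (g 1%N - g 0%N) = (g n.+1 - g 1%N) - ((g n.+1 - g 1%N) - n%:R * (g 1%N - g 0%N)) by ring.
by apply: le_trans (ler_normB _ _) _; rewrite lerD2l.
Qed.

Lemma znorm_le (x y : Zd d) : (forall i, (`|x ord0 i| <= `|y ord0 i|)%N) -> znorm R x <= znorm R y.
Proof.
move=> h; rewrite ler_sqrt; last by apply: sumr_ge0 => i _; exact: sqr_ge0.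
apply: ler_sum => i _; rewrite -[leLHS]real_normK ?num_real // -[leRHS]real_normK ?num_real //.
rewrite lerXn2r ?nnegrE // -!intr_norm ler_int; have := h i; move: (x ord0 i) (y ord0 i) => a b.
by clear; lia.
Qed.

Lemma dec_anti (g Lam : R) t (x y : Zd d) : 0 <= g -> 0 <= Lam ->
  znorm R x <= znorm R y -> dec g Lam t y <= dec g Lam t x.
Proof.
move=> g0 L0 h; rewrite /dec ler_expR !mulNr lerN2 ler_wpM2l //.
have w0 : 0 < Lam * t%:R + 1 by rewrite ltr_wpDl // mulr_ge0 // ler0n.
have zx := znorm_ge0 R x.
rewrite le_min !ge_min h /=; apply/orP; right.
rewrite ler_pM2r ?invr_gt0 // lerXn2r ?nnegrE //; exact: le_trans h.
Qed.

(* Moving away from the origin along a coordinate axis keeps the weight below its value at [x]. *)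
Lemma landau (f e : Zd d -> R) (A B : R) n i : (0 < n)%N ->
  (forall x, `|f x| <= A * e x) -> (forall x, `|dgr2 f x i i| <= B * e x) ->
  0 <= A -> 0 <= B -> (forall x y, znorm R x <= znorm R y -> e y <= e x) ->
  forall x, `|f (x + evec i) - f x| <= (2 * A / n%:R + n%:R * B) * e x.
Proof.
move=> n0 hf hg A0 B0 he x.
have nR : 0 < n%:R :> R by rewrite ltr0n.
suff [g [e1 h1 h2 h3]] : exists g : nat -> R, [/\ `|f (x + evec i) - f x| = `|g 1%N - g 0%N|,
    `|g n.+1| <= A * e x, `|g 1%N| <= A * e x & forall k, `|(g k.+2 - g k.+1) - (g k.+1 - g k)| <= B * e x].
  have := landau1 n h3; rewrite -e1 => h4.
  rewrite -(ler_pM2l nR); apply: le_trans h4 _.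
  have h5 := le_trans (ler_normB (g n.+1) (g 1%N)) (lerD h1 h2).
  apply: le_trans (lerD h5 (lexx _)) _; rewrite le_eqVlt; apply/orP; left; apply/eqP.
  by field; rewrite gt_eqF.
have [x0|x0] := lerP 0 (x ord0 i).
- have hz k : znorm R x <= znorm R (x + evec i *+ k).
    apply: znorm_le => j; rewrite mxE mulmxnE evecE.
    have [<-|_] := eqVneq i j; last by rewrite mul0rn addr0.
    move: x0; rewrite /= mulr1n; move: (x ord0 i) => m.
    have -> : 1%R *+ k = k%:Z by rewrite -[RHS]intz pmulrn.
    by clear; lia.
  have S k : x + evec i *+ k.+1 = x + evec i *+ k + evec i by rewrite mulrSr addrA.
  exists (fun k => f (x + evec i *+ k)); split.
  - by rewrite mulr1n mulr0n addr0.
  - by apply: le_trans (hf _) _; rewrite ler_wpM2l // he // hz.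
  - by apply: le_trans (hf _) _; rewrite ler_wpM2l // he // hz.
  - move=> k; have := hg (x + evec i *+ k.+1); rewrite /dgr2 -S !S addrK => h.
    by apply: le_trans h _; rewrite ler_wpM2l // -S he.
- have hz k : znorm R x <= znorm R (x - evec i *+ k).
    apply: znorm_le => j; rewrite !mxE mulmxnE evecE.
    have [<-|_] := eqVneq i j; last by rewrite mul0rn subr0.
    move: x0; rewrite /= mulr1n; move: (x ord0 i) => m.
    have -> : 1%R *+ k = k%:Z by rewrite -[RHS]intz pmulrn.
    by clear; lia.
  have S k : x - evec i *+ k.+1 = x - evec i *+ k - evec i by rewrite mulrSr opprD addrA.
  exists (fun k => f (x + evec i - evec i *+ k)).
  have S' k : x + evec i - evec i *+ k.+1 = x - evec i *+ k by rewrite mulrSr opprD (addrC (- _)) addrA addrK.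
  split.
  - by rewrite S' mulr0n !subr0 distrC.
  - by rewrite S'; apply: le_trans (hf _) _; rewrite ler_wpM2l // he // hz.
  - by rewrite S'; apply: le_trans (hf _) _; rewrite ler_wpM2l // he // hz.
  - move=> k; rewrite !S'; have := hg (x - evec i *+ k); rewrite /dgr2 subrK -S => h.
    have -> : x + evec i - evec i *+ k = x - evec i *+ k + evec i by rewrite addrAC.
    have -> : f (x - evec i *+ k.+1) - f (x - evec i *+ k) - (f (x - evec i *+ k) - f (x - evec i *+ k + evec i)) =
       f (x - evec i *+ k + evec i) - f (x - evec i *+ k) - (f (x - evec i *+ k) - f (x - evec i *+ k.+1)) by ring.
    by apply: le_trans h _; rewrite ler_wpM2l // he.
Qed.

(** Landau's inequality with n between sqrt(t + 1) and twice that value balances the size of f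
    against its second differences. *)
Lemma grad_bound (f : Zd d -> R) (C g Lam : R) t : 0 < C -> 0 < g -> 0 < Lam ->
  (forall x, `|f x| <= C / rt R t ^+ d * dec g Lam t x) ->
  (forall x i, `|dgr2 f x i i| <= C / rt R t ^+ d.+2 * dec g Lam t x) ->
  forall x i, `|f (x + evec i) - f x| <= 4 * C / rt R t ^+ d.+1 * dec g Lam t x.
Proof.
move=> C0 g0 L0 h1 h2 x i.
have r0 := rt_gt0 R t; have r1 := rt_ge1 R t.
pose n := (Num.trunc (rt R t)).+1.
have n1 : rt R t < n%:R by exact: truncnS_gt.
have n2 : n%:R <= 2 * rt R t.
  have /andP[h _] := truncn_itv (ltW r0); rewrite /n -natr1; lra.
have nR : 0 < n%:R :> R by rewrite ltr0n.
have A0 : 0 <= C / rt R t ^+ d by rewrite divr_ge0 ?(ltW C0) // exprn_ge0 // ltW.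
have B0 : 0 <= C / rt R t ^+ d.+2 by rewrite divr_ge0 ?(ltW C0) // exprn_ge0 // ltW.
apply: le_trans (landau (e := dec g Lam t) (isT : 0 < n)%N h1 (fun x => h2 x i) A0 B0 _ x) _.
  by move=> u v; apply: dec_anti; exact: ltW.
rewrite ler_wpM2r ?(ltW (dec_gt0 _ _ _ _)) //.
have h3 : 2 * (C / rt R t ^+ d) / n%:R <= 2 * (C / rt R t ^+ d) / rt R t.
  apply: ler_wpM2l; first by rewrite mulr_ge0.
  by rewrite lef_pV2 ?posrE // ltW.
have h4 : n%:R * (C / rt R t ^+ d.+2) <= 2 * rt R t * (C / rt R t ^+ d.+2) by rewrite ler_wpM2r.
apply: le_trans (lerD h3 h4) _; rewrite le_eqVlt; apply/orP; left; apply/eqP.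
by rewrite !exprS; move: (rt R t) (rt R t ^+ d) r0 (exprn_gt0 d r0) => r rd r0 rd0; field; rewrite !gt_eqF.
Qed.

Lemma const_annealed (M : 'M[R]_d) (l L : R) : cls l L M ->
  annealed (fun _ : unit -> R => True) (fun f => f tt) (fun (_ : Zd d) (_ : int) (w : unit) => w) (fun _ => M) l L.
Proof. by move=> h; split=> //; case. Qed.
Lemma cls_scalar (Lam : R) : 0 < Lam -> 4 * d%:R * Lam <= 1 -> cls (Lam / 2) (2 * Lam) (Lam%:M : 'M[R]_d).
Proof.
move=> L0 L4 v; rewrite mulv_scalar.
have -> : sqn (fun i => Lam * v i) = Lam ^+ 2 * sqn v.
  by rewrite /sqn mulr_sumr; apply: eq_bigr => i _; rewrite exprMn.
have -> : dotv v (fun i => Lam * v i) = Lam * sqn v.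
  by rewrite /sqn /dotv mulr_sumr; apply: eq_bigr => i _; rewrite expr2 mulrCA.
have s0 := sqn_ge0 v; split.
  rewrite mulrA -mulrDl ler_wpM2r // expr2.
  have -> : 2 * d%:R * (Lam * Lam) = Lam / 2 * (4 * d%:R * Lam) by field.
  have : Lam / 2 * (4 * d%:R * Lam) <= Lam / 2 * 1 by rewrite ler_wpM2l // divr_ge0 // ltW.
  lra.
by rewrite ler_wpM2r // exprMn ler_peMl ?sqr_ge0 // expr2; lra.
Qed.

Lemma geo2 (q : R) N : 0 <= q -> q < 1 ->
  \sum_(j < 2 * N + 1) q ^+ `|(nat_of_ord j)%:Z - N%:Z| <= 2 / (1 - q).
Proof.
move=> q0 q1; have q2 : 0 < 1 - q by rewrite subr_gt0.
rewrite -(big_mkord xpredT (fun j => q ^+ `|j%:Z - N%:Z|)) ler_pdivlMr //.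
suff -> : (\sum_(0 <= j < 2 * N + 1) q ^+ `|j%:Z - N%:Z|) * (1 - q) = 1 + q - 2 * q ^+ N.+1.
  have := exprn_ge0 N.+1 q0; lra.
elim: N => [|N IH]; first by rewrite big_nat1 subrr expr0 expr1; ring.
have -> : (2 * N.+1 + 1 = (2 * N + 1).+2)%N by lia.
rewrite big_nat_recl // big_nat_recr //=.
have -> : \sum_(0 <= i < 2 * N + 1) q ^+ `|i.+1%:Z - N.+1%:Z| = \sum_(0 <= i < 2 * N + 1) q ^+ `|i%:Z - N%:Z|.
  by apply: eq_bigr => j _; congr (_ ^+ _); lia.
rewrite subn0.
have -> : `|(2 * N + 1).+1%:Z - N.+1%:Z|%N = N.+1 by lia.
by rewrite !mulrDl IH !exprS; ring.
Qed.

Lemma expRN_le (s : R) : 0 < s -> 1 / (1 - expR (- s)) <= (1 + s) / s.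
Proof.
move=> s0; have h := expR_ge1Dx s; have s1 : 0 < 1 + s by rewrite addr_gt0.
have h1 : expR (- s) <= 1 / (1 + s) by rewrite expRN div1r lef_pV2 ?posrE ?expR_gt0.
have h2 : s / (1 + s) <= 1 - expR (- s).
  have -> : s / (1 + s) = 1 - 1 / (1 + s) by field; rewrite gt_eqF.
  by move: h1; lra.
have h3 : 0 < s / (1 + s) by rewrite divr_gt0.
have -> : (1 + s) / s = 1 / (s / (1 + s)) by field; rewrite !gt_eqF.
by rewrite !div1r lef_pV2 ?posrE //; apply: lt_le_trans h2.
Qed.

(** For r = sqrt(t + 1), min(|x|, |x|^2/w) >= |x|/r - 1. The weight is therefore dominated by a
    product of one-dimensional geometric weights of range about r, and each of the d factors sums to
    a multiple of r. *)
Lemma dec_box_sum (g Lam : R) : (0 < d)%N -> 0 < g -> 0 < Lam -> Lam <= 1 ->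
  exists2 C : R, 0 < C & forall t N,
   \sum_(b : {ffun 'I_d -> 'I_(2 * N + 1)}) dec g Lam t (boxpt b) <= C * rt R t ^+ d.
Proof.
move=> d0 g0 L0 L1; have dR : 0 < d%:R :> R by rewrite ltr0n.
pose c := 2 + 2 * d%:R / g; have c0 : 0 < c by rewrite addr_gt0 // divr_gt0 // mulr_gt0.
exists (expR g * c ^+ d) => [|t N]; first by rewrite mulr_gt0 ?expR_gt0 // exprn_gt0.
have r0 := rt_gt0 R t; have r1 := rt_ge1 R t; have r2 := rt_sqr R t.
move: (rt R t) r0 r1 r2 => r r0 r1 r2.
pose s := g / (d%:R * r); have s0 : 0 < s by rewrite divr_gt0 // mulr_gt0.
pose q := expR (- s).
have w0 : 0 < Lam * t%:R + 1 by rewrite ltr_wpDl // mulr_ge0 ?ler0n // ltW.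
have wr : Lam * t%:R + 1 <= r ^+ 2.
  by rewrite r2 -natr1 lerD2r -[leRHS]mul1r ler_wpM2r.
have hx (b : {ffun 'I_d -> 'I_(2 * N + 1)}) : dec g Lam t (boxpt b) <=
    expR g * \prod_i q ^+ `|(nat_of_ord (b i))%:Z - N%:Z|.
  set x := boxpt b; have zx := znorm_ge0 R x.
  have e : \prod_i q ^+ `|(nat_of_ord (b i))%:Z - N%:Z| = expR (- s * \sum_i (`|x ord0 i|%N)%:R).
    rewrite mulr_sumr expR_sum; apply: eq_bigr => i _.
    by rewrite /q -expRM_natr mxE.
  rewrite e -expRD ler_expR.
  have h1 : \sum_i (`|x ord0 i|%N)%:R <= d%:R * znorm R x.
    have -> : d%:R * znorm R x = \sum_(i < d) znorm R x by rewrite sumr_const card_ord mulr_natl.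
    apply: ler_sum => i _.
    rewrite -ler_sqr ?nnegrE ?ler0n // znorm_sqr (bigD1 i) //=.
    have -> : (`|x ord0 i|%N)%:R ^+ 2 = ((x ord0 i)%:~R : R) ^+ 2.
      by rewrite natr_absz -[RHS]real_normK ?num_real // intr_norm.
    by rewrite lerDl sumr_ge0 // => j _; exact: sqr_ge0.
  have h2 : s * \sum_i (`|x ord0 i|%N)%:R <= g * (znorm R x / r).
    apply: le_trans (_ : s * (d%:R * znorm R x) <= _); first by rewrite ler_wpM2l // ltW.
    by rewrite le_eqVlt; apply/orP; left; apply/eqP; rewrite /s; field; rewrite !gt_eqF.
  have h3 : znorm R x / r - 1 <= Num.min (znorm R x) (znorm R x ^+ 2 / (Lam * t%:R + 1)).
    rewrite le_min; apply/andP; split.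
      have : znorm R x / r <= znorm R x by rewrite ler_pdivrMr // ler_peMr.
      lra.
    apply: le_trans (_ : znorm R x ^+ 2 / r ^+ 2 <= _); last first.
      by rewrite ler_wpM2l ?sqr_ge0 // lef_pV2 ?posrE ?exprn_gt0.
    have -> : znorm R x ^+ 2 / r ^+ 2 = (znorm R x / r) ^+ 2 by rewrite exprMn exprVn.
    have : 0 <= znorm R x / r by rewrite divr_ge0 // ltW.
    by move: (znorm R x / r) => y y0; have := sqr_ge0 (y - 1); rewrite !expr2; nra.
  have := ler_wpM2l (ltW g0) h3; rewrite !mulNr; move: h2; clear; lra.
apply: le_trans (ler_sum _ (fun b _ => hx b)) _.
rewrite -mulr_sumr -mulrA ler_wpM2l ?expR_ge0 //.
rewrite -(bigA_distr_bigA (fun (i : 'I_d) (j : 'I_(2 * N + 1)) => q ^+ `|(nat_of_ord j)%:Z - N%:Z|)) /=.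
have q1 : q < 1 by rewrite expR_lt1 oppr_lt0.
have S0 : 0 <= \sum_(j < 2 * N + 1) q ^+ `|(nat_of_ord j)%:Z - N%:Z|.
  by apply: sumr_ge0 => j _; rewrite exprn_ge0 // expR_ge0.
have cr0 : 0 <= c * r by rewrite mulr_ge0 // ltW.
rewrite -exprMn prodr_const card_ord lerXn2r ?nnegrE //.
apply: le_trans (geo2 N (expR_ge0 _) q1) _.
have -> : 2 / (1 - q) = 2 * (1 / (1 - q)) by rewrite mulrA mulr1.
apply: le_trans (ler_wpM2l _ (expRN_le s0)) _; first by [].
have -> : 2 * ((1 + s) / s) = 2 + 2 * (d%:R / g) * r by rewrite /s; field; rewrite !gt_eqF.
rewrite /c; have : 0 <= d%:R / g by rewrite divr_ge0 // ltW.
by rewrite -(mulrA 2 d%:R); move: (d%:R / g) => u u0; nra.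
Qed.

(** With S = sqrt eta, the increments of min(sqrt t, 1/S) dominate t^(-1/2) up to times of order
    1/eta and telescope to 1/S. Later t^(-1/2) <= S, and the geometric series costs 1/eta. *)
Lemma time_sum (eta : R) N : 0 < eta -> eta <= 1 ->
  \sum_(t < N) (expR eta)^-1 ^+ t.+1 / rt R t <= 3 / Num.sqrt eta.
Proof.
move=> e0 e1; set q := (expR eta)^-1; set S := Num.sqrt eta.
have S0 : 0 < S by rewrite sqrtr_gt0.
have SS : S * S = eta by rewrite -expr2 sqr_sqrtr // ltW.
have q0 : 0 < q by rewrite invr_gt0 expR_gt0.
have q1 : q < 1 by rewrite invf_lt1 ?expR_gt0 // expR_gt1.
pose m (t : nat) : R := Num.min (Num.sqrt t%:R) S^-1.
have mono t : m t <= m t.+1.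
  rewrite /m le_min !ge_min lexx orbT andbT; apply/orP; left.
  by rewrite ler_sqrt ?ler0n // ler_nat.
have pt t : q ^+ t.+1 / rt R t <= 2 * (m t.+1 - m t) + S * q ^+ t.+1.
  have r0 := rt_gt0 R t; have p0 : 0 < q ^+ t.+1 by rewrite exprn_gt0.
  have p1 : q ^+ t.+1 <= 1 by rewrite exprn_ile1 // ltW.
  have [h|h] := lerP (rt R t) S^-1.
    have h2 : Num.sqrt (t%:R : R) <= rt R t by rewrite ler_sqrt ?ler0n // ler_nat.
    have -> : m t.+1 = rt R t by rewrite /m; apply/min_idPl.
    have -> : m t = Num.sqrt t%:R by rewrite /m; apply/min_idPl; exact: le_trans h.
    have h3 : (rt R t) ^+ 2 - (Num.sqrt t%:R) ^+ 2 = 1.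
      by rewrite rt_sqr sqr_sqrtr ?ler0n // -natr1; ring.
    have s0 : 0 <= Num.sqrt (t%:R : R) by exact: sqrtr_ge0.
    apply: le_trans (_ : 2 * (rt R t - Num.sqrt t%:R) <= _); last first.
      by rewrite lerDl mulr_ge0 // ltW.
    rewrite ler_pdivrMr //; apply: le_trans p1 _.
    by move: (rt R t) (Num.sqrt t%:R) h2 h3 s0 r0 => a b; rewrite !expr2; clear; nra.
  have h2 : (rt R t)^-1 <= S by rewrite -[leRHS]invrK lef_pV2 ?posrE ?invr_gt0 // ltW.
  have := mono t; have : q ^+ t.+1 / rt R t <= S * q ^+ t.+1 by rewrite mulrC ler_pM2r.
  by clear; lra.
apply: le_trans (ler_sum _ (fun t _ => pt (nat_of_ord t))) _.
rewrite big_split /= -!mulr_sumr.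
have h1 : \sum_(t < N) (m t.+1 - m t) <= S^-1.
  have -> : \sum_(t < N) (m t.+1 - m t) = m N - m 0%N.
    elim: {pt} N => [|n IH]; first by rewrite big_ord0 subrr.
    by rewrite big_ord_recr /= IH; ring.
  have : m N <= S^-1 by rewrite /m ge_min lexx orbT.
  have : 0 <= m 0%N by rewrite /m le_min sqrtr_ge0 invr_ge0 ltW.
  by clear; lra.
have h2 : \sum_(t < N) q ^+ t.+1 <= eta^-1.
  have qq : 0 < 1 - q by rewrite subr_gt0.
  have h : \sum_(t < N) q ^+ t.+1 = q * (1 - q ^+ N) / (1 - q).
    elim: N {h1} => [|n IH]; first by rewrite big_ord0 expr0 subrr mulr0 mul0r.
    by rewrite big_ord_recr /= IH !exprS; field; rewrite gt_eqF.
  rewrite h; apply: le_trans (_ : q / (1 - q) <= _).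
    rewrite ler_pM2r ?invr_gt0 // ler_piMr ?(ltW q0) //.
    by rewrite gerBl exprn_ge0 // ltW.
  rewrite ler_pdivrMr // mulrC ler_pdivlMr //.
  have h3 : q * (1 + eta) <= 1.
    rewrite /q mulrC ler_pdivrMr ?expR_gt0 // mul1r; exact: expR_ge1Dx.
  lra.
have h3 : S * (\sum_(t < N) q ^+ t.+1) <= S^-1.
  apply: le_trans (ler_wpM2l (ltW S0) h2) _; rewrite -SS invfM mulrA mulfV ?gt_eqF // mul1r //.
by rewrite -[3 / S]/(3 * S^-1); move: h1 h3; clear; lra.
Qed.

(** The kernel is at most a constant times X = e^(-eta t) t^(-(d+1)/2) times the weight, and X <= 1,
    so its p-th power is at most a constant times X itself. Summing over x leaves e^(-eta t)
    t^(-1/2). The exponent p acts only through the later p-th root, which produces eta^(-1/(2p)). *)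
Lemma kernel_bound (Lam p : R) : (0 < d)%N -> 0 < Lam -> 4 * d%:R * Lam <= 1 -> 1 <= p ->
  exists2 C : R, 0 < C & forall (eta : R) N, 0 < eta -> eta <= 1 ->
    \sum_(t < N) \sum_(b : {ffun 'I_d -> 'I_(2 * N + 1)})
      (Lam * (expR eta)^-1 ^+ t.+1 * rown Lam t (boxpt b)) `^ p <= C / Num.sqrt eta.
Proof.
move=> d0 L0 L4 p1; have dR : 1 <= d%:R :> R by rewrite ler1n.
have L1 : Lam <= 1 by move: (Lam) L0 L4 => l l0; nra.
have [g g0 hap] := apriori d0 (lexx (1 : R)).
have [|||||C C0 hC] := hap Lam (Lam / 2) (2 * Lam); rewrite ?mulr1 //; try lra.
have hM := const_annealed (cls_scalar L0 L4).
have gr t (x : Zd d) j : `|DG Lam t j x| <= 4 * C / rt R t ^+ d.+1 * dec g Lam t x.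
  have := @grad_bound (GLam Lam t) C g Lam t C0 g0 L0 _ _ x j; apply.
    by move=> y; case: (hC _ _ _ _ _ hM t y).
  by move=> y i; case: (hC _ _ _ _ _ hM t y) => _; exact.
have [S S0 hS] := dec_box_sum d0 g0 L0 L1.
pose c1 := Lam * (Num.sqrt d%:R * (4 * C)).
have c10 : 0 <= c1 by rewrite mulr_ge0 ?(ltW L0) // mulr_ge0 ?sqrtr_ge0 // mulr_ge0 // ltW.
exists (c1 `^ p * S * 3 + 1) => [|eta N e0 e1].
  by rewrite ltr_wpDl // mulr_ge0 // mulr_ge0 ?powR_ge0 // ltW.
have E0 := expR_gt0 eta; have q0 : 0 < (expR eta)^-1 by rewrite invr_gt0.
have q1 : (expR eta)^-1 <= 1 by rewrite invf_le1 // ltW // expR_gt1.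
have bd (t : 'I_N) (b : {ffun 'I_d -> 'I_(2 * N + 1)}) :
   (Lam * (expR eta)^-1 ^+ t.+1 * rown Lam t (boxpt b)) `^ p <=
   c1 `^ p * ((expR eta)^-1 ^+ t.+1 / rt R t ^+ d.+1) * dec g Lam t (boxpt b).
  have r0 := rt_gt0 R t; have r1 := rt_ge1 R t; have dc := dec_gt0 g Lam t (boxpt b).
  pose X := (expR eta)^-1 ^+ t.+1 / rt R t ^+ d.+1 * dec g Lam t (boxpt b).
  have rd : 0 < rt R t ^+ d.+1 by rewrite exprn_gt0.
  have X0 : 0 < X by rewrite mulr_gt0 // divr_gt0 // exprn_gt0.
  have X1 : X <= 1.
    rewrite mulr_ile1 ?(ltW dc) ?divr_ge0 ?exprn_ge0 ?(ltW q0) ?(ltW r0) //.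
      rewrite ler_pdivrMr // mul1r; apply: le_trans (_ : 1 <= _); first by rewrite exprn_ile1 // ltW.
      by rewrite exprn_ege1.
    rewrite /dec -expR0 ler_expR mulNr oppr_le0 mulr_ge0 ?(ltW g0) // le_min znorm_ge0 /=.
    rewrite divr_ge0 ?sqr_ge0 // addr_ge0 // mulr_ge0 ?ler0n // ltW //.
  have hr : rown Lam t (boxpt b) <= Num.sqrt d%:R * (4 * C / rt R t ^+ d.+1 * dec g Lam t (boxpt b)).
    have y0 : 0 <= 4 * C / rt R t ^+ d.+1 * dec g Lam t (boxpt b).
      by apply: le_trans (gr t (boxpt b) (Ordinal d0)).
    rewrite /rown -(ger0_norm y0) -sqrtr_sqr -sqrtrM ?ler0n // ler_sqrt; last by rewrite mulr_ge0 ?ler0n ?sqr_ge0.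
    rewrite mulr_natl -[X in _ *+ X]card_ord -sumr_const; apply: ler_sum => j _.
    by rewrite -[leLHS]real_normK ?num_real // lerXn2r ?nnegrE.
  apply: le_trans (_ : (X * c1) `^ p <= _).
    apply: ge0_ler_powR; rewrite ?nnegrE ?(le_trans _ p1) //.
    - by rewrite mulr_ge0 ?sqrtr_ge0 // mulr_ge0 ?(ltW L0) // exprn_ge0 // ltW.
    - by rewrite mulr_ge0 // ltW.
    have c2 : 0 <= Lam * (expR eta)^-1 ^+ t.+1 by rewrite mulr_ge0 ?(ltW L0) // exprn_ge0 // ltW.
    apply: le_trans (ler_wpM2l c2 hr) _; rewrite /X /c1 le_eqVlt; apply/orP; left; apply/eqP; ring.
  apply: le_trans (ge1r_powRZ _ c10 p1) _; first by rewrite X0.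
  by rewrite /X mulrC mulrA.
apply: le_trans (_ : \sum_(t < N) c1 `^ p * S * ((expR eta)^-1 ^+ t.+1 / rt R t) <= _).
  apply: ler_sum => t _; apply: le_trans (ler_sum _ (fun b _ => bd t b)) _.
  have r0 := rt_gt0 R t; have qt : 0 < (expR eta)^-1 ^+ t.+1 by rewrite exprn_gt0.
  rewrite -mulr_sumr; apply: le_trans (ler_wpM2l _ (hS t N)) _.
    by rewrite mulr_ge0 ?powR_ge0 // divr_ge0 ?exprn_ge0 ?(ltW r0) // ltW.
  rewrite (exprS (rt R t)) le_eqVlt; apply/orP; left; apply/eqP.
  move: ((expR eta)^-1 ^+ t.+1) => Q; have := exprn_gt0 d r0; move: (rt R t) (rt R t ^+ d) r0 => r rd r0 rd0.
  by field; rewrite !gt_eqF.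
rewrite -mulr_sumr; apply: le_trans (ler_wpM2l _ (time_sum N e0 e1)) _.
  by rewrite mulr_ge0 ?powR_ge0 // ltW.
have s0 : 0 < (Num.sqrt eta)^-1 by rewrite invr_gt0 sqrtr_gt0.
by rewrite mulrA ler_pM2r // lerDl.
Qed.
End Landau.

Section CorrectorBound.
Context (R : realType) (dsp : measure_display) (Om : measurableType dsp)
        (P : probability Om R) (d : nat) (tau : Zd d -> int -> Om -> Om)
        (A : Om -> 'M[R]_d) (lam Lam p0 C1 : R).
Hypothesis hE : Env P tau A lam Lam.
Hypothesis Lam4 : 4 * d%:R * Lam <= 1.
Hypothesis d0 : (0 < d)%N.
Hypothesis p01 : 1 < p0.
Hypothesis C10 : 0 < C1.
Hypothesis hH : HypH P tau A Lam p0 C1.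
Lemma env_Lam1 : Lam <= 1.
Proof.
have dR : 1 <= d%:R :> R by rewrite ler1n.
by have := env_Lam0 hE; move: Lam4; move: (Lam) => l h l0; nra.
Qed.

Lemma corr_bound : exists2 C : R, 0 < C & forall (xi : 'rV[R]_d) (eta : R) k phi,
  0 < eta -> eta < Lam -> corr P tau A xi eta k phi -> sn P phi <= C * eta `^ (- (2 * p0)^-1).
Proof.
have [Ck hk] := hH (isT : (0 < 1)%N).
have p1 := ltW p01; have p00 : 0 < p0 by apply: lt_trans p01.
have L0 := env_Lam0 hE.
have [C3 C30 h3] := kernel_bound d0 L0 Lam4 p1.
exists (`|Ck| * C3 `^ p0^-1 + 1) => [|xi eta k phi e0 eL hc].
  by rewrite ltr_wpDl // mulr_ge0 ?powR_ge0.
have e1 : eta <= 1 by apply: le_trans (ltW eL) env_Lam1.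
have s0 : 0 < Num.sqrt eta by rewrite sqrtr_gt0.
pose K := (C3 / Num.sqrt eta) `^ p0^-1.
have q0 : 0 <= C3 / Num.sqrt eta by rewrite divr_ge0 ?sqrtr_ge0 // ltW.
have hK : K `^ p0 = C3 / Num.sqrt eta by rewrite /K -powRrM mulVf ?gt_eqF // powRr1.
have eK : K = C3 `^ p0^-1 * eta `^ (- (2 * p0)^-1).
  rewrite /K powRM ?invr_ge0 ?sqrtr_ge0 ?(ltW C30) //; congr (_ * _).
  rewrite -powR12_sqrt ?(ltW e0) // -powRN -powRrM; congr (_ `^ _).
  by field; rewrite gt_eqF.
have := @corr_norm _ _ _ P d tau A lam Lam hE Lam4 (Ordinal d0) xi eta e0 Ck p0 K k phi p1 (powR_ge0 _ _) _ _ hc.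
(* (H) is used for T itself, hence [false], with p1 = p0 and a real frequency, for which the
   condition on the imaginary part is trivial. *)
move=> hn; apply: le_trans (hn _ _) _ => [N|N|].
- have := hk (cxi xi) (cR eta) _ _ false p0 _ [:: (gker Lam (Ordinal d0) xi eta N, supp d N)] erefl _ (vk R k).
  rewrite mnorm_vk mulr1 /= big_ord1 /=; apply.
  + by rewrite e0 eL.
  + rewrite big1 ?sqrtr0 ?mulr_ge0 ?sqrtr_ge0 ?(ltW C10) // => i _.
    by rewrite mxE /= expr0n.
  + by rewrite p1 lexx.
  + move=> gs; rewrite inE => /eqP -> /=; split; first exact: supp_uniq.
    by move=> y; rewrite /gker; case: ifP => // _; rewrite eqxx.
- by rewrite hK; exact: h3.
rewrite eK mulrA ler_wpM2r ?powR_ge0 // lerDl //.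
Qed.
End CorrectorBound.

(** * Dependence of the effective matrix on the frequencies *)

Lemma sqr_le_sum (R : realFieldType) (x y z : R) : 0 <= z -> 0 <= x -> 0 <= y -> z <= y + x ->
  z ^+ 2 <= 2 * y ^+ 2 + 2 * x ^+ 2.
Proof.
move=> z0 x0 y0 h; have h2 : z ^+ 2 <= (y + x) ^+ 2 by rewrite lerXn2r ?nnegrE ?addr_ge0.
by apply: le_trans h2 _; have := sqr_ge0 (y - x); rewrite !expr2; nra.
Qed.

Section Flux.
Context (R : realType) (dsp : measure_display) (Om : measurableType dsp)
        (P : probability Om R) (d : nat) (tau : Zd d -> int -> Om -> Om)
        (A : Om -> 'M[R]_d) (lam Lam : R).
Local Notation C := (complex R).
Hypothesis hE : Env P tau A lam Lam.
Hypothesis Lam4 : 4 * d%:R * Lam <= 1.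
Hypothesis d0 : (0 < d)%N.
Let fl := env_flow hE.
Let L0 := env_Lam0 hE.
Let l0 := env_lam0 hE.
Let cA := env_coef hE.
Let L1 : Lam <= 1 := env_Lam1 hE Lam4 d0.
Lemma expR_ge1 (x : R) : 0 <= x -> 1 <= expR x.
Proof. by move=> h; rewrite -expR0 ler_expR. Qed.
Lemma vn_am F : vl2 P F -> vn P (am A F) <= Lam * vn P F.
Proof.
move=> hF; have h := am_up cA hF; have hA := vl2_am cA hF.
have h1 := le_trans (ler_norm _) (vip_CS hF hA).
rewrite -vn_sqr in h.
have h2 : vn P (am A F) ^+ 2 <= Lam * (vn P F * vn P (am A F)).
  by apply: le_trans h _; rewrite ler_wpM2l // ltW.
have := vn_ge0 P (am A F); rewrite le_eqVlt => /orP[/eqP <-|n0].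
  by rewrite mulr_ge0 ?vn_ge0 // ltW.
by rewrite -(ler_pM2r n0) -expr2 -mulrA.
Qed.

Lemma vip_am_le F : vl2 P F -> vip P F (am A F) <= Lam * vip P F F.
Proof.
move=> hF; have hA := vl2_am cA hF.
apply: le_trans (le_trans (ler_norm _) (vip_CS hF hA)) _.
rewrite -vn_sqr expr2 mulrCA ler_wpM2l ?vn_ge0 // vn_am //.
Qed.

Lemma vip_ek k : vip P (@ek R _ Om d k) (@ek R _ Om d k) = 1.
Proof.
rewrite /vip (bigD1 k) //= big1 ?addr0 => [|i /negPf hi].
  rewrite /ek eqxx sip_cstr ?cexpect_cst; last exact: sl2_cst.
  by rewrite /cdot cRe1 cIm1 mulr1 mulr0 addr0.
by apply: Rint_eq0 => w; rewrite /ek hi /cdot cRe0 cIm0 !mul0r addr0.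
Qed.

Lemma sn_le_vn (F : 'I_d -> Om -> C) i : vl2 P F -> sn P (F i) <= vn P F.
Proof.
move=> hF; rewrite ler_sqrt ?vip_ge0 // /vip (bigD1 i) //= lerDl.
by apply: sumr_ge0 => j _; exact: sip_ge0.
Qed.

Definition B0 : R := 1 + Num.sqrt (Lam / lam).
(** Energy estimate with source e_k. Dropping the nonnegative mass term makes the bound uniform in
    xi and eta. *)
Lemma corr_grad xi eta k phi : 0 < eta -> corr P tau A xi eta k phi ->
  vn P (psik tau xi k phi) <= B0.
Proof.
move=> e0 hc; have [hs _] := hc; have hp := hs.1.
have hk := vl2_ek (R := R) P (d := d) k; have hg := vl2_grad fl (zz xi) hp.
have E1 : 1 <= expR eta by apply: expR_ge1; exact: ltW.
have h := soln_energy hE cA Lam4 L0 hk hs.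
have h1 := am_lo cA hg; have h2 := vip_am_le hk; rewrite vip_ek mulr1 in h2.
have h3 : 0 <= (expR eta ^+ 2 - 1) * sip P phi phi.
  by rewrite mulr_ge0 ?sip_ge0 // subr_ge0 exprn_ege1.
have h4 : vip P (fun i => dd tau (zz xi) i phi) (fun i => dd tau (zz xi) i phi) <= Lam / lam.
  rewrite ler_pdivlMr // mulrC; apply: le_trans h1 _; apply: le_trans h2; apply: le_trans h.
  by rewrite lerDl.
apply: le_trans (vnD hg hk) _; rewrite addrC /B0 lerD //.
  by rewrite /vn vip_ek sqrtr1.
by rewrite ler_sqrt // divr_ge0 // ltW.
Qed.

Lemma B00 : 0 <= B0. Proof. by rewrite addr_ge0 ?sqrtr_ge0. Qed.
Definition qent (xi : 'rV[R]_d) k phi i : C := cexpect P (am A (psik tau xi k phi) i).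
Lemma q_entry xi eta i k : 0 < eta ->
  qhom P tau A xi eta i k = qent xi k (fun w => Phi P tau A xi eta w ord0 k) i.
Proof.
move=> e0; have [[hp _] _] := Phi_corr hE Lam4 xi e0 k.
set phi := fun w => _ in hp *; have hg := vl2_grad fl (zz xi) hp; have hk := vl2_ek (R := R) P (d := d) k.
rewrite /qent /psik amD.
rewrite cexpectD; [|exact: (vl2_am cA hg i)|exact: (vl2_am cA hk i)].
rewrite addrC /qhom !mxE; congr (_ + _).
  by rewrite am_ek; congr cexpect; apply/funext => w; rewrite mxE.
by congr cexpect; apply/funext => w; rewrite mxE; apply: eq_bigr => j _; rewrite !mxE.
Qed.

Lemma expR_le4 (x : R) : x <= 1 -> expR x <= 4.
Proof.
move=> x1; have h : expR x <= expR 1 by rewrite ler_expR.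
apply: le_trans h _; have h2 := @expR_le1D2 R (1 / 2).
have n2 : `|1 / 2 : R| = 1 / 2 by rewrite ger0_norm.
rewrite n2 in h2; have {}h2 := h2 (lexx _).
have h0 := expR_ge0 (1 / 2 : R).
have -> : expR 1 = expR (1 / 2) * expR (1 / 2) :> R by rewrite -expRD; congr expR; field.
by move: (expR _) h0 h2 => y; nra.
Qed.

Lemma expR_diff (x y : R) : x <= 1 -> y <= 1 -> `|expR x - expR y| <= 4 * `|x - y|.
Proof.
have hh (a b : R) : a <= b -> b <= 1 -> expR b - expR a <= 4 * (b - a).
  move=> ab b1; have h := expR_ge1Dx (a - b); rewrite expRD expRN in h.
  have hb := expR_gt0 b.
  have h2 : expR b * (1 + (a - b)) <= expR a by rewrite mulrC -ler_pdivlMr.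
  have : expR b * (b - a) <= 4 * (b - a) by rewrite ler_wpM2r ?subr_ge0 // expR_le4.
  by move: h2; rewrite mulrDr mulr1 mulrBr mulrBr; lra.
move=> x1 y1; have [xy|xy] := lerP x y.
  rewrite distrC !ger0_norm ?subr_ge0 ?ler_expR //; exact: hh.
by rewrite !ger0_norm ?subr_ge0 ?ler_expR ?(ltW xy) //; apply: hh => //; exact: ltW.
Qed.

Lemma q_diff_arith (lV VA a g S D b x y z s1 : R) : lV <= VA -> VA + a <= g + S -> 0 <= a ->
  g <= D * x -> S <= 16 * s1 + 64 * y -> s1 <= b * z ->
  0 <= D -> 0 <= b -> 0 <= x -> 0 <= y -> 0 <= z -> lV <= (D + 64 + 16 * b) * (x + y + z).
Proof.
move=> h1 h2 h3 h4 h5 h6 D0 b0 x0 y0 z0.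
have := mulr_ge0 D0 y0; have := mulr_ge0 D0 z0; have := mulr_ge0 b0 x0; have := mulr_ge0 b0 y0.
lra.
Qed.

(* Two correctors are compared through the energy of their difference, which solves
   the corrector equation up to a residual that is linear in the parameter increments. *)
Lemma q_diff : exists2 K : R, 0 < K & forall xi1 xi2 eta1 eta2 k phi1 phi2 (m dl : R),
  0 < eta1 -> eta1 < Lam -> 0 < eta2 -> eta2 < Lam -> 0 <= dl ->
  (forall j, cdot (zz xi1 j - zz xi2 j) (zz xi1 j - zz xi2 j) <= dl ^+ 2) ->
  corr P tau A xi1 eta1 k phi1 -> corr P tau A xi2 eta2 k phi2 -> sn P phi1 <= m -> sn P phi2 <= m ->
  forall i, cmod (qent xi1 k phi1 i - qent xi2 k phi2 i) ^+ 2 <=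
     K * (dl ^+ 2 * m ^+ 2 + `|eta1 - eta2| * m ^+ 2 + dl * m).
Proof.
have dR : 0 <= d%:R :> R by exact: ler0n.
pose K1 := lam^-1 * (d%:R + 64 + 16 * (d%:R * B0)).
have K10 : 0 <= K1.
  by rewrite mulr_ge0 ?invr_ge0 ?(ltW l0) // !addr_ge0 // mulr_ge0 // mulr_ge0 // B00.
exists (2 * K1 + 2 * d%:R + 1) => [|xi1 xi2 eta1 eta2 k phi1 phi2 m dl e10 e1L e20 e2L dl0 hdl hc1 hc2 hm1 hm2 i].
  by rewrite ltr_wpDl // addr_ge0 // mulr_ge0.
have m0 : 0 <= m by apply: le_trans hm1; exact: sn_ge0.
have [[hp1 hs1] hz1] := hc1; have [[hp2 hs2] hz2] := hc2.
have hW := sl2B hp1 hp2; set W := fun w => phi1 w - phi2 w in hW.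
(* The change of the derivative of phi2 under the change of frequency, of size dl times the norm of
   phi2; it acts as a source for the difference W. *)
pose G (i : 'I_d) (w : Om) : C := dd tau (zz xi1) i phi2 w - dd tau (zz xi2) i phi2 w.
have hG : vl2 P G by apply: vl2B; apply: vl2_grad.
have hps2 := vl2_psik hE xi2 k hp2; have hF2 := vl2_am cA hps2.
set F2 := am A (psik tau xi2 k phi2) in hF2.
pose D w := dv tau (zz xi2) F2 w - dv tau (zz xi1) F2 w.
have hD : sl2 P D by apply: sl2B; exact: sl2_dv.
pose E1 := expR eta1; pose E2 := expR eta2.
(* What remains when both equations are written with the first parameters: the divergence at the
   other frequency, controlled through the bounded flux, and the change of exp(eta), controlled
   through the norm of phi2. *)
pose r w : C := pim P D w - cR (E1 - E2) * phi2 (tau 0 1 w).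
have hs2' := sl2_sh fl 0 1 hp2; have hs1' := sl2_sh fl 0 1 hp1.
have hr : sl2 P r by apply: sl2B; [exact: sl2_pim|exact: sl2Z].
have E10 : 0 <= E1 by exact: expR_ge0.
have hk := vl2_ek (R := R) P (d := d) k.
have hy1 := sl2_yop fl (zz xi1) cA hk hp1; have hy2 := sl2_yop fl (zz xi2) cA hk hp2.
have hG1 : vl2 P (fun i w => dd tau (zz xi1) i W w + G i w) by apply: vl2D => //; exact: vl2_grad.
have ed : (fun i w => dd tau (zz xi1) i W w + G i w) = fun i w => psik tau xi1 k phi1 i w - psik tau xi2 k phi2 i w.
  by apply/funext => j; apply/funext => w; rewrite /G /W ddB /psik; ring.
have hps1 := vl2_psik hE xi1 k hp1.
have res : sn P (fun w => cR E1 * W (tau 0 1 w) - r w - cproj P true (yop tau (zz xi1) A G W) w) = 0.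
  have -> : (fun w => cR E1 * W (tau 0 1 w) - r w - cproj P true (yop tau (zz xi1) A G W) w) =
    fun w => (cR E1 * phi1 (tau 0 1 w) - cproj P true (yop tau (zz xi1) A (ek R k) phi1) w)
      - (cR E2 * phi2 (tau 0 1 w) - cproj P true (yop tau (zz xi2) A (ek R k) phi2) w).
    have -> : yop tau (zz xi1) A G W = fun w => (yop tau (zz xi1) A (ek R k) phi1 w - yop tau (zz xi2) A (ek R k) phi2 w) - D w.
      apply/funext => w; rewrite {1}/yop ed amB dvB /D /F2 /yop /psik /W; ring.
    rewrite /= (pimB (sl2B hy1 hy2) hD) (pimB hy1 hy2); apply/funext => w.
    rewrite /r /W cRD cRN.
    move: (pim P D w) (pim P _ w) (pim P _ w) (phi1 _) (phi2 _) (cR E1) (cR E2) => ? ? ? ? ? ? ?; ring.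
  have hA1 := sl2B (sl2Z (cR E1) hs1') (sl2_proj true hy1); have hA2 := sl2B (sl2Z (cR E2) hs2') (sl2_proj true hy2).
  apply/eqP; rewrite eq_le sn_ge0 andbT; apply: le_trans (snB hA1 hA2) _.
  by rewrite hs1 hs2 addr0.
have en := energy_res fl (zz_unit xi1) cA Lam4 L0 hG hW hr E10 res.
have hgW := vl2_grad fl (zz xi1) hW.
have lo := am_lo cA hgW.
have nW : sn P W <= 2 * m by apply: le_trans (snB hp1 hp2) _; rewrite mulr_natl mulr2n; exact: lerD.
have sG j : sip P (G j) (G j) <= dl ^+ 2 * m ^+ 2.
  have -> : G j = fun w => (zz xi1 j - zz xi2 j) * phi2 (tau (evec j) 0 w).
    by apply/funext => w; rewrite /G /dd; ring.
  have -> : sip P (fun w => (zz xi1 j - zz xi2 j) * phi2 (tau (evec j) 0 w)) (fun w => (zz xi1 j - zz xi2 j) * phi2 (tau (evec j) 0 w))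
    = cdot (zz xi1 j - zz xi2 j) (zz xi1 j - zz xi2 j) * sip P phi2 phi2.
    rewrite -(sip_sh fl (evec j) 0 hp2 hp2) /sip -RintegralZl //; last by apply: sip_int; exact: (sl2_sh fl (evec j) 0).
    by apply: eq_Rintegral => w _; rewrite /cdot !cReM !cImM; ring.
  apply: ler_pM; rewrite ?cdot_ge0 ?sip_ge0 //.
  by rewrite -sn_sqr lerXn2r ?nnegrE ?sn_ge0.
have vG : vip P G G <= d%:R * (dl ^+ 2 * m ^+ 2).
  apply: le_trans (ler_sum _ (fun j _ => sG j)) _.
  by rewrite sumr_const card_ord mulr_natl.
have nF2 : vn P F2 <= Lam * B0.
  by apply: le_trans (vn_am hps2) _; rewrite ler_wpM2l ?(ltW L0) // (corr_grad e20 hc2).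
have nD : sn P D <= dl * (d%:R * (Lam * B0)).
  have -> : D = fun w => \sum_j (cconj (zz xi2 j) - cconj (zz xi1 j)) * F2 j (tau (- evec j) 0 w).
    by apply/funext => w; rewrite /D /dv -sumrB; apply: eq_bigr => j _; rewrite /dds; ring.
  have hj j : sl2 P (fun w => (cconj (zz xi2 j) - cconj (zz xi1 j)) * F2 j (tau (- evec j) 0 w)).
    by apply: sl2Z; exact: (sl2_sh fl (- evec j) 0 (hF2 j)).
  have bj j : sn P (fun w => (cconj (zz xi2 j) - cconj (zz xi1 j)) * F2 j (tau (- evec j) 0 w)) <= dl * (Lam * B0).
    have hh := sl2_sh fl (- evec j) 0 (hF2 j).
    have -> : sn P (fun w => (cconj (zz xi2 j) - cconj (zz xi1 j)) * F2 j (tau (- evec j) 0 w)) =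
       Num.sqrt (cdot (zz xi1 j - zz xi2 j) (zz xi1 j - zz xi2 j)) * sn P (F2 j).
      rewrite -(sn_sh fl (- evec j) 0 (hF2 j)) /sn -sqrtrM ?cdot_ge0 //; congr Num.sqrt.
      rewrite /sip -RintegralZl //; last exact: sip_int.
      by apply: eq_Rintegral => w _; rewrite /cdot !cReM !cImM !cReD !cImD !cReN !cImN !cRe_conj !cIm_conj; ring.
    apply: ler_pM; rewrite ?sqrtr_ge0 ?sn_ge0 //.
      by rewrite -(ger0_norm dl0) -sqrtr_sqr ler_sqrt ?sqr_ge0.
    exact: le_trans (sn_le_vn j hF2) nF2.
  have -> : dl * (d%:R * (Lam * B0)) = \sum_(j < d) dl * (Lam * B0).
    by rewrite sumr_const card_ord -mulr_natl; ring.
  have hsum (s : seq 'I_d) : sl2 P (fun w => \sum_(j <- s) (cconj (zz xi2 j) - cconj (zz xi1 j)) * F2 j (tau (- evec j) 0 w)).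
    exact: (sl2_sum _ (K := fun j w => (cconj (zz xi2 j) - cconj (zz xi1 j)) * F2 j (tau (- evec j) 0 w))).
  elim: (index_enum _) => [|j s IH].
    rewrite big_nil (sn_ae0 (hsum [::])) //; apply: aeW => w; by rewrite big_nil.
  rewrite big_cons; apply: le_trans (lerD (bj j) IH); under eq_fun do rewrite big_cons.
  exact: snD.
have e12 : `|E1 - E2| <= 4 * `|eta1 - eta2|.
  by apply: expR_diff; apply: ltW; apply: lt_le_trans L1.
have E13 : E1 <= 4 by apply: expR_le4; apply: ltW; apply: lt_le_trans L1.
have nr : sn P r <= dl * (d%:R * (Lam * B0)) + 4 * `|eta1 - eta2| * m.
  apply: le_trans (snB (sl2_pim hD) (sl2Z _ hs2')) _; apply: lerD.
    exact: le_trans (sn_pim hD) nD.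
  rewrite (snR _ hs2') (sn_sh fl 0 1 hp2); apply: ler_pM => //; exact: sn_ge0.
have vW : vip P (fun i => dd tau (zz xi1) i W) (fun i => dd tau (zz xi1) i W) <=
    K1 * (dl ^+ 2 * m ^+ 2 + `|eta1 - eta2| * m ^+ 2 + dl * m).
  rewrite /K1 -mulrA ler_pdivlMl //.
  have a1 : 0 <= (E1 ^+ 2 - 1) * sip P W W.
    by rewrite mulr_ge0 ?sip_ge0 // subr_ge0 exprn_ege1 // expR_ge1 // ltW.
  have a2 : vip P G (am A G) <= d%:R * (dl ^+ 2 * m ^+ 2).
    apply: le_trans (vip_am_le hG) _; apply: le_trans (_ : 1 * vip P G G <= _); last by rewrite mul1r.
    by rewrite ler_wpM2r // vip_ge0.
  have a3 : 2 * E1 * sn P W * sn P r <= 2 * 4 * (2 * m) * (dl * (d%:R * (Lam * B0)) + 4 * `|eta1 - eta2| * m).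
    have h4 : 0 <= 2 * E1 by rewrite mulr_ge0.
    have h5 : 2 * E1 <= 2 * 4 by rewrite ler_wpM2l.
    apply: ler_pM => //; first by rewrite mulr_ge0 ?sn_ge0.
    - exact: sn_ge0.
    - by apply: ler_pM => //; exact: sn_ge0.
  have a4 : dl * (d%:R * (Lam * B0)) <= dl * (d%:R * B0).
    by rewrite ler_wpM2l // ler_wpM2l // ler_piMl // B00.
  have a5 := ler_wpM2l m0 a4.
  have a6 : 0 <= d%:R * B0 by rewrite mulr_ge0 // B00.
  apply: (@q_diff_arith _ _ _ _ _ _ _ _ _ _ (m * (dl * (d%:R * (Lam * B0)))) lo en a1 a2) => //.
  - by apply: le_trans a3 _; rewrite le_eqVlt; apply/orP; left; apply/eqP; ring.
  - by apply: le_trans a5 _; rewrite le_eqVlt; apply/orP; left; apply/eqP; ring.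
  - by rewrite mulr_ge0 ?sqr_ge0.
  - by rewrite mulr_ge0 ?sqr_ge0.
  - by rewrite mulr_ge0.
have nd : vn P (fun i w => psik tau xi1 k phi1 i w - psik tau xi2 k phi2 i w) ^+ 2 <=
    2 * vip P (fun i => dd tau (zz xi1) i W) (fun i => dd tau (zz xi1) i W) + 2 * vip P G G.
  rewrite -ed -!vn_sqr; have h := vnD hgW hG.
  have := vn_ge0 P (fun i => dd tau (zz xi1) i W); have := vn_ge0 P G.
  have := vn_ge0 P (fun i w => dd tau (zz xi1) i W w + G i w).
  by move=> x0 y0 z0; exact: (sqr_le_sum x0 y0 z0 h).
have hdp := vl2B hps1 hps2.
rewrite /qent -cexpectB; [|exact: (vl2_am cA hps1 i)|exact: (vl2_am cA hps2 i)].
have hAd := vl2_am cA hdp.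
have q1 : cmod (cexpect P (fun w => am A (psik tau xi1 k phi1) i w - am A (psik tau xi2 k phi2) i w)) <=
   vn P (fun i w => psik tau xi1 k phi1 i w - psik tau xi2 k phi2 i w).
  have e : (fun w => am A (psik tau xi1 k phi1) i w - am A (psik tau xi2 k phi2) i w) =
     am A (fun i w => psik tau xi1 k phi1 i w - psik tau xi2 k phi2 i w) i by rewrite amB.
  rewrite e; apply: le_trans (cexpect_le (hAd i)) _; apply: le_trans (sn_le_vn i hAd) _.
  by apply: le_trans (vn_am hdp) _; rewrite ler_piMl // vn_ge0.
apply: le_trans (_ : vn P (fun i w => psik tau xi1 k phi1 i w - psik tau xi2 k phi2 i w) ^+ 2 <= _).
  by rewrite lerXn2r ?nnegrE ?cmod_ge0 ?vn_ge0.
apply: le_trans nd _; apply: le_trans (lerD (ler_wpM2l _ vW) (ler_wpM2l _ vG)) _ => //.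
have b1 : 0 <= `|eta1 - eta2| * m ^+ 2 by rewrite mulr_ge0 ?sqr_ge0.
have b2 : 0 <= dl * m by rewrite mulr_ge0.
have b3 : 0 <= dl ^+ 2 * m ^+ 2 by rewrite mulr_ge0 ?sqr_ge0.
move: b1 b2 b3 dR; clear; move: (_ * m ^+ 2) (dl * m) (_ * m ^+ 2) (d%:R) K1 => x y z D K x0 y0 z0 D0.
have := mulr_ge0 D0 x0; have := mulr_ge0 D0 y0; lra.
Qed.
End Flux.

Section Dyadic.
Context (R : realType).
Local Notation C := (complex R).
Lemma powRXn (x s : R) n : 0 <= x -> (x ^+ n) `^ s = (x `^ s) ^+ n.
Proof.
move=> x0; rewrite -(powR_mulrn n x0) -powRrM mulrC powRrM powR_mulrn //; exact: powR_ge0.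
Qed.

Lemma powR_le1 (x s : R) : 0 <= x -> x <= 1 -> 0 <= s -> x `^ s <= 1.
Proof.
move=> x0 x1 s0; apply: le_trans (_ : 1 `^ s <= _); last by rewrite powR1.
by apply: ge0_ler_powR; rewrite ?nnegrE.
Qed.

(** Increments over factors of 2 are summable along Lam 2^(-n-1), and every smaller e lies within a
    factor 2 of a point of that sequence. K does not depend on f, so the rate is uniform over all
    frequencies and entries. *)
Lemma dyadic (Lam B s : R) : 0 < Lam -> 0 <= B -> 0 < s -> exists2 K : R, 0 <= K &
  forall f : R -> R, (forall e1 e2, 0 < e2 -> e2 <= e1 -> e1 <= 2 * e2 -> e1 < Lam ->
     `|f e1 - f e2| <= B * e1 `^ s) ->
  exists L, forall e, 0 < e -> e < Lam -> `|f e - L| <= K * e `^ s.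
Proof.
move=> L0 B0 s0; pose r : R := 2^-1 `^ s.
have r0 : 0 < r by rewrite powR_gt0 // invr_gt0.
have r1 : r < 1.
  by rewrite /r /powR gt_eqF ?invr_gt0 // expR_lt1 pmulr_rlt0 // ln_lt0 // invr_gt0 ltr0n /= invf_lt1 ?ltr1n.
have r2 : 0 < 1 - r by rewrite subr_gt0.
exists (B * (1 + (1 - r)^-1)) => [|f hf]; first by rewrite mulr_ge0 // addr_ge0 // invr_ge0 ltW.
pose h (n : nat) : R := Lam / 2 * 2^-1 ^+ n.
have h0 n : 0 < h n by rewrite mulr_gt0 ?divr_gt0 // exprn_gt0 // invr_gt0.
have hS n : h n = 2 * h n.+1 by rewrite /h exprS; field.
have hL n : h n < Lam.
  have : 2^-1 ^+ n <= 1 :> R by rewrite exprn_ile1 // ?invr_ge0 // invf_le1 // ler1n.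
  rewrite /h => hh; apply: le_lt_trans (_ : Lam / 2 * 1 < _); last by lra.
  by rewrite ler_wpM2l // divr_ge0 // ltW.
pose b : R := B * (Lam / 2) `^ s; have b0 : 0 <= b by rewrite mulr_ge0 // powR_ge0.
have hb n : B * h n `^ s = b * r ^+ n.
  rewrite /h powRM; [|by rewrite divr_ge0 // ltW|by rewrite exprn_ge0 // invr_ge0].
  by rewrite powRXn ?invr_ge0 // mulrA.
pose c := b / (1 - r); have c0 : 0 <= c by rewrite divr_ge0 // ltW.
have cb : c * (1 - r) = b by rewrite /c divfK // gt_eqF.
pose u n := f (h n).
have inc n : `|u n - u n.+1| <= b * r ^+ n.
  rewrite -hb; apply: hf => //; last by rewrite -hS.
  by rewrite [leRHS]hS ler_peMl ?ler1n // ltW.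
have inc2 n m : `|u n - u (n + m)%N| <= c * r ^+ n - c * r ^+ (n + m).
  elim: m => [|m IH]; first by rewrite addn0 !subrr normr0.
  have -> : u n - u (n + m.+1)%N = (u n - u (n + m)%N) + (u (n + m)%N - u (n + m).+1) by rewrite addnS; ring.
  apply: le_trans (ler_normD _ _) _; apply: le_trans (lerD IH (inc _)) _.
  by rewrite addnS exprS -cb le_eqVlt; apply/orP; left; apply/eqP; ring.
have mn n m : u m - c * r ^+ m <= u n + c * r ^+ n.
  have p k : 0 <= c * r ^+ k by rewrite mulr_ge0 // exprn_ge0 // ltW.
  have [/subnKC e|/ltnW/subnKC e] := leqP n m.
    by have := inc2 n (m - n)%N; rewrite e ler_norml => /andP[]; have := p m; have := p n; clear; lra.
  by have := inc2 m (n - m)%N; rewrite e ler_norml => /andP[]; have := p m; have := p n; clear; lra.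
(* The limit is the supremum of the lower bounds u m - c r^m. Every u n + c r^n is an upper bound of
   this set, which gives the rate at once. *)
pose S := [set x | exists m, x = u m - c * r ^+ m].
have Sne : S !=set0 by exists (u 0%N - c * r ^+ 0); exists 0%N.
have Sub n : ubound S (u n + c * r ^+ n) by move=> _ [m ->]; exact: mn.
exists (sup S) => e e0 eL.
have up n : sup S <= u n + c * r ^+ n by exact: ge_sup.
have lo n : u n - c * r ^+ n <= sup S by apply: ub_le_sup; [exists (u 0%N + c * r ^+ 0)|exists n].
have [n0 hn0] : exists n, h n <= e.
  pose n := Num.trunc (Lam / e); exists n.
  have h1 : Lam / e < n.+1%:R by exact: truncnS_gt.
  have h2 : Lam < n.+1%:R * e by rewrite -ltr_pdivrMr.
  have h3 : n.+1%:R <= 2 ^+ n :> R by rewrite -natrX ler_nat ltn_expl.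
  have h4 : Lam <= 2 ^+ n * e by apply: le_trans (ltW h2) _; rewrite ler_wpM2r // ltW.
  have p2 : 0 < 2 ^+ n :> R by rewrite exprn_gt0.
  rewrite /h exprVn ler_pdivrMr // mulrC; lra.
have := ex_minnP (ex_intro (fun n => h n <= e) n0 hn0) => -[n hn hmin].
have e2 : e <= 2 * h n.
  case: n hn hmin => [|n] hn hmin; first by rewrite /h expr0 mulr1; lra.
  by rewrite -hS leNgt; apply/negP => /ltW /hmin; rewrite ltnn.
have p1 := hf _ _ (h0 n) hn e2 eL.
have p2 : `|u n - sup S| <= c * r ^+ n.
  by rewrite ler_norml; apply/andP; have := up n; have := lo n; clear; split; lra.
have p3 : c * r ^+ n <= B * (1 - r)^-1 * e `^ s.
  have -> : c * r ^+ n = B / (1 - r) * h n `^ s by rewrite /c mulrAC -hb mulrAC.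
  have Br : 0 <= B / (1 - r) by rewrite divr_ge0 // ltW.
  apply: ler_wpM2l => //.
  by apply: ge0_ler_powR; rewrite ?nnegrE ?(ltW s0) ?(ltW (h0 n)) ?(ltW e0).
have -> : f e - sup S = (f e - u n) + (u n - sup S) by ring.
apply: le_trans (ler_normD _ _) _; apply: le_trans (lerD p1 (le_trans p2 p3)) _.
by rewrite -mulrDl mulrDr mulr1.
Qed.

Lemma cmod_le_sum (x : C) : cmod x <= `|cRe x| + `|cIm x|.
Proof.
rewrite -ler_sqr ?nnegrE ?cmod_ge0 ?addr_ge0 // cmod_sqr /cdot -!expr2.
rewrite sqrrD !real_normK ?num_real // addrAC lerDl mulrn_wge0 // mulr_ge0 //.
Qed.

Lemma cRe_le (x : C) : `|cRe x| <= cmod x.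
Proof.
rewrite -ler_sqr ?nnegrE ?cmod_ge0 // cmod_sqr /cdot -!expr2 real_normK ?num_real //.
by rewrite lerDl sqr_ge0.
Qed.

Lemma cIm_le (x : C) : `|cIm x| <= cmod x.
Proof.
rewrite -ler_sqr ?nnegrE ?cmod_ge0 // cmod_sqr /cdot -!expr2 real_normK ?num_real //.
by rewrite lerDr sqr_ge0.
Qed.

Lemma cmodD (x y : C) : cmod (x + y) <= cmod x + cmod y.
Proof.
rewrite -ler_sqr ?nnegrE ?addr_ge0 ?cmod_ge0 // sqrrD !cmod_sqr.
have h : cdot x y <= cmod x * cmod y.
  apply: le_trans (ler_norm _) _; rewrite -ler_sqr ?nnegrE ?mulr_ge0 ?cmod_ge0 //.
  rewrite real_normK ?num_real // exprMn !cmod_sqr /cdot.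
  have := sqr_ge0 (cRe x * cIm y - cIm x * cRe y); rewrite !expr2; lra.
have -> : cdot (x + y) (x + y) = cdot x x + cdot y y + 2 * cdot x y.
  by rewrite /cdot cReD cImD; ring.
rewrite -mulr_natl; lra.
Qed.

Lemma cmodN (x : C) : cmod (- x) = cmod x.
Proof. by rewrite /cmod cReN cImN !sqrrN. Qed.
Lemma cmodB (x y : C) : cmod (x - y) = cmod (y - x).
Proof. by rewrite -cmodN opprB. Qed.
Lemma cmod_tri (y x z : C) : cmod (x - z) <= cmod (x - y) + cmod (y - z).
Proof. by apply: le_trans (cmodD _ _); rewrite addrA subrK. Qed.
Lemma cmodM (x y : C) : cmod (x * y) = cmod x * cmod y.
Proof.
apply/eqP; rewrite -(eqrXn2 (n := 2)) ?mulr_ge0 ?cmod_ge0 // exprMn !cmod_sqr /cdot !cReM !cImM.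
by apply/eqP; ring.
Qed.

Lemma cmod0 : cmod (0 : C) = 0.
Proof. by rewrite /cmod cRe0 cIm0 expr0n addr0 sqrtr0. Qed.
Lemma cmod_eq0 (x : C) : cmod x = 0 -> x = 0.
Proof.
move=> h; have := cRe_le x; have := cIm_le x; rewrite h !normr_le0 => /eqP a /eqP b.
by apply: ceq.
Qed.

Lemma cmod_sum (I : Type) (s : seq I) (F : I -> C) : cmod (\sum_(i <- s) F i) <= \sum_(i <- s) cmod (F i).
Proof.
elim: s => [|i s IH]; first by rewrite !big_nil cmod0.
by rewrite !big_cons; apply: le_trans (cmodD _ _) _; rewrite lerD2l.
Qed.

Lemma cdyadic (Lam B s : R) : 0 < Lam -> 0 <= B -> 0 < s -> exists2 K : R, 0 <= K &
  forall f : R -> C, (forall e1 e2, 0 < e2 -> e2 <= e1 -> e1 <= 2 * e2 -> e1 < Lam ->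
     cmod (f e1 - f e2) <= B * e1 `^ s) ->
  exists L, forall e, 0 < e -> e < Lam -> cmod (f e - L) <= K * e `^ s.
Proof.
move=> L0 B0 s0; have [K K0 hK] := dyadic L0 B0 s0.
exists (2 * K) => [|f hf]; first by rewrite mulr_ge0.
have [e1 e2 h1 h2 h3 h4|L1 hL1] := hK (fun e => cRe (f e)).
  have -> : cRe (f e1) - cRe (f e2) = cRe (f e1 - f e2) by rewrite cReD cReN.
  exact: le_trans (cRe_le _) (hf _ _ h1 h2 h3 h4).
have [e1 e2 h1 h2 h3 h4|L2 hL2] := hK (fun e => cIm (f e)).
  have -> : cIm (f e1) - cIm (f e2) = cIm (f e1 - f e2) by rewrite cImD cImN.
  exact: le_trans (cIm_le _) (hf _ _ h1 h2 h3 h4).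
exists (Complex L1 L2) => e e0 eL; apply: le_trans (cmod_le_sum _) _.
rewrite cReD cImD cReN cImN /=; apply: le_trans (lerD (hL1 e e0 eL) (hL2 e e0 eL)) _.
by rewrite -mulrDl mulr_natl mulr2n.
Qed.

Lemma arith_q1 (c u v X : R) : c * u <= c * X -> c ^+ 2 * v <= c ^+ 2 * X ->
  c ^+ 2 * v + c * u <= (c ^+ 2 + c) * X.
Proof. lra. Qed.
Lemma arith_q2 (K1 K x y z b c1 c2 : R) : 0 <= b -> K1 * x <= K1 * b -> K1 * y <= K1 * b -> K * z <= K * b ->
  c1 <= K1 * y -> c2 <= K * (z * 2) -> K1 * x + (c1 + c2) <= (2 * K1 + 2 * K + 1) * b.
Proof. lra. Qed.
Lemma arith_q3 (x y u v e : R) : u < e / 2 -> v < e / 2 -> x <= v -> y <= u -> x + y <= e.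
Proof. lra. Qed.
End Dyadic.

(** * Existence of the homogenized matrix and the rate of convergence *)

Section Homogenized.
Context (R : realType) (dsp : measure_display) (Om : measurableType dsp)
        (P : probability Om R) (d : nat) (tau : Zd d -> int -> Om -> Om)
        (A : Om -> 'M[R]_d) (lam Lam p0 C1 : R).
Local Notation C := (complex R).
Hypothesis hE : Env P tau A lam Lam.
Hypothesis Lam4 : 4 * d%:R * Lam <= 1.
Hypothesis d0 : (0 < d)%N.
Hypothesis p01 : 1 < p0.
Hypothesis C10 : 0 < C1.
Hypothesis hH : HypH P tau A Lam p0 C1.
Let L0 := env_Lam0 hE.
Let L1 : Lam <= 1 := env_Lam1 hE Lam4 d0.
Local Notation a := ((2 * p0)^-1).
Definition sig : R := 2^-1 - (2 * p0)^-1.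
(* Locked: unification must never unfold the choice operators behind [qhom]. *)
Definition qhl := locked (fun (xi : 'rV[R]_d) e (i k : 'I_d) => qhom P tau A xi e i k).
Lemma qhlE xi e i k : qhom P tau A xi e i k = qhl xi e i k.
Proof. by rewrite /qhl -lock. Qed.
Lemma qhl_corr xi e k : 0 < e -> exists phi, corr P tau A xi e k phi /\
  forall i, qhl xi e i k = qent P tau A xi k phi i.
Proof.
move=> e0; have c := Phi_corr hE Lam4 xi e0 k.
exists (fun w => Phi P tau A xi e w ord0 k); split=> // i.
by rewrite -qhlE; exact: (q_entry hE Lam4).
Qed.

Lemma subM_entry (X Y : 'M[C]_d) i k : (X - Y) i k = X i k - Y i k.
Proof. by rewrite !mxE. Qed.
Let p00 : 0 < p0. Proof. exact: lt_trans p01. Qed.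
Lemma sig_gt0 : 0 < sig.
Proof. by rewrite subr_gt0 ltf_pV2 ?posrE ?mulr_gt0 // ltr_pMr. Qed.
Lemma sig_lt1 : sig < 1.
Proof. have h : 0 < a by rewrite invr_gt0 mulr_gt0. by move: h; rewrite /sig; lra. Qed.
Let a0 : 0 < a. Proof. by rewrite invr_gt0 mulr_gt0. Qed.
Let a1 : a <= 1.
Proof. by rewrite invf_le1 ?mulr_gt0 //; have := p01; lra. Qed.
(** The lattice substitute for |xi|^2: it is periodic in xi and is the quantity that difference
    operators see. *)
Definition esq (xi : 'rV[R]_d) : R := \sum_j cdot (zz xi j - 1) (zz xi j - 1).
Lemma esq_ge0 xi : 0 <= esq xi. Proof. by apply: sumr_ge0 => j _; exact: cdot_ge0. Qed.
Lemma zz0 j : zz (0 : 'rV[R]_d) j = 1.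
Proof. by rewrite /zz mxE cR0 mulr0 cexp0. Qed.
Lemma zzE (xi : 'rV[R]_d) j : zz xi j = Complex (cos (xi ord0 j)) (- sin (xi ord0 j)).
Proof.
have e1 : cRe (- 'i%C * cR (xi ord0 j)) = 0 by exact: cRe_iM.
have e2 : cIm (- 'i%C * cR (xi ord0 j)) = - xi ord0 j by rewrite cImM cImN cReN /=; ring.
by rewrite /zz /cexp e1 e2 expR0 cosN sinN !mul1r.
Qed.

Lemma powR_half (e : R) : 0 < e -> e * (e `^ (- a)) ^+ 2 = (e `^ sig) ^+ 2.
Proof.
move=> e0; rewrite -{1}(powRr1 (ltW e0)) -!powR_mulrn ?powR_ge0 // -!powRrM -powRD.
  by congr (_ `^ _); rewrite /sig; field; rewrite gt_eqF.
by apply/implyP => _; rewrite gt_eqF.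
Qed.

(** At equal frequencies only the term |eta1 - eta2| m^2 of [q_diff] survives. With m of order
    eta^(-1/(2 p0)) it is eta^(2 sig), which is small only because p0 > 1. *)
Lemma q_dyad : exists2 B : R, 0 <= B & forall xi i k e1 e2,
  0 < e2 -> e2 <= e1 -> e1 <= 2 * e2 -> e1 < Lam -> cmod (qhl xi e1 i k - qhl xi e2 i k) <= B * e1 `^ sig.
Proof.
have [Cb Cb0 hCb] := corr_bound hE Lam4 d0 p01 C10 hH.
have [K K0 hK] := q_diff hE Lam4 d0.
exists (2 * Cb * Num.sqrt K) => [|xi i k e1 e2 h1 h2 h3 h4].
  by rewrite !mulr_ge0 ?sqrtr_ge0 // ltW.
have e10 : 0 < e1 by apply: lt_le_trans h2.
have e2L : e2 < Lam by apply: le_lt_trans h4.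
have [f1 [c1 Q1]] := qhl_corr xi k e10; have [f2 [c2 Q2]] := qhl_corr xi k h1.
rewrite Q1 Q2.
have mon : e2 `^ (- a) <= 2 * e1 `^ (- a).
  rewrite !powRN ler_pdivlMr ?powR_gt0 // mulrC ler_pdivrMr ?powR_gt0 //.
  apply: le_trans (_ : (2 * e2) `^ a <= _).
    by apply: ge0_ler_powR; rewrite ?nnegrE ?(ltW a0) ?(ltW e10) // mulr_ge0 // ltW.
  rewrite powRM ?(ltW h1) // ler_wpM2r ?powR_ge0 //.
  by apply: ler1_powR => //; rewrite ler1n.
have m1 := hCb _ _ _ _ e10 h4 c1; have m2 := hCb _ _ _ _ h1 e2L c2.
pose m := 2 * Cb * e1 `^ (- a).
have pe := powR_ge0 e1 (- a).
have m1' : sn P f1 <= m.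
  by apply: le_trans m1 _; rewrite ler_wpM2r // ler_peMl ?ler1n // ltW.
have m2' : sn P f2 <= m.
  by apply: le_trans m2 _; have h := ler_wpM2l (ltW Cb0) mon; apply: le_trans h _; rewrite /m mulrCA mulrA.
have := hK xi xi e1 e2 k _ _ m 0 e10 h4 h1 e2L (lexx _) _ c1 c2 m1' m2' i.
rewrite expr0n !mul0r add0r addr0 => hq.
have {}hq : cmod (qent P tau A xi k f1 i - qent P tau A xi k f2 i) ^+ 2 <= (2 * Cb * Num.sqrt K * e1 `^ sig) ^+ 2.
  apply: le_trans (hq _) _ => [j|]; first by rewrite subrr /cdot cRe0 cIm0 mulr0 addr0.
  rewrite [leRHS]exprMn -powR_half // [X in _ <= X * _]exprMn sqr_sqrtr ?(ltW K0) // /m [X in `|_| * X]exprMn.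
  have -> : (2 * Cb) ^+ 2 * K * (e1 * e1 `^ (- a) ^+ 2) = K * (e1 * ((2 * Cb) ^+ 2 * e1 `^ (- a) ^+ 2)) by ring.
  have cc : 0 <= (2 * Cb) ^+ 2 * e1 `^ (- a) ^+ 2 by rewrite mulr_ge0 ?sqr_ge0.
  apply: ler_wpM2l; first exact: ltW.
  apply: (ler_wpM2r cc).
  by rewrite ger0_norm ?subr_ge0 // gerBl ltW.
have B2 : 0 <= 2 * Cb * Num.sqrt K * e1 `^ sig.
  by rewrite mulr_ge0 ?powR_ge0 // mulr_ge0 ?sqrtr_ge0 // mulr_ge0 // ltW.
by move: hq; rewrite ler_sqr ?nnegrE ?cmod_ge0.
Qed.

Lemma q_limit : exists2 K : R, 0 <= K & forall xi i k, exists L, forall e, 0 < e -> e < Lam ->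
  cmod (qhl xi e i k - L) <= K * e `^ sig.
Proof.
have [B B0 hB] := q_dyad; have [K K0 hK] := cdyadic L0 B0 sig_gt0.
by exists K => // xi i k; apply: hK => *; exact: hB.
Qed.

(** With y = sqrt(esq xi)/sqrt e and g = e^sig, the product of sqrt(esq xi) with the corrector bound
    is a multiple of y g, so [q_diff] gives at most a constant times g (1 + y)^2. The square root
    explains the exponent sig/2. *)
Lemma q_xi : exists2 K : R, 0 <= K & forall xi i k e, 0 < e -> e < Lam ->
  cmod (qhl xi e i k - qhl 0 e i k) <= K * (e `^ (sig / 2) * (1 + Num.sqrt (esq xi) / Num.sqrt e)).
Proof.
have [Cb Cb0 hCb] := corr_bound hE Lam4 d0 p01 C10 hH.
have [K K0 hK] := q_diff hE Lam4 d0.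
exists (Num.sqrt (K * (Cb ^+ 2 + Cb))) => [|xi i k e e0 eL]; first exact: sqrtr_ge0.
have [f1 [c1 Q1]] := qhl_corr xi k e0; have [f2 [c2 Q2]] := qhl_corr 0 k e0.
rewrite Q1 Q2.
have se : 0 < Num.sqrt e by rewrite sqrtr_gt0.
pose y := Num.sqrt (esq xi) / Num.sqrt e; have y0 : 0 <= y by rewrite divr_ge0 ?sqrtr_ge0.
pose g := e `^ sig; have g0 : 0 <= g by exact: powR_ge0.
have e1 : e <= 1 by apply: le_trans (ltW eL) L1.
have g1 : g <= 1.
  by apply: powR_le1 => //; apply: ltW => //; exact: sig_gt0.
have hh : e `^ (sig / 2) ^+ 2 = g.
  by rewrite -powR_mulrn ?powR_ge0 // -powRrM; congr (_ `^ _); field.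
pose m := Cb * e `^ (- a).
have em : Num.sqrt (esq xi) * m = Cb * (y * g).
  rewrite /m; have -> : e `^ (- a) = g / Num.sqrt e.
    rewrite /g -powR12_sqrt ?(ltW e0) // -powRN -powRD; last by apply/implyP => _; rewrite gt_eqF.
    by congr (_ `^ _); rewrite /sig; field; rewrite gt_eqF.
  by rewrite /y; ring.
have hd j : cdot (zz xi j - zz 0 j) (zz xi j - zz 0 j) <= Num.sqrt (esq xi) ^+ 2.
  rewrite zz0 sqr_sqrtr ?esq_ge0 // /esq (bigD1 j) //= lerDl.
  by apply: sumr_ge0 => l _; exact: cdot_ge0.
have := hK xi 0 e e k _ _ m _ e0 eL e0 eL (sqrtr_ge0 _) hd c1 c2 (hCb _ _ _ _ e0 eL c1) (hCb _ _ _ _ e0 eL c2) i.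
rewrite subrr normr0 mul0r addr0 -exprMn em => hq.
have B2 : 0 <= Num.sqrt (K * (Cb ^+ 2 + Cb)) * (e `^ (sig / 2) * (1 + y)).
  by rewrite !mulr_ge0 ?sqrtr_ge0 ?powR_ge0 // addr_ge0.
rewrite -/y -ler_sqr ?nnegrE ?cmod_ge0 //; apply: le_trans hq _.
have kc : 0 <= K * (Cb ^+ 2 + Cb).
  by apply: mulr_ge0; [exact: ltW|apply: addr_ge0; [exact: sqr_ge0|exact: ltW]].
rewrite [leRHS]exprMn sqr_sqrtr // [X in _ <= _ * X]exprMn hh -[leRHS]mulrA.
apply: ler_wpM2l; first exact: ltW.
have c0 := ltW Cb0; have cc := sqr_ge0 Cb.
have t1 : (y * g) ^+ 2 <= g * (1 + y) ^+ 2.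
  have u1 : g * g <= g by rewrite ler_piMl.
  have u2 : y * y * (g * g) <= y * y * g by rewrite ler_wpM2l // mulr_ge0.
  by have := mulr_ge0 g0 y0; rewrite !expr2; nra.
have t2 : y * g <= g * (1 + y) ^+ 2.
  by have := mulr_ge0 g0 y0; have := mulr_ge0 g0 (mulr_ge0 y0 y0); rewrite expr2; nra.
by rewrite [X in X + _]exprMn; apply: arith_q1; [apply: (ler_wpM2l c0 t2)|apply: (ler_wpM2l cc t1)].
Qed.

(** The rate in the form used by the two-scale expansion: it is useful when esq xi is at most of
    order e, but it is stated for all frequencies. *)
Definition is_limit (M : 'M[C]_d) (K : R) := forall xi i k e, 0 < e -> e < Lam ->
  cmod (qhl xi e i k - M i k) <= K * (e `^ (sig / 2) * (1 + Num.sqrt (esq xi) / Num.sqrt e)).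
Lemma powR_half_le (e : R) : 0 < e -> e <= 1 -> e `^ sig <= e `^ (sig / 2).
Proof.
move=> e0 e1; have -> : e `^ sig = e `^ (sig / 2) * e `^ (sig / 2).
  by rewrite -powRD; [congr (_ `^ _); field|apply/implyP => _; rewrite gt_eqF].
rewrite ler_piMl ?powR_ge0 //; apply: powR_le1 => //; first exact: ltW.
by rewrite divr_ge0 // ltW // sig_gt0.
Qed.

Lemma limit_ex : exists M K, 0 <= K /\ is_limit M K.
Proof.
have [K1 K10 h1] := q_limit; have [K2 K20 h2] := q_xi.
have [f hf] := boolp.choice (fun ik : 'I_d * 'I_d => h1 0 ik.1 ik.2).
exists (\matrix_(i, k) f (i, k)), (K1 + K2); split; first exact: addr_ge0.
move=> xi i k e e0 eL; rewrite mxE; apply: le_trans (cmod_tri (qhl 0 e i k) _ _) _.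
apply: le_trans (lerD (h2 xi i k e e0 eL) (hf (i, k) e e0 eL)) _.
rewrite addrC (mulrDl K1) lerD2r ler_wpM2l //.
have e1 : e <= 1 by apply: le_trans (ltW eL) L1.
apply: le_trans (powR_half_le e0 e1) _; rewrite ler_peMr ?powR_ge0 // lerDl divr_ge0 ?sqrtr_ge0 //.
Qed.

Definition ahom_spec (M : 'M[C]_d) := forall e : R, 0 < e -> exists2 r : R, 0 < r &
    forall (xi : 'rV[R]_d) (eta : R),
      Num.sqrt (\sum_i xi ord0 i ^+ 2) < r -> 0 < eta < r ->
      mnorm (qhom P tau A xi eta - M) < e.
Lemma mnorm_le (M : 'M[C]_d) (b : R) : (forall i j, cmod (M i j) <= b) -> mnorm M <= d%:R * b.
Proof.
move=> h; have b0 : 0 <= b by apply: le_trans (h (Ordinal d0) (Ordinal d0)); exact: cmod_ge0.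
have db : 0 <= d%:R * b by rewrite mulr_ge0 // ler0n.
rewrite -(ger0_norm db) -sqrtr_sqr ler_sqrt ?sqr_ge0 //.
apply: le_trans (_ : \sum_(i < d) \sum_(j < d) b ^+ 2 <= _).
  by apply: ler_sum => i _; apply: ler_sum => j _; rewrite lerXn2r ?nnegrE ?cmod_ge0.
have e (x : R) : \sum_(i < d) x = d%:R * x by rewrite sumr_const card_ord mulr_natl.
rewrite (eq_bigr (fun _ => d%:R * b ^+ 2)) => [|i _]; last exact: e.
by rewrite e exprMn expr2 mulrA.
Qed.

Lemma le_mnorm (M : 'M[C]_d) i j : cmod (M i j) <= mnorm M.
Proof.
rewrite -ler_sqr ?nnegrE ?cmod_ge0 ?mnorm_ge0 // mnorm_sqr cmod_sqr (bigD1 i) //= (bigD1 j) //= -addrA lerDl.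
rewrite addr_ge0 //; first by apply: sumr_ge0 => k _; exact: cdot_ge0.
by apply: sumr_ge0 => k _; apply: sumr_ge0 => l _; exact: cdot_ge0.
Qed.

Lemma esq_small (rho : R) : 0 < rho -> exists2 r : R, 0 < r &
  forall xi : 'rV[R]_d, Num.sqrt (\sum_i xi ord0 i ^+ 2) < r -> esq xi < rho.
Proof.
move=> rho0; have dR : 0 < d%:R :> R by rewrite ltr0n.
have e0 : 0 < rho / (2 * d%:R) by rewrite divr_gt0 // mulr_gt0.
have /cvgrPdist_lt /(_ _ e0) /nbhs_ballP[r r0 hr] := @continuous_cos R 0.
exists r => // xi hxi.
have h j : cdot (zz xi j - 1) (zz xi j - 1) < rho / d%:R.
  have hj : `|xi ord0 j| < r.
    apply: le_lt_trans hxi; rewrite -sqrtr_sqr ler_sqrt; last by apply: sumr_ge0 => k _; exact: sqr_ge0.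
    by rewrite (bigD1 j) //= lerDl; apply: sumr_ge0 => k _; exact: sqr_ge0.
  have := hr (xi ord0 j); rewrite /ball /= sub0r normrN => /(_ hj); rewrite cos0 => h1.
  have -> : cdot (zz xi j - 1) (zz xi j - 1) = 2 * (1 - cos (xi ord0 j)).
    have := cos2Dsin2 (xi ord0 j); rewrite zzE.
    rewrite /cdot !cReD !cImD !cReN !cImN cRe1 cIm1 /= !expr2.
    by move: (cos _) (sin _) => c s hcs; nra.
  have h2 := le_lt_trans (ler_norm _) h1.
  have -> : rho / d%:R = 2 * (rho / (2 * d%:R)) by field; rewrite gt_eqF.
  by rewrite ltr_pM2l.
rewrite /esq; apply: lt_le_trans (_ : \sum_(j < d) rho / d%:R <= _).
  by apply: ltr_sum => //; apply/hasP; exists (Ordinal d0); rewrite ?mem_index_enum.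
have -> : \sum_(j < d) rho / d%:R = d%:R * (rho / d%:R) by rewrite sumr_const card_ord mulr_natl.
by rewrite mulrC mulfVK // gt_eqF.
Qed.

(** The bound [is_limit] is not small when eta is much smaller than esq xi, so it does not give the
    joint limit by itself. At fixed xi, eta is first raised to the level of esq xi by [q_limit]. *)
Lemma limit_spec M K : 0 <= K -> is_limit M K -> ahom_spec M.
Proof.
move=> K0 hM; have [K1 K10 h1] := q_limit; move=> e e0.
have dR : 0 < d%:R :> R by rewrite ltr0n.
pose K2 := 2 * K1 + 2 * K + 1; have K20 : 0 < K2 by rewrite ltr_wpDl // addr_ge0 // mulr_ge0.
pose b := e / (2 * d%:R * K2); have b0 : 0 < b by rewrite divr_gt0 // !mulr_gt0.
have s2 : 0 < sig / 2 by rewrite divr_gt0 // sig_gt0.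
pose rho := Num.min (Lam / 2) (b `^ (sig / 2)^-1).
have rho0 : 0 < rho by rewrite lt_min divr_gt0 // powR_gt0.
have rhoL : rho < Lam by rewrite gt_min; apply/orP; left; have := L0; lra.
have [r r0 hr] := esq_small rho0.
exists (Num.min r rho) => [|xi eta]; first by rewrite lt_min r0.
rewrite !lt_min => /andP[/hr hx _] /andP[eta0 /andP[_ er0]].
have er : eta < rho by rewrite lt_min.
(* At this value the ratio sqrt(esq xi)/sqrt et is at most 1, and et is still small. *)
pose et := Num.max eta (esq xi).
have et0 : 0 < et by rewrite lt_max eta0.
have etr : et < rho by rewrite gt_max er.
have etL : et < Lam by exact: lt_trans rhoL.
have et1 : et <= 1 by apply: le_trans (ltW etL) L1.
have eL : eta < Lam by exact: lt_trans rhoL.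
have pb : et `^ (sig / 2) <= b.
  apply: le_trans (_ : rho `^ (sig / 2) <= _).
    by apply: ge0_ler_powR; rewrite ?nnegrE ?(ltW s2) ?(ltW et0) ?(ltW rho0) // ltW.
  apply: le_trans (_ : (b `^ (sig / 2)^-1) `^ (sig / 2) <= _).
    by apply: ge0_ler_powR; rewrite ?nnegrE ?(ltW s2) ?(ltW rho0) ?powR_ge0 // ge_min lexx orbT.
  by rewrite -powRrM mulVf ?gt_eqF // powRr1 // ltW.
have bd i k : cmod ((qhom P tau A xi eta - M) i k) <= K2 * b.
  rewrite subM_entry qhlE; have [L hL] := h1 xi i k.
  apply: le_trans (cmod_tri L _ _) _.
  apply: le_trans (lerD (hL eta eta0 eL) (cmod_tri (qhl xi et i k) _ _)) _.
  have g1 : eta `^ sig <= et `^ (sig / 2).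
    apply: le_trans (powR_half_le et0 et1).
    by apply: ge0_ler_powR; rewrite ?nnegrE ?(ltW sig_gt0) ?(ltW eta0) ?(ltW et0) // le_max lexx.
  have g2 := powR_half_le et0 et1.
  have g3 : cmod (L - qhl xi et i k) <= K1 * et `^ sig by rewrite cmodB; exact: hL.
  have g4 : cmod (qhl xi et i k - M i k) <= K * (et `^ (sig / 2) * 2).
    apply: le_trans (hM xi i k et et0 etL) _; rewrite ler_wpM2l // ler_wpM2l ?powR_ge0 //.
    have : Num.sqrt (esq xi) / Num.sqrt et <= 1.
      by rewrite ler_pdivrMr ?sqrtr_gt0 // mul1r ler_sqrt ?(ltW et0) // le_max lexx orbT.
    lra.
  have v1 := ler_wpM2l K10 (le_trans g1 pb); have v2 := ler_wpM2l K10 (le_trans g2 pb).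
  have v3 := ler_wpM2l K0 pb.
  exact: (arith_q2 (ltW b0) v1 v2 v3 g3 g4).
apply: le_lt_trans (mnorm_le bd) _.
have -> : d%:R * (K2 * b) = e / 2 by rewrite /b; field; rewrite !gt_eqF.
lra.
Qed.

(** The matrix M shows that the defining predicate of [ahom] is inhabited; two matrices satisfying
    it agree, by evaluation at frequency 0 and small eta. *)
Lemma ahom_limit M K : 0 <= K -> is_limit M K -> ahom P tau A = M.
Proof.
move=> K0 hM; have h1 := limit_spec K0 hM.
have h2 : ahom_spec (ahom P tau A) by apply: epsilon_spec; exists M.
apply/matrixP => i k; apply/eqP; rewrite -subr_eq0; apply/eqP; apply: cmod_eq0.
apply/eqP; rewrite eq_le cmod_ge0 andbT; apply/ler_addgt0Pr => e e0; rewrite add0r.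
have e2 : 0 < e / 2 by rewrite divr_gt0.
have [r1 r10 g1] := h1 _ e2; have [r2 r20 g2] := h2 _ e2.
have x0 : Num.sqrt (\sum_i (0 : 'rV[R]_d) ord0 i ^+ 2) = 0.
  by rewrite big1 ?sqrtr0 // => j _; rewrite mxE expr0n.
pose r := Num.min r1 r2; have r0 : 0 < r by rewrite lt_min r10.
have u1 : mnorm (qhom P tau A 0 (r / 2) - M) < e / 2.
  apply: g1; rewrite ?x0 // divr_gt0 //=; apply: lt_le_trans (_ : r <= _); first by lra.
  by rewrite ge_min lexx.
have u2 : mnorm (qhom P tau A 0 (r / 2) - ahom P tau A) < e / 2.
  apply: g2; rewrite ?x0 // divr_gt0 //=; apply: lt_le_trans (_ : r <= _); first by lra.
  by rewrite ge_min lexx orbT.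
apply: le_trans (cmod_tri (qhl 0 (r / 2) i k) _ _) _; rewrite cmodB.
have := le_mnorm (qhom P tau A 0 (r / 2) - M) i k; have := le_mnorm (qhom P tau A 0 (r / 2) - ahom P tau A) i k.
rewrite !subM_entry qhlE => h3 h4; exact: (arith_q3 u1 u2 h3 h4).
Qed.

Lemma ahom_rate : exists2 K : R, 0 <= K & is_limit (ahom P tau A) K.
Proof.
have [M [K [K0 hM]]] := limit_ex.
by exists K => //; rewrite (ahom_limit K0 hM).
Qed.
End Homogenized.

(** * The homogenized matrix is real and elliptic *)

Lemma arith_class (R : realFieldType) (D lam Lam vq PF gF FF sv sq : R) (PP : R) : 0 <= D -> 0 < lam -> 0 < Lam ->
  4 * D * Lam <= 1 -> vq = PF - gF -> sv <= PP -> lam * PP <= PF -> FF <= Lam * PF ->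
  2 * gF <= 4 * D * (FF - sq) -> 0 <= FF - sq -> vq ^+ 2 <= sv * sq -> 0 <= sv -> 0 <= sq ->
  2 * D * sq + lam / 2 * sv <= vq /\ sq <= (2 * Lam) ^+ 2 * sv.
Proof.
move=> D0 l0 L0 DL e h1 h2 h3 h4 h5 h6 s0 q0.
have PF0 : 0 <= PF.
  by apply: le_trans h2; rewrite mulr_ge0 ?(ltW l0) // (le_trans s0).
have a1 : D * FF <= D * (Lam * PF) by rewrite ler_wpM2l.
have a2 : 4 * D * Lam * PF <= 1 * PF by rewrite ler_wpM2r.
have a3 : 2 * D * sq + PF / 2 <= vq by lra.
have a4 : lam * sv <= lam * PP by rewrite ler_wpM2l // ltW.
split; first lra.
have a5 : 0 <= D * sq by rewrite mulr_ge0.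
have a6 : sq <= 2 * Lam * vq.
  have : Lam * PF <= Lam * (2 * vq) by rewrite ler_wpM2l ?(ltW L0) //; lra.
  lra.
have [->|sq0] := eqVneq sq 0; first by rewrite mulr_ge0 ?sqr_ge0.
have {}sq0 : 0 < sq by rewrite lt_neqAle eq_sym sq0.
have a7 : sq ^+ 2 <= (2 * Lam * vq) ^+ 2 by rewrite ler_sqr ?nnegrE // (le_trans q0).
have a8 : (2 * Lam * vq) ^+ 2 <= (2 * Lam) ^+ 2 * (sv * sq).
  by rewrite exprMn ler_wpM2l ?sqr_ge0.
by rewrite -(ler_pM2r sq0); move: (le_trans a7 a8); rewrite mulrA expr2.
Qed.

Section Class.
Context (R : realType) (dsp : measure_display) (Om : measurableType dsp)
        (P : probability Om R) (d : nat) (tau : Zd d -> int -> Om -> Om)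
        (A : Om -> 'M[R]_d) (lam Lam : R).
Local Notation C := (complex R).
Hypothesis hE : Env P tau A lam Lam.
Hypothesis Lam4 : 4 * d%:R * Lam <= 1.
Hypothesis d0 : (0 < d)%N.
Let fl := env_flow hE.
Let cA := env_coef hE.
Let L0 := env_Lam0 hE.
Let l0 := env_lam0 hE.
Local Notation z0 := (zz (0 : 'rV[R]_d)).
Definition cre (f : Om -> C) (w : Om) : C := cR (cRe (f w)).
Lemma sl2_cre f : sl2 P f -> sl2 P (cre f).
Proof.
case=> h1 h2; split; first exact: h1.
by have [_ h] := @sl2_cst _ _ _ P 0; exact: h.
Qed.

Lemma cReB (x y : C) : cRe (x - y) = cRe x - cRe y. Proof. by rewrite cReD cReN. Qed.
Lemma dd_cre f i w : dd tau z0 i (cre f) w = cR (cRe (dd tau z0 i f w)).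
Proof. by rewrite /dd /cre zz0 !mul1r -cRN -cRD cReB. Qed.
Lemma am_cre (F : 'I_d -> Om -> C) i w : am A (fun j w => cR (cRe (F j w))) i w = cR (cRe (am A F i w)).
Proof.
rewrite /am cRe_sum cR_sum; apply: eq_bigr => j _.
by rewrite cReM cRe_cR cIm_cR mul0r subr0 cRM.
Qed.

Lemma dv_cre (F : 'I_d -> Om -> C) w : dv tau z0 (fun j w => cR (cRe (F j w))) w = cR (cRe (dv tau z0 F w)).
Proof.
rewrite /dv cRe_sum cR_sum; apply: eq_bigr => j _.
have c1 : cconj (1 : C) = 1 by apply: ceq; rewrite ?cRe_conj ?cIm_conj ?cRe1 ?cIm1 ?oppr0.
by rewrite /dds zz0 c1 !mul1r -cRN -cRD cReB.
Qed.

Lemma cexpect_cre f : cexpect P (cre f) = cR (cRe (cexpect P f)).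
Proof. by apply: ceq => //; rewrite /cexpect /=; apply: Rint_eq0. Qed.
(** At xi = 0 every coefficient of the equation is real, so taking real parts commutes with it. With
    uniqueness this makes q real at frequency 0. *)
Lemma corr_real eta k phi : 0 < eta -> corr P tau A 0 eta k phi -> corr P tau A 0 eta k (cre phi).
Proof.
move=> eta0 [[s1 h1] h2].
have m : cexpect P (cre phi) = 0 by rewrite cexpect_cre h2.
split; last exact: m.
split; first exact: sl2_cre.
have ya w : yop tau z0 A (@ek R _ Om d k) (cre phi) w = cre (yop tau z0 A (@ek R _ Om d k) phi) w.
  rewrite /yop /cre cReB cRD cRN; congr (_ - _); rewrite -dv_cre; congr (dv _ _ _ _).
  apply: boolp.funext => i; apply: boolp.funext => v; rewrite -am_cre; congr (am _ _ _ _).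
  apply: boolp.funext => j; apply: boolp.funext => u; rewrite dd_cre cReD cRD; congr (_ + _).
  by rewrite /ek; case: (j == k).
set D := (fun w : Om => cR (expR eta) * phi (tau 0 1 w) - cproj P true (yop tau z0 A (@ek R _ Om d k) phi) w) in h1.
have sD : sl2 P D.
  apply: sl2B; first by apply: sl2Z; exact: (sl2_sh fl 0 1 s1).
  by rewrite /cproj; apply: sl2_pim; apply: (sl2_yop fl z0 cA (vl2_ek P k) s1).
have -> : (fun w : Om => cR (expR eta) * cre phi (tau 0 1 w) - cproj P true (yop tau z0 A (@ek R _ Om d k) (cre phi)) w) = cre D.
  apply: boolp.funext => w; rewrite /D /cre cReB cReM cRe_cR cIm_cR mul0r subr0 cRD cRM cRN; congr (_ - _).
  rewrite /cproj /pim; have -> : yop tau z0 A (@ek R _ Om d k) (cre phi) = cre (yop tau z0 A (@ek R _ Om d k) phi) by apply: boolp.funext => v; exact: ya.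
  by rewrite cexpect_cre /cre cReB cRD cRN.
apply: sn_ae0; first exact: sl2_cre.
have := sn_eq0 sD h1; apply: filterS => w hw; by rewrite /cre hw.
Qed.

Lemma qent_eq eta k phi psi i : 0 < eta -> corr P tau A 0 eta k phi -> corr P tau A 0 eta k psi ->
  qent P tau A 0 k phi i = qent P tau A 0 k psi i.
Proof.
move=> eta0 c1 c2; have [s1 s2] := (c1.1.1, c2.1.1).
have E1 : 1 < expR eta by rewrite expR_gt1.
have u : sn P (fun w => phi w - psi w) = 0.
  by apply: (soln_uniq fl (@zz_unit R d 0) cA Lam4 L0 (ltW l0) E1 (vl2_ek P k) c1.1 c2.1).
have v1 := vl2_psik hE 0 k s1; have v2 := vl2_psik hE 0 k s2.
apply/eqP; rewrite -subr_eq0; apply/eqP; apply: cmod_eq0; apply/eqP; rewrite eq_le cmod_ge0 andbT.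
rewrite /qent -cexpectB; try exact: (vl2_am cA); apply: le_trans (cexpect_le _) _.
  by apply: sl2B; exact: (vl2_am cA).
have -> : (fun w => am A (psik tau 0 k phi) i w - am A (psik tau 0 k psi) i w) =
          am A (fun j w => dd tau z0 j (fun w => phi w - psi w) w) i.
  rewrite -[LHS](congr1 (fun F => F i) (amB A (psik tau 0 k phi) (psik tau 0 k psi))).
  congr (am _ _ _); apply: boolp.funext => j; apply: boolp.funext => w.
  by rewrite ddB /psik; ring.
have sd := sl2B s1 s2; have vg := vl2_grad fl z0 sd.
apply: le_trans (sn_le_vn _ _) _; first exact: (vl2_am cA).
apply: le_trans (vn_am hE vg) _.
have := vn_grad hE 0 sd; rewrite u mulr0 => h.
by rewrite -(mulr0 Lam) ler_wpM2l // ltW.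
Qed.

Lemma qhl_real eta i k : 0 < eta -> cIm (qhl P tau A 0 eta i k) = 0.
Proof.
move=> eta0; have [phi [c ->]] := qhl_corr hE Lam4 0 k eta0.
rewrite (qent_eq i eta0 c (corr_real eta0 c)) /qent.
have -> : am A (psik tau 0 k (cre phi)) i = cre (am A (psik tau 0 k phi) i).
  apply: boolp.funext => w; rewrite /cre -am_cre; congr (am _ _ _ _).
  apply: boolp.funext => j; apply: boolp.funext => v; rewrite /psik dd_cre cReD cRD; congr (_ + _).
  by rewrite /ek; case: (j == k).
by rewrite cexpect_cre.
Qed.

Section Quadratic.
Context (eta : R) (eta0 : 0 < eta) (f : 'I_d -> Om -> C).
Hypothesis cf : forall k, corr P tau A 0 eta k (f k).
Context (v : 'I_d -> R).
Let sf k : sl2 P (f k) := (cf k).1.1.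
Let fv w := \sum_k cR (v k) * f k w.
Let Ps i w := \sum_k cR (v k) * psik tau 0 k (f k) i w.
Let Fk k := am A (psik tau 0 k (f k)).
Let Fv i w := \sum_k cR (v k) * Fk k i w.
Let Q i k := qent P tau A 0 k (f k) i.
Let vF k : vl2 P (Fk k) := vl2_am cA (vl2_psik hE 0 k (sf k)).
Let sfv : sl2 P fv. Proof. by apply: sl2_sum => k; apply: sl2Z. Qed.
Let vPs : vl2 P Ps. Proof. by move=> i; apply: sl2_sum => k; apply: sl2Z; exact: (vl2_psik hE 0 k (sf k)). Qed.
Let vFv : vl2 P Fv. Proof. by move=> i; apply: sl2_sum => k; apply: sl2Z; exact: vF. Qed.
Let cexpect_comb (g : 'I_d -> Om -> C) : (forall k, sl2 P (g k)) ->
  cexpect P (fun w => \sum_k cR (v k) * g k w) = \sum_k cR (v k) * cexpect P (g k).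
Proof.
move=> sg; elim: (index_enum _) => [|a s IH].
  by rewrite big_nil -[RHS](cexpect_cst P); congr cexpect; apply: boolp.funext => w; rewrite big_nil.
rewrite big_cons -IH -cexpectZ // -cexpectD.
- by congr cexpect; apply: boolp.funext => w; rewrite big_cons.
- exact: sl2Z.
- by apply: sl2_sum => k; exact: sl2Z.
Qed.

Let PsE i w : Ps i w = dd tau z0 i fv w + cR (v i).
Proof.
rewrite /Ps /psik (eq_bigr (fun k => cR (v k) * dd tau z0 i (f k) w + cR (v k) * @ek R _ Om d k i w)) => [|k _]; last by rewrite mulrDr.
rewrite big_split /=; congr (_ + _).
  rewrite /dd /fv mulr_sumr -sumrB; apply: eq_bigr => k _; ring.
rewrite (bigD1 i) //= big1 => [|k hk]; first by rewrite /ek eqxx mulr1 addr0.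
by rewrite /ek eq_sym (negPf hk) mulr0.
Qed.

Let amPs : am A Ps = Fv.
Proof.
apply: boolp.funext => i; apply: boolp.funext => w; rewrite /am /Fv /Fk /am /Ps.
under eq_bigr do rewrite mulr_sumr.
rewrite exchange_big; apply: eq_bigr => k _; rewrite mulr_sumr; apply: eq_bigr => j _; ring.
Qed.

Let meanF i : cexpect P (Fv i) = \sum_k cR (v k) * Q i k.
Proof. by rewrite /Fv cexpect_comb // => k; exact: vF. Qed.
Let mean_dd g i : sl2 P g -> cexpect P (dd tau z0 i g) = 0.
Proof.
move=> sg; rewrite /dd zz0; have -> : (fun w => 1 * g (tau (evec i) 0 w) - g w) = fun w => g (tau (evec i) 0 w) - g w.
  by apply: boolp.funext => w; rewrite mul1r.
by rewrite cexpectB ?(cexpect_sh fl) ?subrr //; exact: (sl2_sh fl).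
Qed.

Let soln_fv : sn P (fun w => cR (expR eta) * fv (tau 0 1 w) - (fv w - dv tau z0 (fun i => pim P (Fv i)) w)) = 0.
Proof.
have vpF : vl2 P (fun i => pim P (Fv i)) by move=> i; apply: sl2_pim; exact: vFv.
apply: sn_ae0.
  by apply: sl2B; [apply: sl2Z; exact: (sl2_sh fl)|apply: sl2B => //; exact: (sl2_dv fl)].
have h k : {ae P, forall w, cR (expR eta) * f k (tau 0 1 w) - cproj P true (yop tau z0 A (@ek R _ Om d k) (f k)) w = 0}.
  apply: sn_eq0 (cf k).1.2; apply: sl2B; first by apply: sl2Z; exact: (sl2_sh fl).
  by rewrite /cproj; apply: sl2_pim; exact: (sl2_yop fl z0 cA (vl2_ek P k) (sf k)).
have := ae_forall h; apply: filterS => w hw.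
have dvE : dv tau z0 (fun i => pim P (Fv i)) w = \sum_k cR (v k) * dv tau z0 (fun i => pim P (Fk k i)) w.
  rewrite /dv; under [RHS]eq_bigr do rewrite mulr_sumr.
  rewrite [RHS]exchange_big; apply: eq_bigr => i _; rewrite /dds /pim {1 3}/Fv meanF /Q /qent -/(Fk _).
  rewrite -!sumrB mulr_sumr -sumrB; apply: eq_bigr => k _; rewrite /Fk; ring.
rewrite dvE /fv mulr_sumr -!sumrB; apply: big1 => k _.
have := hw k; rewrite /cproj; have -> : yop tau z0 A (@ek R _ Om d k) (f k) = fun w => f k w - dv tau z0 (Fk k) w by [].
rewrite pimB // ?(pim_dv hE) //; last exact: (sl2_dv fl).
rewrite (pim_mean0 (cf k).2) => e.
have -> : cR (expR eta) * (cR (v k) * f k (tau 0 1 w)) - (cR (v k) * f k w - cR (v k) * dv tau z0 (fun i => pim P (Fk k i)) w) =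
  cR (v k) * (cR (expR eta) * f k (tau 0 1 w) - (f k w - dv tau z0 (fun i => pim P (Fk k i)) w)) by ring.
by rewrite e mulr0.
Qed.

Let qv i := \sum_k v k * cRe (Q i k).
Hypothesis Qreal : forall i k, cIm (Q i k) = 0.
Let meanFr i : cexpect P (Fv i) = cR (qv i).
Proof.
rewrite meanF /qv cR_sum; apply: eq_bigr => k _; rewrite cRM; congr (_ * _).
by apply: ceq; rewrite ?cIm_cR ?Qreal.
Qed.

Let pimF2 : vip P (fun i => pim P (Fv i)) (fun i => pim P (Fv i)) = vip P Fv Fv - sqn qv.
Proof.
rewrite /vip /sqn -sumrB; apply: eq_bigr => i _; rewrite (sip_pim (vFv i)) meanFr /cdot cRe_cR cIm_cR; ring.
Qed.

(** The equation says that E f(tau) equals f - div(Pi F) in norm; expanding squares with E >= 1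
    gives 2 <grad f, F> <= |div(Pi F)|^2. The projection is essential: [dv_le] applied to Pi F
    yields 4 d (|F|^2 - |qv|^2), the mean being subtracted. *)
Let cross_le : 2 * vip P (fun i => dd tau z0 i fv) Fv <= 4 * d%:R * (vip P Fv Fv - sqn qv).
Proof.
have vpF : vl2 P (fun i => pim P (Fv i)) by move=> i; apply: sl2_pim; exact: vFv.
have sdv := sl2_dv fl z0 vpF.
have e1 : sip P (fun w => cR (expR eta) * fv (tau 0 1 w)) (fun w => cR (expR eta) * fv (tau 0 1 w)) =
   sip P (fun w => fv w - dv tau z0 (fun i => pim P (Fv i)) w) (fun w => fv w - dv tau z0 (fun i => pim P (Fv i)) w).
  have s1 : sl2 P (fun w => cR (expR eta) * fv (tau 0 1 w)) by apply: sl2Z; exact: (sl2_sh fl).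
  have s2 : sl2 P (fun w => fv w - dv tau z0 (fun i => pim P (Fv i)) w) by exact: sl2B.
  rewrite -!sn_sqr; congr (_ ^+ 2); apply/eqP; rewrite eq_le; apply/andP; split.
    by have := sn_leB s1 s2; rewrite soln_fv addr0.
  by have := sn_leB s2 s1; rewrite (snBC s2 s1) soln_fv addr0.
move: e1; rewrite sip_sqB // -(vip_dd fl z0 sfv vpF).
have st := sl2_sh fl 0 1 sfv.
rewrite sipRl ?sipRr //; last exact: sl2Z.
rewrite (sip_sh fl) //.
have -> : vip P (fun i => dd tau z0 i fv) (fun i => pim P (Fv i)) = vip P (fun i => dd tau z0 i fv) Fv.
  rewrite /vip; apply: eq_bigr => i _; have sd := sl2_dd fl z0 i sfv.
  have -> : sip P (dd tau z0 i fv) (Fv i) = sip P (dd tau z0 i fv) (fun w => pim P (Fv i) w + cexpect P (Fv i)).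
    by congr sip; apply: boolp.funext => w; rewrite /pim subrK.
  rewrite sipDr //; first by rewrite sip_cstr // mean_dd // /cdot cRe0 cIm0 !mul0r !addr0.
  exact: sl2_cst.
have := dv_le fl (@zz_unit R d 0) vpF; rewrite pimF2.
have E1 : 1 <= expR eta by rewrite expR_ge1 // ltW.
have := sip_ge0 P fv.
move: (sip P fv fv) (vip P _ Fv) (sip P (dv _ _ _) _) (expR eta) E1 => s x y E E1 s0 h1 h2.
have : s <= E * (E * s) by have h3 : s <= E * s by [rewrite ler_peMl]; apply: le_trans h3 _; rewrite ler_peMl // mulr_ge0 // (le_trans _ E1).
lra.
Qed.

(** The quadratic form of q is <Ps, F> - <grad f, F>. The mean subtracted in [cross_le] is precisely
    the term 2 d |qv|^2 required by [cls], and 2 d |F|^2 is absorbed by half of <Ps, F>; the other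
    half gives lam/2. Likewise |qv|^2 <= |F|^2 <= Lam <Ps, F> <= 2 Lam v.qv gives the upper constant
    2 Lam. *)
Lemma q_class : 2 * d%:R * sqn qv + lam / 2 * sqn v <= dotv v qv /\ sqn qv <= (2 * Lam) ^+ 2 * sqn v.
Proof.
have vg := vl2_grad fl z0 sfv.
have vc : vl2 P (fun i (_ : Om) => cR (v i) : C) by move=> i; exact: sl2_cst.
have e1 : dotv v qv = vip P Ps Fv - vip P (fun i => dd tau z0 i fv) Fv.
  have -> : vip P Ps Fv = vip P (fun i w => dd tau z0 i fv w + cR (v i)) Fv.
    by congr vip; apply: boolp.funext => i; apply: boolp.funext => w; exact: PsE.
  rewrite vipDl // addrC addKr /dotv /vip; apply: eq_bigr => i _.
  by rewrite sipC sip_cstr // meanFr /cdot !cRe_cR !cIm_cR mulr0 addr0 mulrC.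
have e2 : sqn v <= vip P Ps Ps.
  rewrite /sqn /vip; apply: ler_sum => i _; rewrite (sip_pim (vPs i)).
  have -> : cexpect P (Ps i) = cR (v i).
    have -> : Ps i = fun w => dd tau z0 i fv w + cR (v i) by apply: boolp.funext => w; exact: PsE.
    have c1 : sl2 P (fun _ : Om => cR (v i) : C) by exact: sl2_cst.
    have c2 := sl2_dd fl z0 i sfv.
    by rewrite (cexpectD c2 c1) cexpect_cst mean_dd // add0r.
  by rewrite /cdot cRe_cR cIm_cR mulr0 addr0 expr2 lerDr sip_ge0.
have h1 := am_lo cA vPs; have h2 := am_up cA vPs; rewrite amPs in h1 h2.
have h3 := cross_le.
have h4 : 0 <= vip P Fv Fv - sqn qv by rewrite -pimF2 vip_ge0.
have h5 := dotv_CS v qv.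
have s0 := sqn_ge0 v; have q0 := sqn_ge0 qv.
have dR : 0 <= d%:R :> R by rewrite ler0n.
exact: (arith_class dR l0 L0 Lam4 e1 e2 h1 h2 h3 h4 h5 s0 q0).
Qed.
End Quadratic.

Lemma qhl_cls eta : 0 < eta -> cls (lam / 2) (2 * Lam) (\matrix_(i, k) cRe (qhl P tau A 0 eta i k)).
Proof.
move=> eta0 v.
have [f hf] := boolp.choice (fun k => qhl_corr hE Lam4 0 k eta0).
have cf k := (hf k).1.
have qr i k : cIm (qent P tau A 0 k (f k) i) = 0 by rewrite -(hf k).2 qhl_real.
have := q_class eta0 cf v qr.
have -> : (fun i => \sum_k v k * cRe (qent P tau A 0 k (f k) i)) = mulv (\matrix_(i, k) cRe (qhl P tau A 0 eta i k)) v.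
  by apply: boolp.funext => i; apply: eq_bigr => k _; rewrite mxE -(hf k).2 mulrC.
by [].
Qed.

Lemma cvg_fsum (I : finType) (f : nat -> I -> R) (l : I -> R) :
  (forall i, (fun n => f n i) @ \oo --> l i) -> (fun n => \sum_i f n i) @ \oo --> \sum_i l i.
Proof.
move=> h; elim: (index_enum I) => [|a s IH].
  by rewrite big_nil; under eq_fun do rewrite big_nil; exact: cvg_cst.
by rewrite big_cons; under eq_fun do rewrite big_cons; apply: cvgD; [exact: h|exact: IH].
Qed.

Lemma cls_lim (u : nat -> 'M[R]_d) (M : 'M[R]_d) l L : (forall n, cls l L (u n)) ->
  (forall i k, (fun n => u n i k) @ \oo --> M i k) -> cls l L M.
Proof.
move=> hu hM v.
have cm i : (fun n => mulv (u n) v i) @ \oo --> mulv M v i.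
  by apply: cvg_fsum => k; apply: cvgMr_tmp; exact: hM.
have cs : (fun n => sqn (mulv (u n) v)) @ \oo --> sqn (mulv M v).
  by apply: cvg_fsum => i; rewrite expr2; under eq_fun do rewrite expr2; apply: cvgM; exact: cm.
have cd : (fun n => dotv v (mulv (u n) v)) @ \oo --> dotv v (mulv M v).
  by apply: cvg_fsum => i; apply: cvgMl_tmp; exact: cm.
split; last by apply: (ler_cvg_to cs (cvg_cst _)); apply: nearW => n; exact: (hu n v).2.
have c1 : (fun n => 2 * d%:R * sqn (mulv (u n) v) + l * sqn v) @ \oo --> 2 * d%:R * sqn (mulv M v) + l * sqn v.
  by apply: cvgD; [apply: cvgMl_tmp|apply: cvg_cst].
by apply: (ler_cvg_to c1 cd); apply: nearW => n; exact: (hu n v).1.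
Qed.
Context (p0 C1 : R).
Hypothesis p01 : 1 < p0.
Hypothesis C10 : 0 < C1.
Hypothesis hH : HypH P tau A Lam p0 C1.
Definition ahr : 'M[R]_d := \matrix_(i, k) cRe (ahom P tau A i k).
Lemma ahom_cvg i k : exists u : nat -> R, (forall n, 0 < u n) /\
  (forall i k, (fun n => cRe (qhl P tau A 0 (u n) i k)) @ \oo --> ahr i k) /\ cIm (ahom P tau A i k) = 0.
Proof.
have [K K0 hK] := ahom_rate hE Lam4 d0 p01 C10 hH.
have s0 : 0 < sig p0 / 2 by rewrite divr_gt0 // sig_gt0.
have e0 : esq (0 : 'rV[R]_d) = 0.
  by rewrite /esq big1 // => j _; rewrite zz0 subrr /cdot cRe0 cIm0 mulr0 addr0.
pose g n := n.+1%:R^-1 * (Lam / 2).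
have g0 n : 0 < g n by rewrite mulr_gt0 ?invr_gt0 ?ltr0n // divr_gt0.
have gL n : g n < Lam.
  have : n.+1%:R^-1 <= 1 :> R by rewrite invf_le1 ?ltr0n // ler1n.
  move=> h; apply: le_lt_trans (_ : 1 * (Lam / 2) < Lam); last by have := L0; lra.
  by rewrite ler_wpM2r // divr_ge0 // ltW.
have hb n i' k' : cmod (qhl P tau A 0 (g n) i' k' - ahom P tau A i' k') <= K * g n `^ (sig p0 / 2).
  by have := hK 0 i' k' (g n) (g0 n) (gL n); rewrite e0 sqrtr0 mul0r addr0 mulr1.
have g_cvg : (fun n => K * g n `^ (sig p0 / 2)) @ \oo --> (0 : R).
  rewrite -(mulr0 K); apply: cvgMl_tmp.
  have /cvg_at_rightP h := @powR_cvg0 R _ s0.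
  apply: h; split=> //.
  by rewrite -(mul0r (Lam / 2)); apply: cvgMr_tmp; exact: cvg_harmonic.
have cre_cvg i' k' : (fun n => cRe (qhl P tau A 0 (g n) i' k')) @ \oo --> ahr i' k'.
  apply/cvgrPdist_le => e ep; have /cvgrPdist_le /(_ _ ep) := g_cvg; apply: filterS => n.
  rewrite sub0r normrN => h; rewrite mxE distrC -cReB; apply: le_trans (cRe_le _) _.
  by apply: le_trans (hb n i' k') _; apply: le_trans h; exact: ler_norm.
exists g; split=> //; split=> //.
apply/eqP; rewrite -normr_eq0 eq_le normr_ge0 andbT; apply/ler_addgt0Pr => e ep; rewrite add0r.
have /cvgrPdist_le /(_ _ ep) [n _ /(_ n (leqnn n))] := g_cvg.
rewrite /= sub0r normrN => h.
have := cIm_le (qhl P tau A 0 (g n) i k - ahom P tau A i k); rewrite cImD cImN qhl_real // sub0r normrN => h1.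
by apply: le_trans h1 _; apply: le_trans (hb n i k) _; apply: le_trans h; exact: ler_norm.
Qed.

Lemma ahom_real : ahom P tau A = map_mx (@cR R) ahr.
Proof.
apply/matrixP => i k; have [u [_ [_ h]]] := ahom_cvg i k.
by rewrite !mxE; apply: ceq; rewrite ?cIm_cR ?h.
Qed.

Lemma ahr_cls : cls (lam / 2) (2 * Lam) ahr.
Proof.
have [u [u0 [h _]]] := ahom_cvg (Ordinal d0) (Ordinal d0).
apply: (cls_lim (fun n => qhl_cls (u0 n))) => i k.
by under eq_fun do rewrite mxE; exact: h.
Qed.
End Class.

Lemma map_heat (V W : comPzRingType) (h : {rmorphism V -> W}) d (M : Zd d -> nat -> 'M[V]_d) t x :
  h (heat M t x) = heat (fun y s => map_mx h (M y s)) t x.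
Proof.
elim: t x => [|t IH] x /=; first by case: (x == 0); rewrite ?rmorph1 ?rmorph0.
rewrite rmorphB IH rmorph_sum; congr (_ - _); apply: eq_bigr => i _.
rewrite rmorphB !rmorph_sum; congr (_ - _); apply: eq_bigr => j _; by rewrite rmorphM rmorphB !IH mxE.
Qed.

(** * The two-scale expansion *)

Section FourierRecursion.
Context (R : realType) (dsp : measure_display) (Om : measurableType dsp) (d : nat) (tau : Zd d -> int -> Om -> Om) (A : Om -> 'M[R]_d)
        (xi : 'rV[R]_d).
Local Notation C := (complex R).
Hypothesis t00 : forall w, tau 0 0 w = w.
Hypothesis tDD : forall x y s t w, tau (x + y) (s + t) w = tau x s (tau y t w).
Local Notation K := (K tau A).
Definition fsu (k : Zd d -> Om -> R) := exists s : seq (Zd d), forall x w, x \notin s -> k x w = 0.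
Definition TT (s : int) (k : Zd d -> Om -> R) (w : Om) : C :=
  zsum (fun x => chr xi (- x) * cR (k x (tau (- x) s w))).
Lemma fs_TT s k w : fsu k -> fs (fun x => chr xi (- x) * cR (k x (tau (- x) s w))).
Proof. by case=> l h; exists l => x hx; rewrite h // cR0 mulr0. Qed.
Lemma fsu_shift k y : fsu k -> fsu (fun x => k (x + y)).
Proof.
case=> l h; exists [seq x - y | x <- l] => x w hx; apply: h; apply: contra hx => hx.
by apply/mapP; exists (x + y); rewrite ?addrK.
Qed.

Lemma fsuB k k' : fsu k -> fsu k' -> fsu (fun x w => k x w - k' x w).
Proof.
case=> l h [l' h']; exists (l ++ l') => x w; rewrite mem_cat negb_or => /andP[a b].
by rewrite h // h' // subrr.
Qed.

Lemma fsuM (c : Zd d -> Om -> R) k : fsu k -> fsu (fun x w => c x w * k x w).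
Proof. by case=> l h; exists l => x w hx; rewrite h // mulr0. Qed.
Lemma fsu_sum (F : 'I_d -> Zd d -> Om -> R) : (forall i, fsu (F i)) -> fsu (fun x w => \sum_i F i x w).
Proof.
move=> h; have [l hl] := boolp.choice h; exists (flatten [seq l i | i <- enum 'I_d]) => x w hx.
apply: big1 => i _; apply: hl; apply: contra hx => hx; apply/flatten_mapP; exists i => //.
by rewrite mem_enum.
Qed.

Lemma TTB s k k' w : fsu k -> fsu k' -> TT s (fun x w => k x w - k' x w) w = TT s k w - TT s k' w.
Proof.
move=> h h'; rewrite /TT -zsumB; [|exact: fs_TT..].
by apply: eq_zsum => x; rewrite cRD cRN mulrBr.
Qed.

Lemma TT_sum s (F : 'I_d -> Zd d -> Om -> R) w : (forall i, fsu (F i)) ->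
  TT s (fun x w => \sum_i F i x w) w = \sum_i TT s (F i) w.
Proof.
move=> h; rewrite /TT -zsum_sum; last by move=> i; exact: fs_TT.
by apply: eq_zsum => x; rewrite cR_sum mulr_sumr.
Qed.

Lemma TT_shift s k y w : fsu k -> TT s (fun x => k (x + y)) w = chr xi y * TT s k (tau y 0 w).
Proof.
move=> hk.
have -> : TT s k (tau y 0 w) = zsum (fun x => chr xi (- x) * cR (k x (tau (- x + y) s w))).
  by apply: eq_zsum => x; rewrite -tDD addr0.
rewrite -(zsum_shift _ y) /TT -zsumZ.
  apply: eq_zsum => x; rewrite mulrA -chrD; congr (chr _ _ * cR (k _ (tau _ _ _))).
    by rewrite opprD addrCA addrN addr0.
  by rewrite opprD -addrA addNr addr0.
by have [l h] := fsu_shift y hk; exists l => x hx; rewrite h // cR0 mulr0.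
Qed.

(* The Fourier transform of the Green function along the environment seen from its endpoint. *)
Definition UU (t : nat) : Om -> C := TT (- t%:Z) (K t).
Lemma fsu_K t : fsu (K t).
Proof. by exists (boxs d t) => x w hx; exact: heat_supp. Qed.
Lemma UU0 w : UU 0 w = 1.
Proof.
have K0 x v : K 0 x v = if x == 0 then 1 else 0 by [].
rewrite /UU /TT (zsum1 (a := 0)) => [|x hx]; first by rewrite oppr0 chr0 mul1r K0 eqxx.
by rewrite K0 (negPf hx) cR0 mulr0.
Qed.

(** Seen from the endpoint, the coefficient at (x, t) is always [A] at the origin of the current
    environment. The lattice recursion of the kernel thus becomes one application of the twisted
    operator with the fixed coefficient [A], followed by a time shift. *)
Lemma UUS t w : UU t.+1 (tau 0 1 w) = yop tau (zz xi) A (fun _ _ => 0) (UU t) w.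
Proof.
pose fx i x v := \sum_j A (tau x t%:Z v) i j * (K t (x + evec j) v - K t x v).
have fK := fsu_K t.
have ff i : fsu (fx i) by apply: fsu_sum => j; apply: fsuM; apply: fsuB => //; exact: fsu_shift.
have TF i v : TT (- t%:Z) (fx i) v = am A (fun j w => dd tau (zz xi) j (UU t) w + 0) i v.
  rewrite /fx TT_sum; last by move=> j; apply: fsuM; apply: fsuB => //; exact: fsu_shift.
  apply: eq_bigr => j _; rewrite addr0 /dd -chr_evec -TT_shift // -TTB //; last exact: fsu_shift.
  rewrite /TT -zsumZ; last by apply: (@fs_TT _ (fun x w => K t (x + evec j) w - K t x w)); apply: fsuB => //; exact: fsu_shift.
  by apply: eq_zsum => x; rewrite cRM -tDD addrN addrN t00 mulrCA.
have -> : UU t.+1 (tau 0 1 w) = TT (- t%:Z) (fun x v => K t x v - \sum_i (fx i (x - evec i) v - fx i x v)) w.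
  apply: eq_zsum => x; congr (_ * cR _); rewrite -tDD addr0.
  by have -> : - t.+1%:Z + 1 = - t%:Z by rewrite -[t.+1]addn1 PoszD opprD addrNK.
rewrite TTB //; last by apply: fsu_sum => i; apply: fsuB => //; exact: fsu_shift.
rewrite /yop; congr (_ - _); rewrite TT_sum; last by move=> i; apply: fsuB => //; exact: fsu_shift.
apply: eq_bigr => i _; rewrite TTB //; last exact: fsu_shift.
by rewrite TT_shift // !TF chrN chr_evec.
Qed.
End FourierRecursion.

Section Symbol.
Context (R : realType) (d : nat) (M : 'M[R]_d) (l L : R) (hM : cls l L M) (l0 : 0 < l) (xi : 'rV[R]_d).
Local Notation C := (complex R).
Hypothesis d0 : (0 < d)%N.
Definition ee j : C := zz xi j - 1.
Definition symb : C := \sum_i cconj (ee i) * \sum_j cR (M i j) * ee j.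
Definition hh (t : nat) : C := UU (fun (_ : Zd d) (_ : int) (w : unit) => w) (fun _ => M) xi t tt.
Lemma hhE t : hh t = zsum (fun x => chr xi (- x) * cR (heat (fun _ _ => M) t x)). Proof. by []. Qed.
Lemma hh_pow t : hh t = (1 - symb) ^+ t.
Proof.
elim: t => [|t IH]; first by rewrite /hh UU0 expr0.
have := @UUS R _ unit d (fun (_ : Zd d) (_ : int) (w : unit) => w) (fun _ => M) xi (fun _ => erefl) (fun _ _ _ _ _ => erefl) t tt.
rewrite -/(hh t.+1) => ->; rewrite exprS -IH /yop mulrBl mul1r -/(hh t); congr (_ - _).
rewrite /symb mulr_suml /dv; apply: eq_bigr => i _; rewrite /dds /am.
have -> : \sum_j cR (M i j) * (dd (fun (_ : Zd d) (_ : int) (w : unit) => w) (zz xi) j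
     (UU (fun (_ : Zd d) (_ : int) (w : unit) => w) (fun _ : unit => M) xi t) tt + 0) = (\sum_j cR (M i j) * ee j) * hh t.
  by rewrite mulr_suml; apply: eq_bigr => j _; rewrite addr0 /dd -/(hh t) /ee; ring.
have -> : cconj (ee i) = cconj (zz xi i) - 1.
  by apply: ceq; rewrite /ee ?cReD ?cImD ?cReN ?cImN ?cRe_conj ?cIm_conj ?cReD ?cImD ?cReN ?cImN ?cRe1 ?cIm1 ?subr0 //; ring.
ring.
Qed.

Lemma esqE : esq xi = \sum_j cdot (ee j) (ee j). Proof. by []. Qed.
Lemma esq_le : esq xi <= 4 * d%:R.
Proof.
have e (x : R) : \sum_(j < d) x = d%:R * x by rewrite sumr_const card_ord mulr_natl.
rewrite mulrC -(e 4) /esq; apply: ler_sum => j _; apply: le_trans (cdotB_le _ _) _.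
by rewrite zz_unit /cdot cRe1 cIm1; lra.
Qed.

(** In 1 - 2 Re p + |p|^2 the last term is at most |e|^2 |Me|^2 <= 4 d |Me|^2, since |e|^2 <= 4 d.
    This is cancelled by the 2 d |Me|^2 in [cls], applied to the real and imaginary parts of e,
    leaving 2 l |e|^2. *)
Lemma symb_le : cmod (1 - symb) ^+ 2 <= 1 - 2 * l * esq xi.
Proof.
pose x j := cRe (ee j); pose y j := cIm (ee j).
have [hx1 _] := hM x; have [hy1 _] := hM y.
pose Me i : C := \sum_j cR (M i j) * ee j.
have eMe i : Me i = Complex (mulv M x i) (mulv M y i).
  apply: ceq.
    rewrite /Me cRe_sum; apply: eq_bigr => j _.
    by rewrite cReM cRe_cR cIm_cR mul0r subr0.
  rewrite /Me cIm_sum; apply: eq_bigr => j _.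
  by rewrite cImM cRe_cR cIm_cR mul0r addr0.
have re : cRe symb = dotv x (mulv M x) + dotv y (mulv M y).
  rewrite /symb cRe_sum /dotv -big_split; apply: eq_bigr => i _.
  rewrite -/(Me i) eMe cReM cRe_conj cIm_conj -/(x i) -/(y i) -[RHS]/(x i * mulv M x i + y i * mulv M y i).
  by rewrite mulNr opprK.
have n1 : cdot symb symb <= (\sum_i cdot (ee i) (ee i)) * (\sum_i cdot (Me i) (Me i)).
  apply: le_trans (cdot_CS _ _) _; rewrite le_eqVlt; apply/orP; left; apply/eqP; congr (_ * _).
  by apply: eq_bigr => i _; rewrite /cdot cRe_conj cIm_conj; ring.
have n2 : \sum_i cdot (Me i) (Me i) = sqn (mulv M x) + sqn (mulv M y).
  by rewrite /sqn -big_split; apply: eq_bigr => i _; rewrite eMe /cdot /= !expr2.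
have n3 : esq xi = sqn x + sqn y.
  by rewrite /sqn -big_split; apply: eq_bigr => i _; rewrite /cdot !expr2.
rewrite -esqE in n1.
have n4 : esq xi * (\sum_i cdot (Me i) (Me i)) <= 4 * d%:R * (\sum_i cdot (Me i) (Me i)).
  apply: (ler_wpM2r _ esq_le); apply: sumr_ge0 => i _; exact: cdot_ge0.
have -> : cmod (1 - symb) ^+ 2 = 1 - 2 * cRe symb + cdot symb symb.
  by rewrite cmod_sqr /cdot cReD cImD cReN cImN cRe1 cIm1; ring.
rewrite re; move: (le_trans n1 n4); rewrite n2 n3.
move: hx1 hy1; move: (dotv x _) (dotv y _) (cdot symb symb) (sqn x) (sqn y) (sqn _) (sqn _) => a b c sx sy mx my; lra.
Qed.

(** Geometric series of ratio q = |1 - p|, where q^2 <= 1 - 2 l |e|^2 gives q <= 1 - l |e|^2. *)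
Lemma hh_sum T : (\sum_(t < T) cmod (hh t)) * (l * esq xi) <= 1 /\ \sum_(t < T) cmod (hh t) <= T%:R.
Proof.
have lt1 := mulr_ge0 (ltW l0) (esq_ge0 xi).
set q := cmod (1 - symb).
have q2 : q ^+ 2 <= 1 - 2 * l * esq xi by exact: symb_le.
have q0 : 0 <= q by exact: cmod_ge0.
have q1 : q <= 1 - l * esq xi.
  have := sqr_ge0 (1 - q); move: q2; rewrite !expr2 => *; lra.
have hq t : cmod (hh t) = q ^+ t.
  rewrite hh_pow; elim: t => [|t IH]; last by rewrite !exprS cmodM IH.
  by rewrite !expr0 /cmod cRe1 cIm1 expr0n addr0 expr1n sqrtr1.
have q1' : q <= 1 by lra.
split; last first.
  apply: le_trans (_ : \sum_(t < T) (1 : R) <= _); last by rewrite sumr_const card_ord.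
  by apply: ler_sum => t _; rewrite hq exprn_ile1.
under eq_bigr do rewrite hq.
elim: T => [|T IH]; first by rewrite big_ord0 mul0r.
have -> : \sum_(i < T.+1) q ^+ i = 1 + q * \sum_(i < T) q ^+ i.
  by rewrite big_ord_recl expr0 mulr_sumr; congr (_ + _); apply: eq_bigr => i _; rewrite -exprS.
rewrite mulrDl mul1r -mulrA.
set S := (\sum_(i < T) _) * _ in IH *.
have : q * S <= q * 1 by rewrite ler_wpM2l.
lra.
Qed.
End Symbol.

Section EnvAnnealed.
Context (R : realType) (dsp : measure_display) (Om : measurableType dsp)
        (P : probability Om R) (d : nat) (tau : Zd d -> int -> Om -> Om)
        (A : Om -> 'M[R]_d) (lam Lam : R).
Hypothesis hE : Env P tau A lam Lam.
Hypothesis Lam4 : 4 * d%:R * Lam <= 1.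
(** Bounded measurable observables form an algebra stable under shifts; it contains every [K t x], a
    polynomial in shifted entries of [A]. *)
Definition adm (f : Om -> R) := measurable_fun setT f /\ exists B, forall w, `|f w| <= B.
Lemma adm_rl2 f : adm f -> rl2 P f.
Proof.
case=> m [B hB]; have [h _] : sl2 P (fun w => cR (f w) * 1) by apply: (sl2_bdd (B := B)) => //; exact: sl2_cst.
by move: h; congr rl2; apply: boolp.funext => w; rewrite mulr1.
Qed.

Lemma adm_int f : adm f -> P.-integrable setT (EFin \o f).
Proof.
move=> h; have := sip_int (P := P) (f := fun w => cR (f w)) (g := fun=> 1).
have -> : (fun w => cdot (cR (f w)) 1) = f by apply: boolp.funext => w; rewrite /cdot cRe1 cIm1 mulr1 mulr0 addr0.
apply; last exact: sl2_cst.
split; [exact: adm_rl2|].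
by have [_ h'] := @sl2_cst _ _ _ P 0; exact: h'.
Qed.

Lemma env_cls w : cls (lam / 2) (2 * Lam) (A w).
Proof.
move=> v; have /andP[h1 h2] := env_form hE w v; have h3 := env_up hE w v.
have L0 := env_Lam0 hE; have s0 := sqn_ge0 v; have l0 := env_lam0 hE.
have dR : 0 <= d%:R :> R by rewrite ler0n.
have q0 : 0 <= dotv v (mulv (A w) v) by apply: le_trans h1; rewrite mulr_ge0 // ltW.
have a1 : d%:R * sqn (mulv (A w) v) <= d%:R * (Lam * dotv v (mulv (A w) v)) by rewrite ler_wpM2l.
have a2 : 4 * d%:R * Lam * dotv v (mulv (A w) v) <= 1 * dotv v (mulv (A w) v) by rewrite ler_wpM2r.
split; first by move: a1 a2 h1; clear -R; move: (dotv _ _) (sqn v) (sqn _) => a b c; lra.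
apply: le_trans h3 _; apply: le_trans (_ : Lam * (Lam * sqn v) <= _); first by rewrite ler_wpM2l // ltW.
have : 0 <= Lam * (Lam * sqn v) by rewrite !mulr_ge0 // ltW.
by rewrite expr2; lra.
Qed.

Lemma an_env : annealed adm (fun f => Rintegral P setT f) tau A (lam / 2) (2 * Lam).
Proof.
have [f1 [f2 f3]] := env_flow hE.
have madd f g : adm f -> adm g -> adm (fun w => f w + g w).
  move=> [m [B hB]] [m' [B' hB']]; split; first exact: measurable_funD.
  by exists (B + B') => w; apply: le_trans (ler_normD _ _) _; rewrite lerD.
have mcst c : adm (fun=> c) by split; [exact: measurable_cst|exists `|c|].
have mmul f g : adm f -> adm g -> adm (fun w => f w * g w).
  move=> [m [B hB]] [m' [B' hB']]; split; first exact: measurable_funM.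
  by exists (B * B') => w; rewrite normrM ler_pM.
have mtau f x s : adm f -> adm (fun w => f (tau x s w)).
  move=> [m [B hB]]; split; last by exists B => w; exact: hB.
  by apply: measurableT_comp => //; exact: (tau_meas (env_flow hE)).
split => //.
- by move=> f g hf hg; rewrite RintegralD //; exact: adm_int.
- by move=> c f hf; rewrite RintegralZl //; exact: adm_int.
- by move=> f g hf hg h; apply: le_Rintegral => //; exact: adm_int.
- have h := cexpect_cst P (1 : complex R).
  exact: (congr1 (@cRe R) h).
- move=> f x s hf; have h : sl2 P (fun w => cR (f w)).
    split; first exact: adm_rl2.
    by have [_ h'] := @sl2_cst _ _ _ P 0; exact: h'.
  by have := congr1 (@cRe R) (cexpect_sh (env_flow hE) x s h).
- move=> i j; split; first exact: (env_meas hE).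
  by exists Lam => w; exact: (env_bdd hE).
- exact: env_cls.
Qed.

Lemma Ga_GG t x : Ga P tau A t x = GG (fun f => Rintegral P setT f) tau A t x.
Proof. by []. Qed.
End EnvAnnealed.

Section TwoScale.
Context (R : realType) (dsp : measure_display) (Om : measurableType dsp)
        (P : probability Om R) (d : nat) (tau : Zd d -> int -> Om -> Om)
        (A : Om -> 'M[R]_d) (lam Lam : R).
Local Notation C := (complex R).
Hypothesis hE : Env P tau A lam Lam.
Hypothesis Lam4 : 4 * d%:R * Lam <= 1.
Hypothesis d0 : (0 < d)%N.
Let fl := env_flow hE.
Let cA := env_coef hE.
Let L0 := env_Lam0 hE.
Let l0 := env_lam0 hE.
Let t00 : forall w, tau 0 0 w = w. Proof. by case: fl. Qed.
Let tDD : forall x y s t w, tau (x + y) (s + t) w = tau x s (tau y t w). Proof. by case: fl => _ []. Qed.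
Lemma sl2_adm c f : adm f -> sl2 P (fun w => c * cR (f w)).
Proof.
move=> h; apply: sl2Z; split; first exact: adm_rl2.
by have [_ h'] := @sl2_cst _ _ _ P 0; exact: h'.
Qed.

Section Freq.
Context (xi : 'rV[R]_d).
Local Notation z := (zz xi).
Lemma UU_sum t : UU tau A xi t = fun w => \sum_(x <- boxs d t) chr xi (- x) * cR (K tau A t x (tau (- x) (- t%:Z) w)).
Proof.
apply: boolp.funext => w; apply: zsumE; first exact: boxs_uniq.
by move=> x hx; rewrite /K heat_supp // cR0 mulr0.
Qed.

Let admK t x : adm (fun w => K tau A t x (tau (- x) (- t%:Z) w)).
Proof. have an := an_env hE Lam4; have [h _] := afs_K an t; exact: (adm_tau an _ _ (h x)). Qed.
Lemma sl2_UU t : sl2 P (UU tau A xi t).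
Proof. by rewrite UU_sum; apply: sl2_sum => x; exact: sl2_adm. Qed.
(** Each term is evaluated in an environment shifted by its own (x, t); stationarity removes these
    shifts under the expectation, and the transform of the averaged kernel remains. *)
Lemma cexpect_UU t : cexpect P (UU tau A xi t) = zsum (fun x => chr xi (- x) * cR (Ga P tau A t x)).
Proof.
rewrite UU_sum (zsumE (s := boxs d t)) ?boxs_uniq //; last first.
  move=> x hx; have -> : Ga P tau A t x = 0; last by rewrite cR0 mulr0.
  by rewrite /Ga; apply: Rint_eq0 => w; exact: heat_supp.
elim: (boxs d t) => [|a s IH].
  by rewrite big_nil -[RHS](cexpect_cst P); congr cexpect; apply: boolp.funext => w; rewrite big_nil.
rewrite big_cons -IH.
have s1 : sl2 P (fun w => \sum_(x <- s) chr xi (- x) * cR (K tau A t x (tau (- x) (- t%:Z) w))).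
  by apply: sl2_sum => x; exact: sl2_adm.
have s2 := sl2_adm (chr xi (- a)) (admK t a).
have -> : (fun w => \sum_(x <- a :: s) chr xi (- x) * cR (K tau A t x (tau (- x) (- t%:Z) w))) =
   (fun w => chr xi (- a) * cR (K tau A t a (tau (- a) (- t%:Z) w)) + \sum_(x <- s) chr xi (- x) * cR (K tau A t x (tau (- x) (- t%:Z) w))).
  by apply: boolp.funext => w; rewrite big_cons.
rewrite (cexpectD s2 s1); congr (_ + _).
have an := an_env hE Lam4; have [h _] := afs_K an t.
have s3 : sl2 P (fun w => cR (K tau A t a w)).
  by have := sl2_adm 1 (h a); congr sl2; apply: boolp.funext => w; rewrite mul1r.
rewrite cexpectZ; last exact: (sl2_sh fl (- a) (- t%:Z) s3).
rewrite (cexpect_sh fl (- a) (- t%:Z) s3); congr (_ * _).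
by apply: ceq => //; rewrite /cexpect /=; apply: Rint_eq0.
Qed.
Context (eta : R) (eta0 : 0 < eta) (f : 'I_d -> Om -> C).
Hypothesis cf : forall k, corr P tau A xi eta k (f k).
Let sf k : sl2 P (f k) := (cf k).1.1.
Let e k := ee xi k.
Definition Fe (w : Om) : C := \sum_k e k * f k w.
Let Fk k := am A (psik tau xi k (f k)).
Let vF k : vl2 P (Fk k) := vl2_am cA (vl2_psik hE xi k (sf k)).
Let Q i k := qent P tau A xi k (f k) i.
Definition eqe : C := \sum_i cconj (e i) * \sum_k Q i k * e k.
Lemma sl2_Fe : sl2 P Fe. Proof. by apply: sl2_sum => k; apply: sl2Z. Qed.
Let y0 := yop tau z A (fun _ _ => 0).
(** The twisted derivative of the constant 1 is e_j, so the gradient of 1 + Fe is the combination of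
    grad phi_k + e_k with coefficients e_k. The corrector equations remove the fluctuation of its
    flux divergence; only the mean, which is e-bar q e, is left. *)
Lemma Fe_yop : {ae P, forall w, y0 (fun w => 1 + Fe w) w = 1 + cR (expR eta) * Fe (tau 0 1 w) - eqe}.
Proof.
have h k : {ae P, forall w, cR (expR eta) * f k (tau 0 1 w) - cproj P true (yop tau z A (@ek R _ Om d k) (f k)) w = 0}.
  apply: sn_eq0 (cf k).1.2; apply: sl2B; first by apply: sl2Z; exact: (sl2_sh fl).
  by rewrite /cproj; apply: sl2_pim; exact: (sl2_yop fl z cA (vl2_ek P k) (sf k)).
have := ae_forall h; apply: filterS => w hw.
have cds i g : sl2 P g -> cexpect P (dds tau z i g) = cconj (e i) * cexpect P g.
  move=> sg; rewrite /dds; have s1 := sl2_sh fl (- evec i) 0 sg.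
  rewrite (cexpectB (sl2Z (cconj (z i)) s1) sg) cexpectZ // (cexpect_sh fl (- evec i) 0 sg).
  have -> : cconj (e i) = cconj (z i) - 1.
    by apply: ceq; rewrite /e /ee ?cReD ?cImD ?cReN ?cImN ?cRe_conj ?cIm_conj ?cReD ?cImD ?cReN ?cImN ?cRe1 ?cIm1 ?subr0 //; ring.
  by ring.
have cdv k : cexpect P (dv tau z (Fk k)) = \sum_i cconj (e i) * Q i k.
  have cs (s : seq 'I_d) : cexpect P (fun w => \sum_(i <- s) dds tau z i (Fk k i) w) = \sum_(i <- s) cconj (e i) * Q i k.
    elim: s => [|a s IH].
      by rewrite big_nil -[RHS](cexpect_cst P); congr cexpect; apply: boolp.funext => v; rewrite big_nil.
    have s1 : sl2 P (dds tau z a (Fk k a)) by exact: (sl2_dds fl z a (vF k a)).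
    have s2 : sl2 P (fun w => \sum_(i <- s) dds tau z i (Fk k i) w) by apply: sl2_sum => i; exact: (sl2_dds fl z i (vF k i)).
    rewrite big_cons -IH; have -> : cconj (e a) * Q a k = cexpect P (dds tau z a (Fk k a)) by rewrite cds //; exact: vF.
    rewrite -(cexpectD s1 s2).
    by congr cexpect; apply: boolp.funext => v; rewrite big_cons.
  exact: cs.
have hk k : cR (expR eta) * f k (tau 0 1 w) = f k w - dv tau z (Fk k) w + \sum_i cconj (e i) * Q i k.
  have := hw k; rewrite /cproj; have -> : yop tau z A (@ek R _ Om d k) (f k) = fun w => f k w - dv tau z (Fk k) w by [].
  have sd := sl2_dv fl z (vF k).
  rewrite pimB // (pim_mean0 (cf k).2) /pim cdv => /eqP; rewrite subr_eq0 => /eqP ->; ring.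
have eqeE : eqe = \sum_k e k * \sum_i cconj (e i) * Q i k.
  rewrite /eqe; under eq_bigr do rewrite mulr_sumr; rewrite exchange_big; apply: eq_bigr => k _.
  by rewrite mulr_sumr; apply: eq_bigr => i _; ring.
have -> : cR (expR eta) * Fe (tau 0 1 w) = Fe w - \sum_k e k * dv tau z (Fk k) w + eqe.
  rewrite eqeE /Fe mulr_sumr -sumrB -big_split; apply: eq_bigr => k _.
  by rewrite mulrCA hk /=; ring.
rewrite /y0 /yop addrA addrK -addrA; congr (_ + _); congr (_ - _).
rewrite /dv; under [RHS]eq_bigr do rewrite mulr_sumr.
rewrite exchange_big; apply: eq_bigr => i _; rewrite /dds.
have aE v : am A (fun i w0 => dd tau z i (fun w1 => 1 + Fe w1) w0 + 0) i v = \sum_k e k * Fk k i v.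
  rewrite /Fk /am; under [RHS]eq_bigr do rewrite mulr_sumr.
  rewrite exchange_big; apply: eq_bigr => j _; rewrite addr0.
  have -> : dd tau z j (fun w1 => 1 + Fe w1) v = \sum_k e k * psik tau xi k (f k) j v.
    rewrite /psik (eq_bigr (fun k => e k * dd tau z j (f k) v + e k * @ek R _ Om d k j v)) => [|k _]; last by rewrite mulrDr.
    have ej : \sum_k e k * @ek R _ Om d k j v = e j.
      rewrite (bigD1 j) //= big1 => [|k hk']; first by rewrite /ek eqxx mulr1 addr0.
      by rewrite /ek eq_sym (negPf hk') mulr0.
    rewrite big_split /= ej /dd /Fe.
    have -> : \sum_k e k * (z j * f k (tau (evec j) 0 v) - f k v) = z j * (\sum_k e k * f k (tau (evec j) 0 v)) - \sum_k e k * f k v.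
      by rewrite mulr_sumr -sumrB; apply: eq_bigr => k _; ring.
    by rewrite /e /ee; ring.
  by rewrite mulr_sumr; apply: eq_bigr => k _; ring.
by rewrite !aE mulr_sumr -sumrB; apply: eq_bigr => k _; ring.
Qed.
Context (M : 'M[R]_d).
Let h t := hh M xi t.
Let p := symb M xi.
(* The error of the two-scale expansion of [UU]. *)
Definition XX t (w : Om) : C := UU tau A xi t w - h t * (1 + Fe w).
Lemma sl2_1Fe : sl2 P (fun w => 1 + Fe w).
Proof. by apply: sl2D; [exact: sl2_cst|exact: sl2_Fe]. Qed.
Lemma sl2_XX t : sl2 P (XX t).
Proof. by apply: sl2B; [exact: sl2_UU|apply: sl2Z; exact: sl2_1Fe]. Qed.
Lemma snZ (c : C) g : sl2 P g -> sn P (fun w => c * g w) = cmod c * sn P g.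
Proof.
move=> sg; apply/eqP; rewrite -(eqrXn2 (n := 2)) ?mulr_ge0 ?cmod_ge0 ?sn_ge0 // exprMn !sn_sqr cmod_sqr; apply/eqP.
rewrite sip_conj; have -> : (fun w => cconj c * (c * g w)) = fun w => cR (cdot c c) * g w.
  apply: boolp.funext => w; rewrite mulrA; congr (_ * _).
  by apply: ceq; rewrite ?cReM ?cImM ?cRe_conj ?cIm_conj /cdot /=; ring.
by rewrite sipRr.
Qed.

Lemma sn_cst (c : C) : sn P (fun=> c) = cmod c.
Proof.
have s1 := @sl2_cst _ _ _ P c.
have h1 := cexpect_le s1; rewrite cexpect_cst in h1; apply/eqP; rewrite eq_le h1 andbT.
rewrite -ler_sqr ?nnegrE ?sn_ge0 ?cmod_ge0 // sn_sqr sip_cstr // cexpect_cst cmod_sqr //.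
Qed.

(** The random step contracts L2, so the error grows only by the consistency defect: the symbol p
    against e-bar q e, and the factor e^eta - 1 + p on the corrector, which stems from the
    regularization and from the time dependence of h. *)
Lemma XX_step t : sn P (XX t.+1) <= sn P (XX t) +
  cmod (h t) * (cmod (p - eqe) + cmod (cR (expR eta) - 1 + p) * sn P Fe).
Proof.
have hS : h t.+1 = h t * (1 - p) by rewrite /h !hh_pow exprSr.
pose r w := h t * ((p - eqe) + (cR (expR eta) - 1 + p) * Fe (tau 0 1 w)).
have sF1 := sl2_sh fl 0 1 sl2_Fe.
have sr0 : sl2 P (fun w => (p - eqe) + (cR (expR eta) - 1 + p) * Fe (tau 0 1 w)).
  by apply: sl2D; [exact: sl2_cst|exact: sl2Z].
have sr : sl2 P r by exact: sl2Z.
have v0 : vl2 P (fun (_ : 'I_d) (_ : Om) => 0 : C) by move=> i; exact: sl2_cst.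
have sy : sl2 P (y0 (XX t)) by exact: (sl2_yop fl z cA v0 (sl2_XX t)).
have ae0 : {ae P, forall w, XX t.+1 (tau 0 1 w) - (y0 (XX t) w + r w) = 0}.
  have := Fe_yop; apply: filterS => w hw.
  have e1 : y0 (XX t) w = y0 (UU tau A xi t) w - h t * y0 (fun w => 1 + Fe w) w.
    have := yopB tau z A (fun _ _ => 0) (fun _ _ => 0) (UU tau A xi t) (fun w => h t * (1 + Fe w)) w.
    have yZ : yop tau z A (fun _ _ => 0) (fun w => h t * (1 + Fe w)) w = h t * y0 (fun w => 1 + Fe w) w.
      rewrite /y0 /yop mulrBr; congr (_ - _); rewrite /dv mulr_sumr; apply: eq_bigr => i _; rewrite /dds.
      have aZ v : am A (fun i0 w0 => dd tau z i0 (fun w1 => h t * (1 + Fe w1)) w0 + 0) i v = h t * am A (fun i0 w0 => dd tau z i0 (fun w1 => 1 + Fe w1) w0 + 0) i v.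
        by rewrite /am mulr_sumr; apply: eq_bigr => j _; rewrite /dd; ring.
      by rewrite !aZ; ring.
    rewrite yZ -/(y0 _) => ->; rewrite /y0 /XX; congr (yop _ _ _ _ _ _).
    by apply: boolp.funext => i; apply: boolp.funext => v; rewrite subr0.
  rewrite e1 hw /XX (UUS A xi t00 tDD) hS /r /y0; ring.
have e2 : sn P (XX t.+1) <= sn P (fun w => y0 (XX t) w + r w).
  rewrite -(sn_sh fl 0 1 (sl2_XX t.+1)).
  have s1 := sl2_sh fl 0 1 (sl2_XX t.+1); have s2 := sl2D sy sr.
  by apply: le_trans (sn_leB s1 s2) _; rewrite (sn_ae0 (sl2B s1 s2) ae0) addr0.
apply: le_trans e2 _; apply: le_trans (snD sy sr) _; apply: lerD.
  exact: (sn_yop0 fl (@zz_unit R d xi) cA Lam4 L0 (ltW l0) (sl2_XX t)).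
rewrite snZ // ler_wpM2l ?cmod_ge0 //; apply: le_trans (snD _ _) _; [exact: sl2_cst|exact: sl2Z|].
by rewrite sn_cst snZ // (sn_sh fl 0 1 sl2_Fe).
Qed.

(** At time 0 the error is -[Fe]. At time T, taking the expectation leaves the difference of the two
    transforms, because the correctors have mean zero. *)
Lemma Dhat_le T : cmod (cexpect P (UU tau A xi T) - h T) <= sn P Fe +
  (\sum_(t < T) cmod (h t)) * (cmod (p - eqe) + cmod (cR (expR eta) - 1 + p) * sn P Fe).
Proof.
set B := cmod (p - eqe) + _.
have X0 : sn P (XX 0) = sn P Fe.
  rewrite -(snN sl2_Fe); congr sn; apply: boolp.funext => w.
  by rewrite /XX UU0 /h hh_pow expr0; ring.
have hX : sn P (XX T) <= sn P Fe + (\sum_(t < T) cmod (h t)) * B.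
  elim: T => [|T IH]; first by rewrite big_ord0 mul0r addr0 X0.
  by rewrite big_ord_recr /= mulrDl addrA; apply: le_trans (XX_step T) _; rewrite lerD2r.
apply: le_trans hX; have -> : cexpect P (UU tau A xi T) - h T = cexpect P (XX T).
  have m : cexpect P Fe = 0.
    have cs (s : seq 'I_d) : cexpect P (fun w => \sum_(k <- s) e k * f k w) = 0.
      elim: s => [|a s IH].
        by rewrite -[RHS](cexpect_cst P); congr cexpect; apply: boolp.funext => v; rewrite big_nil.
      have -> : (fun w => \sum_(k <- a :: s) e k * f k w) = (fun w => e a * f a w + \sum_(k <- s) e k * f k w).
        by apply: boolp.funext => v; rewrite big_cons.
      rewrite cexpectD ?IH ?cexpectZ ?(cf a).2 ?mulr0 ?addr0 //; first exact: sl2Z.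
      by apply: sl2_sum => i; exact: sl2Z.
    exact: cs.
  rewrite /XX cexpectB ?cexpectZ; [|exact: sl2_1Fe|exact: sl2_UU|apply: sl2Z; exact: sl2_1Fe].
  rewrite (cexpectD _ sl2_Fe); last exact: sl2_cst.
  by rewrite cexpect_cst m addr0 mulr1.
exact: (cexpect_le (sl2_XX T)).
Qed.
End Freq.

End TwoScale.
Lemma arith_dhat (R : realFieldType) (nF c1 c2 H s2 y g D X Cp li eta B : R) :
  0 <= nF -> nF <= D * (y * g) -> c1 <= X * s2 * (g * (1 + y)) -> c2 <= 4 * eta + Cp * s2 ->
  0 <= H -> H * s2 <= li -> H * eta <= 1 -> 0 <= y -> 0 <= g -> 0 <= D -> 0 <= X -> 0 <= Cp -> 0 <= li ->
  B <= nF + H * (c1 + c2 * nF) -> B <= (D * (5 + Cp * li) + X * li) * (g * (1 + y)).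
Proof.
move=> n0 hn h1 h2 H0 hs he y0 g0 D0 X0 Cp0 li0 hB.
have gy : y * g <= g * (1 + y) by rewrite mulrDr mulr1 (mulrC y) lerDr.
have G0 : 0 <= g * (1 + y) by rewrite mulr_ge0 // addr_ge0.
have a1 : H * c1 <= X * li * (g * (1 + y)).
  apply: le_trans (ler_wpM2l H0 h1) _.
  have -> : H * (X * s2 * (g * (1 + y))) = X * (H * s2) * (g * (1 + y)) by ring.
  by rewrite ler_wpM2r // ler_wpM2l.
have a2 : H * c2 <= 4 + Cp * li.
  apply: le_trans (ler_wpM2l H0 h2) _.
  have -> : H * (4 * eta + Cp * s2) = 4 * (H * eta) + Cp * (H * s2) by ring.
  by apply: lerD; [lra|rewrite ler_wpM2l].
have a3 : H * c2 * nF <= (4 + Cp * li) * nF by rewrite ler_wpM2r.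
have k0 : 0 <= 5 + Cp * li by rewrite addr_ge0 // mulr_ge0.
have a4 : (5 + Cp * li) * nF <= (5 + Cp * li) * (D * (g * (1 + y))).
  rewrite ler_wpM2l //; apply: le_trans hn _; by rewrite ler_wpM2l.
lra.
Qed.

(** * Bound on the transform of the difference of the kernels *)

Section FourierBound.
Context (R : realType) (dsp : measure_display) (Om : measurableType dsp)
        (P : probability Om R) (d : nat) (tau : Zd d -> int -> Om -> Om)
        (A : Om -> 'M[R]_d) (lam Lam p0 C1 : R).
Local Notation C := (complex R).
Hypothesis hE : Env P tau A lam Lam.
Hypothesis Lam4 : 4 * d%:R * Lam <= 1.
Hypothesis d0 : (0 < d)%N.
Hypothesis p01 : 1 < p0.
Hypothesis C10 : 0 < C1.
Hypothesis hH : HypH P tau A Lam p0 C1.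
Let L0 := env_Lam0 hE.
Let l0 := env_lam0 hE.
Let L1 : Lam <= 1 := env_Lam1 hE Lam4 d0.
Definition Dr (t : nat) (x : Zd d) : R := Ga P tau A t x - heat (fun _ _ => ahr P tau A) t x.
Lemma fs_Dr t : fs (Dr t).
Proof.
exists (boxs d t) => x hx; rewrite /Dr heat_supp // subr0.
by rewrite /Ga; apply: Rint_eq0 => w; exact: heat_supp.
Qed.

Lemma Dr_hat xi t : zsum (fun x => chr xi (- x) * cR (Dr t x)) =
  cexpect P (UU tau A xi t) - hh (ahr P tau A) xi t.
Proof.
rewrite (cexpect_UU hE Lam4) hhE -zsumB.
- by apply: eq_zsum => x; rewrite /Dr cRD cRN mulrBr.
- exists (boxs d t) => x hx; rewrite /Ga (Rint_eq0 P) ?cR0 ?mulr0 // => w; exact: heat_supp.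
- by exists (boxs d t) => x hx; rewrite heat_supp // cR0 mulr0.
Qed.

Lemma sum_cst_ord (n : nat) (x : R) : \sum_(j < n) x = n%:R * x.
Proof. by rewrite sumr_const card_ord mulr_natl. Qed.
Lemma Dhat_bound : exists2 B : R, 0 <= B & forall (xi : 'rV[R]_d) t,
  cmod (zsum (fun x => chr xi (- x) * cR (Dr t x))) <=
  B * (rt R t `^ (- sig p0) * (1 + rt R t * Num.sqrt (esq xi))).
Proof.
have [Cb Cb0 hCb] := corr_bound hE Lam4 d0 p01 C10 hH.
have [K K0 hK] := ahom_rate hE Lam4 d0 p01 C10 hH.
have aR := ahom_real hE Lam4 d0 p01 C10 hH.
have cM := ahr_cls hE Lam4 d0 p01 C10 hH.
set M := ahr P tau A in aR cM *.
pose Cp := \sum_i \sum_j `|M i j|.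
have Cp0 : 0 <= Cp by apply: sumr_ge0 => i _; apply: sumr_ge0 => j _.
pose li := (lam / 2)^-1; have li0 : 0 <= li by rewrite invr_ge0 divr_ge0 // ltW.
pose D := d%:R * Cb; have D0 : 0 <= D by rewrite mulr_ge0 ?ler0n // ltW.
pose X := d%:R ^+ 2 * K; have X0 : 0 <= X by rewrite mulr_ge0 ?sqr_ge0.
have s0 := sig_gt0 p01; have s20 : 0 < sig p0 / 2 by rewrite divr_gt0.
pose B0' := D * (5 + Cp * li) + X * li.
have B0 : 0 <= B0'.
  by apply: addr_ge0; apply: mulr_ge0 => //; apply: addr_ge0 => //; exact: mulr_ge0.
exists (B0' * (1 + Num.sqrt (2 / Lam))) => [|xi T]; first by rewrite mulr_ge0 // addr_ge0 ?sqrtr_ge0.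
have T0 : 0 < T.+1%:R :> R by rewrite ltr0n.
(* Regularization at the inverse of the time: eta stays below Lam, T eta is at most 1, and sqrt(esq
   xi)/sqrt eta becomes a multiple of sqrt(T + 1) sqrt(esq xi). *)
pose eta := Lam / 2 / T.+1%:R.
have e0 : 0 < eta by rewrite !divr_gt0.
have e2 : eta <= Lam / 2.
  by rewrite ler_pdivrMr // ler_peMr ?ler1n // divr_ge0 // ltW.
have eL : eta < Lam by have := L0; move: e2; lra.
have e1 : eta <= 1 by apply: le_trans (ltW eL) L1.
have [f hf] := boolp.choice (fun k => qhl_corr hE Lam4 xi k e0).
have cf k := (hf k).1.
have hQ i k : qent P tau A xi k (f k) i = qhl P tau A xi eta i k by rewrite (hf k).2.
pose s := Num.sqrt (esq xi); have s_ge0 : 0 <= s by exact: sqrtr_ge0.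
have ssq : s ^+ 2 = esq xi by rewrite sqr_sqrtr // esq_ge0.
have es k : cmod (ee xi k) <= s.
  rewrite -ler_sqr ?nnegrE ?cmod_ge0 // ssq cmod_sqr esqE (bigD1 k) //= lerDl.
  by apply: sumr_ge0 => j _; exact: cdot_ge0.
have se : 0 < Num.sqrt eta by rewrite sqrtr_gt0.
pose y := s / Num.sqrt eta; have y0 : 0 <= y by rewrite divr_ge0 ?sqrtr_ge0.
pose g := eta `^ (sig p0 / 2); have g0 : 0 <= g by exact: powR_ge0.
have nF : sn P (Fe xi f) <= D * (y * g).
  apply: le_trans (_ : d%:R * (s * (Cb * eta `^ (- (2 * p0)^-1))) <= _).
    rewrite -[leRHS]sum_cst_ord /Fe.
    have st (r : seq 'I_d) : sn P (fun w => \sum_(k <- r) ee xi k * f k w) <= \sum_(k <- r) s * (Cb * eta `^ (- (2 * p0)^-1)).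
      elim: r => [|a r IH].
        have -> : (fun w => \sum_(k <- [::]) ee xi k * f k w) = fun=> 0 by apply: boolp.funext => w; rewrite big_nil.
        by rewrite big_nil sn_cst cmod0.
      have -> : (fun w => \sum_(k <- a :: r) ee xi k * f k w) = fun w => ee xi a * f a w + \sum_(k <- r) ee xi k * f k w.
        by apply: boolp.funext => w; rewrite big_cons.
      have s1 := sl2Z (ee xi a) (cf a).1.1.
      have s2 : sl2 P (fun w => \sum_(k <- r) ee xi k * f k w) by apply: sl2_sum => k; exact: (sl2Z _ (cf k).1.1).
      rewrite big_cons; apply: le_trans (snD s1 s2) (lerD _ IH).
      rewrite (snZ _ (cf a).1.1) ler_pM ?cmod_ge0 ?sn_ge0 //; exact: (hCb _ _ _ _ e0 eL (cf a)).
    exact: st.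
  have -> : s * (Cb * eta `^ (- (2 * p0)^-1)) = Cb * (y * eta `^ sig p0).
    have -> : eta `^ (- (2 * p0)^-1) = eta `^ sig p0 / Num.sqrt eta.
      rewrite -powR12_sqrt ?(ltW e0) // -powRN -powRD; last by apply/implyP => _; rewrite gt_eqF.
      by congr (_ `^ _); rewrite /sig; lra.
    by rewrite /y; ring.
  by rewrite /D -mulrA; do 3!(apply: ler_wpM2l => //; rewrite ?ler0n ?(ltW Cb0) //); exact: (powR_half_le p01).
(* The sum H of the |h_t| is bounded in two ways: by a multiple of 1/esq xi, to absorb the defects
   proportional to esq xi, and by T, to absorb the one proportional to eta. *)
have [hs1 hs2] := hh_sum cM (divr_gt0 l0 (ltr0Sn R 1)) xi T.
set H := \sum_(t < T) _ in hs1 hs2.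
have H0 : 0 <= H by apply: sumr_ge0 => i _; exact: cmod_ge0.
have c1 : cmod (symb M xi - eqe P tau A xi f) <= X * s ^+ 2 * (g * (1 + y)).
  have -> : symb M xi - eqe P tau A xi f = \sum_i \sum_k cconj (ee xi i) * ((ahom P tau A i k - qhl P tau A xi eta i k) * ee xi k).
    rewrite /symb /eqe -sumrB; apply: eq_bigr => i _; rewrite -mulrBr -sumrB mulr_sumr; apply: eq_bigr => k _.
    by have -> : ahom P tau A i k = cR (M i k); [rewrite aR [LHS]mxE|rewrite hQ -mulrBl].
  have -> : X * s ^+ 2 * (g * (1 + y)) = \sum_(i < d) \sum_(k < d) s * (K * (g * (1 + y)) * s).
    by rewrite (eq_bigr (fun _ => d%:R * (s * (K * (g * (1 + y)) * s)))) => [|i _]; rewrite sum_cst_ord // /X; ring.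
  apply: le_trans (cmod_sum _ _) _; apply: ler_sum => i _; apply: le_trans (cmod_sum _ _) _; apply: ler_sum => k _.
  have cc : cmod (cconj (ee xi i)) = cmod (ee xi i) by rewrite /cmod cRe_conj cIm_conj sqrrN.
  rewrite !cmodM cc ler_pM ?cmod_ge0 ?mulr_ge0 ?cmod_ge0 // ler_pM ?cmod_ge0 //.
  by rewrite cmodB; exact: hK.
have c2 : cmod (cR (expR eta) - 1 + symb M xi) <= 4 * eta + Cp * s ^+ 2.
  apply: le_trans (cmodD _ _) _; apply: lerD.
    have -> : cR (expR eta) - 1 = cR (expR eta - 1) by rewrite cRD cRN.
    have -> : cmod (cR (expR eta - 1)) = `|expR eta - 1| by rewrite /cmod cRe_cR cIm_cR expr0n addr0 sqrtr_sqr.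
    have := expR_diff e1 ler01; rewrite expR0 subr0 (ger0_norm (ltW e0)); exact.
  rewrite /symb /Cp mulr_suml; apply: le_trans (cmod_sum _ _) _; apply: ler_sum => i _.
  have cc : cmod (cconj (ee xi i)) = cmod (ee xi i) by rewrite /cmod cRe_conj cIm_conj sqrrN.
  rewrite cmodM cc expr2 mulrA (mulrC _ s) -/s.
  apply: ler_pM; rewrite ?cmod_ge0 //.
  apply: le_trans (cmod_sum _ _) _; rewrite mulr_suml; apply: ler_sum => j _.
  have cn : cmod (cR (M i j)) = `|M i j| by rewrite /cmod cRe_cR cIm_cR expr0n addr0 sqrtr_sqr.
  by rewrite cmodM cn ler_wpM2l.
have Hs : H * s ^+ 2 <= li.
  rewrite /li ssq -(@ler_pM2r _ (lam / 2)) ?divr_gt0 // mulVf ?gt_eqF ?divr_gt0 //.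
  by rewrite -mulrA (mulrC _ (lam / 2)).
have He : H * eta <= 1.
  apply: le_trans (ler_wpM2r (ltW e0) hs2) _; rewrite /eta mulrA ler_pdivrMr // mul1r.
  apply: le_trans (_ : T%:R * 1 <= _); last by rewrite mulr1 ler_nat.
  by rewrite ler_wpM2l ?ler0n //; have := L1; lra.
rewrite Dr_hat.
have hB := Dhat_le hE Lam4 cf M T; rewrite -/H in hB.
have hA := arith_dhat (sn_ge0 P _) nF c1 c2 H0 Hs He y0 g0 D0 X0 Cp0 li0 hB.
apply: le_trans hA _; rewrite -/B0' -mulrA ler_wpM2l //.
have rt0 := rt_gt0 R T.
have gE : g <= rt R T `^ (- sig p0).
  have -> : rt R T `^ (- sig p0) = (T.+1%:R^-1) `^ (sig p0 / 2).
    rewrite /rt -powR12_sqrt ?ler0n // -powRrM -(powR_inv1 (ltW T0)) -powRrM.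
    by congr (_ `^ _); field.
  apply: ge0_ler_powR; rewrite ?nnegrE ?(ltW s20) ?(ltW e0) ?invr_ge0 ?ler0n //.
  by rewrite /eta ler_piMl ?invr_ge0 ?ler0n //; have := L1; lra.
have yE : y = Num.sqrt (2 / Lam) * (rt R T * s).
  rewrite /y; have -> : (Num.sqrt eta)^-1 = Num.sqrt (2 / Lam) * rt R T.
    rewrite /rt -sqrtrM ?divr_ge0 ?(ltW L0) // -sqrtrV ?(ltW e0) //; congr Num.sqrt.
    by rewrite /eta; field; rewrite !gt_eqF.
  ring.
have rs0 : 0 <= rt R T * s by rewrite mulr_ge0 // ltW.
have q0 := sqrtr_ge0 (2 / Lam).
have yl : 1 + y <= (1 + Num.sqrt (2 / Lam)) * (1 + rt R T * s).
  by rewrite yE; have := mulr_ge0 q0 rs0; lra.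
rewrite -/s mulrCA; apply: ler_pM => //; by rewrite addr_ge0.
Qed.
End FourierBound.

(** * Box averages and the discrete Fourier transform *)

Section Paths.
Context (R : realType) (d : nat).
(** The path changes one coordinate at a time, always towards x, so its points are coordinatewise no
    farther from x than y is. Increments of f are needed only there, a region where the Gaussian
    weights will be comparable. *)
Lemma path_bound (f : Zd d -> R) (G : R) n (x y : Zd d) : 0 <= G ->
  (\sum_l `|y ord0 l - x ord0 l| <= n)%N ->
  (forall z : Zd d, (forall l, (`|z ord0 l - x ord0 l| <= `|y ord0 l - x ord0 l|)%N) ->
     forall i, `|f (z + evec i) - f z| <= G) ->
  `|f y - f x| <= n%:R * G.
Proof.
move=> G0; elim: n y => [|n IH] y hn hG.
  have -> : y = x.
    apply/rowP => l; move: hn; rewrite leqn0 sum_nat_eq0 => /forallP /(_ l) /=.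
    by rewrite absz_eq0 subr_eq0 => /eqP.
  by rewrite subrr normr0 mul0r.
have [l hl|hall] := pickP (fun l => y ord0 l != x ord0 l); last first.
  have -> : y = x by apply/rowP => l; apply/eqP; exact: negbFE (hall l).
  by rewrite subrr normr0 mulr_ge0.
pose s : int := if (y ord0 l > x ord0 l)%R then 1 else -1.
pose y' := y - s *: evec l.
have yE m : y' ord0 m = y ord0 m - s * (l == m)%:R.
  by rewrite /y' mxE [X in _ + X]mxE [X in _ - X]mxE evecE.
have hlt : (`|y' ord0 l - x ord0 l| < `|y ord0 l - x ord0 l|)%N.
  by rewrite yE eqxx mulr1 /s; case: ltP hl; lia.
have hle m : (`|y' ord0 m - x ord0 m| <= `|y ord0 m - x ord0 m|)%N.
  have [->|hm] := eqVneq m l; first exact: ltnW.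
  by rewrite yE eq_sym (negPf hm) mulr0 subr0.
have step : `|f y - f y'| <= G.
  have [sE|sE] : s = 1 \/ s = -1 by rewrite /s; case: ltP; [left|right].
    have -> : y = y' + evec l by rewrite /y' sE scale1r subrK.
    exact: hG.
  rewrite distrC; have -> : y' = y + evec l by rewrite /y' sE scaleN1r opprK.
  by apply: hG.
have h2 : `|f y' - f x| <= n%:R * G.
  apply: IH => [|z hz]; last by apply: hG => m; exact: leq_trans (hz m) (hle m).
  rewrite -ltnS; apply: leq_trans hn.
  rewrite (bigD1 l) //= [X in (_ < X)%N](bigD1 l) //= -addSn leq_add //.
  by apply: leq_sum => m _; exact: hle.
rewrite -(subrK (f y') (f y)) -addrA; apply: le_trans (ler_normD _ _) _.
by rewrite -natr1 mulrDl mul1r [leRHS]addrC; exact: lerD.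
Qed.

Lemma dist_sum_le (x y : Zd d) : (\sum_l `|y ord0 l - x ord0 l| : nat)%N%:R <= d%:R * znorm R (y - x).
Proof.
rewrite natr_sum -sum_cst_ord; apply: ler_sum => l _.
rewrite /znorm -(ger0_norm (ler0n R `|y ord0 l - x ord0 l|%N)) -sqrtr_sqr ler_sqrt; last by apply: sumr_ge0 => i _; exact: sqr_ge0.
rewrite (bigD1 l) //= !mxE.
have -> : (`|y ord0 l - x ord0 l|%N%:R : R) ^+ 2 = (y ord0 l - x ord0 l)%:~R ^+ 2.
  by rewrite natr_absz intr_norm real_normK ?num_real.
by rewrite lerDl; apply: sumr_ge0 => i _; exact: sqr_ge0.
Qed.
End Paths.

Section DFT.
Context (R : realType) (d : nat).
Local Notation C := (complex R).
Definition cis (r : R) : C := cexp (- 'i%C * cR r).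
Lemma cisE r : cis r = Complex (cos r) (- sin r).
Proof.
have e1 : cRe (- 'i%C * cR r) = 0 by exact: cRe_iM.
have e2 : cIm (- 'i%C * cR r) = - r by rewrite cImM cImN cReN /=; ring.
by rewrite /cis /cexp e1 e2 expR0 cosN sinN !mul1r.
Qed.

Lemma cisD r s : cis (r + s) = cis r * cis s.
Proof. by rewrite /cis cRD mulrDr cexpD. Qed.
Lemma cis0 : cis 0 = 1. Proof. by rewrite /cis cR0 mulr0 cexp0. Qed.
Lemma cisX r n : cis (r *+ n) = cis r ^+ n.
Proof. by elim: n => [|n IH]; rewrite ?mulr0n ?cis0 // mulrS exprS cisD IH. Qed.
Lemma cis_sum (I : Type) (s : seq I) (F : I -> R) : cis (\sum_(i <- s) F i) = \prod_(i <- s) cis (F i).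
Proof. by elim: s => [|a s IH]; rewrite ?big_nil ?cis0 // !big_cons cisD IH. Qed.
Lemma cis_chr (xi : 'rV[R]_d) x : chr xi x = \prod_l cis ((x ord0 l)%:~R * xi ord0 l).
Proof. by rewrite /chr zdotE -cis_sum. Qed.
Lemma cis2pi : cis (pi *+ 2) = 1.
Proof. by rewrite cisE cos2pi sin2pi oppr0. Qed.
Lemma cisN1 r : cis r = 1 -> cis (- r) = 1.
Proof. by move=> h; have := cisD r (- r); rewrite subrr cis0 h mul1r. Qed.
Lemma cis2piz (n : int) : cis ((pi *+ 2) * n%:~R) = 1.
Proof.
case: n => n; first by rewrite -pmulrn mulr_natr cisX cis2pi expr1n.
by rewrite NegzE mulrNz mulrN -pmulrn mulr_natr; apply: cisN1; rewrite cisX cis2pi expr1n.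
Qed.

Definition fr N (k : 'I_N) : R := (pi *+ 2) * (k%:R / N%:R).
(** Geometric sum over powers of an N-th root of unity, which differs from 1 because sin(pi |n|/N) >
    0 for 0 < |n| < N. *)
Lemma orth1 N (n : int) : (0 < N)%N -> (`|n| < N)%N ->
  \sum_(k < N) cis (n%:~R * fr k) = if n == 0 then N%:R else 0.
Proof.
move=> N0 hn; have Nr : 0 < N%:R :> R by rewrite ltr0n.
have [->|n0] := eqVneq n 0.
  under eq_bigr do rewrite mul0r cis0.
  by rewrite sumr_const card_ord.
pose w := cis ((pi *+ 2) * n%:~R / N%:R).
have e (k : 'I_N) : cis (n%:~R * fr k) = w ^+ k.
  by rewrite /w -cisX /fr -[_ *+ k]mulr_natr; congr cis; move: (pi *+ 2) => p; ring.
under eq_bigr do rewrite e.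
have wN : w ^+ N = 1.
  by rewrite /w -cisX -[X in cis X]mulr_natr mulfVK ?gt_eqF // cis2piz.
have w1 : w - 1 != 0.
  rewrite subr_eq0; apply/eqP => hw.
  have : cos ((pi *+ 2) * n%:~R / N%:R) = 1 :> R.
    have hc : cRe w = 1 by rewrite hw.
    by rewrite /w cisE in hc.
  have -> : (pi *+ 2) * n%:~R / N%:R = (pi * (n%:~R / N%:R)) *+ 2 :> R by rewrite !mulrnAl mulrA.
  rewrite cos_mulr2n cos2sin2 => hc.
  have : sin (pi * (n%:~R / N%:R)) ^+ 2 = 0 :> R by move: hc; rewrite -mulr_natr; lra.
  move/eqP; rewrite sqrf_eq0 => /eqP hs.
  have {}hs : sin (pi * (`|n|%N%:R / N%:R)) = 0 :> R.
    rewrite natr_absz intr_norm; case: (lerP 0 (n%:~R : R)) => h; first by rewrite ger0_norm.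
    by rewrite ltr0_norm // mulNr mulrN sinN hs oppr0.
  have : 0 < sin (pi * (`|n|%N%:R / N%:R)) :> R.
    apply: sin_gt0_pi; rewrite mulr_gt0 ?pi_gt0 ?divr_gt0 ?ltr0n ?absz_gt0 //=.
    by rewrite gtr_pMr ?pi_gt0 // ltr_pdivrMr // mul1r ltr_nat.
  by rewrite hs ltxx.
have := subrX1 w N; rewrite wN subrr => /esym /eqP; rewrite mulf_eq0 (negPf w1) /= => /eqP ->.
by [].
Qed.

Definition xk N (k : {ffun 'I_d -> 'I_N}) : 'rV[R]_d := \row_l fr (k l).
Lemma orth N (x : Zd d) : (0 < N)%N -> (forall l, (`|x ord0 l| < N)%N) ->
  \sum_(k : {ffun 'I_d -> 'I_N}) chr (xk k) x = if x == 0 then (N%:R ^+ d) else 0.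
Proof.
move=> N0 hx.
transitivity (\sum_(k : {ffun 'I_d -> 'I_N}) \prod_l cis ((x ord0 l)%:~R * fr (k l))).
  by apply: eq_bigr => k _; rewrite cis_chr; apply: eq_bigr => l _; rewrite mxE.
rewrite -(bigA_distr_bigA (fun l j => cis ((x ord0 l)%:~R * fr j))).
under eq_bigr do rewrite orth1 //.
have [->|x0] := eqVneq x 0.
  under eq_bigr do rewrite mxE eqxx.
  by rewrite prodr_const card_ord.
have [l hl] : exists l, x ord0 l != 0.
  apply/existsP; apply: contraNT x0 => /existsPn h; apply/eqP/rowP => l; rewrite mxE.
  by apply/eqP; have := h l; rewrite negbK.
by rewrite (bigD1 l) //= (negPf hl) mul0r.
Qed.

Definition hat (f : Zd d -> R) (xi : 'rV[R]_d) : C := zsum (fun x => chr xi (- x) * cR (f x)).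
(** Since N > 2 n, two distinct points of the box of radius n never agree modulo N, so the finite
    transform inverts without aliasing. No integral over the torus is needed. *)
Lemma inversion f n N (y : Zd d) : (0 < N)%N -> (2 * n < N)%N -> (forall x, x \notin boxs d n -> f x = 0) ->
  y \in boxs d n ->
  \sum_(k : {ffun 'I_d -> 'I_N}) chr (xk k) y * hat f (xk k) = N%:R ^+ d * cR (f y).
Proof.
move=> N0 nN hf hy.
have e (k : {ffun 'I_d -> 'I_N}) : chr (xk k) y * hat f (xk k) = \sum_(x <- boxs d n) chr (xk k) (y - x) * cR (f x).
  rewrite /hat (zsumE (s := boxs d n)) ?boxs_uniq => [|//|x hx]; last by rewrite hf // cR0 mulr0.
  by rewrite mulr_sumr; apply: eq_bigr => x _; rewrite mulrA -chrD.
under eq_bigr do rewrite e.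
rewrite exchange_big /= (eq_big_seq (fun x => (if x == y then N%:R ^+ d else 0) * cR (f x))) => [|x hx].
  rewrite (bigD1_seq y) ?boxs_uniq //= eqxx big1 ?addr0 // => x /negPf ->; by rewrite mul0r.
rewrite -mulr_suml orth // ?subr_eq0 1?eq_sym // => l; rewrite !mxE.
move: hx hy; rewrite !mem_boxs => /forallP /(_ l) hx /forallP /(_ l) hy.
have ab (a b : int) : (`|a| <= n)%N -> (`|b| <= n)%N -> (`|a - b| < N)%N by move: nN; lia.
exact: ab.
Qed.

Lemma fs_box f (x : Zd d) : fs f -> exists n, (forall y, y \notin boxs d n -> f y = 0 :> R) /\ x \in boxs d n.
Proof.
case=> s hs; pose n := (\sum_(y <- x :: s) \sum_l `|y ord0 l|)%N; exists n.
have h y : y \in x :: s -> y \in boxs d n.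
  move=> hy; rewrite mem_boxs; apply/forallP => l; rewrite /n (big_rem y) //= (bigD1 l) //= -addnA.
  exact: leq_addr.
split=> [y hy|]; last by apply: h; rewrite inE eqxx.
by apply: hs; apply: contra hy => hy; apply: h; rewrite inE hy orbT.
Qed.

Section Box.
Context (r : nat) (r0 : (0 < r)%N).
Definition Av (f : Zd d -> R) (x : Zd d) : R := \sum_(a : {ffun 'I_d -> 'I_r}) f (x + qpt a).
Definition bm (xi : 'rV[R]_d) : C := \sum_(a : {ffun 'I_d -> 'I_r}) chr xi (qpt a).
Lemma fs_Av f : fs f -> fs (Av f).
Proof. by move=> h; apply: fs_sum => a; exact: fs_shift. Qed.
Lemma hat_Av f xi : fs f -> hat (Av f) xi = bm xi * hat f xi.
Proof.
move=> hf; rewrite /hat /Av /bm mulr_suml.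
have fsx (a : {ffun 'I_d -> 'I_r}) : fs (fun x => chr xi (- x) * cR (f (x + qpt a))).
  by have [s hs] := fs_shift (qpt a) hf; exists s => x hx; rewrite hs // cR0 mulr0.
rewrite (eq_zsum (g := fun x => \sum_(a : {ffun 'I_d -> 'I_r}) chr xi (- x) * cR (f (x + qpt a)))) => [|x].
  rewrite zsum_sum //; apply: eq_bigr => a _.
  rewrite -(zsum_shift (fun x => chr xi (- x) * cR (f x)) (qpt a)) -zsumZ.
    by apply: eq_zsum => x; rewrite mulrA -chrD opprD addrCA addrN addr0.
  have [s hs] := fs_shift (qpt a) hf; exists s => x hx; by rewrite hs // cR0 mulr0.
by rewrite cR_sum mulr_sumr.
Qed.

Lemma bm_le xi : cmod (bm xi) <= r%:R ^+ d.
Proof.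
apply: le_trans (cmod_sum _ _) _.
have c1 (a : {ffun 'I_d -> 'I_r}) : cmod (chr xi (qpt a)) <= 1.
  by rewrite -ler_sqr ?nnegrE ?cmod_ge0 // cmod_sqr chr_unit expr1n.
apply: le_trans (ler_sum _ (fun a _ => c1 a)) _.
by rewrite sumr_const card_qpt natrX.
Qed.

Lemma bm_prod xi : bm xi = \prod_l \sum_(a < r) zz xi l ^+ a.
Proof.
rewrite bigA_distr_bigA; apply: eq_bigr => a _; rewrite cis_chr; apply: eq_bigr => l _.
by rewrite /qpt mxE -pmulrn mulr_natl cisX.
Qed.

(** The factor z_j - 1 telescopes the geometric sum in direction j to z_j^r - 1, of modulus at most
    2: a factor of the frequency is traded for one power of r. *)
Lemma ee_bm xi j : cmod (ee xi j) * cmod (bm xi) <= 2 * r%:R ^+ d.-1.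
Proof.
rewrite -cmodM bm_prod (bigD1 j) //= mulrA /ee -subrX1 cmodM.
have z1 l n : cmod (zz xi l ^+ n) = 1.
  elim: n => [|n IH]; first by rewrite expr0 /cmod cRe1 cIm1 expr0n addr0 expr1n sqrtr1.
  rewrite exprS cmodM IH mulr1; apply/eqP; rewrite -(eqrXn2 (n := 2)) ?cmod_ge0 // cmod_sqr zz_unit expr1n //.
apply: ler_pM; rewrite ?cmod_ge0 //.
  apply: le_trans (cmodD _ _) _; rewrite cmodN z1.
  by rewrite /cmod cRe1 cIm1 expr0n addr0 expr1n sqrtr1.
have cp (s : seq 'I_d) (Q : pred 'I_d) : cmod (\prod_(l <- s | Q l) \sum_(a < r) zz xi l ^+ a) <= \prod_(l <- s | Q l) r%:R.
  elim: s => [|a s IH]; first by rewrite !big_nil /cmod cRe1 cIm1 expr0n addr0 expr1n sqrtr1.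
  rewrite !big_cons; case: (Q a) => //; rewrite cmodM; apply: ler_pM; rewrite ?cmod_ge0 //.
  apply: le_trans (cmod_sum _ _) _; rewrite (eq_bigr (fun=> 1)) => [|i _]; last exact: z1.
  by rewrite sumr_const card_ord.
apply: le_trans (cp _ _) _; rewrite prodr_const; have -> : #|[pred i | i != j]| = d.-1; last by [].
by rewrite cardC1 card_ord.
Qed.

Lemma esq_bm xi : Num.sqrt (esq xi) * cmod (bm xi) <= 2 * d%:R * r%:R ^+ d.-1.
Proof.
apply: le_trans (_ : (\sum_j cmod (ee xi j)) * cmod (bm xi) <= _).
  rewrite ler_wpM2r ?cmod_ge0 //.
  have s0 : 0 <= \sum_j cmod (ee xi j) by apply: sumr_ge0 => j _; exact: cmod_ge0.
  rewrite -(ger0_norm s0) -sqrtr_sqr ler_sqrt ?sqr_ge0 // /esq.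
  have h (s : seq 'I_d) : 0 <= \sum_(j <- s) cmod (ee xi j) /\
     \sum_(j <- s) cdot (zz xi j - 1) (zz xi j - 1) <= (\sum_(j <- s) cmod (ee xi j)) ^+ 2.
    elim: s => [|a s [h1 h2]]; first by rewrite !big_nil expr0n.
    rewrite !big_cons; have ca := cmod_ge0 (ee xi a); split; first exact: addr_ge0.
    rewrite -cmod_sqr -/(ee xi a) sqrrD; have := mulr_ge0 ca h1; rewrite -mulr_natr; move: h2; lra.
  exact: (h _).2.
rewrite mulr_suml; apply: le_trans (ler_sum _ (fun j _ => ee_bm xi j)) _.
by rewrite sum_cst_ord mulrCA mulrA.
Qed.

Lemma bm_parseval N : (r <= N)%N ->
  \sum_(k : {ffun 'I_d -> 'I_N}) cmod (bm (xk k)) ^+ 2 = N%:R ^+ d * r%:R ^+ d.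
Proof.
move=> rN; have N0 : (0 < N)%N by exact: leq_trans rN.
suff h : \sum_(k : {ffun 'I_d -> 'I_N}) (bm (xk k) * cconj (bm (xk k))) = N%:R ^+ d * r%:R ^+ d :> C.
  have := congr1 (@cRe R) h; rewrite cRe_sum.
  have cn n : (n%:R : C) = cR n%:R by rewrite -[n%:R in LHS]/(n%:~R) cR_int.
  rewrite -natrX -natrX -natrM cn cRe_cR natrM !natrX => <-; apply: eq_bigr => k _.
  by rewrite cmod_sqr cReM cRe_conj cIm_conj /cdot; ring.
have cs (s : seq {ffun 'I_d -> 'I_r}) xi : cconj (\sum_(a <- s) chr xi (qpt a)) = \sum_(a <- s) chr xi (- qpt a).
  elim: s => [|a s IH]; first by rewrite !big_nil; apply: ceq; rewrite ?cRe_conj ?cIm_conj ?cRe0 ?cIm0 ?oppr0.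
  rewrite !big_cons -IH chrN; apply: ceq; rewrite ?cReD ?cImD ?cRe_conj ?cIm_conj ?cReD ?cImD //; ring.
have e (k : {ffun 'I_d -> 'I_N}) : bm (xk k) * cconj (bm (xk k)) =
    \sum_(a : {ffun 'I_d -> 'I_r}) \sum_(b : {ffun 'I_d -> 'I_r}) chr (xk k) (qpt a - qpt b).
  rewrite cs mulr_suml; apply: eq_bigr => a _; rewrite mulr_sumr; apply: eq_bigr => b _.
  by rewrite -chrD.
under eq_bigr do rewrite e.
rewrite exchange_big /= (eq_bigr (fun=> N%:R ^+ d)) => [|a _].
  by rewrite sumr_const card_qpt -[_ *+ (r ^ d)%N]mulr_natr natrX.
rewrite exchange_big /= (eq_bigr (fun b => if b == a then N%:R ^+ d else 0)) => [|b _].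
  by rewrite (bigD1 a) //= eqxx big1 ?addr0 // => b /negPf ->.
rewrite orth //; first by rewrite subr_eq0 (inj_eq (@qpt_inj d r)) eq_sym.
have ab (u v : nat) : (u < r)%N -> (v < r)%N -> (`|u%:Z - v%:Z| < N)%N by move: rN; lia.
by move=> l; rewrite !mxE; apply: ab.
Qed.

Lemma Av_grad f G : (forall y i, `|f (y + evec i) - f y| <= G) ->
  forall y i, `|Av f (y + evec i) - Av f y| <= r%:R ^+ d * G.
Proof.
move=> h y i; rewrite /Av -sumrB; apply: le_trans (ler_norm_sum _ _ _) _.
apply: le_trans (_ : \sum_(a : {ffun 'I_d -> 'I_r}) G <= _).
  by apply: ler_sum => a _; rewrite addrAC; exact: h.
by rewrite sumr_const card_qpt -[G *+ _]mulr_natl natrX.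
Qed.

Lemma Av_near f G : 0 <= G -> (forall y i, `|f (y + evec i) - f y| <= G) ->
  forall y, `|Av f y - r%:R ^+ d * f y| <= r%:R ^+ d * ((d * r)%:R * G).
Proof.
move=> G0 h y.
have e (u : R) : \sum_(a : {ffun 'I_d -> 'I_r}) u = r%:R ^+ d * u by rewrite sumr_const card_qpt -[u *+ _]mulr_natl natrX.
rewrite /Av -e -sumrB; apply: le_trans (ler_norm_sum _ _ _) _; rewrite -e; apply: ler_sum => a _.
apply: (path_bound (n := (d * r)%N) G0); last by move=> z _ i; exact: h.
apply: leq_trans (_ : \sum_(l < d) r <= _)%N; last by rewrite sum_nat_const card_ord.
by apply: leq_sum => l _; rewrite !mxE addrC addKr absz_nat ltnW.
Qed.

(* After three box averages the symbol is [bm ^ 3]: two factors are summed by Parseval,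
   the third one absorbs the frequency. *)
Lemma smooth_bound f (B rho G : R) : fs f -> 0 <= B -> 0 <= rho -> 0 <= G ->
  (forall xi, cmod (hat f xi) <= B * (1 + rho * Num.sqrt (esq xi))) ->
  (forall y i, `|f (y + evec i) - f y| <= G) ->
  forall x, `|f x| <= B / r%:R ^+ d * (1 + 2 * d%:R * rho / r%:R) + 3 * (d * r)%:R * G.
Proof.
move=> hf B0 rho0 G0 hh hG x.
have rr : 0 < r%:R :> R by rewrite ltr0n.
set c := r%:R ^+ d : R; have c0 : 0 < c by rewrite exprn_gt0.
pose g := Av (Av (Av f)).
have fg : fs g by do 3!apply: fs_Av.
have near : `|g x - c ^+ 3 * f x| <= c ^+ 3 * (3 * ((d * r)%:R * G)).
  have a1 := Av_near G0 hG x.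
  have cG : 0 <= c * G by rewrite mulr_ge0 // ltW.
  have ccG : 0 <= c * (c * G) by rewrite mulr_ge0 // ltW.
  have a2 := Av_near cG (Av_grad hG) x.
  have a3 := Av_near ccG (Av_grad (Av_grad hG)) x.
  rewrite -!/c in a1 a2 a3.
  have -> : g x - c ^+ 3 * f x = (g x - c * Av (Av f) x) + (c * (Av (Av f) x - c * Av f x) + c * (c * (Av f x - c * f x))) by ring.
  apply: le_trans (ler_normD _ _) _.
  have b2 := ler_wpM2l (ltW c0) a2; have b1 := ler_wpM2l (ltW c0) (ler_wpM2l (ltW c0) a1).
  have n2 := ler_normD (c * (Av (Av f) x - c * Av f x)) (c * (c * (Av f x - c * f x))).
  rewrite !normrM !(gtr0_norm c0) in n2 b1 b2 *.
  apply: le_trans (lerD a3 (le_trans n2 (lerD b2 b1))) _.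
  by rewrite le_eqVlt; apply/orP; left; apply/eqP; ring.
have [n [hn hx]] := fs_box x fg.
(* Larger than 2 n for the inversion and at least r for Parseval. *)
pose N := (2 * n + r).+1.
have N0 : (0 < N)%N by [].
have inv := inversion (N := N) N0 (_ : (2 * n < N)%N) hn hx.
have {}inv := inv (leq_addr _ _ : (2 * n <= 2 * n + r)%N).
have Nd : 0 < N%:R ^+ d :> R by rewrite exprn_gt0 // ltr0n.
have gx : `|g x| <= B * (c * (c + 2 * d%:R * rho * r%:R ^+ d.-1)).
  rewrite -(ler_pM2l Nd).
  have -> : N%:R ^+ d * `|g x| = cmod (N%:R ^+ d * cR (g x)).
    have -> : (N%:R ^+ d : C) = cR (N%:R ^+ d) by rewrite -!natrX -[LHS]/((N ^ d)%N%:~R) cR_int.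
    by rewrite -cRM /cmod cRe_cR cIm_cR expr0n addr0 sqrtr_sqr normrM (gtr0_norm Nd).
  rewrite -inv; apply: le_trans (cmod_sum _ _) _.
  apply: le_trans (_ : \sum_(k : {ffun 'I_d -> 'I_N}) cmod (bm (xk k)) ^+ 2 * (B * (c + 2 * d%:R * rho * r%:R ^+ d.-1)) <= _).
    apply: ler_sum => k _; rewrite /g !hat_Av //; try by do 2?apply: fs_Av.
    have u : cmod (chr (xk k) x) = 1.
      by apply/eqP; rewrite -(eqrXn2 (n := 2)) ?cmod_ge0 // cmod_sqr chr_unit expr1n.
    rewrite !cmodM u mul1r; set m := cmod (bm (xk k)); have m0 : 0 <= m by exact: cmod_ge0.
    rewrite expr2 -!mulrA; do 2!(apply: (ler_wpM2l m0)).
    apply: le_trans (ler_wpM2l m0 (hh (xk k))) _.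
    rewrite mulrCA ler_wpM2l // mulrDr mulr1 lerD //; first exact: bm_le.
    have := esq_bm (xk k); rewrite -/m => h3.
    have := ler_wpM2l rho0 h3; rewrite !mulrA => h4.
    have -> : m * rho * Num.sqrt (esq (xk k)) = rho * Num.sqrt (esq (xk k)) * m by ring.
    by apply: le_trans h4 _; rewrite le_eqVlt; apply/orP; left; apply/eqP; ring.
  rewrite -mulr_suml bm_parseval; last by rewrite /N; lia.
  by rewrite -/c le_eqVlt; apply/orP; left; apply/eqP; ring.
have c3 : 0 < c ^+ 3 by rewrite exprn_gt0.
rewrite -(ler_pM2l c3) -[X in X * `|_|](gtr0_norm c3) -normrM -(subKr (g x) (c ^+ 3 * f x)).
apply: le_trans (ler_normB _ _) _; rewrite mulrDr; apply: lerD.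
  apply: le_trans gx _; rewrite le_eqVlt; apply/orP; left; apply/eqP.
  have [d0|d0] := posnP d; last first.
    have -> : r%:R ^+ d.-1 = c / r%:R by rewrite /c -(prednK d0) exprSr mulfK ?gt_eqF.
    by field; rewrite !gt_eqF.
  by rewrite d0 !mulr0 !mul0r !addr0 !mulr1; field; rewrite gt_eqF.
by apply: le_trans near _; rewrite le_eqVlt; apply/orP; left; apply/eqP; ring.
Qed.
End Box.

End DFT.
(** * Interpolation *)

Section Weights.
Context (R : realType) (d : nat).
Lemma int_above (v : R) : 1 <= v -> exists n, (0 < n)%N /\ v <= n%:R <= 2 * v.
Proof.
move=> v1; have v0 : 0 <= v by apply: le_trans v1.
exists (Num.trunc v).+1; split=> //; have /andP[h1 h2] := truncn_itv v0.
by rewrite (ltW h2) /= -natr1; lra.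
Qed.

Lemma powR_ge1 (x s : R) : 1 <= x -> 0 <= s -> 1 <= x `^ s.
Proof. by move=> x1 s0; rewrite -(powRr0 x); exact: ler_powR. Qed.
Lemma powR_decr (x s r : R) : 1 <= x -> r <= s -> x `^ (- s) <= x `^ (- r).
Proof. by move=> x1 h; apply: ler_powR => //; rewrite lerN2. Qed.
Lemma powRDx (x s r : R) : 0 < x -> x `^ s * x `^ r = x `^ (s + r).
Proof. by move=> x0; rewrite powRD //; apply/implyP => _; rewrite gt_eqF. Qed.
Lemma powRVn (x : R) n : 0 < x -> (x ^+ n)^-1 = x `^ (- n%:R).
Proof. by move=> x0; rewrite powRN powR_mulrn // ltW. Qed.
(** Passes from powers of sqrt(t + 1) to powers of w = Lam t + 1, which is at most t + 1 as Lam <=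
    1; the exponent is halved because [rt] is a square root. *)
Lemma rt_w (Lam s c : R) t : 0 < Lam -> Lam <= 1 -> 0 <= s -> 0 <= c ->
  c * rt R t `^ (- s) <= c / (Lam * t%:R + 1) `^ (s / 2).
Proof.
move=> L0 L1 s0 c0; have w1 : 1 <= Lam * t%:R + 1 by rewrite lerDr mulr_ge0 ?ler0n // ltW.
have w0 : 0 < Lam * t%:R + 1 by apply: lt_le_trans w1.
rewrite powRN; apply: ler_wpM2l => //; rewrite lef_pV2 ?posrE ?powR_gt0 ?rt_gt0 //.
have -> : rt R t `^ s = t.+1%:R `^ (s / 2).
  by rewrite /rt -powR12_sqrt ?ler0n // -powRrM mulrC.
apply: ge0_ler_powR; rewrite ?nnegrE ?ler0n ?(ltW w0) //; first by rewrite divr_ge0.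
by rewrite -natr1 lerD2r ler_piMl ?ler0n.
Qed.

Lemma dec_mono (g g' Lam : R) t (x : Zd d) : 0 <= Lam -> g' <= g -> dec g Lam t x <= dec g' Lam t x.
Proof.
move=> L0 h; rewrite /dec ler_expR !mulNr lerN2; apply: ler_wpM2r => //.
by rewrite le_min znorm_ge0 divr_ge0 ?sqr_ge0 // addr_ge0 // mulr_ge0.
Qed.

Lemma dec_half (g Lam : R) t (x : Zd d) : dec (g / 2) Lam t x ^+ 2 = dec g Lam t x.
Proof. by rewrite /dec -expRM_natl; congr expR; rewrite -mulr_natr; field. Qed.
Lemma dec_le1 (g Lam : R) t (x : Zd d) : 0 <= g -> 0 <= Lam -> dec g Lam t x <= 1.
Proof.
move=> g0 L0; rewrite /dec -(expR0 R) ler_expR mulNr oppr_le0 mulr_ge0 //.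
by rewrite le_min znorm_ge0 divr_ge0 ?sqr_ge0 // addr_ge0 // mulr_ge0.
Qed.

Lemma znorm_evec (x y : Zd d) j : znorm R (x + evec j - y) <= znorm R (x - y) + 1.
Proof.
have -> : x + evec j - y = (x - y) + evec j by rewrite addrAC.
move: (x - y) => z; have z0 := znorm_ge0 R z.
have z1 : 0 <= znorm R z + 1 by lra.
rewrite -ler_sqr ?nnegrE ?znorm_ge0 // sqrrD expr1n mulr1 !znorm_sqr.
have hj : (z ord0 j)%:~R <= znorm R z.
  apply: le_trans (ler_norm _) _; rewrite -sqrtr_sqr /znorm ler_sqrt; last by apply: sumr_ge0 => i _; exact: sqr_ge0.
  by rewrite (bigD1 j) //= lerDl; apply: sumr_ge0 => i _; exact: sqr_ge0.
rewrite (bigD1 j) //= [X in _ <= X + _ + _](bigD1 j) //= !mxE !eqxx intrD.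
rewrite (eq_bigr (fun i => (z ord0 i)%:~R ^+ 2)) => [|i hi]; last by rewrite !mxE (negPf hi) andbF addr0.
have -> : ((true && true)%:R : int)%:~R = 1 :> R by [].
move: (\sum_(i < d | i != j) _) ((z ord0 j)%:~R : R) (znorm R z) hj => S a b hj.
by rewrite !expr2; lra.
Qed.

Section Compare.
Context (g Lam : R) (t : nat) (g0 : 0 < g) (L0 : 0 < Lam) (L1 : Lam <= 1).
Let w := Lam * t%:R + 1.
Let w1 : 1 <= w. Proof. by rewrite lerDr mulr_ge0 ?ler0n // ltW. Qed.
Let w0 : 0 < w. Proof. exact: lt_le_trans w1. Qed.
(** The Gaussian branch of the minimum loses 4^2 = 16 and the linear branch only 4, hence the rate
    g/16. *)
Lemma dec_quarter (x z : Zd d) : znorm R x <= 4 * znorm R z -> dec g Lam t z <= dec (g / 16) Lam t x.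
Proof.
move=> h; rewrite /dec ler_expR !mulNr lerN2 -/w -[X in X <= _]mulrA ler_pM2l //.
have x0 := znorm_ge0 R x; have z0 := znorm_ge0 R z.
rewrite le_min; apply/andP; split.
  apply: le_trans (_ : 16^-1 * znorm R x <= _); last lra.
  by rewrite ler_pM2l ?invr_gt0 // ge_min lexx.
apply: le_trans (_ : 16^-1 * (znorm R x ^+ 2 / w) <= _).
  by rewrite ler_pM2l ?invr_gt0 // ge_min lexx orbT.
rewrite mulrA ler_pM2r ?invr_gt0 //.
have : znorm R x ^+ 2 <= (4 * znorm R z) ^+ 2 by rewrite ler_sqr ?nnegrE ?mulr_ge0.
rewrite exprMn; lra.
Qed.

Definition Ccmp : R := expR (g / 8 + g / Lam).
(** In these ranges the exponent at x is at most g/8 or g/Lam, the latter from Lam (t + 1) <= w, so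
    a constant makes up for any decay at x. *)
Lemma dec_small (x z : Zd d) : znorm R x <= 2 \/ znorm R x ^+ 2 <= 16 * rt R t ^+ 2 ->
  dec g Lam t z <= Ccmp * dec (g / 16) Lam t x.
Proof.
move=> h; apply: le_trans (dec_le1 _ _ (ltW g0) (ltW L0)) _.
rewrite /Ccmp /dec -expRD; apply: expR_ge1; rewrite -/w mulNr subr_ge0.
have gL : 0 < g / Lam by rewrite divr_gt0.
case: h => h.
  apply: le_trans (_ : g / 16 * 2 <= _); last lra.
  apply: ler_wpM2l; first by rewrite divr_ge0 // ltW.
  by rewrite ge_min h.
apply: le_trans (_ : g / 16 * (16 / Lam) <= _).
  apply: ler_wpM2l; first by rewrite divr_ge0 // ltW.
  rewrite ge_min; apply/orP; right; rewrite ler_pdivrMr //.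
  apply: le_trans h _; rewrite rt_sqr -mulrA ler_pM2l // mulrC -ler_pdivrMr ?invr_gt0 // invrK.
  by rewrite -natr1 mulrDl mul1r mulrC /w lerD2l.
have -> : g / 16 * (16 / Lam) = g / Lam by field; rewrite gt_eqF.
by rewrite lerDr divr_ge0 // ltW.
Qed.

(** For |x| > 2 the hypothesis gives |z| >= (|x| - 1)/2 >= |x|/4, and [dec_quarter] applies; for
    smaller x the weight at x is of order one. *)
Lemma dec_ratio (x z : Zd d) : 1 / 2 <= (znorm R z + 1) / (znorm R x + 1) ->
  dec g Lam t z <= Ccmp * dec (g / 16) Lam t x.
Proof.
have x0 := znorm_ge0 R x.
rewrite ler_pdivlMr; last lra.
move=> h; have [hx|hx] := lerP (znorm R x) 2; first by apply: dec_small; left.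
apply: le_trans (dec_quarter (x := x) _) _; first lra.
rewrite ler_peMl ?(ltW (dec_gt0 _ _ _ _)) //; apply: expR_ge1.
by rewrite addr_ge0 // divr_ge0 // ltW.
Qed.

Lemma znorm_sqD (x z : Zd d) : znorm R x ^+ 2 <= 2 * znorm R z ^+ 2 + 2 * znorm R (z - x) ^+ 2.
Proof.
rewrite !znorm_sqr !mulr_sumr -big_split; apply: ler_sum => i _ /=.
rewrite !mxE intrB; have := sqr_ge0 ((x ord0 i)%:~R - 2 * (z ord0 i)%:~R : R); rewrite !expr2; lra.
Qed.

Lemma dec_near (x z : Zd d) : znorm R (z - x) ^+ 2 <= 4 * rt R t ^+ 2 ->
  dec g Lam t z <= Ccmp * dec (g / 16) Lam t x.
Proof.
move=> h; have [hx|hx] := lerP (znorm R x ^+ 2) (16 * rt R t ^+ 2); first by apply: dec_small; right.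
apply: le_trans (dec_quarter (x := x) _) _.
  rewrite -ler_sqr ?nnegrE ?mulr_ge0 ?znorm_ge0 // exprMn.
  have := znorm_sqD x z; have := sqr_ge0 (znorm R z); rewrite -!natrX; lra.
rewrite ler_peMl ?(ltW (dec_gt0 _ _ _ _)) //; apply: expR_ge1.
by rewrite addr_ge0 // divr_ge0 // ltW.
Qed.
End Compare.

End Weights.
Section Interpolation.
Context (R : realType) (d : nat) (g Lam sg Cg B : R) (f : nat -> Zd d -> R).
Hypothesis d0 : (0 < d)%N.
Hypothesis g0 : 0 < g.
Hypothesis L0 : 0 < Lam.
Hypothesis L1 : Lam <= 1.
Hypothesis s0 : 0 < sg.
Hypothesis s1 : sg < 1.
Hypothesis C0 : 0 < Cg.
Hypothesis B0 : 0 <= B.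
Hypothesis hfs : forall t, fs (f t).
Hypothesis hf : forall t x, `|f t x| <= Cg / rt R t ^+ d * dec g Lam t x.
Hypothesis hf2 : forall t x i j, `|dgr2 (f t) x i j| <= Cg / rt R t ^+ d.+2 * dec g Lam t x.
Hypothesis hhat : forall t (xi : 'rV[R]_d), cmod (hat (f t) xi) <=
  B * (rt R t `^ (- sg) * (1 + rt R t * Num.sqrt (esq xi))).
Local Notation r t := (rt R t).
(** Write p = sqrt(t + 1) and take boxes of side p^(1 - eps). The transform term of [smooth_bound]
    is of order p^(-sg - (1 - eps) d + eps), the averaging error p^(1 - eps) p^(-(d + 1)). They
    coincide, with value p^(-(d + eps)), when eps (d + 2) = sg. *)
Definition eps0 : R := sg / (d%:R + 2).
Let dR : 1 <= d%:R :> R. Proof. by rewrite ler1n. Qed.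
Lemma eps0_gt0 : 0 < eps0. Proof. by rewrite divr_gt0 // addr_gt0 // ltr0n. Qed.
Lemma eps0_lt1 : eps0 < 1.
Proof. by rewrite ltr_pdivrMr; have := dR; have := s1; lra. Qed.
Lemma sup_decay : exists2 K : R, 0 < K & forall t x, `|f t x| <= K * r t `^ (- (d%:R + eps0)).
Proof.
have e0 := eps0_gt0; have e1 := eps0_lt1.
exists (B * (1 + 2 * d%:R) + 24 * d%:R * Cg) => [|t x].
  have : 0 <= B * (1 + 2 * d%:R) by rewrite mulr_ge0 // addr_ge0 // mulr_ge0 ?ler0n.
  by have := mulr_gt0 (lt_le_trans ltr01 dR) C0; lra.
have p1 := rt_ge1 R t; have p0 := rt_gt0 R t; set p := r t in p1 p0 *.
have u1 : 1 <= p `^ (1 - eps0) by apply: powR_ge1 => //; lra.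
have [n [n0 /andP[n1 n2]]] := int_above u1.
set u := p `^ (1 - eps0) in u1 n1 n2.
have u0 : 0 < u by apply: lt_le_trans u1.
have nR : 0 < n%:R :> R by rewrite ltr0n.
pose G := 4 * Cg / p ^+ d.+1.
have G0 : 0 <= G by rewrite divr_ge0 ?exprn_ge0 // ?mulr_ge0 // ltW.
have hG y i : `|f t (y + evec i) - f t y| <= G.
  have := grad_bound (g := g) C0 g0 L0 (hf t) (fun x i => hf2 t x i i) y i => h.
  by apply: le_trans h _; rewrite ler_piMr // dec_le1 // ltW.
have BB : 0 <= B * p `^ (- sg) by rewrite mulr_ge0 // powR_ge0.
have hB xi : cmod (hat (f t) xi) <= B * p `^ (- sg) * (1 + p * Num.sqrt (esq xi)).
  by rewrite -mulrA; exact: hhat.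
apply: le_trans (smooth_bound n0 (hfs t) BB (ltW p0) G0 hB hG x) _.
rewrite [leRHS]mulrDl; apply: lerD.
  have a1 : (n%:R ^+ d)^-1 <= p `^ (- ((1 - eps0) * d%:R)).
    rewrite powRN powRrM -/u powR_mulrn ?(ltW u0) // lef_pV2 ?posrE ?exprn_gt0 //.
    by rewrite lerXn2r // nnegrE ltW.
  have a2 : 1 + 2 * d%:R * p / n%:R <= (1 + 2 * d%:R) * p `^ eps0.
    have b1 : p / n%:R <= p `^ eps0.
      rewrite ler_pdivrMr //; apply: le_trans (_ : p `^ eps0 * u <= _); last by rewrite ler_wpM2l // powR_ge0.
      by rewrite /u powRDx // addrC subrK powRr1 // ltW.
    have b2 : 1 <= p `^ eps0 by apply: powR_ge1 => //; exact: ltW.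
    rewrite [leRHS]mulrDl mul1r; apply: lerD => //; rewrite -[leLHS]mulrA.
    by apply: ler_wpM2l => //; rewrite mulr_ge0 ?ler0n.
  apply: le_trans (_ : B * p `^ (- sg) * p `^ (- ((1 - eps0) * d%:R)) * ((1 + 2 * d%:R) * p `^ eps0) <= _).
    apply: ler_pM => //; first by rewrite mulr_ge0 // invr_ge0 exprn_ge0 // ltW.
      by rewrite addr_ge0 // divr_ge0 ?(ltW nR) // mulr_ge0 ?(ltW p0) // mulr_ge0 ?ler0n.
    by rewrite ler_wpM2l.
  have -> : B * p `^ (- sg) * p `^ (- ((1 - eps0) * d%:R)) * ((1 + 2 * d%:R) * p `^ eps0) =
      B * (1 + 2 * d%:R) * (p `^ (- sg) * p `^ (- ((1 - eps0) * d%:R)) * p `^ eps0) by ring.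
  rewrite !powRDx // ler_wpM2l ?mulr_ge0 ?addr_ge0 ?mulr_ge0 ?ler0n //.
  apply: ler_powR => //.
  have : eps0 * (d%:R + 2) = sg by rewrite /eps0 divfK // gt_eqF // addr_gt0 // ltr0n.
  by rewrite mulrDr mulrBl mul1r; lra.
have -> : 3 * (d * n)%:R * G = 12 * d%:R * Cg * (n%:R * (p ^+ d.+1)^-1) by rewrite /G natrM; ring.
have -> : 24 * d%:R * Cg * p `^ (- (d%:R + eps0)) = 12 * d%:R * Cg * (2 * p `^ (- (d%:R + eps0))) by ring.
rewrite ler_wpM2l ?mulr_ge0 ?ler0n ?(ltW C0) //.
rewrite powRVn //; apply: le_trans (_ : (2 * u) * p `^ (- d.+1%:R) <= _); first by rewrite ler_wpM2r // powR_ge0.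
rewrite -mulrA ler_pM2l // /u powRDx // ; apply: ler_powR => //; rewrite -natr1; lra.
Qed.

(** Geometric mean of the uniform bound, which has the gain and no weight, and of the a priori
    bound, which has the weight and no gain; both the gain and the rate are halved. *)
Lemma gauss_decay : exists2 K : R, 0 < K & forall t x,
  `|f t x| <= K * r t `^ (- (d%:R + eps0 / 2)) * dec (g / 2) Lam t x.
Proof.
have [K K0 hK] := sup_decay; exists (K + Cg) => [|t x]; first exact: addr_gt0.
have p0 := rt_gt0 R t; set p := r t in p0 *.
have D0 := dec_gt0 (g / 2) Lam t x.
have Q0 : 0 <= (K + Cg) * p `^ (- (d%:R + eps0 / 2)) * dec (g / 2) Lam t x.
  by rewrite !mulr_ge0 ?powR_ge0 ?(ltW D0) ?addr_ge0 // ltW.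
rewrite -ler_sqr ?nnegrE // [leLHS]expr2 !exprMn dec_half.
have h1 := hK t x; have h2 := hf t x; rewrite -/p powRVn // in h1 h2.
apply: le_trans (ler_pM (normr_ge0 _) (normr_ge0 _) h1 h2) _.
have -> : K * p `^ (- (d%:R + eps0)) * (Cg * p `^ (- d%:R) * dec g Lam t x) =
   K * Cg * (p `^ (- (d%:R + eps0)) * p `^ (- d%:R)) * dec g Lam t x by ring.
apply: ler_wpM2r; first exact: ltW (dec_gt0 _ _ _ _).
rewrite powRDx //; have -> : p `^ (- (d%:R + eps0 / 2)) ^+ 2 = p `^ (- (d%:R + eps0) - d%:R).
  by rewrite expr2 powRDx //; congr (_ `^ _); lra.
apply: ler_wpM2r; first exact: powR_ge0.
by have := mulr_ge0 (ltW K0) (ltW C0); rewrite expr2; nra.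
Qed.

Lemma grad_decay : exists2 K : R, 0 < K & forall t x i,
  `|f t (x + evec i) - f t x| <= K * r t `^ (- (d%:R + 1 + eps0 / 4)) * dec (g / 2) Lam t x.
Proof.
have e0 := eps0_gt0; have e1 := eps0_lt1.
have [K K0 hK] := gauss_decay; exists (2 * K + 2 * Cg) => [|t x i].
  by rewrite addr_gt0 // mulr_gt0.
have p1 := rt_ge1 R t; have p0 := rt_gt0 R t; set p := r t in p1 p0 *.
(* A step n of this order equalizes A/n and n B in [landau], where A is of order p^(-(d + eps0/2))
   and B of order p^(-(d + 2)). *)
have u1 : 1 <= p `^ (1 - eps0 / 4) by apply: powR_ge1 => //; lra.
have [n [n0 /andP[n1 n2]]] := int_above u1.
set u := p `^ (1 - eps0 / 4) in u1 n1 n2.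
have u0 : 0 < u by apply: lt_le_trans u1.
have nR : 0 < n%:R :> R by rewrite ltr0n.
have g2 : 0 <= g / 2 by rewrite divr_ge0 // ltW.
have h2 y : `|dgr2 (f t) y i i| <= Cg * p `^ (- d.+2%:R) * dec (g / 2) Lam t y.
  apply: le_trans (hf2 t y i i) _; rewrite -/p powRVn //; apply: ler_wpM2l.
    by rewrite mulr_ge0 ?powR_ge0 // ltW.
  by apply: dec_mono; [exact: ltW|have := g0; lra].
have A0 : 0 <= K * p `^ (- (d%:R + eps0 / 2)) by rewrite mulr_ge0 ?powR_ge0 // ltW.
have BB : 0 <= Cg * p `^ (- d.+2%:R) by rewrite mulr_ge0 ?powR_ge0 // ltW.
have := landau n0 (hK t) h2 A0 BB (fun a b => dec_anti t g2 (ltW L0)) x => h.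
apply: le_trans h _; apply: ler_wpM2r; first exact: ltW (dec_gt0 _ _ _ _).
rewrite -/p [leRHS]mulrDl; apply: lerD.
  rewrite ler_pdivrMr //; apply: le_trans (_ : 2 * K * p `^ (- (d%:R + 1 + eps0 / 4)) * u <= _).
    have -> : 2 * K * p `^ (- (d%:R + 1 + eps0 / 4)) * u = 2 * (K * (p `^ (- (d%:R + 1 + eps0 / 4)) * u)) by ring.
    rewrite ler_pM2l // ler_pM2l // /u powRDx //; apply: ler_powR => //; lra.
  by apply: ler_wpM2l => //; rewrite !mulr_ge0 ?powR_ge0 // ltW.
apply: le_trans (_ : (2 * u) * (Cg * p `^ (- d.+2%:R)) <= _); first by apply: ler_wpM2r.
have -> : 2 * u * (Cg * p `^ (- d.+2%:R)) = 2 * Cg * (u * p `^ (- d.+2%:R)) by ring.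
rewrite ler_pM2l ?mulr_gt0 // /u powRDx //; apply: ler_powR => //; rewrite -!natr1; lra.
Qed.

(** X is written as the product of its powers 1 - e and e, and one of the two bounds is used in each
    factor; the common weight D is recovered whole. *)
Lemma interp_pow (X a b D e : R) : 0 <= X -> 0 <= a -> 0 <= b -> 0 <= D -> 0 < e -> e <= 1 ->
  X <= a * D -> X <= b * D -> X <= a `^ (1 - e) * b `^ e * D.
Proof.
move=> X0 a0 b0 D0 e0 e1 ha hb.
have [->|Xn] := eqVneq X 0; first by rewrite !mulr_ge0 ?powR_ge0.
have Xp : 0 < X by rewrite lt_neqAle eq_sym Xn.
have Dp : 0 < D.
  by rewrite lt_neqAle D0 andbT eq_sym; apply: contraTneq Xp => D_0; rewrite -leNgt (le_trans ha) // D_0 mulr0.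
have E (Y : R) : 0 < Y -> Y = Y `^ (1 - e) * Y `^ e by move=> Y0; rewrite powRDx // subrK powRr1 // ltW.
rewrite [X in _ <= _ * X]E // mulrACA -!powRM // [leLHS](E _ Xp).
apply: ler_pM; rewrite ?powR_ge0 //; apply: ge0_ler_powR; rewrite ?nnegrE ?mulr_ge0 ?subr_ge0 //; exact: ltW.
Qed.

Lemma znorm_ge1 (x : Zd d) : x != 0 -> 1 <= znorm R x.
Proof.
move=> x0; have [l hl] : exists l, x ord0 l != 0.
  apply/existsP; apply: contraNT x0 => /existsPn h; apply/eqP/rowP => l; rewrite mxE.
  by apply/eqP; have := h l; rewrite negbK.
apply: le_trans (_ : Num.sqrt 1 <= _); first by rewrite sqrtr1.
rewrite /znorm ler_sqrt; last by apply: sumr_ge0 => i _; exact: sqr_ge0.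
rewrite (bigD1 l) //=; apply: le_trans (_ : (x ord0 l)%:~R ^+ 2 <= _); last first.
  by rewrite lerDl; apply: sumr_ge0 => i _; exact: sqr_ge0.
rewrite -[leRHS]real_normK ?num_real // -intr_norm; apply: exprn_ege1.
by rewrite -[1]/(1%:~R) ler_int -gtz0_ge1 normr_gt0.
Qed.

(* Far pairs are handled by the gradient bound alone, close ones by interpolating it with
   the second-difference bound along a path that stays in the region where the weights are
   comparable. *)
Lemma holder_decay (dl : R) : 0 < dl -> dl <= 1 -> exists2 K : R, 0 < K & forall t x x' i,
  1 / 2 <= (znorm R x' + 1) / (znorm R x + 1) ->
  `|(f t (x' + evec i) - f t x') - (f t (x + evec i) - f t x)| <=
   znorm R (x' - x) `^ (1 - dl) * (K * r t `^ (- (d%:R + 2 - dl + dl * (eps0 / 4)))) * dec (g / 2 / 16) Lam t x.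
Proof.
move=> l0 l1; have e0 := eps0_gt0; have e1 := eps0_lt1.
have [K K0 hK] := grad_decay.
have g2 : 0 < g / 2 by rewrite divr_gt0.
pose Cc := Ccmp (g / 2) Lam; have Cc1 : 1 <= Cc.
  by apply: expR_ge1; rewrite addr_ge0 // divr_ge0 // ltW.
have Cc0 : 0 < Cc by apply: lt_le_trans Cc1.
pose KK := (d%:R * Cg) `^ (1 - dl) * (2 * K) `^ dl.
have KK0 : 0 <= KK by rewrite mulr_ge0 ?powR_ge0.
exists (KK * Cc + 2 * K * Cc) => [|t x x' i hr].
  by apply: ltr_wpDl; rewrite ?mulr_gt0 // mulr_ge0 // ltW.
have [->|hx] := eqVneq x' x.
  rewrite subrr normr0; apply: mulr_ge0; last exact: ltW (dec_gt0 _ _ _ _).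
  apply: mulr_ge0; first exact: powR_ge0.
  apply: mulr_ge0; last exact: powR_ge0.
  by apply: addr_ge0; apply: mulr_ge0 => //; [exact: ltW|apply: mulr_ge0 => //; exact: ltW|exact: ltW].
have m1 : 1 <= znorm R (x' - x) by apply: znorm_ge1; rewrite subr_eq0.
have p1 := rt_ge1 R t; have p0 := rt_gt0 R t; set p := r t in p1 p0 *.
set m := znorm R (x' - x) in m1 *; have m0 : 0 < m by apply: lt_le_trans m1.
set gg := fun y => f t (y + evec i) - f t y.
rewrite -/(gg x') -/(gg x).
set E := dec (g / 2 / 16) Lam t x; have E0 : 0 < E by exact: dec_gt0.
have dx : dec (g / 2) Lam t x <= Cc * E.
  apply: le_trans (_ : E <= _); last by rewrite ler_peMl // ltW.
  by apply: dec_mono; [exact: ltW|have := g2; lra].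
have dx' : dec (g / 2) Lam t x' <= Cc * E by exact: dec_ratio.
set P1 := p `^ (- (d%:R + 1 + eps0 / 4)).
have P10 : 0 <= P1 by exact: powR_ge0.
have b1 : `|gg x' - gg x| <= 2 * K * P1 * (Cc * E).
  apply: le_trans (ler_normB _ _) _.
  have k1 := hK t x' i; have k2 := hK t x i; rewrite -/p -/P1 in k1 k2.
  have KP : 0 <= K * P1 by rewrite mulr_ge0 // ltW.
  have k3 := le_trans k1 (ler_wpM2l KP dx'); have k4 := le_trans k2 (ler_wpM2l KP dx).
  by apply: le_trans (lerD k3 k4) _; rewrite le_eqVlt; apply/orP; left; apply/eqP; ring.
have CE : 0 <= Cc * E by rewrite mulr_ge0 // ltW.
have [mp|pm] := ltrP m p; last first.
  apply: le_trans b1 _.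
  have -> : m `^ (1 - dl) * ((KK * Cc + 2 * K * Cc) * p `^ (- (d%:R + 2 - dl + dl * (eps0 / 4)))) * E =
     (KK + 2 * K) * (m `^ (1 - dl) * p `^ (- (d%:R + 2 - dl + dl * (eps0 / 4)))) * (Cc * E) by ring.
  apply: ler_wpM2r => //; apply: ler_pM => //; first by rewrite mulr_ge0 // ltW.
    by rewrite lerDr.
  apply: le_trans (_ : p `^ (1 - dl) * p `^ (- (d%:R + 2 - dl + dl * (eps0 / 4))) <= _); last first.
    apply: ler_wpM2r; first exact: powR_ge0.
    by apply: ge0_ler_powR; rewrite ?nnegrE ?subr_ge0 ?(ltW p0) ?(ltW m0).
  rewrite powRDx // /P1; apply: ler_powR => //.
  have : dl * (eps0 / 4) <= 1 * (eps0 / 4) by rewrite ler_wpM2r // divr_ge0 // ltW.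
  lra.
have b2 : `|gg x' - gg x| <= d%:R * Cg * m * p `^ (- (d%:R + 2)) * (Cc * E).
  pose G := Cg * p `^ (- (d%:R + 2)) * (Cc * E).
  have G0 : 0 <= G by rewrite !mulr_ge0 ?powR_ge0 // ltW.
  apply: le_trans (path_bound (n := (\sum_l `|x' ord0 l - x ord0 l|)%N) (x := x) G0 (leqnn _) _) _ => [z hz j|].
    have -> : gg (z + evec j) - gg z = dgr2 (f t) (z + evec j) i j.
      by rewrite /gg /dgr2 addrK.
    apply: le_trans (hf2 t _ _ _) _; rewrite -/p powRVn //.
    have -> : d.+2%:R = d%:R + 2 :> R by rewrite -addn2 natrD.
    apply: ler_wpM2l; first by rewrite mulr_ge0 ?powR_ge0 // ltW.
    apply: le_trans (dec_mono t (z + evec j) (ltW L0) (_ : g / 2 <= g)) _; first by have := g0; lra.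
    apply: dec_near => //.
    have n1 : znorm R (z - x) ^+ 2 <= m ^+ 2.
      rewrite ler_sqr ?nnegrE ?znorm_ge0 //; apply: znorm_le => l; rewrite !mxE; exact: hz.
    have n2 : znorm R (z + evec j - x) <= znorm R (z - x) + 1.
      exact: znorm_evec.
    have p2 : znorm R (z - x) <= m by rewrite -ler_sqr ?nnegrE ?znorm_ge0.
    have -> : 4 * p ^+ 2 = (2 * p) ^+ 2 by rewrite exprMn -natrX.
    rewrite ler_sqr ?nnegrE ?znorm_ge0 ?mulr_ge0 // ?(ltW p0) //; lra.
  have := dist_sum_le R x x'; rewrite -/m => h.
  apply: le_trans (ler_wpM2r G0 h) _.
  by rewrite /G le_eqVlt; apply/orP; left; apply/eqP; ring.
set P2 := p `^ (- (d%:R + 2)) in b2; have P20 : 0 <= P2 by exact: powR_ge0.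
have a0 : 0 <= d%:R * Cg * m * P2 by rewrite !mulr_ge0 ?ler0n // ltW.
have c0 : 0 <= 2 * K * P1 by rewrite !mulr_ge0 // ltW.
have := interp_pow (normr_ge0 _) a0 c0 CE l0 l1 b2 b1 => h.
apply: le_trans h _.
have dC : 0 <= d%:R * Cg by rewrite mulr_ge0 ?ler0n // ltW.
have k2 : 0 <= 2 * K by rewrite mulr_ge0 // ltW.
have -> : (d%:R * Cg * m * P2) `^ (1 - dl) * (2 * K * P1) `^ dl = KK * (m `^ (1 - dl) * (P2 `^ (1 - dl) * P1 `^ dl)).
  have dCm : 0 <= d%:R * Cg * m by rewrite mulr_ge0 // ltW.
  rewrite (powRM (1 - dl) dCm P20) (powRM (1 - dl) dC (ltW m0)) (powRM dl k2 P10) /KK.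
  move: (_ `^ (1 - dl)) (m `^ _) (P2 `^ _) ((2 * K) `^ _) (P1 `^ _) => a1 a2 a3 a4 a5; ring.
have -> : P2 `^ (1 - dl) * P1 `^ dl = p `^ (- (d%:R + 2 - dl + dl * (eps0 / 4))).
  rewrite /P1 /P2 -!powRrM powRDx //; congr (_ `^ _); ring.
have -> : m `^ (1 - dl) * ((KK * Cc + 2 * K * Cc) * p `^ (- (d%:R + 2 - dl + dl * (eps0 / 4)))) * E =
     (KK + 2 * K) * (m `^ (1 - dl) * p `^ (- (d%:R + 2 - dl + dl * (eps0 / 4)))) * (Cc * E) by ring.
by apply: ler_wpM2r => //; apply: ler_wpM2r; rewrite ?mulr_ge0 ?powR_ge0 // lerDl.
Qed.
End Interpolation.

(** * Uniform constants and the passage to the complex-valued difference *)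

Section Data.
Context (R : realType) (d : nat) (kappa p0 C1 : R).
Hypothesis d0 : (0 < d)%N.
Hypothesis p01 : 1 < p0.
Hypothesis C10 : 0 < C1.
Definition gauss_data (g Lam : R) (f : nat -> Zd d -> R) (Cg B : R) :=
  [/\ 0 < Cg /\ 0 <= B, forall t, fs (f t),
      forall t x, `|f t x| <= Cg / rt R t ^+ d * dec g Lam t x,
      forall t x i j, `|dgr2 (f t) x i j| <= Cg / rt R t ^+ d.+2 * dec g Lam t x &
      forall t (xi : 'rV[R]_d), cmod (hat (f t) xi) <=
        B * (rt R t `^ (- sig p0) * (1 + rt R t * Num.sqrt (esq xi)))].
(** Collects everything the interpolation needs about the difference of the kernels. Both kernels
    satisfy the same a priori bounds because [A] and the homogenized matrix lie in the same class,
    and g is fixed before the environment. *)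
Lemma gauss_data_ex : exists2 g : R, 0 < g &
  forall (dsp : measure_display) (Om : measurableType dsp)
            (P : probability Om R) (tau : Zd d -> int -> Om -> Om)
            (A : Om -> 'M[R]_d) (lam Lam : R),
       Env P tau A lam Lam -> Lam / lam = kappa ->
       4 * d%:R * Lam <= 1 -> HypH P tau A Lam p0 C1 ->
  exists Cg B, gauss_data g Lam (Dr P tau A) Cg B.
Proof.
(* [apriori] asks for a ratio at least 1, while kappa is an arbitrary real until an environment is
   given. *)
have k1 : 1 <= Num.max kappa 1 by rewrite le_max lexx orbT.
have [g g0 hg] := apriori d0 k1; exists g => // dsp Om P tau A lam Lam hE hk Lam4 hH.
have l0 := env_lam0 hE; have lL := env_lamLam hE; have L0 := env_Lam0 hE.
have h1 : 0 < lam / 2 by rewrite divr_gt0.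
have h2 : lam / 2 <= 2 * Lam by lra.
have h4 : 2 * Lam <= 4 * Num.max kappa 1 * (lam / 2).
  have -> : 2 * Lam = 2 * kappa * lam by rewrite -hk -mulrA divfK // gt_eqF.
  have : kappa * lam <= Num.max kappa 1 * lam by rewrite ler_wpM2r ?(ltW l0) // le_max lexx.
  lra.
have h5 : 2 * d%:R * (2 * Lam) <= 1 by move: Lam4; lra.
have [C C0 hC] := hg Lam (lam / 2) (2 * Lam) h1 h2 erefl h4 h5.
have b1 := hC _ _ _ _ _ (an_env hE Lam4).
have b2 := hC _ _ _ _ _ (const_annealed (ahr_cls hE Lam4 d0 p01 C10 hH)).
have [B B0 hB] := Dhat_bound hE Lam4 d0 p01 C10 hH.
exists (2 * C), B; split.
- by split=> //; rewrite mulr_gt0.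
- by move=> t; exact: fs_Dr.
- move=> t x; rewrite /Dr; apply: le_trans (ler_normB _ _) _.
  apply: le_trans (lerD (b1 t x).1 (b2 t x).1) _.
  by rewrite le_eqVlt; apply/orP; left; apply/eqP; ring.
- move=> t x i j.
  have -> : dgr2 (Dr P tau A t) x i j = dgr2 (GG (fun f => Rintegral P setT f) tau A t) x i j -
     dgr2 (GG (fun f : unit -> R => f tt) (fun _ _ => id) (fun _ => ahr P tau A) t) x i j.
    rewrite /dgr2 /Dr.
    have e y : heat (fun _ _ => ahr P tau A) t y = GG (fun f : unit -> R => f tt) (fun _ _ => id) (fun _ => ahr P tau A) t y by [].
    by rewrite !e !Ga_GG; ring.
  apply: le_trans (ler_normB _ _) _.
  apply: le_trans (lerD ((b1 t x).2 i j) ((b2 t x).2 i j)) _.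
  by rewrite le_eqVlt; apply/orP; left; apply/eqP; ring.
- by move=> t xi; exact: hB.
Qed.

(** The homogenized matrix being real, its complex lattice kernel is the image of the real one under
    the embedding, so complex moduli become absolute values. *)
Lemma Gdiff_Dr (dsp : measure_display) (Om : measurableType dsp)
   (P : probability Om R) (tau : Zd d -> int -> Om -> Om) (A : Om -> 'M[R]_d) (lam Lam : R) :
   Env P tau A lam Lam -> 4 * d%:R * Lam <= 1 -> HypH P tau A Lam p0 C1 ->
   forall t x, Gdiff P tau A t x = cR (Dr P tau A t x).
Proof.
move=> hE Lam4 hH t x; rewrite /Gdiff /Dr cRD cRN; congr (_ - _).
rewrite /Glat (ahom_real hE Lam4 d0 p01 C10 hH).
by rewrite -(map_heat (real_complex R)).
Qed.

Lemma cmod_cR (r : R) : cmod (cR r) = `|r|.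
Proof. by rewrite /cmod cRe_cR cIm_cR expr0n addr0 sqrtr_sqr. Qed.
Lemma mnorm_col_le (v : 'cV[complex R]_d) (b : R) :
  (forall i, cmod (v i ord0) <= b) -> mnorm v <= d%:R * b.
Proof.
move=> h; have b0 : 0 <= b by apply: le_trans (h (Ordinal d0)); exact: cmod_ge0.
have dR : 1 <= d%:R :> R by rewrite ler1n.
rewrite -ler_sqr ?nnegrE ?mnorm_ge0 ?mulr_ge0 ?ler0n // mnorm_cV.
apply: le_trans (_ : \sum_(i < d) b ^+ 2 <= _).
  by apply: ler_sum => i _; rewrite -cmod_sqr ler_sqr ?nnegrE ?cmod_ge0.
rewrite sum_cst_ord exprMn ler_wpM2r ?sqr_ge0 // expr2 ler_peMl ?ler0n //.
Qed.
End Data.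

Theorem theorem4p1 (R : realType) (d : nat) (kappa p0 C1 : R) :
  (0 < d)%N -> 1 < p0 -> 0 < C1 ->
  (exists alpha gamma : R,
     0 < alpha <= 1 /\ 0 < gamma /\
     forall (dsp : measure_display) (Om : measurableType dsp)
            (P : probability Om R) (tau : Zd d -> int -> Om -> Om)
            (A : Om -> 'M[R]_d) (lam Lam : R),
       Env P tau A lam Lam -> Lam / lam = kappa ->
       4 * d%:R * Lam <= 1 -> HypH P tau A Lam p0 C1 ->
       exists C : R, forall (x : Zd d) (t : nat),
         let w := Lam * t%:R + 1 in
         let dec := expR (- gamma * Num.min (znorm R x) (znorm R x ^+ 2 / w)) in
         cmod (Gdiff P tau A t x) <= C / w `^ ((d%:R + alpha) / 2) * dec /\
         mnorm (gradGdiff P tau A t x)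
           <= C / w `^ ((d%:R + 1 + alpha) / 2) * dec)
  /\
  (forall delta : R, 0 < delta <= 1 ->
   exists alpha gamma : R,
     0 < alpha < delta /\ 0 < gamma /\
     forall (dsp : measure_display) (Om : measurableType dsp)
            (P : probability Om R) (tau : Zd d -> int -> Om -> Om)
            (A : Om -> 'M[R]_d) (lam Lam : R),
       Env P tau A lam Lam -> Lam / lam = kappa ->
       4 * d%:R * Lam <= 1 -> HypH P tau A Lam p0 C1 ->
       exists Cdelta : R, forall (x' x : Zd d) (t : nat),
         1 / 2 <= (znorm R x' + 1) / (znorm R x + 1) <= 2 ->
         let w := Lam * t%:R + 1 in
         let dec := expR (- gamma * Num.min (znorm R x) (znorm R x ^+ 2 / w)) in
         mnorm (gradGdiff P tau A t x' - gradGdiff P tau A t x)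
           <= znorm R (x' - x) `^ (1 - delta)
              * (Cdelta / w `^ ((d%:R + 2 - delta + alpha) / 2)) * dec).
Proof.
move=> d0 p01 C10; have [g g0 hg] := gauss_data_ex kappa d0 p01 C10.
have s0 := sig_gt0 p01; have s1 := sig_lt1 p01.
have e0 := eps0_gt0 d s0; have e1 := eps0_lt1 d0 s1.
have dR : 1 <= d%:R :> R by rewrite ler1n.
set e := eps0 d (sig p0) in e0 e1.
split.
  (* The gradient estimate dictates the exponent: it gains only eps0/4, whereas the kernel gains
     eps0/2. The rate g/2 is that of the geometric mean. *)
  exists (e / 4), (g / 2); split; first by apply/andP; split; lra.
  split; first by lra.
  move=> dsp Om P tau A lam Lam hE hk Lam4 hH.
  have L0 := env_Lam0 hE; have L1 := env_Lam1 hE Lam4 d0.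
  have [Cg [B [[C0 B0] q1 q2 q3 q4]]] := hg _ _ _ _ _ _ _ hE hk Lam4 hH.
  have [K1 K10 h1] := gauss_decay d0 g0 L0 s0 s1 C0 B0 q1 q2 q3 q4.
  have [K2 K20 h2] := grad_decay d0 g0 L0 s0 s1 C0 B0 q1 q2 q3 q4.
  have dK : 0 <= d%:R * K2 by rewrite mulr_ge0 ?ler0n // ltW.
  exists (K1 + d%:R * K2) => x t w dc.
  have dc0 : 0 <= dc by exact: expR_ge0.
  have w0 s : 0 <= (w `^ s)^-1 by rewrite invr_ge0 powR_ge0.
  have GD := Gdiff_Dr d0 p01 C10 hE Lam4 hH t.
  split.
    rewrite GD cmod_cR; apply: le_trans (h1 t x) _; apply: ler_wpM2r => //.
    apply: le_trans (_ : K1 * rt R t `^ (- (d%:R + e / 4)) <= _).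
      rewrite ler_wpM2l ?(ltW K10) //; apply: powR_decr; [exact: rt_ge1|rewrite -/e; lra].
    apply: le_trans (rt_w t L0 L1 _ (ltW K10)) _; first by lra.
    by apply: ler_wpM2r => //; rewrite lerDl.
  apply: le_trans (mnorm_col_le d0 (b := K2 * rt R t `^ (- (d%:R + 1 + e / 4)) * dc) _) _ => [i|].
    by rewrite mxE !GD -cRN -cRD cmod_cR; exact: h2.
  rewrite mulrA; apply: ler_wpM2r => //; rewrite mulrA.
  apply: le_trans (rt_w t L0 L1 _ dK) _; first by lra.
  by apply: ler_wpM2r => //; rewrite lerDr ltW.
(* Interpolation with the second differences keeps the fraction delta of the gradient gain, which
   also gives alpha < delta; the factor 16 is lost in comparing weights at different points. *)
move=> dl /andP[l0 l1]; exists (dl * (e / 4)), (g / 2 / 16).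
split; first by apply/andP; split; [rewrite mulr_gt0 //; lra|rewrite gtr_pMr //; lra].
split; first by lra.
move=> dsp Om P tau A lam Lam hE hk Lam4 hH.
have L0 := env_Lam0 hE; have L1 := env_Lam1 hE Lam4 d0.
have [Cg [B [[C0 B0] q1 q2 q3 q4]]] := hg _ _ _ _ _ _ _ hE hk Lam4 hH.
have [K K0 h] := holder_decay d0 g0 L0 L1 s0 s1 C0 B0 q1 q2 q3 q4 l0 l1.
have dK : 0 <= d%:R * K by rewrite mulr_ge0 ?ler0n // ltW.
exists (d%:R * K) => x' x t /andP[hr _]; cbv zeta.
set dc := expR _.
have dc0 : 0 <= dc by exact: expR_ge0.
have GD := Gdiff_Dr d0 p01 C10 hE Lam4 hH t.
apply: le_trans (mnorm_col_le d0 (b := znorm R (x' - x) `^ (1 - dl) *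
   (K * rt R t `^ (- (d%:R + 2 - dl + dl * (e / 4)))) * dc) _) _ => [i|].
  rewrite /gradGdiff /dgrad !mxE !GD -!cRN -!cRD -cRN -cRD cmod_cR; exact: h.
rewrite mulrA; apply: ler_wpM2r => //; rewrite mulrCA; apply: ler_wpM2l; first exact: powR_ge0.
rewrite [leLHS]mulrA; apply: (rt_w t L0 L1 _ dK).
have : 0 < dl * (e / 4) by rewrite mulr_gt0 //; lra.
lra.
Qed.
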